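(* Let $Z$ be a two-dimensional topological manifold (possibly with boundary) with countable base, and let $\Delta$ be a one-dimensional foliation on $Z$ such that each connected component of $\partial Z$ is a leaf of $\Delta$, and each leaf of $\Delta$ is homeomorphic to $\mathbb{R}$ and is a closed subset of $Z$. Then the following conditions are equivalent: (1) $(Z,\Delta)$ admits a striped atlas whose canonical foliation is $\Delta$; (2) the family of all singular leaves of $\Delta$ is locally finite.
   Context: A foliated homeomorphism between foliated surfaces is a homeomorphism sending each leaf onto a leaf. A leaf $\omega\subset \operatorname{Int} Z$ is regular if there is a saturated neighbourhood $U$ of $\omega$ (a union of leaves) such that the pair $(\overline{U},U)$ is foliated homeomorphic to $(\mathbb{R}\times[-1,1],\mathbb{R}\times(-1,1))$ (foliated by horizontal lines $\mathbb{R}\times\{t\}$) via a homeomorphism sending $\omega$ onto $\mathbb{R}\times 0$. A leaf $\omega\subset\partial Z$ is regular if there is a saturated neighbourhood $U$ of $\omega$ such that $(\overline{U},U)$ is foliated homeomorphic to $(\mathbb{R}\times[0,1],\mathbb{R}\times[0,1))$ via a homeomorphism sending $\omega$ onto $\mathbb{R}\times 0$. A leaf that is not regular is singular. A strip is a subset $S\subset\mathbb{R}^2$ such that for some $u<v$ one has $\mathbb{R}\times(u,v)\subset S\subset \mathbb{R}\times[u,v]$ and $S$ is open in $\mathbb{R}\times[u,v]$; put $\partial_-S=S\cap(\mathbb{R}\times\{u\})$, $\partial_+S=S\cap(\mathbb{R}\times\{v\})$, $\partial S=\partial_-S\cup\partial_+S$ (a disjoint union of at most countably many open intervals, called boundary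 intervals). The canonical foliation of $S$ consists of the lines $\mathbb{R}\times\{t\}$, $t\in(u,v)$, and the boundary intervals. A striped atlas on $Z$ is a map $q:\bigsqcup_{\lambda\in\Lambda}S_\lambda\to Z$ from a disjoint union of at most countably many strips such that: $q$ is a quotient map (continuous, surjective, and $A\subset Z$ is open iff $q^{-1}(A)\cap S_\lambda$ is open in $S_\lambda$ for all $\lambda$); and there are two disjoint families $\{X_\gamma\}_{\gamma\in\Gamma}$, $\{Y_\gamma\}_{\gamma\in\Gamma}$ of mutually distinct boundary intervals of the strips, indexed by the same set $\Gamma$, such that $q$ is injective on the complement of $\bigcup_\gamma (X_\gamma\cup Y_\gamma)$, $q(X_\gamma)=q(Y_\gamma)$ for each $\gamma$, and $q|_{X_\gamma}$, $q|_{Y_\gamma}$ are embeddings with closed images. The canonical foliation of the atlas is the foliation of $Z$ whose leaves are the images under $q$ of the leaves of the canonical foliations of the strips. *)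

(* Defs.v *)
From HB Require Import structures.
From mathcomp Require Import all_boot all_order all_algebra.
From mathcomp Require Import all_classical all_reals all_analysis.
From mathcomp Require Import Rstruct Rstruct_topology.

Set Implicit Arguments.
Unset Strict Implicit.
Unset Printing Implicit Defensive.

Import Order.TTheory GRing.Theory Num.Theory.
Local Open Scope classical_set_scope.
Local Open Scope ring_scope.

Notation RR := Rdefinitions.R.
Definition plane : Type := (RR * RR)%type.

Section TopDefs.
Context {X Y : topologicalType}.

Definition homeo_on (A : set X) (B : set Y) (f : X -> Y) : Prop :=
  exists g : Y -> X,
    [/\ {within A, continuous f}, {within B, continuous g},
        (forall x, A x -> B (f x) /\ g (f x) = x) &
        (forall y, B y -> A (g y) /\ f (g y) = y)].

Definition open_in (A V : set X) : Prop := exists O : set X, open O /\ V = O `&` A.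

Definition path_in (A : set X) (x y : X) : Prop :=
  exists g : RR -> X,
    [/\ {within [set t : RR | 0 <= t <= 1], continuous g}, g 0 = x, g 1 = y &
        g @` [set t : RR | 0 <= t <= 1] `<=` A].

Definition path_connected_set (A : set X) : Prop :=
  forall x y, A x -> A y -> path_in A x y.

Definition path_component (A : set X) (x : X) : set X :=
  [set y | A x /\ path_in A x y].

Definition locally_finite_family (F : set (set X)) : Prop :=
  forall z : X, exists W : set X,
    [/\ open W, W z & finite_set [set w | F w /\ w `&` W !=set0]].

End TopDefs.

Definition halfplane : set plane := [set p | 0 <= p.2].

Section Surfaces.
Context {Z : topologicalType}.

Definition manifold2 : Prop :=
  hausdorff_space Z /\
  forall z : Z, exists (U : set Z) (h : Z -> plane) (V : set plane),
    [/\ open U, U z, V `<=` halfplane, open_in halfplane V & homeo_on U V h].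

Definition mboundary : set Z :=
  [set z | exists (U : set Z) (h : Z -> plane) (V : set plane),
    [/\ open U /\ U z, V `<=` halfplane, open_in halfplane V,
        homeo_on U V h & (h z).2 = 0]].

Definition partition (D : set (set Z)) : Prop :=
  [/\ (forall w, D w -> w !=set0),
      (forall w w', D w -> D w' -> w `&` w' !=set0 -> w = w') &
      (forall z, exists w, D w /\ w z)].

Definition foliation1 (D : set (set Z)) : Prop :=
  [/\ partition D,
      (forall w, D w -> path_connected_set w) &
      (forall z : Z, exists (U : set Z) (h : Z -> plane),
        [/\ open U, U z,
            (mboundary z -> homeo_on U halfplane h),
            (~ mboundary z -> homeo_on U setT h) &
            (forall w, D w -> exists T : set RR,
                h @` (w `&` U) = [set p | T p.2])])].

Definition saturated (D : set (set Z)) (U : set Z) : Prop :=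
  forall w, D w -> w `&` U !=set0 -> w `<=` U.

Definition nbhd_of_set (w U : set Z) : Prop :=
  exists O : set Z, [/\ open O, w `<=` O & O `<=` U].

(** [h] is foliated on C, where C carries the foliation induced by D (leaves:
    path components of w \cap C) and the target carries the horizontal
    foliation: each induced leaf is sent onto a horizontal line. *)
Definition foliated_on (D : set (set Z)) (C : set Z) (h : Z -> plane) : Prop :=
  forall w x, D w -> w x -> C x ->
    h @` path_component (w `&` C) x = [set p | p.2 = (h x).2].

Definition regular_int_leaf (D : set (set Z)) (w : set Z) : Prop :=
  exists (U : set Z) (h : Z -> plane),
    [/\ saturated D U /\ nbhd_of_set w U,
        homeo_on (closure U) [set p : plane | -1 <= p.2 <= 1] h,
        h @` U = [set p : plane | -1 < p.2 < 1],
        h @` w = [set p : plane | p.2 = 0] &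
        foliated_on D (closure U) h].

Definition regular_bd_leaf (D : set (set Z)) (w : set Z) : Prop :=
  exists (U : set Z) (h : Z -> plane),
    [/\ saturated D U /\ nbhd_of_set w U,
        homeo_on (closure U) [set p : plane | 0 <= p.2 <= 1] h,
        h @` U = [set p : plane | 0 <= p.2 < 1],
        h @` w = [set p : plane | p.2 = 0] &
        foliated_on D (closure U) h].

Definition regular_leaf (D : set (set Z)) (w : set Z) : Prop :=
  (w `<=` ~` mboundary /\ regular_int_leaf D w) \/
  (w `<=` mboundary /\ regular_bd_leaf D w).

Definition singular_leaf (D : set (set Z)) (w : set Z) : Prop :=
  D w /\ ~ regular_leaf D w.

End Surfaces.

Definition is_strip (S : set plane) (u v : RR) : Prop :=
  [/\ u < v,
      [set p : plane | u < p.2 < v] `<=` S,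
      S `<=` [set p : plane | u <= p.2 <= v] &
      open_in [set p : plane | u <= p.2 <= v] S].

Definition strip_boundary (S : set plane) (u v : RR) : set plane :=
  S `&` [set p | p.2 = u \/ p.2 = v].

Definition boundary_interval (S : set plane) (u v : RR) (I : set plane) : Prop :=
  exists p, strip_boundary S u v p /\ I = connected_component (strip_boundary S u v) p.

Definition canonical_leaf (S : set plane) (u v : RR) (L : set plane) : Prop :=
  (exists t, u < t < v /\ L = [set p : plane | p.2 = t]) \/ boundary_interval S u v L.

(** (Z, D) admits a striped atlas whose canonical foliation is D. The strips
    are indexed by an at most countable type [Lam]; the disjoint union is
    represented by pairs (l, p) with p in S l; q l is the restriction of the
    atlas map to the strip S l. The families X_g, Y_g are boundary intervals
    (lx g, X g) and (ly g, Y g). *)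
Definition has_striped_atlas {Z : topologicalType} (D : set (set Z)) : Prop :=
  exists (Lam : Type) (S : Lam -> set plane) (u v : Lam -> RR)
         (q : Lam -> plane -> Z)
         (Gam : Type) (lx ly : Gam -> Lam) (X Y : Gam -> set plane),
    let inXY l p := exists g, (lx g = l /\ X g p) \/ (ly g = l /\ Y g p) in
    [/\ countable [set: Lam] /\ (forall l, is_strip (S l) (u l) (v l)),
        [/\ (forall l, {within S l, continuous (q l)}),
            (forall z : Z, exists l p, S l p /\ q l p = z) &
            (forall A : set Z,
                open A <-> forall l, open_in (S l) (S l `&` q l @^-1` A))],
        [/\ (forall g, boundary_interval (S (lx g)) (u (lx g)) (v (lx g)) (X g)),
            (forall g, boundary_interval (S (ly g)) (u (ly g)) (v (ly g)) (Y g)),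
            (forall g g', lx g = lx g' -> X g = X g' -> g = g'),
            (forall g g', ly g = ly g' -> Y g = Y g' -> g = g') &
            (forall g g', ~ (lx g = ly g' /\ X g = Y g'))],
        [/\ (forall l l' p p', S l p -> S l' p' -> ~ inXY l p -> ~ inXY l' p' ->
                q l p = q l' p' -> l = l' /\ p = p'),
            (forall g, q (lx g) @` X g = q (ly g) @` Y g),
            (forall g, homeo_on (X g) (q (lx g) @` X g) (q (lx g)) /\
                       closed (q (lx g) @` X g)) &
            (forall g, homeo_on (Y g) (q (ly g) @` Y g) (q (ly g)) /\
                       closed (q (ly g) @` Y g))] &
        D = [set w | exists l L, canonical_leaf (S l) (u l) (v l) L /\ w = q l @` L]].

(* Main.v *)
(* In a striped atlas the lines inside a strip are regular leaves, and the union of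
   all open strips with one further leaf is open in the surface; hence every point
   has a neighbourhood meeting at most one singular leaf.

   Conversely, let the singular leaves be locally finite.  A leaf meets a short
   transversal that ends at a singular leaf at most once, so that the regular part is
   covered by countably many saturated strips of leaves; making them disjoint cuts
   it along a locally finite family F of leaves into open pieces homeomorphic to
   R * (0, 1), with coordinates (Y, T).  The leaves of F have to be added to the
   pieces as boundary intervals, so Y is replaced by a coordinate with finite limits
   at them.  Cover F by countably many half-discs.  The n-th one lies in one piece and
   its leaves tend to T = 0 or to T = 1; the position of its intersection with a leaf
   defines a monotone function g_n of Y with values in [0, 1].  Let A and B be the
   dyadic sums of the g_n and of the 1 - g_n, with weights that in the limit at one
   end of the piece only count the half-discs lying at that end.  Then 1 / B - 1 / A
   is increasing in Y and onto R, it extends continuously to F, and its limits from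
   one end of a piece separate the points of the leaves of F there, because comparing
   two germs on a common nearby leaf orders all g_n in the same way. *)
Require Import Defs.
From HB Require Import structures.
From mathcomp Require Import all_boot all_order all_algebra.
From mathcomp Require Import all_classical all_reals all_analysis.
From mathcomp Require Import Rstruct Rstruct_topology.
From mathcomp Require Import ring lra.
Set Implicit Arguments.
Unset Strict Implicit.
Unset Printing Implicit Defensive.
Import Order.TTheory GRing.Theory Num.Theory.
Import numFieldNormedType.Exports.
Local Open Scope classical_set_scope.
Local Open Scope ring_scope.


(** The obstacle is that the product coordinate [Y] of a piece says nothing near the leaves of [F]:
    infinitely many of them may lie at one end, they need not be separated in the leaf space, and a
    leaf may border the same piece from both sides. A boundary point of a strip therefore has to be
    a germ of a half-disc, that is, a point of a leaf together with a side. Boundary leaves of the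
    surface also go into [F], since they become boundary intervals as well. The form [1 / B - 1 / A]
    has this origin: at a point of [F] a half-disc around it contributes a value strictly between 0
    and 1, so that [A] and [B] stay positive and the limit is finite; along a leaf inside a piece
    exactly one of them tends to 0 in each direction, so that the whole line is attained. A further
    term, vanishing at both ends of the piece, makes [A] and [B] strictly monotone on leaves that no
    half-disc detects. Invariance of domain is avoided throughout: the maps respect levels, so
    openness reduces to the intermediate value theorem in one variable with a parameter. *)

HB.instance Definition _ := NormedModule.copy RR (RR^o).

Ltac clear_nonarith := repeat match goal with
  | H : ?T |- _ => lazymatch T with
     | is_true (@Order.le _ _ _ _) => fail
     | is_true (@Order.lt _ _ _ _) => fail
     | is_true (andb _ _) => fail
     | @eq ?A _ _ => tryif unify A Rdefinitions.R then fail else clear H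
     | _ => lazymatch type of T with Prop => clear H | _ => fail end
     end end.
Ltac clear_unrelated := repeat match goal with
  | H : is_true ?T |- ?G =>
      tryif match T with context [?x] => is_var x;
              match type of x with Rdefinitions.R => idtac end;
              match G with context [x] => idtac end end
      then fail else clear H
  end.
Ltac qlra := clear_nonarith; first [solve [clear_unrelated; lra] | lra].

(** * Real functions on intervals *)

Lemma nbhsRP (x : RR) (A : set RR) :
  nbhs x A <-> exists2 e : RR, 0 < e & forall (y : RR), `|y - x| < e -> A y.
Proof.
split => [/nbhs_ballP[e e0 H]|[e e0 H]].
  by exists e => // y yx; apply: H; rewrite /ball/= distrC.
by apply/nbhs_ballP; exists e => // y; rewrite /ball/= distrC; apply: H.
Qed.

Lemma nbhs2P (p : plane) (A : set plane) :
  nbhs p A <-> exists2 e : RR, 0 < e & forall (x s : RR),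
    `|x - p.1| < e -> `|s - p.2| < e -> A (x, s).
Proof.
split => [/nbhs_ballP[e e0 H]|[e e0 H]].
  exists e => // x s xp sp; apply: H; split; rewrite /ball/= distrC//.
by apply/nbhs_ballP; exists e => // -[x s] [/=];
  rewrite /ball/= distrC => xp; rewrite distrC; apply: H.
Qed.

(** Real induction: the supremum of the points reached from [a] is passed by its local hypothesis
    unless it equals [b]. Stated for a relation on subintervals, it serves below as compactness of
    [[a, b]]. *)
Lemma seg_ind (P : RR -> RR -> Prop) (a b : RR) : a <= b ->
  (forall (t : RR), a <= t <= b -> exists2 d : RR, 0 < d & forall (c c' : RR),
     a <= c -> c <= c' -> c' <= b -> t - d < c -> c' < t + d -> P c c') ->
  (forall (x y z : RR), a <= x -> x <= y -> y <= z -> z <= b -> P x y -> P y z -> P x z) ->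
  P a b.
Proof.
move=> ab loc glue.
pose S := [set t | a <= t <= b /\ P a t].
have Paa : P a a.
  have [|d d0 H] := loc a; first by rewrite lexx.
  by apply: H => //; qlra.
have Sa : S a by split => //; rewrite lexx.
have Sub : has_sup S by split; [exists a | exists b => t [/andP[]]].
have sa : a <= sup S by apply: sup_upper_bound.
have sb : sup S <= b by apply: ge_sup; [exists a|move=> t [/andP[]]].
have [|d d0 H] := loc (sup S); first by rewrite sa.
have [t [/andP[ta tb] Pt] ts] := sup_adherent d0 Sub.
have tS : t <= sup S by apply: sup_upper_bound => //; split => //; apply/andP.
pose t' := Num.min b (sup S + d / 2).
have t't : t <= t' by rewrite /t' le_min tb /=; qlra.
have t'b : t' <= b by rewrite /t' ge_min lexx.
have Pt' : P a t'.
  apply: (glue _ t) => //; apply: H => //.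
  by rewrite /t' gt_min; apply/orP; right; qlra.
have : t' <= sup S.
  by apply: sup_upper_bound => //; split => //; apply/andP; split => //; qlra.
rewrite /t' ge_min => /orP[bs|]; last by qlra.
suff <- : t' = b by [].
by apply/eqP; rewrite eq_le t'b /= /t' le_min lexx /=; qlra.
Qed.

Lemma locally_constant_seg (P : RR -> Prop) (a b : RR) : a <= b ->
  (forall (t : RR), a <= t <= b -> exists2 d : RR, 0 < d & forall (c : RR),
     a <= c <= b -> `|c - t| < d -> (P c <-> P t)) ->
  (P a <-> P b).
Proof.
move=> ab loc; apply: (@seg_ind (fun c c' => P c <-> P c')) => //.
- move=> t /loc[d d0 H]; exists d => // c c' ac cc' c'b tc tc'.
  by rewrite H ?H //; rewrite ?ltr_distl; qlra.
- by move=> x y z _ _ _ _ -> ->.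
Qed.

Lemma IVT_for (f : RR -> RR) (a b v : RR) : a <= b ->
  (forall (t : RR), a <= t <= b -> {for t, continuous f}) ->
  (f a <= v <= f b) \/ (f b <= v <= f a) ->
  exists2 c : RR, a <= c <= b & f c = v.
Proof.
move=> ab cf H.
have [||c cab fc] := @IVT _ f a b v ab.
- by apply: continuous_in_subspaceT => t; rewrite inE/= in_itv/=; apply: cf.
- by case: (leP (f a) (f b)) => ?; case: H => /andP[? ?]; qlra.
- by exists c => //; move: cab; rewrite in_itv.
Qed.

(** If [f a = f b], then [f] has an interior extremum or is constant. At an interior extremum the
    intermediate value theorem yields two close points on different sides with the same value,
    against local injectivity; for a constant [f] the midpoint is such an extremum. *)
Lemma locally_injective_seg (f : RR -> RR) (a b : RR) : a < b ->
  (forall (t : RR), a <= t <= b -> {for t, continuous f}) ->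
  (forall (t : RR), a <= t <= b -> exists2 d : RR, 0 < d & forall (c c' : RR),
     a <= c <= b -> a <= c' <= b ->
     `|c - t| < d -> `|c' - t| < d -> f c = f c' -> c = c') ->
  f a <> f b.
Proof.
move=> ab cf li fab.
have cfs : {within `[a, b], continuous f}.
  by apply: continuous_in_subspaceT => t; rewrite inE/= in_itv/=; apply: cf.
have [M Mab HM] := EVT_max (ltW ab) cfs.
have [m mab Hm] := EVT_min (ltW ab) cfs.
have noext : forall (x : RR), a < x < b -> ~ ((forall (t : RR), a <= t <= b -> f t <= f x) \/
    (forall (t : RR), a <= t <= b -> f x <= f t)).
  move=> x /andP[ax xb] ext.
  have [|d d0 H] := li x; first by qlra.
  pose h := Num.min (d / 2) (Num.min (x - a) (b - x)).
  have h0 : 0 < h by rewrite /h !lt_min; apply/and3P; split; qlra.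
  have : h <= h by []. rewrite {2}/h !le_min => /and3P[h1 h2 h3].
  have inh : forall (y : RR), x - h <= y <= x + h -> a <= y <= b /\ `|y - x| < d.
    move=> y /andP[? ?]; split; first by qlra.
    by rewrite ltr_distl; qlra.
  have injh : forall (y z : RR), x - h <= y <= x + h -> x - h <= z <= x + h ->
      f y = f z -> y = z.
    by move=> y z /inh[? ?] /inh[? ?]; apply: H.
  have [vl vr] : f (x - h) <> f x /\ f (x + h) <> f x.
    split => /injh E; (suff: h = 0 by qlra); suff : (x - h = x) \/ (x + h = x) by move=> [?|?]; qlra.
      by left; apply: E; qlra.
    by right; apply: E; qlra.
  have [wl wr] : a <= x - h <= b /\ a <= x + h <= b.
    by split; qlra.
  have cfl : forall (t : RR), x - h <= t <= x -> {for t, continuous f}.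
    by move=> t /andP[? ?]; apply: cf; qlra.
  have cfr : forall (t : RR), x <= t <= x + h -> {for t, continuous f}.
    by move=> t /andP[? ?]; apply: cf; qlra.
  have key : forall (y z : RR), x - h <= y <= x -> x <= z <= x + h -> f y = f z -> y = x.
    move=> y z /andP[? ?] /andP[? ?] /injh E.
    suff: y = z by qlra.
    by apply: E; qlra.
  have xhx : x - h <= x by qlra.
  have xxh : x <= x + h by qlra.
  case: ext => ext; have := ext _ wl; have := ext _ wr => er el.
    have [le|lt] := leP (f (x - h)) (f (x + h)).
      have [|c cc fc] := @IVT_for f (x - h) x (f (x + h)) xhx cfl.
        by left; apply/andP.
      have E : c = x by apply: (key c (x + h)) => //; qlra.
      by apply: vr; rewrite -fc E.
    have [|c cc fc] := @IVT_for f x (x + h) (f (x - h)) xxh cfr.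
      by right; apply/andP; split => //; qlra.
    have E : x - h = x by apply: (key _ c) => //; qlra.
    qlra.
  have [le|lt] := leP (f (x - h)) (f (x + h)).
    have [|c cc fc] := @IVT_for f x (x + h) (f (x - h)) xxh cfr.
      by left; apply/andP; split => //; qlra.
    have E : x - h = x by apply: (key _ c) => //; qlra.
    qlra.
  have [|c cc fc] := @IVT_for f (x - h) x (f (x + h)) xhx cfl.
    by right; apply/andP; split => //; qlra.
  have E : c = x by apply: (key c (x + h)) => //; qlra.
  by apply: vr; rewrite -fc E.
have ends : forall (x : RR), x \in `[a, b] -> ~ (a < x < b) -> f x = f a.
  move=> x; rewrite in_itv/= => /andP[ax xb] nx.
  have [->//|xa] := eqVneq x a.
  have [->//|xb'] := eqVneq x b.
  by exfalso; apply: nx; rewrite !lt_neqAle eq_sym xa ax xb' xb.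
have fM : f M = f a.
  apply: ends => // Min; apply: (noext _ Min); left => t tab.
  by apply: HM; rewrite in_itv.
have fm : f m = f a.
  apply: ends => // Min; apply: (noext _ Min); right => t tab.
  by apply: Hm; rewrite in_itv.
apply: (noext ((a + b) / 2)); first by qlra.
left => t tab; have := HM t; rewrite in_itv/= => /(_ tab); rewrite fM -fm => /le_trans; apply.
by apply: Hm; rewrite in_itv/=; qlra.
Qed.

Lemma inj_between (f : RR -> RR) (a c b : RR) : a < c < b ->
  (forall (t : RR), a <= t <= b -> {for t, continuous f}) ->
  (forall (t t' : RR), a <= t <= b -> a <= t' <= b -> f t = f t' -> t = t') ->
  (f a < f c < f b) \/ (f b < f c < f a).
Proof.
move=> acb cf inj.
have cfl t : a <= t <= c -> {for t, continuous f} by move=> ?; apply: cf; qlra.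
have cfr t : c <= t <= b -> {for t, continuous f} by move=> ?; apply: cf; qlra.
have ac : a <= c by qlra.
have cb : c <= b by qlra.
have nac : f a <> f c by move=> /inj E; suff ? : a = c; [qlra|apply: E; qlra].
have nbc : f c <> f b by move=> /inj E; suff ? : c = b; [qlra|apply: E; qlra].
have L v : (f a <= v <= f c) \/ (f c <= v <= f a) ->
    (f c <= v <= f b) \/ (f b <= v <= f c) -> v = f c.
  move=> /(IVT_for ac cfl)[x xa <-] /(IVT_for cb cfr)[y yb xy].
  suff -> : x = c by [].
  by have : x = y by [apply: inj => //; qlra]; qlra.
have [ha|ha] := leP (f a) (f c); have [hb|hb] := leP (f c) (f b).
- left; apply/andP; split; rewrite lt_neqAle ?ha ?hb andbT; exact/eqP.
- exfalso; have [hab|hab] := leP (f a) (f b).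
  + by apply: nbc; rewrite (L (f b)) //; [left|right]; qlra.
  + by apply: nac; rewrite (L (f a)) //; [left|right]; qlra.
- exfalso; have [hab|hab] := leP (f a) (f b).
  + by apply: nac; rewrite (L (f a)) //; [right|left]; qlra.
  + by apply: nbc; rewrite (L (f b)) //; [right|left]; qlra.
- by right; qlra.
Qed.

(** A parametrized intermediate value theorem: injectivity at [s0] puts [X x0 s0] strictly between
    the values at [a] and [b], and this persists for nearby [s] and [v]. It takes the place of
    invariance of domain for maps that respect the levels [s]; the predicate [Q] allows one-sided
    ranges of [s]. *)
Lemma slide (Q : RR -> Prop) (X : RR -> RR -> RR) (a b x0 s0 : RR) :
  a < x0 < b -> Q s0 ->
  (forall (s : RR), Q s -> forall (x : RR), a <= x <= b -> {for x, continuous (X ^~ s)}) ->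
  (forall (x x' : RR), a <= x <= b -> a <= x' <= b -> X x s0 = X x' s0 -> x = x') ->
  (forall (x : RR), a <= x <= b -> forall (e : RR), 0 < e -> exists2 d : RR, 0 < d &
     forall (s : RR), Q s -> `|s - s0| < d -> `|X x s - X x s0| < e) ->
  exists2 d : RR, 0 < d & forall (s v : RR), Q s -> `|s - s0| < d -> `|v - X x0 s0| < d ->
    exists2 x : RR, a < x < b & X x s = v.
Proof.
move=> axb Qs0 cX inj cs.
have btw := inj_between axb (cX _ Qs0) inj.
pose e := Num.min `|X a s0 - X x0 s0| `|X b s0 - X x0 s0|.
have e0 : 0 < e.
  rewrite /e lt_min !normr_gt0 !subr_eq0.
  by case: btw => /andP[? ?]; apply/andP; split; apply/eqP; qlra.
have ea : e <= `|X a s0 - X x0 s0| by rewrite /e ge_min lexx.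
have eb : e <= `|X b s0 - X x0 s0| by rewrite /e ge_min lexx orbT.
have e20 : 0 < e / 2 by qlra.
have [|da da0 Ha] := cs a _ _ e20; first by qlra.
have [|db db0 Hb] := cs b _ _ e20; first by qlra.
exists (Num.min (e / 2) (Num.min da db)).
  by rewrite !lt_min e20 da0 db0.
move=> s v Qs; rewrite !lt_min => /and3P[_ sa sb] /and3P[ve _ _].
have := Ha _ Qs sa; have := Hb _ Qs sb.
have ab : a <= b by qlra.
rewrite !ltr_distl => /andP[b1 b2] /andP[a1 a2].
move: ve; rewrite ltr_distl => /andP[v1 v2].
have [ltv [c cab Xc]] : (X a s < v < X b s \/ X b s < v < X a s) /\
    exists2 c : RR, a <= c <= b & X c s = v.
  have ltv : X a s < v < X b s \/ X b s < v < X a s.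
    case: btw => /andP[h1 h2]; [left|right].
      rewrite ler0_norm in ea; last by qlra.
      rewrite ger0_norm in eb; last by qlra.
      by qlra.
    rewrite ger0_norm in ea; last by qlra.
    rewrite ler0_norm in eb; last by qlra.
    by qlra.
  split=> //; apply: (IVT_for ab (cX _ Qs)).
  by case: ltv => ?; [left|right]; qlra.
exists c => //.
have ca : c != a by apply/eqP => E; move: ltv; rewrite -Xc E; case=> ?; qlra.
have cb : c != b by apply/eqP => E; move: ltv; rewrite -Xc E; case=> ?; qlra.
by move: cab; rewrite !le_eqVlt (negPf cb) eq_sym (negPf ca).
Qed.

Lemma mono_solve (X : RR -> RR) (y : RR) :
  (forall (t : RR), 0 <= t <= 1 -> {for t, continuous X}) ->
  (forall (t t' : RR), 0 <= t -> t < t' -> t' <= 1 -> X t < X t') ->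
  exists g : RR, [/\ 0 <= g <= 1,
    forall (c : RR), 0 <= c < 1 -> (c < g <-> X c < y) &
    forall (c : RR), 0 < c <= 1 -> (g < c <-> y < X c)].
Proof.
move=> cX mX.
have mX' t t' : 0 <= t -> t <= t' -> t' <= 1 -> X t <= X t'.
  by move=> t0; rewrite le_eqVlt => /orP[/eqP->//|tt'] t1; apply/ltW/mX.
have [y0|y0] := leP y (X 0).
  exists 0; split; first by qlra.
    move=> c c01; split => // Xc; first by qlra.
    by have := mX' 0 c; lra.
  move=> c /andP[c0 c1]; split => // _.
  by have := mX 0 c; lra.
have [y1|y1] := leP (X 1) y.
  exists 1; split; first by qlra.
    move=> c /andP[c0 c1]; split => // _.
    by have := mX c 1; lra.
  move=> c c01; split => // Xc; first by qlra.
  by have := mX' c 1; lra.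
have [|c c01 Xc] := @IVT_for X 0 1 y ler01 cX; first by left; qlra.
exists c; split=> // c' c'01; rewrite -Xc.
  split => [cc'|]; first by apply: mX => //; qlra.
  by move=> h; rewrite ltNge; apply/negP => cc'; have := mX' c c'; lra.
split => [cc'|]; first by apply: mX => //; qlra.
by move=> h; rewrite ltNge; apply/negP => cc'; have := mX' c' c; lra.
Qed.

Lemma bijection_inverse_continuous (h k : RR -> RR) : continuous h ->
  cancel h k -> cancel k h -> continuous k.
Proof.
move=> ch hk kh y0 A /nbhsRP[e e0 HA].
have axb : k y0 - e / 2 < k y0 < k y0 + e / 2 by qlra.
have [||||d d0 Hd] := @slide (fun=> True) (fun x _ => h x) _ _ _ 0 axb => //.
- by move=> s _ x _; apply: ch.
- by move=> x x' _ _ /(can_inj hk).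
- by move=> x _ e' e'0; exists 1 => // s _ _; rewrite subrr normr0.
apply/nbhsRP; exists d => // y yy0; apply: HA.
have [||x xk <-] := Hd 0 y I => //; first by rewrite subrr normr0.
  by rewrite kh.
by rewrite hk ltr_distl; qlra.
Qed.

(** By [slide] the rows [s] and [s'] both attain the value [X x0 s0]. If [c] agreed on them, the
    injective map [(X, c)] would take one value at two heights. *)
Lemma locally_injective_height (X : RR -> RR -> RR) (c : RR -> RR)
    (e x0 s0 : RR) : 0 < e ->
  (forall (s : RR), `|s - s0| < e -> forall (x : RR), `|x - x0| < e ->
     {for x, continuous (X ^~ s)}) ->
  (forall (x : RR), `|x - x0| < e -> {for s0, continuous (X x)}) ->
  (forall (x s x' s' : RR), `|x - x0| < e -> `|s - s0| < e -> `|x' - x0| < e ->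
     `|s' - s0| < e -> X x s = X x' s' -> c s = c s' -> x = x' /\ s = s') ->
  exists2 d : RR, 0 < d & forall (s s' : RR), `|s - s0| < d -> `|s' - s0| < d ->
    c s = c s' -> s = s'.
Proof.
move=> e0 cx cs inj.
have near x : x0 - e / 2 <= x <= x0 + e / 2 -> `|x - x0| < e.
  by move=> ?; rewrite ltr_distl; qlra.
have s0e : `|s0 - s0| < e by rewrite subrr normr0.
have axb : x0 - e / 2 < x0 < x0 + e / 2 by qlra.
have [||||d d0 Hd] := @slide (fun s => `|s - s0| < e) X _ _ _ s0 axb => //.
- by move=> s se x /near; apply: cx.
- by move=> x x' /near ? /near ? Xx; have [] := inj x s0 x' s0.
- move=> x /near xe e' e'0.
  have [|d d0 Hd] := (nbhsRP s0 _).1 (cs _ xe (ball (X x s0) e') _).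
    exact: nbhsx_ballx.
  by exists d => // s _ /Hd; rewrite /ball/= distrC.
exists (Num.min d e); first by rewrite lt_min d0 e0.
move=> s s'; rewrite !lt_min => /andP[sd se] /andP[s'd s'e] ss'.
have v0 : `|X x0 s0 - X x0 s0| < d by rewrite subrr normr0.
have [x xx Xx] := Hd s _ se sd v0.
have [x' xx' Xx'] := Hd s' _ s'e s'd v0.
have [] := inj x s x' s' => //; try by apply: near; qlra.
by rewrite Xx Xx'.
Qed.

(** * Dyadic sums of sequences in [0, 1] *)

Definition dyadic_psum (g : nat -> RR) n : RR := \sum_(k < n) g k / 2 ^+ k.+1.
Definition dyadic_sum (g : nat -> RR) : RR := sup (range (dyadic_psum g)).

Lemma half_expr_small (e : RR) : 0 < e -> exists n, (2^-1) ^+ n < e.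
Proof.
move=> e0; have : (fun n => (2^-1 : RR) ^+ n) @ \oo --> (0 : RR).
  by apply: cvg_expr; rewrite ger0_norm; qlra.
move/cvgrPdist_lt => /(_ _ e0)[n _ /(_ n (leqnn n))].
rewrite sub0r normrN ger0_norm; first by exists n.
by apply: exprn_ge0; qlra.
Qed.

Lemma dyadic_psum_tail (g : nat -> RR) n m : (forall k, 0 <= g k <= 1) ->
  dyadic_psum g n <= dyadic_psum g (n + m) <= dyadic_psum g n + (2^-1) ^+ n - (2^-1) ^+ (n + m).
Proof.
move=> g01; elim: m => [|m /andP[IH1 IH2]]; first by rewrite addn0 lexx addrK lexx.
have /andP[g0 g1] := g01 (n + m)%N.
rewrite addnS /dyadic_psum big_ord_recr /= -/(dyadic_psum _ _).
have p0 : 0 <= (2^-1 : RR) ^+ (n + m) by apply: exprn_ge0; qlra.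
have -> : g (n + m)%N / 2 ^+ (n + m).+1 = g (n + m)%N * (2^-1 ^+ (n + m) / 2).
  by rewrite -exprVn exprS; ring.
rewrite [(2^-1) ^+ (n + m).+1]exprS.
have h1 : 0 <= g (n + m)%N * (2^-1 ^+ (n + m) / 2) by apply: mulr_ge0; qlra.
have h2 : g (n + m)%N * (2^-1 ^+ (n + m) / 2) <= 2^-1 ^+ (n + m) / 2.
  by apply: ler_piMl; qlra.
by rewrite -/(dyadic_psum g n) -/(dyadic_psum g (n + m)); qlra.
Qed.

Lemma dyadic_sum_bounds (g : nat -> RR) n : (forall k, 0 <= g k <= 1) ->
  dyadic_psum g n <= dyadic_sum g <= dyadic_psum g n + (2^-1) ^+ n.
Proof.
move=> g01.
have ub m : dyadic_psum g m <= dyadic_psum g n + (2^-1) ^+ n.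
  have p0 k : 0 <= (2^-1 : RR) ^+ k by apply: exprn_ge0; qlra.
  have [mn|nm] := leqP m n.
    have := @dyadic_psum_tail g m (n - m) g01; rewrite subnKC // => /andP[? _].
    by have := p0 n; lra.
  have := @dyadic_psum_tail g n (m - n) g01; rewrite subnKC ?(ltnW nm) // => /andP[_ ?].
  by have := p0 m; lra.
apply/andP; split.
  apply: sup_upper_bound; last by exists n.
  split; first by exists (dyadic_psum g 0); exists 0%N.
  by exists (dyadic_psum g n + (2^-1) ^+ n) => _ [m _ <-].
apply: ge_sup; first by exists (dyadic_psum g 0); exists 0%N.
by move=> _ [m _ <-].
Qed.

Lemma dyadic_sum_ge0 g : (forall k, 0 <= g k <= 1) -> 0 <= dyadic_sum g.
Proof. by move=> /(dyadic_sum_bounds 0)/andP[]; rewrite /dyadic_psum big_ord0. Qed.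

Lemma dyadic_psum_gap (g g' : nat -> RR) k n : (forall k, g k <= g' k) -> (k < n)%N ->
  dyadic_psum g n + (g' k - g k) / 2 ^+ k.+1 <= dyadic_psum g' n.
Proof.
move=> gg' kn; rewrite -lerBrDl /dyadic_psum -sumrB.
rewrite (bigD1 (Ordinal kn)) //= -mulrBl lerDl sumr_ge0 // => i _.
by rewrite -mulrBl divr_ge0 ?subr_ge0 ?exprn_ge0.
Qed.

Lemma ler_dyadic_sum_gap (g g' : nat -> RR) k : (forall k, 0 <= g k <= 1) ->
  (forall k, 0 <= g' k <= 1) -> (forall k, g k <= g' k) ->
  dyadic_sum g + (g' k - g k) / 2 ^+ k.+1 <= dyadic_sum g'.
Proof.
move=> g01 g01' gg'; apply/ler_addgt0Pr => e e0.
have [n ne] := half_expr_small e0.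
pose m := (n + k.+1)%N.
have km : (k < m)%N by rewrite /m addnS ltnS leq_addl.
have mn : (2^-1 : RR) ^+ m <= (2^-1) ^+ n.
  by apply: ler_wiXn2l; rewrite ?leq_addr//; qlra.
have := dyadic_psum_gap gg' km.
have := dyadic_sum_bounds m g01; have := dyadic_sum_bounds m g01'.
by move=> /andP[? _] /andP[_ ?] ?; qlra.
Qed.

Lemma ler_dyadic_sum (g g' : nat -> RR) : (forall k, 0 <= g k <= 1) ->
  (forall k, 0 <= g' k <= 1) -> (forall k, g k <= g' k) ->
  dyadic_sum g <= dyadic_sum g'.
Proof.
move=> g01 g01' gg'; have := ler_dyadic_sum_gap 0 g01 g01' gg'.
have : 0 <= (g' 0%N - g 0%N) / 2 ^+ 1 by rewrite divr_ge0 ?subr_ge0.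
lra.
Qed.

Lemma ltr_dyadic_sum (g g' : nat -> RR) k : (forall k, 0 <= g k <= 1) ->
  (forall k, 0 <= g' k <= 1) -> (forall k, g k <= g' k) -> g k < g' k ->
  dyadic_sum g < dyadic_sum g'.
Proof.
move=> g01 g01' gg' gk; have := ler_dyadic_sum_gap k g01 g01' gg'.
have : 0 < (g' k - g k) / 2 ^+ k.+1 by rewrite divr_gt0 ?subr_gt0 ?exprn_gt0.
lra.
Qed.

(** The tails are at most [2^-n] uniformly in [p], so termwise convergence is enough. The three
    thirds of [e] go to the two tails and to the partial sum. *)
Lemma cvg_dyadic_sum (T : Type) (F : set_system T) {FF : ProperFilter F}
    (G : T -> nat -> RR) (l : nat -> RR) :
  (forall p k, 0 <= G p k <= 1) -> (forall k, 0 <= l k <= 1) ->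
  (forall k, (G ^~ k) @ F --> l k) ->
  (fun p => dyadic_sum (G p)) @ F --> dyadic_sum l.
Proof.
move=> G01 l01 Gl; apply/cvgrPdist_lt => e e0.
have e30 : 0 < e / 3 by qlra.
have [n ne] := half_expr_small e30.
have : (fun p => dyadic_psum (G p) n) @ F --> dyadic_psum l n.
  rewrite /dyadic_psum; elim: {ne} n => [|n IH].
    rewrite big_ord0; under eq_fun do rewrite big_ord0; exact: cvg_cst.
  rewrite big_ord_recr /=; under eq_fun do rewrite big_ord_recr /=.
  by apply: cvgD => //; apply: cvgMr_tmp; apply: Gl.
move/cvgrPdist_lt => H; have := H _ e30; apply: filterS => p.
have := dyadic_sum_bounds n (G01 p); have := dyadic_sum_bounds n l01.
move=> /andP[? ?] /andP[? ?]; rewrite !ltr_norml => /andP[? ?].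
by qlra.
Qed.

(** * Half-boxes at a leaf *)

Lemma within_continuous_nbhs (X Y : topologicalType) (A : set X) (f : X -> Y) :
  {within A, continuous f} <->
  forall x, A x -> forall B, nbhs (f x) B -> nbhs x [set y | A y -> B (f y)].
Proof.
rewrite subspace_continuousP; split => H x Ax B /(H x Ax); exact.
Qed.

Lemma within_setT_continuous (X Y : topologicalType) (f : X -> Y) :
  {within setT, continuous f} -> continuous f.
Proof.
move=> /within_continuous_nbhs H x B /(H x I); apply: filterS => y; exact.
Qed.

Lemma continuous_nbhs (X Y : topologicalType) (f : X -> Y) x (B : set Y) :
  {for x, continuous f} -> nbhs (f x) B -> nbhs x [set y | B (f y)].
Proof. by move=> cf; apply: cf. Qed.

Section Leaves.
Context {Z : topologicalType} (D : set (set Z)).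
Context (partD : Defs.partition D).
Context (leafR : forall w, D w -> exists f : RR -> Z, homeo_on setT w f).

Definition sameleaf (y z : Z) : Prop := exists w, [/\ D w, w y & w z].

Lemma sameleaf_refl y : sameleaf y y.
Proof. by have [_ _ /(_ y)[w [? ?]]] := partD; exists w. Qed.

Lemma sameleaf_sym y z : sameleaf y z -> sameleaf z y.
Proof. by move=> [w [? ? ?]]; exists w. Qed.

Lemma leaf_unique w w' y : D w -> D w' -> w y -> w' y -> w = w'.
Proof. by have [_ H _] := partD => Dw Dw' wy w'y; apply: H => //; exists y. Qed.

Lemma sameleaf_trans y z x : sameleaf y z -> sameleaf z x -> sameleaf y x.
Proof.
move=> [w [Dw wy wz]] [w' [Dw' w'z w'x]]; exists w; split => //.
by rewrite (leaf_unique Dw Dw' wz w'z).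
Qed.

Lemma sameleaf_in w y z : D w -> w y -> sameleaf y z -> w z.
Proof. by move=> Dw wy [w' [Dw' w'y ?]]; rewrite (leaf_unique Dw Dw' wy w'y). Qed.


(** The leaf carries the topology of the line. The leaf coordinate along the arc [l] is injective
    and continuous, so its values fill a neighbourhood of [g (l x0)], and every point of [w] close
    to [l x0] has its coordinate there. Hence a leaf does not accumulate at a point of itself. *)
Lemma leaf_isolated w (l : RR -> Z) x0 a : D w -> 0 < a ->
  (forall x, `|x - x0| < a -> {for x, continuous l}) ->
  (forall x x', `|x - x0| < a -> `|x' - x0| < a -> l x = l x' -> x = x') ->
  (forall x, `|x - x0| < a -> w (l x)) ->
  nbhs (l x0) [set y | w y -> exists2 x, `|x - x0| < a & y = l x].
Proof.
move=> Dw a0 cl il wl.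
have [f [g [_ /within_continuous_nbhs cg gf fg]]] := leafR Dw.
have inA x : x0 - a / 2 <= x <= x0 + a / 2 -> `|x - x0| < a.
  by move=> ?; rewrite ltr_distl; qlra.
have wlx0 : w (l x0) by apply: wl; rewrite subrr normr0.
have axb : x0 - a / 2 < x0 < x0 + a / 2 by qlra.
have [||||d d0 Hd] := @slide (fun=> True) (fun x _ => g (l x)) _ _ _ 0 axb => //.
- move=> _ _ x /inA xa B /(cg _ (wl _ xa)) /(cl _ xa) HB.
  have xN : nbhs x [set x' | `|x' - x0| < a].
    apply/nbhsRP; exists (a - `|x - x0|); first by rewrite subr_gt0.
    move=> y yx /=; have := ler_distD x y x0; move: yx; lra.
  have HB' : nbhs x [set x' | w (l x') -> B (g (l x'))] by exact: HB.
  change (nbhs x [set x' | B (g (l x'))]).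
  by move: HB' xN; apply: filterS2 => y /= H /wl /H.
- move=> x x' /inA xa /inA xa' E; apply: il => //.
  by rewrite -(fg _ (wl _ xa)).2 E (fg _ (wl _ xa')).2.
- by move=> x _ e' e'0; exists 1 => // s _ _; rewrite subrr normr0.
have : nbhs (l x0) [set y | w y -> `|g y - g (l x0)| < d].
  by apply: (cg _ wlx0 [set v | `|v - g (l x0)| < d]); apply/nbhsRP; exists d.
apply: filterS => y H wy; have := H wy => {}H.
have [|x xa gx] := Hd 0 (g y) I _ H; first by rewrite subrr normr0.
exists x; first by apply: inA; qlra.
have xa' : `|x - x0| < a by apply: inA; qlra.
by rewrite -(fg _ wy).2 -gx (fg _ (wl _ xa')).2.
Qed.

(** A half-disc with its diameter in a leaf and its levels in leaves. The even extension to negative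
    [s] turns continuity at the edge into ordinary continuity in the plane; injectivity is asked for
    [s >= 0] and openness for [s > 0]. By [hb_iso] no other level lies on the leaf of the edge. *)
Record half_box (b : plane -> Z) : Prop := HalfBox {
  hb_cont : forall (x s : RR), `|x| < 1 -> `|s| < 1 -> {for (x, s), continuous b};
  hb_even : forall (x s : RR), b (x, - s) = b (x, s);
  hb_inj : forall (x s x' s' : RR), `|x| < 1 -> 0 <= s < 1 -> `|x'| < 1 -> 0 <= s' < 1 ->
    b (x, s) = b (x', s') -> x = x' /\ s = s';
  hb_leaf : forall (x s x' : RR), `|x| < 1 -> `|s| < 1 -> `|x'| < 1 ->
    sameleaf (b (x, s)) (b (x', s));
  hb_open : forall (x s : RR) (A : set plane), `|x| < 1 -> 0 < s < 1 -> nbhs (x, s) A ->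
    nbhs (b (x, s)) (b @` A);
  hb_iso : forall (x s : RR), `|x| < 1 -> `|s| < 1 -> sameleaf (b (x, s)) (b (0, 0)) ->
    s = 0 }.

Definition full_pair (b1 b2 : plane -> Z) : Prop :=
  forall (x s x' s' : RR), `|x| < 1 -> 0 < s < 1 -> `|x'| < 1 -> 0 < s' < 1 ->
    b1 (x, s) <> b2 (x', s').

(* Two half-boxes with a common edge covering a neighbourhood of it: the two
   sides of the edge, or twice the same half-box at a boundary point. *)
Record box_pair (b1 b2 : plane -> Z) : Prop := BoxPair {
  bp_l : half_box b1;
  bp_r : half_box b2;
  bp_edge : forall (x : RR), `|x| < 1 -> b1 (x, 0) = b2 (x, 0);
  bp_cover : forall (x : RR) (A : set plane), `|x| < 1 -> nbhs (x, 0) A ->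
    nbhs (b1 (x, 0)) (b1 @` A `|` b2 @` A);
  bp_sides : b1 = b2 \/ full_pair b1 b2 }.


Record foliated_chart (U : set Z) (h : Z -> plane) (g : plane -> Z)
    (V : set plane) : Prop := FoliatedChart {
  fc_open : open U;
  fc_can : forall p, V p -> U (g p) /\ h (g p) = p;
  fc_inv : forall y, U y -> V (h y) /\ g (h y) = y;
  fc_contg : forall p, V p -> forall B, nbhs (g p) B -> nbhs p [set q | V q -> B (g q)];
  fc_conth : forall y, U y -> {for y, continuous h};
  fc_leaf : forall p q, V p -> V q -> p.2 = q.2 -> sameleaf (g p) (g q) }.

(** The sign of [e'] selects the side of the level [s0] that is covered. *)
Definition param_box (g : plane -> Z) (x0 s0 e e' : RR) : plane -> Z :=
  fun p => g (x0 + e * p.1, s0 + e' * `|p.2|).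

Lemma param_half_box U h g V (x0 s0 e e' : RR) : foliated_chart U h g V ->
  0 < e -> e' = e \/ e' = - e ->
  (forall (x s : RR), `|x| < 1 -> 0 <= s < 1 -> V (x0 + e * x, s0 + e' * s)) ->
  (forall (x s : RR), `|x| < 1 -> 0 < s < 1 -> nbhs (x0 + e * x, s0 + e' * s) V) ->
  (forall (x s : RR), `|x - x0| < e -> `|s - s0| < e -> V (x, s) ->
     sameleaf (g (x, s)) (g (x0, s0)) -> s = s0) ->
  half_box (param_box g x0 s0 e e').
Proof.
move=> fc e0 ee v1 v2 iso.
have e'0 : e' != 0 by case: ee => ->; rewrite ?oppr_eq0 gt_eqF.
have ne' : `|e'| = e by case: ee => ->; rewrite ?normrN gtr0_norm.
have v1' (x s : RR) : `|x| < 1 -> `|s| < 1 -> V (x0 + e * x, s0 + e' * `|s|).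
  by move=> x1 s1; apply: v1 => //; rewrite s1 normr_ge0.
split.
- move=> x s x1 s1 B /(fc_contg fc (v1' x s x1 s1)) /nbhs2P[d d0 /= Hd].
  apply/nbhs2P; exists (Num.min (d / e) (Num.min (1 - `|x|) (1 - `|s|))).
    by rewrite !lt_min divr_gt0 // !subr_gt0 x1 s1.
  move=> x' s' /=; rewrite !lt_min => /and3P[xd x1' _] /and3P[sd _ s1'].
  have x'1 : `|x'| < 1 by have := ler_distD x x' 0; rewrite !subr0; qlra.
  have s'1 : `|s'| < 1 by have := ler_distD s s' 0; rewrite !subr0; qlra.
  rewrite /param_box /=; apply: Hd; last exact: v1'.
    have -> : x0 + e * x' - (x0 + e * x) = e * (x' - x) by ring.
    by rewrite normrM (gtr0_norm e0) mulrC -ltr_pdivlMr.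
  have -> : s0 + e' * `|s'| - (s0 + e' * `|s|) = e' * (`|s'| - `|s|) by ring.
  rewrite normrM ne' mulrC -ltr_pdivlMr //.
  exact: le_lt_trans (ler_dist_dist _ _) sd.
- by move=> x s; rewrite /param_box /= normrN.
- move=> x s x' s' x1 /andP[s0' s1] x'1 /andP[s'0 s'1]; rewrite /param_box /=.
  rewrite !ger0_norm // => E.
  have [|_ E1] := fc_can fc (v1 x s x1 _); first by rewrite s0'.
  have [|_ E2] := fc_can fc (v1 x' s' x'1 _); first by rewrite s'0.
  move: E1; rewrite E E2 => -[] /addrI /(mulfI (lt0r_neq0 e0)) ->.
  by move=> /addrI /(mulfI e'0) ->.
- by move=> x s x' x1 s1 x'1; apply: (fc_leaf fc) => //; apply: v1'.
- move=> x s A x1 s01 /nbhs2P[d d0 /= Hd].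
  have sa : `|s| = s by rewrite gtr0_norm //; qlra.
  rewrite /param_box /= sa.
  set p := (_, _) : plane.
  have Vp : V p by apply: v1 => //; qlra.
  have [Ugp hgp] := fc_can fc Vp.
  have nU : nbhs (g p) U by apply: open_nbhs_nbhs; split => //; exact: fc_open fc.
  have nB : nbhs (h (g p)) [set q : plane | `|q.1 - p.1| < e * Num.min d s /\ `|q.2 - p.2| < e * Num.min d s].
    rewrite hgp; apply/nbhs2P; exists (e * Num.min d s); last by [].
    by rewrite mulr_gt0 // lt_min d0 /=; qlra.
  have := fc_conth fc Ugp nB; apply: filterS2 nU => y Uy /= [h1 h2].
  have [Vh ghy] := fc_inv fc Uy.
  have ev (a1 a2 : RR) : e * (a1 - a2) = (x0 + e * a1) - (x0 + e * a2) by ring.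
  have ev' (a1 a2 : RR) : e' * (a1 - a2) = (s0 + e' * a1) - (s0 + e' * a2) by ring.
  pose u := ((h y).1 - x0) / e; pose t := ((h y).2 - s0) / e'.
  have hu : x0 + e * u = (h y).1 by rewrite /u mulrC divfK ?gt_eqF//; ring.
  have ht : s0 + e' * t = (h y).2 by rewrite /t mulrC divfK //; ring.
  have ud : `|u - x| < d.
    have : e * `|u - x| < e * Num.min d s.
      by rewrite -{1}(gtr0_norm e0) -normrM ev hu.
    by rewrite ltr_pM2l // lt_min => /andP[].
  have : `|t - s| < Num.min d s.
    by rewrite -(ltr_pM2l e0) -{1}ne' -normrM ev' ht.
  rewrite lt_min ltr_distl => /andP[/andP[td1 td2]]; rewrite ltr_distl => /andP[ts1 ts2].
  exists (u, t); last by rewrite /= hu gtr0_norm ?ht -?surjective_pairing //; qlra.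
  by apply: Hd => //; rewrite ltr_distl; qlra.
- move=> x s x1 s1; rewrite /param_box /= mulr0 normr0 mulr0 !addr0 => E.
  have /addrI : s0 + e' * `|s| = s0 + 0.
    rewrite addr0; apply: (iso (x0 + e * x) _ _ _ _ E).
    + by rewrite addrAC subrr add0r normrM gtr0_norm // gtr_pMr.
    + by rewrite addrAC subrr add0r normrM ne' normr_id gtr_pMr.
    + exact: v1'.
  by move=> /eqP; rewrite mulf_eq0 (negPf e'0) normr_eq0 => /eqP.
Qed.

(** By [leaf_isolated] the points of the leaf near [g (x0, s0)] all lie on the plaque at height
    [s0], and the chart is injective. *)
Lemma chart_isolated U h g V (x0 s0 r : RR) : foliated_chart U h g V -> 0 < r ->
  (forall x : RR, `|x - x0| < r -> V (x, s0)) ->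
  exists2 e : RR, 0 < e & forall x s : RR, `|x - x0| < e -> `|s - s0| < e ->
    V (x, s) -> sameleaf (g (x, s)) (g (x0, s0)) -> s = s0.
Proof.
move=> fc r0 Vl.
have V0 : V (x0, s0) by apply: Vl; rewrite subrr normr0.
have [w [Dw wg _]] := sameleaf_refl (g (x0, s0)).
have wl (x : RR) : `|x - x0| < r -> w (g (x, s0)).
  move=> xr; apply: (sameleaf_in Dw wg); apply: (fc_leaf fc) => //; exact: Vl.
have c1 (x : RR) : `|x - x0| < r -> {for x, continuous (fun x : RR => g (x, s0))}.
  move=> xr B /(fc_contg fc (Vl x xr)) /nbhs2P[d d0 Hd].
  apply/nbhsRP; exists (Num.min d (r - `|x - x0|)); first by rewrite lt_min d0 subr_gt0.
  move=> y; rewrite lt_min => /andP[yd yr]; apply: Hd; rewrite ?subrr ?normr0 //.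
  by apply: Vl; have := ler_distD x y x0; qlra.
have c2 (x x' : RR) : `|x - x0| < r -> `|x' - x0| < r -> g (x, s0) = g (x', s0) -> x = x'.
  move=> xr x'r E; have := (fc_can fc (Vl x xr)).2.
  by rewrite E (fc_can fc (Vl x' x'r)).2 => -[].
have W := leaf_isolated Dw r0 c1 c2 wl.
have := fc_contg fc V0 W.
move=> /nbhs2P[d d0 Hd]; exists d => // x s xd sd Vxs /sameleaf_sym E.
have [x' x'r gE] := Hd x s xd sd Vxs (sameleaf_in Dw wg E).
have := (fc_can fc Vxs).2.
by rewrite gE (fc_can fc (Vl x' x'r)).2 => -[].
Qed.

(** [full] tells whether the chart extends to both sides of the level [s0]. Otherwise it ends at
    this level, and one half-box is used for both entries of the pair. *)
Lemma box_of_chart U h g V (x0 s0 r : RR) (full : bool) O :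
  foliated_chart U h g V -> 0 < r ->
  (forall x s : RR, `|x - x0| < r -> `|s - s0| < r ->
     (V (x, s) <-> (full || (s0 <= s)))) ->
  nbhs (g (x0, s0)) O ->
  exists b1 b2, [/\ box_pair b1 b2, b1 (0, 0) = g (x0, s0),
    forall x s : RR, `|x| < 1 -> `|s| < 1 -> O (b1 (x, s)) /\ O (b2 (x, s)) &
    if full then full_pair b1 b2 else b1 = b2].
Proof.
move=> fc r0 VE nO.
have Vl (x : RR) : `|x - x0| < r -> V (x, s0).
  by move=> xr; apply/VE; rewrite ?subrr ?normr0 // lexx orbT.
have V0 : V (x0, s0) by apply: Vl; rewrite subrr normr0.
have [e1 e10 iso] := chart_isolated fc r0 Vl.
have [e2 e20 HO] := (nbhs2P _ _).1 (fc_contg fc V0 nO).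
pose e := Num.min r (Num.min e1 e2).
have e0 : 0 < e by rewrite !lt_min r0 e10 e20.
have [er ee1 ee2] : [/\ e <= r, e <= e1 & e <= e2].
  by rewrite /e !ge_min !lexx !orbT.
have sc (x x1 : RR) (e' : RR) : e' = e \/ e' = - e -> `|x| < 1 -> `|x1 + e' * x - x1| < e.
  move=> ee x1'; rewrite addrAC subrr add0r normrM.
  have -> : `|e'| = e by case: ee => ->; rewrite ?normrN gtr0_norm.
  by rewrite gtr_pMr.
have ab (s : RR) : 0 <= s < 1 -> `|s| < 1 by move=> ?; rewrite ger0_norm; qlra.
have lp := @param_half_box U h g V x0 s0 e.
have iso' (x s : RR) : `|x - x0| < e -> `|s - s0| < e -> V (x, s) ->
     sameleaf (g (x, s)) (g (x0, s0)) -> s = s0.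
  by move=> xe se; apply: iso; qlra.
have ndV (x s : RR) : `|x - x0| < e -> `|s - s0| < e -> (full \/ s0 < s) ->
    nbhs (x, s) V.
  move=> xe se fs; apply/nbhs2P => /=.
  exists (Num.min (e - `|x - x0|) (if full then e - `|s - s0| else Num.min (e - `|s - s0|) (s - s0))).
    by rewrite lt_min subr_gt0 xe /=; case: full fs {VE} => fs; rewrite ?lt_min !subr_gt0 ?se //=; case: fs.
  move=> x' s'; rewrite !lt_min => /andP[xx _] /andP[_ ss].
  have se' : `|s' - s| < e - `|s - s0| by move: ss; case: ifP => // _; rewrite lt_min => /andP[].
  apply/VE; first by have := ler_distD x x' x0; qlra.
    by have := ler_distD s s' s0; qlra.
  case: full fs ss {VE} => //= -[//|ss0]; rewrite lt_min => /andP[_].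
  by rewrite ltr_distl; qlra.
have b1hb : half_box (param_box g x0 s0 e e).
  apply: lp => //; first by left.
    move=> x s x1 s1; apply/VE.
    + by apply: lt_le_trans er; apply: sc => //; left.
    + by apply: lt_le_trans er; apply: sc => //; [left|apply: ab].
    + by case: full {VE ndV} => //=; rewrite lerDl mulr_ge0 //; qlra.
  move=> x s x1 s1; apply: ndV.
    + by apply: sc => //; left.
    + by apply: sc => //; [left|apply: ab; qlra].
    + by right; rewrite ltrDl mulr_gt0 //; qlra.
have b2hb : full -> half_box (param_box g x0 s0 e (- e)).
  move=> ft; apply: lp => //; first by right.
    move=> x s x1 s1; apply/VE.
    + by apply: lt_le_trans er; apply: sc => //; left.
    + by apply: lt_le_trans er; apply: sc => //; [right|apply: ab].
    + by rewrite ft.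
  move=> x s x1 s1; apply: ndV.
    + by apply: sc => //; left.
    + by apply: sc => //; [right|apply: ab; qlra].
    + by left.
have inO (x s e' : RR) : e' = e \/ e' = - e -> full \/ e' = e -> `|x| < 1 -> `|s| < 1 ->
    O (param_box g x0 s0 e e' (x, s)).
  move=> ee fe x1 s1; rewrite /param_box /=.
  have hx : `|x0 + e * x - x0| < e by apply: sc => //; left.
  have hs : `|s0 + e' * `|s| - s0| < e by apply: sc => //; rewrite normr_id.
  apply: HO => /=; try exact: lt_le_trans ee2.
  apply/VE; try exact: lt_le_trans er.
  case: full fe {VE ndV b2hb} => //= -[//|->]; by rewrite lerDl mulr_ge0 // ltW.
pose e' := if full then - e else e.
have ee' : e' = e \/ e' = - e by rewrite /e'; case: ifP => _; [right|left].
have fe' : full \/ e' = e by rewrite /e'; case: ifP => _; [left|right].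
have fp : full -> full_pair (param_box g x0 s0 e e) (param_box g x0 s0 e (- e)).
  move=> ft x s x' s' x1 s1 x'1 s'1.
  have [sp s'p] : 0 < s /\ 0 < s' by qlra.
  rewrite /param_box /= (gtr0_norm sp) (gtr0_norm s'p).
  have Vall (y t ee : RR) : ee = e \/ ee = - e -> `|y| < 1 -> `|t| < 1 -> V (x0 + e * y, s0 + ee * t).
    move=> hee y1 t1; apply/VE; rewrite ?ft //.
      by apply: lt_le_trans er; apply: sc => //; left.
    by apply: lt_le_trans er; apply: sc.
  have [|||_ E1] := fc_can fc (Vall x s e _ _ _) => //; [by left| by apply: ab; qlra|].
  have [|||_ E2] := fc_can fc (Vall x' s' (- e) _ _ _) => //; [by right| by apply: ab; qlra|].
  move=> E; move: E1; rewrite E E2 => -[_ /addrI].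
  have : 0 < e * s by rewrite mulr_gt0 //; qlra.
  have : 0 < e * s' by rewrite mulr_gt0 //; qlra.
  by rewrite mulNr; qlra.
exists (param_box g x0 s0 e e), (param_box g x0 s0 e e'); split.
- split.
  + exact: b1hb.
  + by rewrite /e'; case: ifP => // ft; exact: b2hb.
  + by move=> x x1; rewrite /param_box /= normr0 !mulr0.
  + move=> x A x1 /nbhs2P[d d0 /= Hd]; rewrite /param_box /= normr0 mulr0 addr0.
    have hx : `|x0 + e * x - x0| < e by apply: sc => //; left.
    have Vx : V (x0 + e * x, s0) by apply: Vl; apply: lt_le_trans er.
    have [Ugp hgp] := fc_can fc Vx.
    set p := (_, _) : plane in Vx Ugp hgp *.
    have nU : nbhs (g p) U by apply: open_nbhs_nbhs; split => //; exact: fc_open fc.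
    pose m := Num.min d (1 - `|x|).
    have m0 : 0 < m by rewrite lt_min d0 subr_gt0.
    have nB : nbhs (h (g p)) [set q : plane | `|q.1 - p.1| < e * m /\ `|q.2 - p.2| < e * m].
      rewrite hgp; apply/nbhs2P; exists (e * m); last by [].
      by rewrite mulr_gt0.
    have := fc_conth fc Ugp nB; apply: filterS2 nU => y Uy /= [h1 h2].
    have [Vh ghy] := fc_inv fc Uy.
    pose u := ((h y).1 - x0) / e.
    have hu : x0 + e * u = (h y).1 by rewrite /u mulrC divfK ?gt_eqF//; ring.
    have um : `|u - x| < m.
      rewrite -(ltr_pM2l e0) -{1}(gtr0_norm e0) -normrM.
      by have -> : e * (u - x) = (h y).1 - p.1 by rewrite /= -hu; ring.
    have [ud u1] : `|u - x| < d /\ `|u| < 1.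
      move: um; rewrite /m lt_min => /andP[-> ux]; split => //.
      by have := ler_distD x u 0; rewrite !subr0; qlra.
    have md : e * m <= e * d by rewrite ler_pM2l // /m ge_min lexx.
    have mul1 : e * m <= e by rewrite ler_piMr ?(ltW e0) // /m ge_min gerBl normr_ge0 orbT.
    have hp2 : p.2 = s0 by [].
    have hy1 : `|(h y).1 - x0| < r.
      by rewrite -hu; apply: lt_le_trans er; apply: sc => //; left.
    have hy2 : `|(h y).2 - s0| < r by rewrite -hp2; qlra.
    have yin (ee : RR) (b : bool) : ee = e \/ ee = - e -> 0 <= ((h y).2 - s0) / ee ->
        (param_box g x0 s0 e ee @` A) y.
      move=> hee t0; exists (u, ((h y).2 - s0) / ee).
        apply: Hd => //=; rewrite subr0 normrM normfV.
        have -> : `|ee| = e by case: hee => ->; rewrite ?normrN gtr0_norm.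
        by rewrite ltr_pdivrMr // mulrC -hp2; qlra.
      rewrite /param_box /= hu ger0_norm // mulrC divfK; last first.
        by case: hee => ->; rewrite ?oppr_eq0 gt_eqF.
      by rewrite addrC subrK -surjective_pairing.
    have [le|lt] := leP s0 (h y).2.
      by left; apply: (yin e true); [left|rewrite divr_ge0 ?subr_ge0 // ltW].
    right; rewrite /e'; case: ifP => E.
      apply: (yin (- e) true); first by right.
      by rewrite invrN mulrN -mulNr opprB divr_ge0 ?subr_ge0 // ltW.
    have : V ((h y).1, (h y).2) by rewrite -surjective_pairing.
    by move=> /(VE _ _ hy1 hy2); rewrite E /=; qlra.
  + rewrite /e'; case: ifP => E; last by left.
    by right; apply: fp.
- by rewrite /param_box /= normr0 !mulr0 !addr0.
- by move=> x s x1 s1; split; apply: inO => //; [left|right].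
- by have [ft|ft] := boolP full; rewrite /e' ?ft ?(negPf ft) //; exact: fp.
Qed.
End Leaves.

(** * Germs at an edge, and neighbourhoods spread along a leaf *)

Lemma hrect_const (P : plane -> Prop) (x0 e : RR) :
  (forall x s : RR, `|x - x0| < e -> 0 < s < e -> nbhs (x, s) [set q | P q <-> P (x, s)]) ->
  forall x s x' s' : RR, `|x - x0| < e -> 0 < s < e -> `|x' - x0| < e -> 0 < s' < e ->
  (P (x, s) <-> P (x', s')).
Proof.
move=> loc.
have V (x s s' : RR) : `|x - x0| < e -> 0 < s < e -> 0 < s' < e -> s <= s' ->
    (P (x, s) <-> P (x, s')).
  move=> xe se s'e ss; apply: (@locally_constant_seg (fun t => P (x, t))) => // t tt.
  have [|d d0 Hd] := (nbhs2P _ _).1 (loc x t xe _); first by qlra.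
  by exists d => // c _ cd; apply: (Hd x c); rewrite /= ?subrr ?normr0.
have H (x x' s : RR) : `|x - x0| < e -> `|x' - x0| < e -> 0 < s < e -> x <= x' ->
    (P (x, s) <-> P (x', s)).
  move=> xe x'e se ss; apply: (@locally_constant_seg (fun t => P (t, s))) => // t tt.
  have te : `|t - x0| < e by move: xe x'e; rewrite !ltr_distl; qlra.
  have [d d0 Hd] := (nbhs2P _ _).1 (loc t s te se).
  by exists d => // c _ cd; apply: (Hd c s); rewrite /= ?subrr ?normr0.
move=> x s x' s' xe se x'e s'e.
have -> : P (x, s) <-> P (x, s').
  by case: (leP s s') => ?; [|symmetry]; apply: V => //; apply: ltW.
by case: (leP x x') => ?; [|symmetry]; apply: H => //; apply: ltW.
Qed.

Section Boxes.
Context {Z : topologicalType} (D : set (set Z)).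
Context (partD : Defs.partition D).
Context (leafR : forall w, D w -> exists f : RR -> Z, homeo_on setT w f).
Local Notation sameleaf := (sameleaf D).
Local Notation half_box := (half_box D).
Local Notation box_pair := (box_pair D).

Definition prect (b : plane -> Z) (x e : RR) : set Z :=
  [set z | exists y s : RR, [/\ `|y - x| < e, 0 < s < e & b (y, s) = z]].

(* Near (x', 0) the open side of [c] lies in the open side of [b] near (x, 0). *)
Definition germ_sub (c : plane -> Z) (x' : RR) (b : plane -> Z) (x : RR) : Prop :=
  forall e : RR, 0 < e -> exists2 e' : RR, 0 < e' & prect c x' e' `<=` prect b x e.

Lemma nbhs_rect (x e s e' : RR) : 0 < e -> 0 < e' ->
  nbhs (x, s) [set p : plane | `|p.1 - x| < e /\ `|p.2 - s| < e'].
Proof.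
move=> e0 e'0; apply/nbhs2P; exists (Num.min e e'); first by rewrite lt_min e0.
by move=> y t; rewrite !lt_min => /andP[? _] /andP[_ ?].
Qed.

Lemma prect_open b x e y : half_box b -> e <= 1 -> e <= 1 - `|x| ->
  prect b x e y -> nbhs y (prect b x e).
Proof.
move=> hb e1 ex [u [s [ue se <-]]].
have u1 : `|u| < 1 by have := ler_distD x u 0; rewrite !subr0; qlra.
have s1 : 0 < s < 1 by qlra.
pose d := Num.min (e - `|u - x|) (Num.min s (e - s)).
have d0 : 0 < d by rewrite !lt_min !subr_gt0 ue; qlra.
have N := nbhs_rect u s d0 d0.
have := hb_open hb u1 s1 N; apply: filterS => _ [[v t] [/= vd td] <-].
exists v, t; split => //.
  by move: vd; rewrite /d !lt_min => /andP[? _]; have := ler_distD u v x; qlra.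
by move: td; rewrite /d !lt_min => /and3P[_]; rewrite !ltr_distl; qlra.
Qed.

(** For a full pair the two open sides are disjoint open sets, so the side on which [c] lies is
    locally constant, hence constant on the rectangle. *)
Lemma sides_const b1 b2 c (x x' e e' : RR) : box_pair b1 b2 -> e <= 1 -> e <= 1 - `|x| ->
  (forall y s : RR, `|y - x'| < e' -> 0 < s < e' -> {for (y, s), continuous c}) ->
  (forall y s : RR, `|y - x'| < e' -> 0 < s < e' ->
     exists u t : RR, [/\ `|u - x| < e, `|t| < e, t <> 0 &
       c (y, s) = b1 (u, t) \/ c (y, s) = b2 (u, t)]) ->
  prect c x' e' `<=` prect b1 x e \/ prect c x' e' `<=` prect b2 x e.
Proof.
move=> bp e1 ex cc H.
have H2 (y s : RR) : `|y - x'| < e' -> 0 < s < e' ->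
    prect b1 x e (c (y, s)) \/ prect b2 x e (c (y, s)).
  move=> ye se; have [u [t [ue te t0 E]]] := H y s ye se.
  have E' : c (y, s) = b1 (u, `|t|) \/ c (y, s) = b2 (u, `|t|).
    have [t1|t1] := leP 0 t; first by rewrite ger0_norm.
    by rewrite ltr0_norm // (hb_even (bp_l bp)) (hb_even (bp_r bp)).
  have t0' : 0 < `|t| < e by rewrite te normr_gt0 andbT; apply/eqP.
  by case: E' => ->; [left|right]; exists u, `|t|.
case: (bp_sides bp) => [E|fp].
  by left => z [y [s [ye se <-]]]; rewrite E; have := H2 y s ye se; rewrite E => -[].
have dis z : prect b1 x e z -> prect b2 x e z -> False.
  move=> [u [s [ue se <-]]] [u' [s' [ue' se' /esym]]]; apply: fp; try by qlra.
    by have := ler_distD x u 0; rewrite !subr0; qlra.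
  by have := ler_distD x u' 0; rewrite !subr0; qlra.
have loc (y s : RR) : `|y - x'| < e' -> 0 < s < e' ->
    nbhs (y, s) [set q | prect b1 x e (c q) <-> prect b1 x e (c (y, s))].
  move=> ye se; have := cc y s ye se; case: (H2 y s ye se) => h cys.
    have := continuous_nbhs cys (prect_open (bp_l bp) e1 ex h).
    by apply: filterS => q hq; split.
  have := continuous_nbhs cys (prect_open (bp_r bp) e1 ex h).
  by apply: filterS => q hq; split => // ?; exfalso; [apply: (dis (c q))|apply: (dis (c (y, s)))].
have K := hrect_const loc.
have [h|h] := EM (prect c x' e' `<=` prect b1 x e); first by left.
right => z [y [s [ye se <-]]]; case: (H2 y s ye se) => // h1.
exfalso; apply: h => _ [y' [s' [y'e s'e <-]]].
by apply/(K y s y' s').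
Qed.

(** Off its own edge [c] does not meet the leaf of the edge, by [hb_iso]. A small rectangle of [c]
    therefore lies in the union of the two open sides and, being connected, in one of them. *)
Lemma germ_cover b1 b2 c (x x' : RR) : box_pair b1 b2 -> half_box c ->
  `|x| < 1 -> `|x'| < 1 -> c (x', 0) = b1 (x, 0) ->
  germ_sub c x' b1 x \/ germ_sub c x' b2 x.
Proof.
move=> bp hc x1 x'1 cb.
have dich (e : RR) : 0 < e -> exists2 e' : RR, 0 < e' &
    prect c x' e' `<=` prect b1 x e \/ prect c x' e' `<=` prect b2 x e.
  move=> e0; pose m := Num.min e (Num.min 1 (1 - `|x|)).
  have m0 : 0 < m by rewrite !lt_min e0 ltr01 subr_gt0.
  have [me m1 mx] : [/\ m <= e, m <= 1 & m <= 1 - `|x|].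
    by rewrite /m !ge_min !lexx !orbT.
  have := bp_cover bp x1 (nbhs_rect x 0 m0 m0); rewrite -cb.
  have z1 : `|0 : RR| < 1 by rewrite normr0.
  move=> /(hb_cont hc x'1 z1)/nbhs2P[d d0 /= Hd].
  pose e' := Num.min d (Num.min 1 (1 - `|x'|)).
  have e'0 : 0 < e' by rewrite !lt_min d0 ltr01 subr_gt0.
  have [e'd e'1 e'x] : [/\ e' <= d, e' <= 1 & e' <= 1 - `|x'|].
    by rewrite /e' !ge_min !lexx !orbT.
  have in1 (y s : RR) : `|y - x'| < e' -> 0 < s < e' -> `|y| < 1 /\ `|s| < 1.
    move=> ye se; split; first by have := ler_distD x' y 0; rewrite !subr0; qlra.
    by rewrite gtr0_norm; qlra.
  exists e' => //.
  suff : prect c x' e' `<=` prect b1 x m \/ prect c x' e' `<=` prect b2 x m.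
    have mon b z : prect b x m z -> prect b x e z.
      by move=> [y [s [ye se <-]]]; exists y, s; split => //; qlra.
    by case=> S; [left|right] => z /S /mon.
  apply: (sides_const bp m1 mx).
    by move=> y s ye se; have [y1 s1] := in1 y s ye se; apply: (hb_cont hc).
  move=> y s ye se; have [y1 s1] := in1 y s ye se.
  have : (b1 @` [set p | `|p.1 - x| < m /\ `|p.2 - 0| < m] `|`
       b2 @` [set p | `|p.1 - x| < m /\ `|p.2 - 0| < m]) (c (y, s)).
    by apply: Hd; rewrite ?subr0 ?(gtr0_norm (_ : 0 < s)) //; qlra.
  have u1 (u : RR) : `|u - x| < m -> `|u| < 1.
    by move=> um; have := ler_distD x u 0; rewrite !subr0; qlra.
  have nz b (u : RR) : half_box b -> b (x, 0) = c (x', 0) -> `|u - x| < m -> b (u, 0) <> c (y, s).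
    move=> hb bx um E; have : s = 0; last by move: se; clear; qlra.
    apply: (hb_iso hc y1 s1); rewrite -E.
    apply: (sameleaf_trans partD (z := c (x', 0))).
      by rewrite -bx; apply: (hb_leaf hb) => //; apply: u1.
    by apply: (hb_leaf hc).
  have bx2 : b2 (x, 0) = c (x', 0) by rewrite -(bp_edge bp).
  move=> [|] [[u t] /= [ux]]; rewrite subr0 => tm E; exists u, t; split => //; first 1 last.
  - by left.
  - by move=> t0; rewrite t0 in E; apply: nz E => //; exact: bp_r bp.
  - by right.
  - by move=> t0; rewrite t0 in E; apply: nz E => //; exact: bp_l bp.
(* The dichotomy names a side for each [e], but one side has to serve for all of them. If the first
   side fails for some [e1], it fails for every smaller size, which leaves the second. *)
have [h|h] := EM (germ_sub c x' b1 x); first by left.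
right => e e0.
have [e1 [e10 he1]] : exists e1 : RR, 0 < e1 /\ forall e' : RR, 0 < e' -> ~ prect c x' e' `<=` prect b1 x e1.
  apply: contrapT => H; apply: h => e1 e10; apply: contrapT => H1; apply: H.
  by exists e1; split => // e' e'0 S; apply: H1; exists e'.
pose m := Num.min e e1.
have [|e' e'0 He'] := dich m; first by rewrite lt_min e0.
have mon b (m' : RR) : m <= m' -> prect b x m `<=` prect b x m'.
  by move=> mm _ [y [s [ye se <-]]]; exists y, s; split => //; qlra.
exists e' => //; case: He' => S.
  exfalso; apply: (he1 e' e'0); apply: (subset_trans S); apply: mon.
  by rewrite /m ge_min lexx orbT.
by apply: (subset_trans S); apply: mon; rewrite /m ge_min lexx.
Qed.

(* At an interior point of a full box there is no half-disc neighbourhood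
   whose diameter lies in the leaf. *)
Lemma full_pair_no_half_disc b1 b2 (c : plane -> Z) (x x' e : RR) :
  box_pair b1 b2 -> full_pair b1 b2 -> `|x| < 1 -> 0 < e ->
  (forall y s : RR, `|y - x'| < e -> `|s| < e -> {for (y, s), continuous c}) ->
  (forall y s : RR, c (y, - s) = c (y, s)) ->
  (forall y s y' s' : RR, `|y - x'| < e -> 0 <= s < e -> `|y' - x'| < e ->
     0 <= s' < e -> c (y, s) = c (y', s') -> y = y' /\ s = s') ->
  (forall e' : RR, 0 < e' -> nbhs (c (x', 0)) (c @` [set p | `|p.1 - x'| < e' /\ `|p.2| < e'])) ->
  (forall y : RR, `|y - x'| < e -> sameleaf (c (x', 0)) (c (y, 0))) ->
  c (x', 0) = b1 (x, 0) -> False.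
Proof.
move=> bp fp x1 e0 cc ce ci cn cl cb.
have [w [Dw wc _]] := sameleaf_refl partD (c (x', 0)).
have z1 : `|0 : RR| < 1 by rewrite normr0.
have ze : `|0 : RR| < e by rewrite normr0.
have ce1 (y : RR) : `|y - x'| < e -> {for y, continuous (fun y : RR => c (y, 0))}.
  move=> ye B /(cc y 0 ye ze)/nbhs2P[d d0 Hd]; apply/nbhsRP; exists d => // y' y'd.
  by apply: Hd => //=; rewrite subrr normr0.
have iso := leaf_isolated leafR Dw e0 ce1.
have {iso} : nbhs (c (x', 0)) [set y | w y -> exists2 u : RR, `|u - x'| < e & y = c (u, 0)].
  apply: iso.
    by move=> y y' ye y'e E; have [] := ci y 0 y' 0 => //; rewrite lexx.
  by move=> y ye; apply: (sameleaf_in partD Dw wc); apply: cl.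
rewrite cb => iso.
have b12 := bp_edge bp x1.
have [d1 d10 Hd1] := (nbhs2P _ _).1 (hb_cont (bp_l bp) x1 z1 iso).
have iso' := iso; rewrite b12 in iso'.
have [d2 d20 Hd2] := (nbhs2P _ _).1 (hb_cont (bp_r bp) x1 z1 iso').
pose m := Num.min (Num.min d1 d2) (Num.min 1 (1 - `|x|)).
have m0 : 0 < m by rewrite !lt_min d10 d20 ltr01 subr_gt0.
have [md1 md2 m1 mx] : [/\ m <= d1, m <= d2, m <= 1 & m <= 1 - `|x|].
  by rewrite /m !ge_min !lexx !orbT.
have := bp_cover bp x1 (nbhs_rect x 0 m0 m0); rewrite -cb.
have x'e : `|x' - x'| < e by rewrite subrr normr0.
move=> /(cc x' 0 x'e ze)/nbhs2P[d d0 /= Hd].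
pose e' := Num.min d e.
have e'0 : 0 < e' by rewrite lt_min d0.
have [e'd e'e] : e' <= d /\ e' <= e by rewrite /e' !ge_min !lexx !orbT.
have u1 (u : RR) : `|u - x| < m -> `|u| < 1.
  by move=> um; have := ler_distD x u 0; rewrite !subr0; qlra.
have wb1 (u : RR) : `|u - x| < m -> w (b1 (u, 0)) /\ w (b2 (u, 0)).
  move=> um; rewrite -(bp_edge bp (u1 u um)).
  suff : w (b1 (u, 0)) by [].
  apply: (sameleaf_in partD Dw wc); rewrite cb; apply: (hb_leaf (bp_l bp)) => //.
  exact: u1.
have dis z : prect b1 x m z -> prect b2 x m z -> False.
  by move=> [u [s [ue se <-]]] [u' [s' [ue' se' /esym]]]; apply: fp; try (by qlra); apply: u1.
(* Near [b1 (x, 0)] the points of the leaf are of the form [c (v, 0)], so at positive height [c]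
   avoids the edges of [b1] and [b2] and stays on one side. *)
have key : prect c x' e' `<=` prect b1 x m \/ prect c x' e' `<=` prect b2 x m.
  apply: (sides_const bp m1 mx).
    by move=> y s ye se; apply: cc; rewrite ?(gtr0_norm (_ : 0 < s)); qlra.
  move=> y s ye se.
  have : (b1 @` [set p | `|p.1 - x| < m /\ `|p.2 - 0| < m] `|`
       b2 @` [set p | `|p.1 - x| < m /\ `|p.2 - 0| < m]) (c (y, s)).
    by apply: Hd; rewrite ?subr0 ?(gtr0_norm (_ : 0 < s)) //; qlra.
  have nz (u t : RR) : `|u - x'| < e -> c (u, 0) = c (y, s) -> False.
    by move=> ue /ci[||||_ E] //; move: se; qlra.
  move=> [|] [[u t] /= [ux]]; rewrite subr0 => tm E; exists u, t; split => //; first 1 last.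
  - by left.
  - move=> t0; rewrite t0 in E.
    have [||v ve Ev] := Hd2 u 0 _ _ (wb1 u ux).2; rewrite /= ?subrr ?normr0 //; first by qlra.
    by apply: (nz v 0 ve); rewrite -Ev E.
  - by right.
  - move=> t0; rewrite t0 in E.
    have [||v ve Ev] := Hd1 u 0 _ _ (wb1 u ux).1; rewrite /= ?subrr ?normr0 //; first by qlra.
    by apply: (nz v 0 ve); rewrite -Ev E.
(* The image of [c] is a neighbourhood of the edge point, so it contains points [b (x, t)] of the
   side [b] that [c] is known to avoid. *)
have fin b b' : half_box b -> b (x, 0) = c (x', 0) -> prect c x' e' `<=` prect b' x m ->
    (forall z, prect b x m z -> prect b' x m z -> False) -> False.
  move=> hb bx S disj; have := cn _ e'0; rewrite -bx.
  move=> /(hb_cont hb x1 z1)/nbhs2P[d' d'0 /= Hd'].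
  pose t := Num.min (d' / 2) (m / 2).
  have t0 : 0 < t by rewrite lt_min !divr_gt0.
  have [td tm] : t <= d' / 2 /\ t <= m / 2 by rewrite /t !ge_min !lexx !orbT.
  have ta : `|t| = t by rewrite gtr0_norm.
  have [||[y s] [/= ye se] E] := Hd' x t.
  - by rewrite subrr normr0.
  - by rewrite subr0 ta; qlra.
  have s0 : s <> 0.
    move=> s0; rewrite s0 in E.
    suff : t = 0 by move=> E0; move: t0; rewrite E0 ltxx.
    apply: (hb_iso hb x1); first by rewrite ta; qlra.
    rewrite -E; apply: (sameleaf_trans partD (z := c (x', 0))).
      by apply/sameleaf_sym/cl; qlra.
    by rewrite -bx; apply: (hb_leaf hb); rewrite ?normr0.
  apply: (disj (b (x, t))).
    by exists x, t; split => //; [rewrite subrr normr0|qlra].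
  apply: S; exists y, `|s|; split => //; first by rewrite se andbT normr_gt0; apply/eqP.
  by rewrite -E; have [h|h] := leP 0 s; rewrite ?(ger0_norm h) // ltr0_norm // ce.
by case: key => S; [apply: (fin b2 b1)|apply: (fin b1 b2)] => //;
  rewrite -?b12 ?cb //; [exact: bp_r bp|move=> z h1 h2; exact: dis h2 h1|exact: bp_l bp].
Qed.

(** A saturated set that contains [b1 (x, s)] and [b2 (x, s)] for all small [s] contains these whole
    levels, hence a band around the edge. *)
Lemma box_pair_edge_nbhs b1 b2 (S : set Z) (x x' : RR) : box_pair b1 b2 ->
  (forall y z, S y -> sameleaf y z -> S z) -> `|x| < 1 -> `|x'| < 1 ->
  nbhs (b1 (x, 0)) S -> nbhs (b1 (x', 0)) S.
Proof.
move=> bp sat x1 x'1 nS.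
have z1 : `|0 : RR| < 1 by rewrite normr0.
have [d1 d10 Hd1] := (nbhs2P _ _).1 (hb_cont (bp_l bp) x1 z1 nS).
have nS' := nS; rewrite (bp_edge bp x1) in nS'.
have [d2 d20 Hd2] := (nbhs2P _ _).1 (hb_cont (bp_r bp) x1 z1 nS').
pose m := Num.min (Num.min d1 d2) 1; pose m' := 1 - `|x'|.
have m0 : 0 < m by rewrite !lt_min d10 d20 ltr01.
have [md1 md2 m1] : [/\ m <= d1, m <= d2 & m <= 1] by rewrite /m !ge_min !lexx !orbT.
have m'0 : 0 < m' by rewrite subr_gt0.
have := bp_cover bp x'1 (nbhs_rect x' 0 m'0 m0).
have u1 (u : RR) : `|u - x'| < m' -> `|u| < 1.
  by rewrite /m' => um; have := ler_distD x' u 0; rewrite !subr0; qlra.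
apply: filterS => y; case=> -[[u s] /= [/u1 um]]; rewrite subr0 => sm <-.
- apply: (sat (b1 (x, s))); last by apply: (hb_leaf (bp_l bp)) => //; qlra.
  by apply: Hd1; rewrite /= ?subrr ?subr0 ?normr0 //; qlra.
- apply: (sat (b2 (x, s))); last by apply: (hb_leaf (bp_r bp)) => //; qlra.
  by apply: Hd2; rewrite /= ?subrr ?subr0 ?normr0 //; qlra.
Qed.

Context (boxes : forall z O, nbhs z O -> exists b1 b2, [/\ box_pair b1 b2, b1 (0, 0) = z &
   forall x s : RR, `|x| < 1 -> `|s| < 1 -> O (b1 (x, s)) /\ O (b2 (x, s))]).

(** The interior of a saturated set is saturated: along a parametrization [f] of the leaf, the boxes
    make the property [nbhs (f t) S] locally constant in [t]. *)
Lemma saturated_nbhs (S : set Z) y z : (forall y z, S y -> sameleaf y z -> S z) ->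
  sameleaf y z -> nbhs y S -> nbhs z S.
Proof.
move=> sat [w [Dw wy wz]] nS.
have [f [g [/within_setT_continuous cf _ gf fg]]] := leafR Dw.
have loc (t : RR) : exists2 d : RR, 0 < d & forall c : RR, `|c - t| < d ->
    (nbhs (f c) S <-> nbhs (f t) S).
  have [b1 [b2 [bp bz _]]] := boxes (filterT : nbhs (f t) setT).
  have := bp_cover bp (_ : `|0 : RR| < 1) (nbhs_rect 0 0 ltr01 ltr01).
  rewrite normr0 bz => /(_ ltr01) /(cf t) /nbhsRP[d d0 Hd]; exists d => // c /Hd cd.
  have [x x1 fcx] : exists2 x : RR, `|x| < 1 & f c = b1 (x, 0).
    have lf : sameleaf (f c) (b1 (0, 0)).
      by rewrite bz; exists w; split => //; [have [] := gf c|have [] := gf t].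
    case: cd => -[[x s] /= [x1 s1]] E; rewrite !subr0 in x1 s1; exists x => //.
      have s0 := hb_iso (bp_l bp) x1 s1; rewrite E in s0.
      by rewrite -E (s0 lf).
    rewrite (bp_edge bp) ?normr0 // in lf.
    have s0 := hb_iso (bp_r bp) x1 s1; rewrite E in s0.
    by rewrite (bp_edge bp x1) -E (s0 lf).
  rewrite fcx -bz; split; apply: (box_pair_edge_nbhs bp) => //; by rewrite normr0.
have P a b : a <= b -> (nbhs (f a) S <-> nbhs (f b) S).
  move=> ab; apply: (@locally_constant_seg (fun t => nbhs (f t) S)) => // t _.
  by have [d d0 Hd] := loc t; exists d => // c _; apply: Hd.
rewrite -(fg _ wy).2 in nS; rewrite -(fg _ wz).2.
by case: (leP (g y) (g z)) => h; [apply/(P _ _ h)|apply/(P _ _ (ltW h))].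
Qed.
End Boxes.

(** * Half-boxes from foliation charts, and the boundary of the surface *)

Section Charts.
Context {Z : topologicalType} (D : set (set Z)).
Context (folD : foliation1 D).
Context (bdD : forall z : Z, mboundary z -> D (connected_component mboundary z)).
Context (leafD : forall w, D w -> closed w /\ exists f : RR -> Z, homeo_on setT w f).
Local Notation box_pair := (box_pair D).

Let partD : Defs.partition D. Proof. by case: folD. Qed.
Let leafR w : D w -> exists f : RR -> Z, homeo_on setT w f.
Proof. by move=> /leafD[]. Qed.

Lemma foliated_chart_of_homeo (U : set Z) (h : Z -> plane) (V : set plane) : open U ->
  homeo_on U V h ->
  (forall w, D w -> exists T : set RR, h @` (w `&` U) = [set p | T p.2]) ->
  exists g, foliated_chart D U h g V.
Proof.
move=> oU [g [/within_continuous_nbhs ch /within_continuous_nbhs cg hU gV]] lf.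
exists g; split => //.
- move=> y Uy B /(ch _ Uy); have := open_nbhs_nbhs (conj oU Uy).
  by apply: filterS2 => x Ux /(_ Ux).
- move=> p q Vp Vq pq; have [Ugp hgp] := gV _ Vp; have [Ugq hgq] := gV _ Vq.
  have [w [Dw wg _]] := sameleaf_refl partD (g p).
  have [T HT] := lf w Dw.
  have : [set p : plane | T p.2] q.
    have : (h @` (w `&` U)) p by exists (g p).
    by rewrite HT /= pq.
  rewrite -HT => -[y [wy Uy] hy]; exists w; split => //.
  by rewrite -hy (hU _ Uy).2.
Qed.

Definition chart_model (b : bool) : set plane := if b then setT else halfplane.

Lemma foliation_chart z : exists U h g b, U z /\ foliated_chart D U h g (chart_model b).
Proof.
have [_ _ /(_ z)[U [h [oU Uz hb hi lf]]]] := folD.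
have [zb|zb] := EM (mboundary z).
  by have [g gc] := foliated_chart_of_homeo oU (hb zb) lf; exists U, h, g, false.
by have [g gc] := foliated_chart_of_homeo oU (hi zb) lf; exists U, h, g, true.
Qed.

Lemma chart_box U h g b y O : foliated_chart D U h g (chart_model b) -> U y -> nbhs y O ->
  exists b1 b2, [/\ box_pair b1 b2, b1 (0, 0) = y,
    forall x s : RR, `|x| < 1 -> `|s| < 1 -> O (b1 (x, s)) /\ O (b2 (x, s)) &
    if b || (0 < (h y).2) then full_pair b1 b2 else b1 = b2].
Proof.
move=> fc Uy nO; have [Vh ghy] := fc_inv fc Uy.
(* At a point of positive height in a half-plane chart the radius is that height, which keeps the
   box off the boundary line. *)
pose r := if b then 1 else if 0 < (h y).2 then (h y).2 else 1.
have r0 : 0 < r by rewrite /r; do 2 case: ifP => //.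
have hy : ((h y).1, (h y).2) = h y by rewrite -surjective_pairing.
have [||b1 [b2 [? b10 bO ?]]] := @box_of_chart Z D partD leafR U h g (chart_model b)
  (h y).1 (h y).2 r (b || (0 < (h y).2)) O fc r0.
- move=> x s xr sr; rewrite /chart_model; move: sr; rewrite /r.
  case: b fc Vh {xr r r0} => //= _ Vh; rewrite /halfplane /=.
  have : 0 <= (h y).2 by [].
  rewrite le_eqVlt => /orP[/eqP<-|h0]; first by rewrite ltxx.
  by rewrite h0 ltr_distl => sr; split => // _; qlra.
- by rewrite hy ghy.
by exists b1, b2; split => //; rewrite b10 hy.
Qed.

Lemma box_exists z O : nbhs z O -> exists b1 b2, [/\ box_pair b1 b2, b1 (0, 0) = z &
   forall x s : RR, `|x| < 1 -> `|s| < 1 -> O (b1 (x, s)) /\ O (b2 (x, s))].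
Proof.
have [U [h [g [b [Uz fc]]]]] := foliation_chart z.
by move=> /(chart_box fc Uz)[b1 [b2 [? ? ? _]]]; exists b1, b2.
Qed.

(** The half-plane chart that witnesses [mboundary] is only a topological one. But its diameter is a
    connected part of [mboundary], hence lies in one leaf by [bdD], and [full_pair_no_half_disc]
    excludes it. *)
Lemma full_pair_not_mboundary b1 b2 (x : RR) : box_pair b1 b2 -> full_pair b1 b2 ->
  `|x| < 1 -> ~ mboundary (b1 (x, 0)).
Proof.
move=> bp fp x1 mb; have := mb => -[U [h [V [[oU Uz] Vh [Q [oQ VQ]] hUV hz0]]]].
have := hUV => -[g [/within_continuous_nbhs ch /within_continuous_nbhs cg hU gV]].
set z := b1 (x, 0) in mb Uz hz0.
pose x' := (h z).1.
have hzE : h z = (x', 0) by rewrite /x' -[in RHS]hz0 -surjective_pairing.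
have [Vhz ghz] := hU _ Uz.
have [e e0 HQ] : exists2 e : RR, 0 < e & forall y s : RR, `|y - x'| < e ->
    `|s - 0| < e -> Q (y, s).
  apply: (nbhs2P (x', 0) Q).1; rewrite -hzE; apply: open_nbhs_nbhs; split => //.
  by move: Vhz; rewrite VQ => -[].
have Ve (y s : RR) : `|y - x'| < e -> `|s| < e -> V (y, `|s|).
  move=> ye se; rewrite VQ; split; last by rewrite /halfplane /=.
  by apply: HQ => //; rewrite subr0 normr_id.
pose c : plane -> Z := fun p => g (p.1, `|p.2|).
have cz : c (x', 0) = z by rewrite /c /= normr0 -hzE.
have ze : `|0 : RR| < e by rewrite normr0.
have cc (y s : RR) : `|y - x'| < e -> `|s| < e -> {for (y, s), continuous c}.
  move=> ye se B /(cg _ (Ve y s ye se)) /nbhs2P[d d0 /= Hd].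
  apply/nbhs2P; exists (Num.min d (Num.min (e - `|y - x'|) (e - `|s|))).
    by rewrite !lt_min d0 !subr_gt0 ye.
  move=> u t /=; rewrite !lt_min => /and3P[ud ue _] /and3P[td _ te].
  apply: Hd => //; first exact: le_lt_trans (ler_dist_dist _ _) td.
  apply: Ve; first by have := ler_distD y u x'; qlra.
  by have := ler_distD s t 0; rewrite !subr0; qlra.
have cmb (y : RR) : `|y - x'| < e -> mboundary (c (y, 0)).
  move=> ye; have [Uc hc] := gV _ (Ve y 0 ye ze).
  by exists U, h, V; split => //; [exists Q|rewrite /c hc /= normr0].
apply: (full_pair_no_half_disc partD leafR (c := c) (x' := x') bp fp x1 e0 cc) => //.
- by move=> y s; rewrite /c /= normrN.
- move=> y s y' s' ye /andP[s0 se] y'e /andP[s'0 s'e] E.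
  have [_ E1] : U (c (y, s)) /\ h (c (y, s)) = (y, `|s|) by apply: gV; apply: Ve => //; rewrite ger0_norm.
  have [_ E2] : U (c (y', s')) /\ h (c (y', s')) = (y', `|s'|) by apply: gV; apply: Ve => //; rewrite ger0_norm.
  by move: E1; rewrite E E2 !ger0_norm // => -[-> ->].
- move=> e' e'0; rewrite cz.
  have N : nbhs (h z) [set p : plane | `|p.1 - x'| < e' /\ `|p.2 - 0| < e'].
    by rewrite hzE; apply: nbhs_rect.
  have := ch _ Uz _ N; have := open_nbhs_nbhs (conj oU Uz).
  apply: filterS2 => y Uy /(_ Uy) /= [h1]; rewrite subr0 => h2.
  exists (h y); first by [].
  rewrite /c ger0_norm -?surjective_pairing ?(hU _ Uy).2 //.
  exact: Vh (hU _ Uy).1.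
- move=> y ye; exists (connected_component mboundary z); split.
  + exact: bdD.
  + by rewrite cz; apply: connected_component_refl.
  + pose I := [set u : RR | `|u - x'| < e].
    apply: (@connected_component_max Z mboundary ((fun u : RR => c (u, 0)) @` I) z).
    * by exists x' => //=; rewrite /I /= subrr normr0.
    * by move=> _ [u ue <-]; apply: cmb.
    * apply: connected_continuous_connected.
        apply/connected_intervalP => u v; rewrite /I /= => ue ve t /andP[ut tv].
        by move: ue ve; rewrite !ltr_distl; qlra.
      apply/within_continuous_nbhs => u ue B; rewrite /I /= in ue.
      move=> /(continuous_nbhs (cc u 0 ue ze))/nbhs2P[d d0 Hd].
      apply/nbhsRP; exists d => // v vd _; apply: Hd => //=.
      by rewrite subrr normr0.
    * by exists y.
Qed.

(** Leaves that are regular only in the boundary sense are included: they too must become boundary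
    intervals of strips. *)
Definition irregular_leaf (w : set Z) : Prop := D w /\ ~ regular_int_leaf D w.

(** The leaves added to the singular ones lie in [mboundary]. Within a half-plane chart such a leaf
    can only be that of the boundary line, so a chart adds at most the leaf of [g (0, 0)]. *)
Lemma irregular_locally_finite : locally_finite_family (singular_leaf D) ->
  locally_finite_family irregular_leaf.
Proof.
move=> lf z; have [W [oW Wz Wf]] := lf z.
have [U [h [g [b [Uz fc]]]]] := foliation_chart z.
exists (W `&` U); split => //; first by apply: openI => //; exact: fc_open fc.
have : finite_set ([set w | singular_leaf D w /\ w `&` W !=set0] `|`
    [set w | D w /\ w (g (0, 0))]).
  rewrite finite_setU; split => //.
  have [w [Dw wg _]] := sameleaf_refl partD (g (0, 0)).
  apply: (@sub_finite_set _ _ [set w]); last exact: finite_set1.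
  by move=> w' [Dw' w'g]; apply: (leaf_unique partD Dw' Dw w'g wg).
apply: sub_finite_set => w [[Dw nr] [y [wy [Wy Uy]]]].
have [sw|/not_andP[//|/contrapT rw]] := EM (singular_leaf D w).
  by left; split => //; exists y.
case: rw => -[wm rw]; first by case: nr.
right; split => //.
have [b1 [b2 [bp b10 _ bf]]] := chart_box fc Uy (filterT : nbhs y setT).
have my : mboundary y by apply: wm.
have nf : ~ full_pair b1 b2.
  move=> fp; apply: (full_pair_not_mboundary bp fp (_ : `|0 : RR| < 1)).
    by rewrite normr0.
  by rewrite b10.
move: bf; case: ifP => [_ /nf //|] /negbT; rewrite negb_or -leNgt => /andP[nb hy0] _.
have [Vh ghy] := fc_inv fc Uy.
rewrite /chart_model (negPf nb) in fc Vh.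
have hy : (h y).2 = 0 by apply/eqP; rewrite eq_le hy0; exact: Vh.
apply: (sameleaf_in partD Dw wy); rewrite -ghy; apply: (fc_leaf fc) => //.
by rewrite /halfplane /=.
Qed.
End Charts.

(** * Striped atlases have locally finite singular leaves *)

Lemma open_in_nbhs (X : topologicalType) (A V : set X) : V `<=` A ->
  (forall x, V x -> nbhs x [set y | A y -> V y]) -> open_in A V.
Proof.
move=> VA H; exists ([set y | A y -> V y]^°); split; first exact: open_interior.
apply/seteqP; split => [x Vx|x [/interior_subset H1 Ax]]; last exact: H1.
by split; [apply: H|apply: VA].
Qed.

Record foliated_surface {Z : topologicalType} (D : set (set Z)) : Prop :=
  FoliatedSurface {
  fs_fol : foliation1 D;
  fs_bd : forall z : Z, mboundary z -> D (connected_component mboundary z);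
  fs_leaf : forall w, D w -> closed w /\ exists f : RR -> Z, homeo_on setT w f }.

Lemma fs_part (Z : topologicalType) (D : set (set Z)) :
  foliated_surface D -> Defs.partition D.
Proof. by move=> /fs_fol[]. Qed.

Lemma fs_leafR (Z : topologicalType) (D : set (set Z)) : foliated_surface D ->
  forall w, D w -> exists f : RR -> Z, homeo_on setT w f.
Proof. by move=> fs w /(fs_leaf fs)[]. Qed.

(** [glued l] stands for the union of those boundary intervals of the two families that lie in the
    strip [l]. *)
Record strip_atlas {Z : topologicalType} (D : set (set Z)) (Lam : Type)
    (S : Lam -> set plane) (u v : Lam -> RR) (q : Lam -> plane -> Z)
    (glued : Lam -> set plane) : Prop := StripAtlas {
  sa_strip : forall l, is_strip (S l) (u l) (v l);
  sa_cont : forall l, {within S l, continuous (q l)};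
  sa_surj : forall z : Z, exists l p, S l p /\ q l p = z;
  sa_quot : forall A : set Z, open A <-> forall l, open_in (S l) (S l `&` q l @^-1` A);
  sa_glued : forall l, glued l `<=` strip_boundary (S l) (u l) (v l);
  sa_inj : forall l l' p p', S l p -> S l' p' -> ~ glued l p -> ~ glued l' p' ->
    q l p = q l' p' -> l = l' /\ p = p';
  sa_leaves : D = [set w | exists l L, canonical_leaf (S l) (u l) (v l) L /\ w = q l @` L] }.

Section AtlasRegular.
Context {Z : topologicalType} (D : set (set Z)) (fsD : foliated_surface D).
Context (Lam : Type) (S : Lam -> set plane) (u v : Lam -> RR) (q : Lam -> plane -> Z).
Context (glued : Lam -> set plane) (sa : strip_atlas D S u v q glued).
Local Notation sameleaf := (sameleaf D).
Local Notation partD := (fs_part fsD).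
Local Notation leafR := (fs_leafR fsD).
Local Notation folD := (fs_fol fsD).
Local Notation hS := (sa_strip sa).
Local Notation gluedb := (sa_glued sa).
Local Notation qi := (sa_inj sa).
Local Notation DE := (sa_leaves sa).

Lemma strip_nbhs l p B : S l p -> nbhs (q l p) B -> nbhs p [set y | S l y -> B (q l y)].
Proof.
have H := @sa_cont _ _ _ _ _ _ _ _ sa l.
move/within_continuous_nbhs: H => H Sp nB; exact: (H p Sp B nB).
Qed.

Definition strip_int l : set plane := [set p | u l < p.2 < v l].
Local Notation int := strip_int.

Lemma strip_int_sub l : int l `<=` S l.
Proof. by have [_ h _ _] := hS l => p /h. Qed.

Lemma strip_int_nbhs l p : int l p -> nbhs p (int l).
Proof.
move=> ip; rewrite /strip_int /= in ip.
apply/nbhs2P; exists (Num.min (p.2 - u l) (v l - p.2)).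
  by rewrite lt_min !subr_gt0.
by move=> x s _; rewrite /strip_int /= lt_min !ltr_distl; qlra.
Qed.

Lemma strip_int_not_glued l p : int l p -> ~ glued l p.
Proof. by rewrite /strip_int /= => ip /gluedb[_ /= [|]] E; move: ip; qlra. Qed.

Lemma strip_cont l p : int l p -> {for p, continuous (q l)}.
Proof.
move=> ip B nB; have := strip_nbhs (strip_int_sub ip) nB.
by move: (strip_int_nbhs ip); apply: filterS2 => y /strip_int_sub Sy; apply.
Qed.

Lemma strip_inj l l' p p' : int l p -> int l' p' -> q l p = q l' p' -> l = l' /\ p = p'.
Proof.
by move=> ip ip'; apply: qi; [apply: strip_int_sub..|apply: strip_int_not_glued|apply: strip_int_not_glued].
Qed.

Lemma strip_line_leaf l t : u l < t < v l -> D (q l @` [set p | p.2 = t]).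
Proof. by move=> ut; rewrite DE; exists l, [set p | p.2 = t]; split => //; left; exists t. Qed.

Lemma strip_sameleaf l l' p p' : int l p -> int l' p' -> sameleaf (q l p) (q l' p') ->
  l = l' /\ p.2 = p'.2.
Proof.
move=> ip ip' /sameleaf_sym E.
have : (q l' @` [set r | r.2 = p'.2]) (q l p).
  by apply: (sameleaf_in partD (strip_line_leaf ip') _ E); exists p'.
move=> [r /= rp' rp]; have ir : int l' r by rewrite /strip_int /= rp'.
by have [-> ->] := strip_inj ip ir (esym rp).
Qed.

(** The case to exclude is a glued boundary point [p'] with the image of an inner point [p]. In a
    chart the leaves near that image are levels of the strip [l] close to [p.2]. An inner point near
    [p'] lies on one of them, which forces [l = l'] and brings a level near the boundary together
    with one near [p.2]. *)
Lemma strip_int_inj l l' p p' : int l p -> S l' p' -> q l p = q l' p' ->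
  l = l' /\ p = p'.
Proof.
move=> ip Sp' E.
have [gp'|ngp'] := EM (glued l' p'); last first.
  by apply: qi => //; [apply: strip_int_sub|apply: strip_int_not_glued].
exfalso.
have [_ bp'] := gluedb gp'; rewrite /= in bp'.
have [U [h [g [b [Uz fc]]]]] := foliation_chart folD (q l p).
have nU y : U y -> nbhs y U by move=> Uy; apply: open_nbhs_nbhs; split => //; exact: fc_open fc.
(* The chart height along the vertical segment through [p]. It is injective, so by [slide] it takes
   all values close to [al 0]. *)
pose al (s : RR) := (h (q l (p.1, p.2 + s))).2.
have pE : p = (p.1, p.2) by rewrite -surjective_pairing.
have ip2 : u l < p.2 < v l := ip.
have [d1 d10 Hd1] : exists2 d : RR, 0 < d & forall s : RR, `|s| < d ->
    U (q l (p.1, p.2 + s)).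
  have := continuous_nbhs (strip_cont ip) (nU _ Uz) => /nbhs2P[d d0 Hd].
  exists d => // s sd; apply: Hd; rewrite /= ?subrr ?normr0 //.
  by rewrite addrAC subrr add0r.
pose e := Num.min (d1 / 2) (Num.min ((p.2 - u l) / 2) ((v l - p.2) / 2)).
have e0 : 0 < e by rewrite /e !lt_min; qlra.
have [ed eu ev] : [/\ e <= d1 / 2, e <= (p.2 - u l) / 2 & e <= (v l - p.2) / 2].
  by rewrite /e !ge_min !lexx !orbT.
have ins (s : RR) : - e <= s <= e -> int l (p.1, p.2 + s) /\ U (q l (p.1, p.2 + s)).
  move=> se; split; first by rewrite /strip_int /=; qlra.
  by apply: Hd1; rewrite ltr_norml; qlra.
have heq y y' : U y -> U y' -> (h y).2 = (h y').2 -> sameleaf y y'.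
  move=> Uy Uy' hy; have [Vy gy] := fc_inv fc Uy; have [Vy' gy'] := fc_inv fc Uy'.
  by rewrite -gy -gy'; apply: (fc_leaf fc).
have snd_cont y : U y -> {for y, continuous (fun y => (h y).2)}.
  move=> Uy B /nbhsRP[d d0 Hd]; apply: (continuous_nbhs (fc_conth fc Uy) (B := [set p : plane | B p.2])).
  by apply/nbhs2P; exists d => // x s _ sd; apply: Hd.
have := @slide (fun=> True) (fun x _ => al x) (- e) e 0 0.
case.
- by rewrite oppr_lt0 e0.
- by [].
- move=> _ _ s se B nB; have [is_ Us] := ins s se.
  have := continuous_nbhs (snd_cont _ Us) nB.
  move=> /(continuous_nbhs (strip_cont is_))/nbhs2P[d d0 Hd].
  apply/nbhsRP; exists d => // s' s'd; apply: Hd; rewrite /= ?subrr ?normr0 //.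
  by have -> : p.2 + s' - (p.2 + s) = s' - s by ring.
- move=> s s' /ins[is_ Us] /ins[is' Us'] /(heq _ _ Us Us')/(strip_sameleaf is_ is')[_ /=].
  by move=> /addrI.
- by move=> x _ e' e'0; exists 1 => // s _ _; rewrite subrr normr0.
move=> d d0 Hd.
(* The direction that leads from [p'] into its strip. *)
pose sg : RR := if p'.2 == u l' then 1 else -1.
have uv : u l' < v l' by have [] := hS l'.
have insb (s : RR) : 0 < s -> s < v l' - u l' -> int l' (p'.1, p'.2 + sg * s).
  move=> s0 s1; rewrite /strip_int /= /sg; case: eqP => [->|/eqP ne]; first by qlra.
  by case: bp' => E'; [move: ne; rewrite E' eqxx|rewrite E'; qlra].
have Up' : U (q l' p') by rewrite -E.
have nB : nbhs (q l' p') (U `&` [set y | `|(h y).2 - al 0| < d]).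
  apply: filterI; first exact: nU.
  apply: (continuous_nbhs (snd_cont _ Up') (B := [set t | `|t - al 0| < d])).
  by apply/nbhsRP; exists d => // t; rewrite -E /al addr0 -surjective_pairing.
have := strip_nbhs Sp' nB.
move=> /nbhs2P[d2 d20 Hd2].
(* Smaller than [e], so that the level at distance [s] from the boundary differs from all levels
   [p.2 + x] with [|x| <= e]. *)
pose s := Num.min (d2 / 2) (Num.min (e / 2) ((v l' - u l') / 2)).
have s0 : 0 < s by rewrite /s !lt_min; qlra.
have [sd2 se suv] : [/\ s <= d2 / 2, s <= e / 2 & s <= (v l' - u l') / 2].
  by rewrite /s !ge_min !lexx !orbT.
have is' : int l' (p'.1, p'.2 + sg * s) by apply: insb => //; qlra.
have [||Us hs] := Hd2 p'.1 (p'.2 + sg * s) _ _ (strip_int_sub is').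
- by rewrite subrr normr0.
- rewrite addrAC subrr add0r normrM (gtr0_norm s0) /sg; case: ifP => _; rewrite ?normrN normr1; qlra.
have [|x xe alx] := Hd 0 _ I _ hs; first by rewrite subrr normr0.
have [|ix Ux] := ins x; first by qlra.
have [ll /= hh] := strip_sameleaf ix is' (heq _ _ Ux Us alx).
move: hh; subst l'; rewrite /sg; case: eqP => [->|ne]; first by qlra.
by case: bp' => // ->; qlra.
Qed.

Lemma strip_image_open l A : open A -> A `<=` int l -> open (q l @` A).
Proof.
move=> oA Ai; apply/(sa_quot sa) => l'; apply: open_in_nbhs => [p []//|p [Sp [p0 Ap0 E]]].
have [ll pp] := strip_int_inj (Ai _ Ap0) Sp E; subst l' p0.
have : nbhs p A by apply: open_nbhs_nbhs.
by apply: filterS => y Ay Sy; split => //; exists y.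
Qed.

Definition strip_coord l (z : Z) : plane := xget (0, 0) [set p | int l p /\ q l p = z].

Lemma strip_coordK l p : int l p -> strip_coord l (q l p) = p.
Proof.
move=> ip; rewrite /strip_coord; case: xgetP => [p' _ [ip' E]|/(_ p)]; last by case.
by have [_ ->] := strip_inj ip' ip E.
Qed.

Lemma open_strip_int l : open (int l).
Proof. by rewrite openE => p /strip_int_nbhs. Qed.

Lemma strip_coord_cont l p : int l p -> {for q l p, continuous (strip_coord l)}.
Proof.
move=> ip B; rewrite strip_coordK // => nB.
have nB' : nbhs p (B `&` int l) by apply: filterI => //; exact: strip_int_nbhs.
have oI : open ((B `&` int l)^°) by apply: open_interior.
have : open (q l @` (B `&` int l)^°).
  by apply: strip_image_open => // y /interior_subset[].
move=> oq; have : nbhs (q l p) (q l @` (B `&` int l)^°).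
  by apply: open_nbhs_nbhs; split => //; exists p.
apply: filterS => _ [y /interior_subset[By iy] <-].
by rewrite /= strip_coordK.
Qed.

Lemma strip_chart l : foliated_chart D (q l @` int l) (strip_coord l) (q l) (int l).
Proof.
split.
- by apply: strip_image_open => //; exact: open_strip_int.
- by move=> p ip; split; [exists p|exact: strip_coordK].
- by move=> _ [p ip <-]; rewrite strip_coordK.
- by move=> p ip B nB; have := strip_nbhs (strip_int_sub ip) nB;
    apply: filterS => y H /strip_int_sub /H.
- by move=> _ [p ip <-]; exact: strip_coord_cont.
- move=> p p' ip ip' pp'; exists (q l @` [set r | r.2 = p.2]); split.
  + exact: strip_line_leaf.
  + by exists p.
  + by exists p'.
Qed.

Lemma strip_not_mboundary l p : int l p -> ~ mboundary (q l p).
Proof.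
move=> ip; have [e e0 He] := (nbhs2P p (int l)).1 (strip_int_nbhs ip).
have pE : (p.1, p.2) = p by rewrite -surjective_pairing.
have [||b1 [b2 [bp b10 _ fp]]] := @box_of_chart Z D partD leafR _ _ _ _ p.1 p.2 e true setT
  (strip_chart l) e0.
- by move=> x s xe se; split => // _; apply: He.
- exact: filterT.
rewrite pE in b10; rewrite -b10.
by apply: (full_pair_not_mboundary fsD.(fs_fol) fsD.(fs_bd) fsD.(fs_leaf) bp fp); rewrite normr0.
Qed.

(** The saturated neighbourhood is the band [A] of half-width [e] around the level. As [e] is at
    most half the distance to the ends, the closed band [C] consists of inner points, which have a
    single preimage; so the image of [C] is closed in the quotient topology and is the closure of
    the image of [A]. *)
Lemma strip_line_regular l t : u l < t < v l ->
  regular_leaf D (q l @` [set p | p.2 = t]).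
Proof.
move=> ut; left; split.
  by move=> _ [p /= pt <-]; apply: strip_not_mboundary; rewrite /strip_int /= pt.
pose e := Num.min ((t - u l) / 2) ((v l - t) / 2).
have e0 : 0 < e by rewrite /e lt_min; qlra.
have [eu ev] : e <= (t - u l) / 2 /\ e <= (v l - t) / 2 by rewrite /e !ge_min !lexx !orbT.
pose A := [set p : plane | `|p.2 - t| < e]; pose C := [set p : plane | `|p.2 - t| <= e].
have Ci p : C p -> int l p by rewrite /C /strip_int /= ler_distl; qlra.
have Ai p : A p -> int l p by move=> Ap; apply: Ci; exact: ltW.
have c2 : continuous (fun p : plane => `|p.2 - t|).
  by move=> p; apply: cvg_norm; apply: cvgB; [exact: cvg_snd|exact: cvg_cst].
have oA : open A by apply: (open_comp _ (@open_lt _ e)) => p _; exact: c2.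
have cC : closed C by apply: (closed_comp _ (@closed_le _ e)) => p _; exact: c2.
have oqA : open (q l @` A) by apply: strip_image_open.
have cqC : closed (q l @` C).
  rewrite -[X in closed X]setCK; apply: open_closedC.
  apply/(sa_quot sa) => l'; apply: open_in_nbhs => [p []//|p [Sp nCp]].
  have [ll|nl] := EM (l' = l); last first.
    apply: filterE => y Sy; split => // -[y' /Ci iy' E].
    by have [ll _] := strip_int_inj iy' Sy E; apply: nl.
  subst l'; have : nbhs p (~` C).
    by apply: open_nbhs_nbhs; split; [exact: closed_openC|move=> Cp; apply: nCp; exists p].
  apply: filterS => y nCy Sy; split => // -[y' Cy' E].
  by have [_ yy] := strip_int_inj (Ci _ Cy') Sy E; apply: nCy; rewrite -yy.
have clA : closure (q l @` A) = q l @` C.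
  apply/seteqP; split.
    rewrite closureE => z; apply; split => // _ [p Ap <-]; exists p => //; exact: ltW.
  move=> _ [p Cp <-] B nB; have := continuous_nbhs (strip_cont (Ci _ Cp)) nB.
  move=> /nbhs2P[d d0 Hd].
  (* The point [p] is moved towards the level [t] so that its distance from it shrinks by the factor
     [1 - m], which brings it into [A]; the displacement is at most [m * e < d]. *)
  pose m := Num.min (1 / 2) (d / (2 * (1 + e))).
  have m0 : 0 < m by rewrite lt_min !divr_gt0 // ?mulr_gt0 //; qlra.
  have [m1 md] : m <= 1 / 2 /\ m <= d / (2 * (1 + e)) by rewrite /m !ge_min !lexx !orbT.
  exists (q l (p.1, p.2 + m * (t - p.2))); split.
    exists (p.1, p.2 + m * (t - p.2)) => //; rewrite /A /=.
    have -> : p.2 + m * (t - p.2) - t = (1 - m) * (p.2 - t) by ring.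
    rewrite normrM ger0_norm; last by qlra.
    have := Cp; rewrite /C /= => Cp'.
    have [->|nz] := eqVneq `|p.2 - t| 0; first by rewrite mulr0.
    have : (1 - m) * `|p.2 - t| < `|p.2 - t|.
      by rewrite gtr_pMl; [qlra|rewrite lt0r nz normr_ge0].
    by move=> h; apply: lt_le_trans Cp'.
  apply: Hd; first by rewrite /= subrr normr0.
  rewrite addrAC subrr add0r normrM (gtr0_norm m0) distrC.
  have h1 : m * `|p.2 - t| <= m * e by rewrite ler_pM2l.
  have h2 : m * e <= d / (2 * (1 + e)) * e by rewrite ler_pM2r.
  have h3 : d / (2 * (1 + e)) * e < d.
    rewrite mulrAC ltr_pdivrMr; last by qlra.
    by rewrite ltr_pM2l //; qlra.
  by qlra.
have leafC w x : D w -> w x -> (q l @` C) x -> exists2 p, C p /\ q l p = x & w = q l @` [set r | r.2 = p.2].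
  move=> Dw wx [p Cp px]; exists p => //.
  by apply: (leaf_unique partD Dw (strip_line_leaf (Ci _ Cp)) wx); exists p.
pose h z : plane := ((strip_coord l z).1, ((strip_coord l z).2 - t) / e).
have hq p : int l p -> h (q l p) = (p.1, (p.2 - t) / e) by move=> ip; rewrite /h strip_coordK.
pose g (p : plane) := q l (p.1, t + e * p.2).
have gC p : -1 <= p.2 <= 1 -> C (p.1, t + e * p.2).
  move=> p1; rewrite /C /= addrAC subrr add0r normrM (gtr0_norm e0) ger_pMr // ler_norml.
  exact: p1.
have eK (x : RR) : (t + e * x - t) / e = x by rewrite addrAC subrr add0r mulrC mulKf // gt_eqF.
have eK' (x : RR) : t + e * ((x - t) / e) = x.
  by rewrite mulrC divfK ?gt_eqF //; ring.
exists (q l @` A), h; split.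
- split.
    move=> w Dw [x [wx [p Ap px]]].
    have [|p' [Cp' E] ->] := leafC w x Dw wx; first by exists p => //; exact: ltW.
    have [_ pp] : l = l /\ p = p' by apply: strip_inj; [exact: Ai|exact: Ci|rewrite px E].
    by move=> _ [r /= rp <-]; exists r => //; rewrite /A /= rp -pp.
  exists (q l @` A); split => // _ [p /= pt <-]; exists p => //.
  by rewrite /A /= pt subrr normr0.
- rewrite clA; exists g; split.
  + apply/within_continuous_nbhs => _ [p Cp <-] B nB.
    have N : nbhs (strip_coord l (q l p)) [set r : plane | B (r.1, (r.2 - t) / e)].
      rewrite strip_coordK; last exact: Ci.
      rewrite hq in nB; last exact: Ci.
      have [d d0 Hd] := (nbhs2P _ _).1 nB; apply/nbhs2P; exists (Num.min d (e * d)).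
        by rewrite lt_min d0 mulr_gt0.
      move=> x s; rewrite !lt_min => /andP[xd _] /andP[_ sd]; apply: Hd => //=.
      rewrite -mulrBl normrM normfV (gtr0_norm e0) ltr_pdivrMr // mulrC.
      by have -> : s - t - (p.2 - t) = s - p.2 by ring.
    have := continuous_nbhs (strip_coord_cont (Ci _ Cp)) N.
    by apply: filterS => y By _; exact: By.
  + apply/within_continuous_nbhs => p p1 B nB.
    have [d d0 Hd] := (nbhs2P _ _).1 (continuous_nbhs (strip_cont (Ci _ (gC _ p1))) nB).
    apply/nbhs2P; exists (Num.min d (d / e)); first by rewrite lt_min d0 divr_gt0.
    move=> x s; rewrite !lt_min => /andP[xd _] /andP[_ sd] _; apply: Hd => //=.
    have -> : t + e * s - (t + e * p.2) = e * (s - p.2) by ring.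
    by rewrite normrM (gtr0_norm e0) mulrC -ltr_pdivlMr.
  + move=> _ [p Cp <-]; rewrite hq /=; last exact: Ci.
    split; last by rewrite /g /= eK' -surjective_pairing.
    rewrite -ler_norml normrM normfV (gtr0_norm e0) ler_pdivrMr // mul1r.
    exact: Cp.
  + move=> p p1; have Cp := gC _ p1; split; first by exists (p.1, t + e * p.2).
    by rewrite /g hq /= ?eK -?surjective_pairing //; exact: Ci.
- apply/seteqP; split.
    move=> _ [_ [p Ap <-] <-]; rewrite hq /=; last exact: Ai.
    by rewrite -ltr_norml normrM normfV (gtr0_norm e0) ltr_pdivrMr // mul1r.
  move=> p /= p1; exists (g p); last by rewrite /g hq /= ?eK -?surjective_pairing //; apply/Ci/gC; qlra.
  exists (p.1, t + e * p.2) => //; rewrite /A /= addrAC subrr add0r normrM (gtr0_norm e0).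
  by rewrite gtr_pMr // ltr_norml.
- apply/seteqP; split.
    move=> _ [_ [p pt <-] <-]; rewrite hq /= ?pt ?subrr ?mul0r //.
    by rewrite /strip_int /= pt.
  move=> p /= p0; exists (q l (p.1, t)); first by exists (p.1, t).
  by rewrite hq /= ?subrr ?mul0r -?p0 -?surjective_pairing.
- rewrite clA => w x Dw wx Cx; have [p [Cp px] wE] := leafC w x Dw wx Cx.
  have wC : w `<=` q l @` C by rewrite wE => _ [r /= rp <-]; exists r => //; rewrite /C /= rp.
  have hx : h x = (p.1, (p.2 - t) / e) by rewrite -px hq //; exact: Ci.
  rewrite hx /=; apply/seteqP; split.
    move=> _ [y [_ [ga [_ _ g1 gi]]] <-].
    have : (w `&` q l @` C) y by rewrite -g1; apply: gi; exists 1 => //=; rewrite ler01 lexx.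
    rewrite wE => -[[r rp <-] _]; rewrite /= in rp.
    have ir : int l r by have := Ci _ Cp; rewrite /strip_int /= rp.
    by rewrite (hq r ir) /= rp.
  move=> r /= rE; exists (q l (r.1, p.2)); last first.
    rewrite hq /= -?rE -?surjective_pairing //.
    by have := Ci _ Cp; rewrite /strip_int.
  split; first by split.
  have [_ /(_ w Dw) pc _] := fsD.(fs_fol).
  have [|ga [? ? ? gi]] := pc x (q l (r.1, p.2)) wx; first by rewrite wE; exists (r.1, p.2).
  by exists ga; split => // y /gi wy; split => //; exact: wC.
Qed.

(** As the strip is open in the closed strip, a horizontal segment around [p] belongs to its
    boundary and, being connected, to the interval of [p]. The radius is at most [v l - u l], so the
    opposite side is not reached. *)
Lemma strip_boundary_nbhs l p w : D w -> strip_boundary (S l) (u l) (v l) p -> w (q l p) ->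
  nbhs p [set y | S l y -> int l y \/ w (q l y)].
Proof.
move=> Dw bp wp; have [Sp /= pb] := bp.
have [uv iS Suv [Q [oQ SQ]]] := sa_strip sa l.
have Qp : Q p by move: Sp; rewrite SQ => -[].
have [d d0 Hd] := (nbhs2P p Q).1 (open_nbhs_nbhs (conj oQ Qp)).
pose I := [set y : plane | `|y.1 - p.1| < d /\ y.2 = p.2].
have Ib : I `<=` strip_boundary (S l) (u l) (v l).
  move=> [x s] [/= xd ->]; split => //=; rewrite SQ; split => /=.
    by apply: Hd; rewrite ?subrr ?normr0.
  by case: pb => ->; qlra.
have Ip : I p by split => //; rewrite subrr normr0.
have cI : connected I.
  have -> : I = (fun x : RR => (x, p.2) : plane) @` [set x | `|x - p.1| < d].
    apply/seteqP; split => [[x s] [/= xd ->]|_ [x xd <-]]; first by exists x.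
    by [].
  apply: connected_continuous_connected.
    apply/connected_intervalP => a b /= ae be t /andP[at_ tb].
    by move: ae be; rewrite !ltr_distl; qlra.
  apply: continuous_subspaceT => x B /nbhs2P[d' d'0 Hd'].
  by apply/nbhsRP; exists d' => // y yd; apply: Hd'; rewrite //= subrr normr0.
pose L := connected_component (strip_boundary (S l) (u l) (v l)) p.
have LD : D (q l @` L).
  rewrite (sa_leaves sa); exists l, L; split => //; right; exists p; split => //.
have wE : w = q l @` L.
  by apply: (leaf_unique partD Dw LD wp); exists p => //; apply: connected_component_refl.
have IL : I `<=` L by apply: connected_component_max.
apply/nbhs2P; exists (Num.min d (v l - u l)); first by rewrite lt_min d0 subr_gt0.
move=> x s; rewrite !lt_min => /andP[xd _] /andP[_ sd] Sxs.
have := Suv _ Sxs; rewrite /= => us.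
have [/eqP sp|np] := boolP (s == p.2).
  by right; rewrite wE; exists (x, s) => //; apply: IL; rewrite sp.
left; rewrite /strip_int /=; move: sd np; rewrite ltr_distl neq_lt.
by case: pb => ->; qlra.
Qed.

Lemma atlas_singular_locally_finite : locally_finite_family (singular_leaf D).
Proof.
move=> z; have [w [Dw wz _]] := sameleaf_refl partD z.
exists ([set y | exists l p, int l p /\ q l p = y] `|` w); split.
- apply/(sa_quot sa) => l; apply: open_in_nbhs => [p []//|p [Sp]].
  have intc y : int l y -> nbhs y [set y' | S l y' -> (S l `&` q l @^-1`
      ([set y | exists l p, int l p /\ q l p = y] `|` w)) y'].
    move=> iy; have := strip_int_nbhs iy; apply: filterS => y' iy' Sy'; split => //.
    by left; exists l, y'.
  case=> [[l' [p' [ip' E]]]|wp].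
    have [ll pp] := strip_int_inj ip' Sp E; subst l' p'; exact: intc.
  have [ip|nip] := EM (int l p); first exact: intc.
  have bp : strip_boundary (S l) (u l) (v l) p.
    split => //=; have [_ _ Suv _] := sa_strip sa l.
    have /andP[h1 h2] := Suv _ Sp; rewrite /= in h1 h2.
    have [->|nu] := eqVneq p.2 (u l); first by left.
    have [->|nv] := eqVneq p.2 (v l); first by right.
    by exfalso; apply: nip; rewrite /strip_int /= !lt_neqAle h1 h2 nv eq_sym nu.
  have := strip_boundary_nbhs Dw bp wp; apply: filterS => y H Sy.
  split => //; case: (H Sy) => h; [left|by right].
  by exists l, y.
- by right.
- apply: (@sub_finite_set _ _ [set w]); last exact: finite_set1.
  move=> w' [[Dw' nr] [y [w'y [[l [p [ip E]]]|wy]]]].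
    exfalso; apply: nr; have -> : w' = q l @` [set r | r.2 = p.2].
      apply: (leaf_unique partD Dw' (strip_line_leaf ip) w'y); by exists p.
    exact: strip_line_regular.
  by have := leaf_unique partD Dw' Dw w'y wy.
Qed.
End AtlasRegular.

(** * Regular leaves *)

(** A saturated chart onto the open strip of height 2 whose leaves are exactly the lines. By
    [rc_closed] narrower closed bands are closed in all of [Z], which separates leaves in the chart
    from those outside. *)
Record regular_chart {Z : topologicalType} (D : set (set Z)) (r : plane -> Z)
    (k : Z -> plane) : Prop := RegularChart {
  rc_cont : forall p : plane, `|p.2| < 1 -> {for p, continuous r};
  rc_can : forall p : plane, `|p.2| < 1 -> k (r p) = p;
  rc_kcont : forall p : plane, `|p.2| < 1 -> {for r p, continuous k};
  rc_open : forall p : plane, `|p.2| < 1 -> nbhs (r p) (r @` [set q | `|q.2| < 1]);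
  rc_leaf : forall p q : plane, `|p.2| < 1 -> `|q.2| < 1 ->
    (sameleaf D (r p) (r q) <-> p.2 = q.2);
  rc_sat : forall (p : plane) y, `|p.2| < 1 -> sameleaf D (r p) y ->
    exists x : RR, y = r (x, p.2);
  rc_closed : forall c : RR, c < 1 -> closed (r @` [set q | `|q.2| <= c]) }.

Section Regular.
Context {Z : topologicalType} (D : set (set Z)) (fsD : foliated_surface D).
Local Notation sameleaf := (sameleaf D).
Local Notation partD := (fs_part fsD).
Local Notation leafR := (fs_leafR fsD).

Lemma fs_box z O : nbhs z O -> exists b1 b2, [/\ box_pair D b1 b2, b1 (0, 0) = z &
   forall x s : RR, `|x| < 1 -> `|s| < 1 -> O (b1 (x, s)) /\ O (b2 (x, s))].
Proof. exact: (box_exists fsD.(fs_fol) fsD.(fs_leaf)). Qed.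

Lemma fs_saturated_nbhs (S : set Z) y z : (forall y z, S y -> sameleaf y z -> S z) ->
  sameleaf y z -> nbhs y S -> nbhs z S.
Proof. by apply: (saturated_nbhs leafR); exact: fs_box. Qed.

(** The set [U] is a neighbourhood of [w] but possibly not open. Levels close to 0 contain points
    interior to [U], so by [fs_saturated_nbhs] they consist of such points; the factor [a] shrinks
    the chart to these levels. *)
Lemma regular_int_chart w : D w -> regular_int_leaf D w ->
  exists r k, regular_chart D r k /\ w = r @` [set p | p.2 = 0].
Proof.
move=> Dw [U [h [[satU [Q [oQ wQ QU]]] hom hU hw fol]]].
have := hom => -[g [/within_continuous_nbhs ch /within_continuous_nbhs cg hC gC]].
have UC : U `<=` closure U by exact: subset_closure.
have gU (p : plane) : `|p.2| < 1 -> U (g p).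
  rewrite ltr_norml => p1; have : (h @` U) p by rewrite hU.
  by move=> [y Uy <-]; rewrite (hC _ (UC _ Uy)).2.
have hg (p : plane) : `|p.2| < 1 -> h (g p) = p.
  by rewrite ltr_norml => p1; apply: (gC p _).2 => /=; qlra.
have leafU w' x : D w' -> w' x -> U x -> w' `<=` U /\ h @` w' = [set p | p.2 = (h x).2].
  move=> Dw' w'x Ux; have w'U : w' `<=` U by apply: satU => //; exists x.
  split => //; rewrite -(fol w' x Dw' w'x (UC _ Ux)); congr (h @` _).
  have -> : w' `&` closure U = w'.
    by apply/seteqP; split => [y []//|y w'y]; split => //; apply/UC/w'U.
  apply/seteqP; split => [y w'y|y [_ [ga [_ _ <- gi]]]].
    by split => //; have [_ /(_ w' Dw') pc _] := fsD.(fs_fol); apply: pc.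
  by apply: gi; exists 1 => //=; rewrite ler01 lexx.
have leafE (p p' : plane) : `|p.2| < 1 -> `|p'.2| < 1 ->
    (sameleaf (g p) (g p') <-> p.2 = p'.2).
  move=> p1 p'1; have [w' [Dw' w'p _]] := sameleaf_refl partD (g p).
  have [w'U] := leafU _ _ Dw' w'p (gU _ p1); rewrite hg // => hw'; split.
    move=> /(sameleaf_in partD Dw' w'p) w'p'.
    have : (h @` w') p' by exists (g p') => //; rewrite hg.
    by rewrite hw' => /= ->.
  move=> pp'; have : (h @` w') p' by rewrite hw' /= pp'.
  move=> [y w'y hy]; exists w'; split => //.
  by rewrite -hy (hC _ (UC _ (w'U _ w'y))).2.
have satUl y z : U y -> sameleaf y z -> U z.
  by move=> Uy [w' [Dw' w'y w'z]]; apply: (satU w') => //; exists y.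
pose p0 : plane := (0, 0).
have wg0 : w (g p0).
  have : (h @` w) p0 by rewrite hw.
  move=> [y wy hy]; rewrite -hy (hC _ _).2 //.
  by apply/UC/QU/wQ.
have nU0 : nbhs (g p0) U.
  by apply: (filterS QU); apply: open_nbhs_nbhs; split => //; apply: wQ.
have [c c0 Hc] : exists2 c : RR, 0 < c & forall x s : RR, `|x - 0| < c -> `|s - 0| < c ->
    -1 <= s <= 1 -> nbhs (g (x, s)) U.
  have p01 : [set p : plane | -1 <= p.2 <= 1] p0 by rewrite /=; qlra.
  have [c c0 Hc] := (nbhs2P _ _).1 (cg _ p01 _ (nbhs_interior nU0)).
  by exists c => // x s xc sc s1; apply: Hc.
pose a := Num.min c (1 / 2).
have a0 : 0 < a by rewrite lt_min c0; qlra.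
have [ac a1] : a <= c /\ a <= 1 / 2 by rewrite /a !ge_min !lexx !orbT.
have as1 (s : RR) : `|s| < 1 -> `|a * s| < a.
  by move=> s1; rewrite normrM (gtr0_norm a0) gtr_pMr.
have as1' (s : RR) : `|s| < 1 -> `|a * s| < 1 by move=> /as1; qlra.
have nU (x s : RR) : `|s| < 1 -> nbhs (g (x, a * s)) U.
  move=> s1; apply: (@fs_saturated_nbhs U (g (0, a * s))) => //.
    by apply/leafE => //=; apply: as1'.
  have as_ := as1 _ s1; apply: Hc; rewrite ?subrr ?normr0 ?subr0 //.
    by apply: lt_le_trans ac.
  by move: as_; rewrite ltr_norml; qlra.
pose r (p : plane) := g (p.1, a * p.2); pose k z : plane := ((h z).1, (h z).2 / a).
have kr (p : plane) : `|p.2| < 1 -> k (r p) = p.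
  move=> p1; rewrite /k /r hg /=; last exact: as1'.
  by rewrite mulrC mulKf ?gt_eqF // -surjective_pairing.
have rk y : closure U y -> r (k y) = y.
  move=> Uy; rewrite /r /k /= mulrC divfK ?gt_eqF // -surjective_pairing.
  exact: (hC _ Uy).2.
have kc (p : plane) : `|p.2| < 1 -> {for r p, continuous k}.
  move=> p1 B nB; have nUp := nU p.1 p.2 p1.
  have Urp : closure U (r p) by apply: UC; apply: nbhs_singleton nUp.
  have : nbhs (h (r p)) [set q : plane | B (q.1, q.2 / a)].
    have [d d0 Hd] := (nbhs2P _ _).1 nB; apply/nbhs2P; exists (Num.min d (a * d)).
      by rewrite lt_min d0 mulr_gt0.
    move=> x s; rewrite !lt_min => /andP[xd _] /andP[_ sd]; apply: Hd => //=.
    by rewrite /k /= -mulrBl normrM normfV (gtr0_norm a0) ltr_pdivrMr // mulrC.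
  move=> /(ch _ Urp); move: nUp; apply: filterS2 => y Uy /(_ (UC _ Uy)).
  exact.
exists r, k; split.
  split => //.
  - move=> p p1 B nB; have p1' : [set p : plane | -1 <= p.2 <= 1] (p.1, a * p.2).
      by have := as1' _ p1; rewrite ltr_norml /=; qlra.
    have [d d0 Hd] := (nbhs2P _ _).1 (cg _ p1' _ nB).
    apply/nbhs2P; exists (Num.min d (Num.min (d / a) (1 - `|p.2|))).
      by rewrite !lt_min d0 divr_gt0 // subr_gt0.
    move=> x s; rewrite !lt_min => /and3P[xd _ _] /and3P[_ sd s1]; apply: Hd => //=.
      by rewrite -mulrBr normrM (gtr0_norm a0) mulrC -ltr_pdivlMr.
    have : `|s| < 1 by have := ler_distD p.2 s 0; rewrite !subr0; qlra.
    by move=> /as1'; rewrite ltr_norml; qlra.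
  - move=> p p1; have kp : nbhs (k (r p)) [set q : plane | `|q.2| < 1].
      rewrite kr //; apply/nbhs2P; exists (1 - `|p.2|); first by rewrite subr_gt0.
      by move=> x s _ sp /=; have := ler_distD p.2 s 0; rewrite !subr0; qlra.
    have := continuous_nbhs (kc _ p1) kp; move: (nU p.1 p.2 p1).
    apply: filterS2 => y Uy ky; exists (k y) => //; apply: rk; exact: UC.
  - move=> p q p1 q1; rewrite /r leafE /=; [|exact: as1'..].
    by split => [/(mulfI (lt0r_neq0 a0))//|->].
  - move=> p y p1 E; exists (h y).1.
    have Ury : U (r p) by apply: gU; apply: as1'.
    have Uy : U y by apply: satUl E.
    have gy : g (h y) = y by exact: (hC _ (UC _ Uy)).2.
    have h1 : `|(h y).2| < 1.
      have : (h @` U) (h y) by exists y.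
      by rewrite hU /= ltr_norml.
    have : a * p.2 = (h y).2.
      by apply: ((leafE (p.1, a * p.2) (h y) _ h1).1); [apply: as1'|rewrite gy].
    by rewrite /r /= => ->; rewrite -surjective_pairing.
  - move=> c' c'1; rewrite -[X in closed X]setCK; apply: open_closedC.
    rewrite openE => z nz; rewrite /interior.
    have [Uz|nUz] := EM (closure U z); last first.
      have : nbhs z (~` closure U).
        by apply: open_nbhs_nbhs; split => //; apply: closed_openC; exact: closed_closure.
      apply: filterS => y nUy [q /= qc E]; apply: nUy; rewrite -E; apply: UC; apply: gU.
      by apply: as1'; apply: le_lt_trans c'1.
    have hz : a * c' < `|(h z).2|.
      rewrite ltNge; apply/negP => hz; apply: nz; exists (k z); last exact: rk.
      by rewrite /k /= normrM normfV (gtr0_norm a0) ler_pdivrMr // mulrC.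
    have : nbhs (h z) [set q : plane | a * c' < `|q.2|].
      apply/nbhs2P; exists (`|(h z).2| - a * c'); first by rewrite subr_gt0.
      by move=> x s _ sd /=; have := ler_distD s (h z).2 0; rewrite !subr0 distrC; qlra.
    move=> /(ch _ Uz); apply: filterS => y H [q /= qc E].
    have q1 : `|q.2| < 1 by apply: le_lt_trans c'1.
    have : closure U y by rewrite -E; apply: UC; apply: gU; apply: as1'.
    move=> /H; rewrite /= -E /r hg /=; last exact: as1'.
    by rewrite normrM (gtr0_norm a0) ltr_pM2l // ltNge qc.
apply/seteqP; split.
  move=> y wy; have Uy : U y by apply/QU/wQ.
  have : (h @` w) (h y) by exists y.
  rewrite hw /= => h0; exists (k y); last by apply/rk/UC.
  by rewrite /k /= h0 mul0r.
move=> _ [q /= q0 <-]; rewrite /r q0 mulr0.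
have : (h @` w) (q.1, 0) by rewrite hw.
by move=> [y wy <-]; rewrite (hC _ _).2 //; apply/UC/QU/wQ.
Qed.


Lemma regular_chart_recenter r k (s0 : RR) : regular_chart D r k -> `|s0| < 1 ->
  exists r' k', regular_chart D r' k' /\ forall x : RR, r (x, s0) = r' (x, 0).
Proof.
move=> rc s01; pose e := 1 - `|s0|.
have e0 : 0 < e by rewrite subr_gt0.
have in1 (t : RR) : `|t| < 1 -> `|s0 + e * t| < 1.
  move=> t1; apply: le_lt_trans (ler_normD _ _) _.
  have : `|e * t| < e by rewrite normrM (gtr0_norm e0) gtr_pMr.
  by rewrite /e; qlra.
pose r' (p : plane) := r (p.1, s0 + e * p.2).
pose k' z : plane := ((k z).1, ((k z).2 - s0) / e).
have eK (t : RR) : (s0 + e * t - s0) / e = t.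
  by rewrite addrAC subrr add0r mulrC mulKf // gt_eqF.
have kr (p : plane) : `|p.2| < 1 -> k' (r' p) = p.
  move=> p1; rewrite /k' /r' (rc_can rc) /=; last exact: in1.
  by rewrite eK -surjective_pairing.
have kc (p : plane) : `|p.2| < 1 -> {for r' p, continuous k'}.
  move=> p1 B nB; have q1 := in1 _ p1.
  have : nbhs (k (r' p)) [set q : plane | B (q.1, (q.2 - s0) / e)].
    have [d d0 Hd] := (nbhs2P _ _).1 nB; apply/nbhs2P; exists (Num.min d (e * d)).
      by rewrite lt_min d0 mulr_gt0.
    move=> x s; rewrite !lt_min => /andP[xd _] /andP[_ sd]; apply: Hd => //=.
    rewrite /k' /= -mulrBl normrM normfV (gtr0_norm e0) ltr_pdivrMr // mulrC.
    by have -> : s - s0 - ((k (r' p)).2 - s0) = s - (k (r' p)).2 by ring.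
  exact: (continuous_nbhs (rc_kcont rc (p := (p.1, s0 + e * p.2)) q1)).
have rimg (c : RR) : c <= 1 -> r' @` [set q | `|q.2| < c] =
    r @` [set q | `|q.2 - s0| < e * c].
  move=> c1; apply/seteqP; split => _ [q /= qc <-].
    exists (q.1, s0 + e * q.2) => //=.
    by rewrite addrAC subrr add0r normrM (gtr0_norm e0) ltr_pM2l.
  exists (q.1, (q.2 - s0) / e) => /=.
    by rewrite normrM normfV (gtr0_norm e0) ltr_pdivrMr // mulrC.
  by rewrite /r' /= mulrC divfK ?gt_eqF // addrC subrK -surjective_pairing.
exists r', k'; split; last by move=> x; rewrite /r' /= mulr0 addr0.
split => //.
- move=> p p1 B nB; have [d d0 Hd] := (nbhs2P _ _).1
    (continuous_nbhs (rc_cont rc (p := (p.1, s0 + e * p.2)) (in1 _ p1)) nB).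
  apply/nbhs2P; exists (Num.min d (d / e)); first by rewrite lt_min d0 divr_gt0.
  move=> x s; rewrite !lt_min => /andP[xd _] /andP[_ sd]; apply: Hd => //=.
  have -> : s0 + e * s - (s0 + e * p.2) = e * (s - p.2) by ring.
  by rewrite normrM (gtr0_norm e0) mulrC -ltr_pdivlMr.
- move=> p p1; rewrite rimg // mulr1.
  have ke := kc p p1 [set q : plane | `|q.2| < 1].
  have : nbhs (r' p) [set y | `|(k' y).2| < 1].
    apply: ke; rewrite kr //; apply/nbhs2P; exists (1 - `|p.2|); first by rewrite subr_gt0.
    by move=> x s _ sp /=; have := ler_distD p.2 s 0; rewrite !subr0; qlra.
  have := rc_open rc (p := (p.1, s0 + e * p.2)) (in1 _ p1).
  apply: filterS2 => _ [q /= q1 <-]; rewrite /= (rc_can rc) //= => h; exists q => //=.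
  by move: h; rewrite normrM normfV (gtr0_norm e0) ltr_pdivrMr // mul1r.
- move=> p q p1 q1; rewrite /r' (rc_leaf rc) /=; [|exact: in1..].
  by split => [/addrI/(mulfI (lt0r_neq0 e0))//|->].
- by move=> p y p1 /(rc_sat rc (p := (p.1, s0 + e * p.2)) (in1 _ p1))[x ->]; exists x.
- move=> c c1; pose C := Num.max 0 c.
  have C1 : C < 1 by rewrite /C gt_max c1 andbT.
  have C0 : 0 <= C by rewrite /C le_max lexx.
  have cC : c <= C by rewrite /C le_max lexx orbT.
  pose m := `|s0| + e * C.
  have m1 : m < 1 by rewrite /m; have : e * C < e by [rewrite gtr_pMr]; rewrite /e; qlra.
  (* The closed band around [s0] is a closed band around 0 minus an open set. *)
  have -> : r' @` [set q | `|q.2| <= c] = r @` [set q | `|q.2| <= m] `&`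
      ~` (r @` [set q | `|q.2| < 1] `&` [set y | e * c < `|(k y).2 - s0|]).
    apply/seteqP; split.
      move=> _ [q /= qc <-]; have qC : `|e * q.2| <= e * C.
        by rewrite normrM (gtr0_norm e0) ler_pM2l //; qlra.
      have q1 : `|s0 + e * q.2| < 1.
        by apply: in1; qlra.
      split.
        exists (q.1, s0 + e * q.2) => //=; apply: le_trans (ler_normD _ _) _.
        by rewrite /m; qlra.
      move=> [_]; rewrite /r' (rc_can rc) //= addrAC subrr add0r normrM (gtr0_norm e0).
      by rewrite ltr_pM2l // ltNge qc.
    move=> _ [[q /= qm <-] H]; have q1 : `|q.2| < 1 by qlra.
    have : ~ (e * c < `|q.2 - s0|).
      by move=> h; apply: H; split; [exists q|rewrite /= (rc_can rc)].
    move=> /negP; rewrite -leNgt => h; exists (q.1, (q.2 - s0) / e) => /=.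
      by rewrite normrM normfV (gtr0_norm e0) ler_pdivrMr // mulrC.
    by rewrite /r' /= mulrC divfK ?gt_eqF // addrC subrK -surjective_pairing.
  apply: closedI; first exact: (rc_closed rc).
  apply: open_closedC; rewrite openE => _ [[q /= q1 <-] h].
  rewrite /interior; apply: filterI; first exact: (rc_open rc).
  rewrite (rc_can rc) // in h.
  apply: (continuous_nbhs (rc_kcont rc q1) (B := [set p : plane | e * c < `|p.2 - s0|])).
  rewrite (rc_can rc) //; apply/nbhs2P; exists (`|q.2 - s0| - e * c); first by rewrite subr_gt0.
  by move=> x s _ sd /=; have := ler_distD s q.2 s0; rewrite (distrC q.2 s); qlra.
Qed.

Definition regular_pt (z : Z) : Prop :=
  exists r k (p : plane), [/\ regular_chart D r k, `|p.2| < 1 & z = r p].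

Lemma regular_int_leaf_pt w z : D w -> w z -> regular_int_leaf D w -> regular_pt z.
Proof.
move=> Dw wz rw; have [r [k [rc wE]]] := regular_int_chart Dw rw.
move: wz; rewrite wE => -[p /= p0 <-]; exists r, k, p; split => //.
by rewrite p0 normr0.
Qed.

Lemma regular_pt_sameleaf y z : regular_pt y -> sameleaf y z -> regular_pt z.
Proof.
move=> [r [k [p [rc p1 ->]]]] /(rc_sat rc p1)[x ->].
by exists r, k, (x, p.2).
Qed.

Lemma regular_pt_chart z : regular_pt z ->
  exists r k (x : RR), regular_chart D r k /\ z = r (x, 0).
Proof.
move=> [r [k [[x s] [rc /= s1 ->]]]].
have [r' [k' [rc' E]]] := regular_chart_recenter rc s1.
by exists r', k', x.
Qed.

Lemma regular_chart_nbhs r k (x s e : RR) : regular_chart D r k -> 0 < e ->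
  `|s| < 1 -> nbhs (r (x, s)) [set y | exists u t : RR, [/\ `|u - x| < e, `|t - s| < e,
     `|t| < 1 & y = r (u, t)]].
Proof.
move=> rc e0 s1; have N : nbhs (k (r (x, s))) [set p : plane | `|p.1 - x| < e /\ `|p.2 - s| < e].
  by rewrite (rc_can rc) //; apply: nbhs_rect.
have := continuous_nbhs (rc_kcont rc (p := (x, s)) s1) N.
have := rc_open rc (p := (x, s)) s1.
apply: filterS2 => _ [[u t] /= t1 <-]; rewrite (rc_can rc) //= => -[ux ts].
by exists u, t.
Qed.

(** A regular leaf is separated in the leaf space from every other leaf: some closed band around it
    misses [y] and is closed in [Z], and no leaf meets both the complement of this band and its
    interior. Only irregular leaves can be non-separated from each other. *)
Lemma regular_separated y z : regular_pt z -> ~ sameleaf y z ->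
  exists V V', [/\ nbhs y V, nbhs z V' & forall v v', V v -> V' v' -> ~ sameleaf v v'].
Proof.
move=> /regular_pt_chart[r [k [x [rc ->]]]] nyz.
have z1 : `|0 : RR| < 1 by rewrite normr0.
have [c /andP[c0 c1] yc] : exists2 c : RR, 0 < c < 1 & ~ (r @` [set q | `|q.2| <= c]) y.
  have [[q /= q1 qy]|ny] := EM ((r @` [set q | `|q.2| < 1]) y).
    have q0 : 0 < `|q.2|.
      rewrite normr_gt0; apply/eqP => q0; apply: nyz; rewrite -qy.
      by apply/(rc_leaf rc).
    exists (`|q.2| / 2); first by qlra.
    move=> [q' /= q'c q'y].
    have q'1 : `|q'.2| < 1 by qlra.
    have : k (r q') = k (r q) by rewrite q'y qy.
    by rewrite !(rc_can rc) // => E; move: q'c; rewrite E; qlra.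
  exists (1 / 2); first by qlra.
  by move=> [q /= qc qy]; apply: ny; exists q => //=; qlra.
exists (~` (r @` [set q | `|q.2| <= c])), [set y | exists u t : RR, [/\ `|u - x| < c, `|t - 0| < c, `|t| < 1 & y = r (u, t)]]; split.
- by apply: open_nbhs_nbhs; split => //; apply: closed_openC; apply: (rc_closed rc).
- exact: (regular_chart_nbhs x rc c0 z1).
- move=> v v' nv [u [t [_ tc t1 ->]]] /sameleaf_sym E; apply: nv.
  have [x' ->] := rc_sat rc (p := (u, t)) t1 E.
  by exists (x', t) => //=; rewrite -[t]subr0 ltW.
Qed.
End Regular.

(** * Countably many strips *)

Lemma locally_finite_isolate (Z : topologicalType) (F : set (set Z)) z :
  (forall w, F w -> closed w) -> locally_finite_family F ->
  nbhs z [set y | forall w, F w -> w y -> w z].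
Proof.
move=> cF lF; have [W [oW Wz Wf]] := lF z.
pose A := [set w | F w /\ w `&` W !=set0] `&` [set w | ~ w z].
have cA : closed (\bigcup_(w in A) w).
  apply: closed_bigcup; first by apply: finite_setIl.
  by move=> w [[/cF]].
have : nbhs z (W `&` ~` \bigcup_(w in A) w).
  apply: filterI; first exact: open_nbhs_nbhs.
  by apply: open_nbhs_nbhs; split; [exact: closed_openC|case=> w [_ nwz]].
apply: filterS => y [Wy nA] w Fw wy; apply: contrapT => nwz; apply: nA.
by exists w => //; split => //; split => //; exists y.
Qed.

(** The basic sets for which some datum works are numbered by the injection [f] of the base into
    [nat]; indices that name no such set get [None]. *)
Lemma countable_cover (Z : topologicalType) (T : Type) (P : set Z -> T -> Prop) :
  @second_countable Z ->
  (forall A B t, A `<=` B -> P B t -> P A t) ->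
  (forall z : Z, exists (B : set Z) t, nbhs z B /\ P B t) ->
  exists e : nat -> option (set Z * T),
    (forall n B t, e n = Some (B, t) -> open B /\ P B t) /\
    (forall z : Z, exists n B t, e n = Some (B, t) /\ B z).
Proof.
move=> [B0 /countable_injP[f fi] [B0o B0b]] Pmono Pz.
pose good n (x : set Z * T) := [/\ B0 x.1, f x.1 = n & P x.1 x.2].
pose e n : option (set Z * T) :=
  match pselect (exists x, good n x) with
  | left H => Some (projT1 (cid H)) | right _ => None end.
have eP n x : e n = Some x -> good n x.
  by rewrite /e; case: pselect => // H [<-]; case: cid.
exists e; split.
  by move=> n B t /eP[/= B0B _ PB]; split => //; apply: B0o.
move=> z; have [B [t [nB PB]]] := Pz z.
have [U [B0U Uz] UB] := B0b z B nB.
have gU : good (f U) (U, t) by split => //=; apply: Pmono PB.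
have : exists x, e (f U) = Some x.
  by rewrite /e; case: pselect => [H|[]]; [eexists|exists (U, t)].
move=> [[V t'] eV]; have [/= B0V fV PV] := eP _ _ eV.
exists (f U), V, t'; split => //.
by have -> : V = U by apply: fi; rewrite ?inE.
Qed.

Section Strips.
Context {Z : topologicalType} (D : set (set Z)) (fsD : foliated_surface D).
Local Notation sameleaf := (sameleaf D).
Local Notation partD := (fs_part fsD).
Local Notation regular_pt := (regular_pt D).

Lemma half_box_vertical_open b (t0 e : RR) y : half_box D b -> 0 < t0 < 1 ->
  0 < e -> sameleaf y (b (0, t0)) ->
  nbhs y [set y' | exists t : RR, [/\ `|t - t0| < e, 0 < t < 1 & sameleaf y' (b (0, t))]].
Proof.
move=> hb t01 e0 /sameleaf_sym E; apply: (fs_saturated_nbhs fsD _ E).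
  move=> y' z [t [te t1 E1]] E2; exists t; split => //.
  by apply: (sameleaf_trans partD (sameleaf_sym E2)).
pose d := Num.min e (Num.min t0 (1 - t0)).
have d0 : 0 < d by rewrite /d !lt_min e0; qlra.
have z1 : `|0 : RR| < 1 by rewrite normr0.
have := hb_open hb z1 t01 (nbhs_rect 0 t0 ltr01 d0).
apply: filterS => _ [[x t] /= [x1 td] <-]; rewrite subr0 in x1.
move: td; rewrite /d !lt_min => /and3P[te]; rewrite !ltr_distl => ta tb.
exists t; split => //; first by qlra.
by apply: (hb_leaf hb) => //; rewrite ger0_norm; qlra.
Qed.

(** Read in a regular chart, the half-box is an injective planar map that sends levels to levels, so
    [locally_injective_height] applies to its height. *)
Lemma half_box_locally_injective b (t0 : RR) : half_box D b -> 0 < t0 < 1 ->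
  regular_pt (b (0, t0)) ->
  exists2 d : RR, 0 < d & forall s s' : RR, `|s - t0| < d -> `|s' - t0| < d ->
    sameleaf (b (0, s)) (b (0, s')) -> s = s'.
Proof.
move=> hb t01 /regular_pt_chart[r [k [x0 [rc E0]]]].
have z1 : `|0 : RR| < 1 by rewrite normr0.
have t1 : `|t0| < 1 by rewrite ger0_norm; qlra.
have rr1 := rc_open rc (p := (x0, 0)) z1; rewrite -E0 in rr1.
have [d1 d10 Hd1] := (nbhs2P _ _).1 (continuous_nbhs (hb_cont hb z1 t1) rr1).
pose e := Num.min d1 (Num.min t0 (1 - t0)).
have e0 : 0 < e by rewrite /e !lt_min d10; qlra.
have [ed et et'] : [/\ e <= d1, e <= t0 & e <= 1 - t0].
  by rewrite /e !ge_min !lexx !orbT.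
have ins (x s : RR) : `|x - 0| < e -> `|s - t0| < e -> [/\ `|x| < 1, 0 < s < 1,
    `|s| < 1 & (r @` [set q | `|q.2| < 1]) (b (x, s))].
  move=> xe; rewrite ltr_distl => se.
  rewrite subr0 in xe; split => //; try by qlra.
    by rewrite ger0_norm; qlra.
  by apply: Hd1; rewrite /= ?subr0 ?ltr_distl; qlra.
pose X (x s : RR) := (k (b (x, s))).1; pose c (s : RR) := (k (b (0, s))).2.
have kE (x s : RR) : `|x - 0| < e -> `|s - t0| < e -> k (b (x, s)) = (X x s, c s).
  move=> xe se; have [x1 s1 s1' [q /= q1 qE]] := ins x s xe se.
  have ze : `|0 - 0 : RR| < e by rewrite subrr normr0.
  have [_ _ _ [q' /= q'1 q'E]] := ins 0 s ze se.
  rewrite /X /c -qE -q'E !(rc_can rc) // [LHS]surjective_pairing; congr pair.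
  by apply/(rc_leaf rc) => //; rewrite qE q'E; apply: (hb_leaf hb).
have rk (x s : RR) : `|x - 0| < e -> `|s - t0| < e -> r (X x s, c s) = b (x, s).
  move=> xe se; have [x1 s1 s1' [q /= q1 qE]] := ins x s xe se.
  by rewrite -kE // -qE (rc_can rc).
have ck (x s : RR) B : `|x - 0| < e -> `|s - t0| < e -> nbhs (k (b (x, s))) B ->
    nbhs (x, s) [set p | B (k (b p))].
  move=> xe se nB; have [x1 s1 s1' [q /= q1 qE]] := ins x s xe se.
  apply: (continuous_nbhs (hb_cont hb x1 s1') (B := [set y | B (k y)])).
  rewrite -qE; apply: (continuous_nbhs (rc_kcont rc q1)); by rewrite qE.
have cX (x s : RR) (B : set RR) : `|x - 0| < e -> `|s - t0| < e -> nbhs (X x s) B ->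
    nbhs (x, s) [set p : plane | B (X p.1 p.2)].
  move=> xe se /nbhsRP[d d0 Hd].
  have : nbhs (k (b (x, s))) [set p : plane | B p.1].
    by apply/nbhs2P; exists d => // u v ud _; apply: Hd.
  move=> /(ck x s _ xe se)/nbhs2P[d' d'0 Hd']; apply/nbhs2P; exists d' => //.
have cs : `|t0 - t0| < e by rewrite subrr normr0.
have c1 (s : RR) : `|s - t0| < e -> forall x : RR, `|x - 0| < e -> {for x, continuous (X ^~ s)}.
  move=> se x xe B /(cX x s B xe se)/nbhs2P[d d0 Hd]; apply/nbhsRP; exists d => //.
  by move=> y yd; apply: (Hd y s) => //=; rewrite subrr normr0.
have c2 (x : RR) : `|x - 0| < e -> {for t0, continuous (X x)}.
  move=> xe B /(cX x t0 B xe cs)/nbhs2P[d d0 Hd]; apply/nbhsRP; exists d => //.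
  by move=> y yd; apply: (Hd x y) => //=; rewrite subrr normr0.
have c3 (x s x' s' : RR) : `|x - 0| < e -> `|s - t0| < e -> `|x' - 0| < e ->
    `|s' - t0| < e -> X x s = X x' s' -> c s = c s' -> x = x' /\ s = s'.
  move=> xe se x'e s'e XX cc.
  have [x1 s1 _ _] := ins x s xe se; have [x'1 s'1 _ _] := ins x' s' x'e s'e.
  have [s0 s'0] : 0 <= s < 1 /\ 0 <= s' < 1 by qlra.
  apply: (hb_inj hb) => //.
  by rewrite -rk // -[RHS]rk // XX cc.
have [d d0 Hd] := locally_injective_height e0 c1 c2 c3.
exists (Num.min d e); first by rewrite lt_min d0.
move=> s s'; rewrite !(lt_min _ d e) => /andP[sd se] /andP[s'd s'e] E.
apply: Hd => //; have ze : `|0 - 0 : RR| < e by rewrite subrr normr0.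
have [_ _ _ [q q1 qE]] := ins 0 s ze se; have [_ _ _ [q' q'1 q'E]] := ins 0 s' ze s'e.
by rewrite /c -qE -q'E !(rc_can rc) //; apply/(rc_leaf rc) => //; rewrite qE q'E.
Qed.

(* Leaves near an end do not come back: a return map would push a coincidence
   up to the first hit of a fixed closed leaf. *)
Lemma end_injective b : half_box D b ->
  (forall t : RR, 0 < t < 1 -> regular_pt (b (0, t))) -> ~ regular_pt (b (0, 0)) ->
  exists2 m : RR, 0 < m < 1 & forall s t : RR, 0 < s < m -> 0 < t < m ->
    sameleaf (b (0, s)) (b (0, t)) -> s = t.
Proof.
move=> hb breg nreg.
have z1 : `|0 : RR| < 1 by rewrite normr0.
pose tau (t : RR) := b (0, t).
have ctau (t : RR) : `|t| < 1 -> {for t, continuous tau}.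
  move=> t1 B /(continuous_nbhs (hb_cont hb z1 t1))/nbhs2P[d d0 Hd].
  by apply/nbhsRP; exists d => // y yd; apply: Hd => //=; rewrite subrr normr0.
have [w [Dw w12 _]] := sameleaf_refl partD (tau (1 / 2)).
have cw : closed w by have [] := fs_leaf fsD Dw.
(* Here [w] is the leaf of [tau (1 / 2)], and [m] will be the first height at which it is met. It is
   positive because [w] is closed and misses the irregular point [tau 0]. *)
pose H := [set s : RR | 0 < s <= 1 / 2 /\ w (tau s)].
have nwt (s : RR) : `|s| < 1 -> ~ w (tau s) -> exists2 d : RR, 0 < d &
    forall t : RR, `|t - s| < d -> ~ w (tau t).
  move=> s1 nws; have : nbhs (tau s) (~` w).
    by apply: open_nbhs_nbhs; split => //; exact: closed_openC.
  by move=> /(continuous_nbhs (ctau s s1))/nbhsRP.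
have h12 : H (1 / 2) by split; [rewrite /=; lra|exact: w12].
have hiH : has_inf H by split; [exists (1 / 2)|exists 0 => s [/andP[/ltW]]].
pose m := inf H.
have ilb s : H s -> m <= s by apply: ge_inf; case: hiH.
have m12 : m <= 1 / 2 by apply: ilb.
have m0 : 0 < m.
  have [||d d0 Hd] := nwt 0 => //.
    by move=> w0; apply: nreg; apply: (regular_pt_sameleaf (breg (1 / 2) _)); [qlra|exists w].
  apply: (lt_le_trans d0); apply: lb_le_inf; first by exists (1 / 2).
  move=> s [s0 ws]; rewrite leNgt; apply/negP => sd; apply: (Hd s) => //.
  by rewrite subr0 gtr0_norm //; qlra.
have wm : w (tau m).
  apply: contrapT => nwm; have [|d d0 Hd] := nwt m _ nwm; first by rewrite gtr0_norm; qlra.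
  have [s [s0 ws] sm] := inf_adherent d0 hiH.
  have ms : m <= s by apply: ilb.
  by apply: (Hd s) => //; rewrite ger0_norm; rewrite -/m in sm; qlra.
exists m; first by qlra.
suff K s t : 0 < s -> s < t -> t < m -> ~ sameleaf (tau s) (tau t).
  move=> s t sm tm E; apply/eqP; rewrite eq_le; apply/andP; split; rewrite leNgt; apply/negP => lt.
    by apply: (K t s) => //; [qlra|qlra|exact: sameleaf_sym].
  by apply: (K s t) => //; qlra.
move=> s0 st tm E.
(* The heights up to [m] whose leaf also passes at some lower positive height. *)
pose T := [set t' : RR | t <= t' <= m /\ exists s' : RR, 0 < s' < t' /\ sameleaf (tau s') (tau t')].
have Tt : T t by split; [qlra|exists s; split => //; qlra].
have hsT : has_sup T by split; [exists t|exists m => x [/andP[]]].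
pose T0 := sup T.
have tT0 : t <= T0 by apply: sup_upper_bound.
have T0m : T0 <= m by apply: ge_sup; [exists t|move=> x [/andP[]]].
have T01 : 0 < T0 < 1 by qlra.
have [d1 d10 Hd1] := half_box_locally_injective hb T01 (breg T0 T01).
(* The supremum belongs to [T]. Otherwise the leaf of [tau T0] would be separated from that of every
   lower [tau c]; with local injectivity near [T0], compactness of [[0, T0]] would exclude all
   coincidences just below [T0]. *)
have [s' [s'T Es']] : exists s' : RR, 0 < s' < T0 /\ sameleaf (tau s') (tau T0).
  apply: contrapT => nex.
  have [d d0 Hd] : exists2 d : RR, 0 < d & forall a a' : RR, 0 <= a <= T0 -> 0 < a -> `|a' - T0| < d ->
      a < a' -> ~ sameleaf (tau a) (tau a').
    pose P (c c' : RR) := exists2 d : RR, 0 < d & forall a a' : RR, c <= a <= c' -> 0 < a -> `|a' - T0| < d ->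
      a < a' -> ~ sameleaf (tau a) (tau a').
    apply: (@seg_ind P 0 T0); first by qlra.
    - move=> c /andP[c0 cT].
      have [->|cT0] := eqVneq c T0.
        exists d1 => // c1 c2 _ _ c2T h1 h2; exists d1 => // a a' ac _ a'd aa' E1.
        have : a = a' by apply: Hd1 => //; rewrite ltr_distl; qlra.
        by move: aa'; qlra.
      have ncT : ~ sameleaf (tau c) (tau T0).
        move=> Ec; have [c00|c00] := eqVneq c 0.
          apply: nreg; rewrite -/(tau 0) -c00.
          exact: (regular_pt_sameleaf (breg T0 T01) (sameleaf_sym Ec)).
        by apply: nex; exists c; split => //; rewrite !lt_neqAle eq_sym c00 c0 cT0.
      have [V [V' [nV nV' VV]]] := regular_separated (breg T0 T01) ncT.
      have c1 : `|c| < 1 by rewrite ger0_norm; qlra.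
      have T1 : `|T0| < 1 by rewrite ger0_norm; qlra.
      have [e1 e10 He1] := (nbhsRP _ _).1 (continuous_nbhs (ctau c c1) nV).
      have [e2 e20 He2] := (nbhsRP _ _).1 (continuous_nbhs (ctau T0 T1) nV').
      exists e1 => // c1' c2' _ _ _ h1 h2; exists e2 => // a a' ac _ a'T _.
      by apply: VV; [apply: He1; rewrite ltr_distl; qlra|apply: He2].
    - move=> x y z' _ _ _ _ [d d0 Hd] [d' d'0 Hd']; exists (Num.min d d').
        by rewrite lt_min d0.
      move=> a a' /andP[xa az] a0; rewrite lt_min => /andP[ad ad'] aa'.
      have [ay|ya] := leP a y; first by apply: Hd => //; rewrite xa.
      by apply: Hd' => //; rewrite az (ltW ya).
  have d20 : 0 < Num.min d d1 by rewrite lt_min d0.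
  have [t' Tt' t'T] := sup_adherent d20 hsT.
  have t'T0 : t' <= T0 by apply: sup_upper_bound.
  have := t'T; rewrite ltrBlDl -ltrBlDr lt_min -/T0 => /andP[td td1].
  have t'd : `|t' - T0| < d by rewrite ltr_distl; qlra.
  case: Tt' => _ [a [/andP[a0 at_] Ea]].
  apply: (Hd a t') => //; apply/andP; split; qlra.
(* If [T0 = m], then [w] is met at [s'], below its first hit. *)
have [TM|TM] := eqVneq T0 m.
  have : m <= s'.
    apply: ilb; split; first by qlra.
    by apply: (sameleaf_in partD Dw wm); rewrite -TM; apply: sameleaf_sym.
  by rewrite -TM; move: s'T; qlra.
have Tlm : T0 < m by rewrite lt_neqAle TM.
(* If [T0 < m], levels slightly above [T0] still return close to [s']. Half the gap keeps these
   returns below [T0], so [T] has an element above its supremum. *)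
pose e := (T0 - s') / 2.
have e0 : 0 < e by rewrite /e; qlra.
have s'1 : 0 < s' < 1 by qlra.
have T1 : `|T0| < 1 by rewrite ger0_norm; qlra.
have := half_box_vertical_open hb s'1 e0 (sameleaf_sym Es').
move=> /(continuous_nbhs (ctau T0 T1))/nbhsRP[d d0 Hd].
pose t' := T0 + Num.min (d / 2) (m - T0).
have mm : 0 < Num.min (d / 2) (m - T0) by rewrite lt_min; qlra.
have [md mm'] : Num.min (d / 2) (m - T0) <= d / 2 /\ Num.min (d / 2) (m - T0) <= m - T0.
  by rewrite !ge_min !lexx !orbT.
have [|a [ae a1 Ea]] := Hd t'; first by rewrite ltr_distl /t'; qlra.
have : t' <= T0.
  apply: sup_upper_bound => //; split; first by rewrite /t'; qlra.
  exists a; split; last exact: sameleaf_sym.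
  by move: ae; rewrite ltr_distl /t' /e; qlra.
by rewrite /t'; qlra.
Qed.
End Strips.

(** * Transversals and the strips of leaves that they span *)

Section Transversals.
Context {Z : topologicalType} (D : set (set Z)) (fsD : foliated_surface D).
Local Notation sameleaf := (sameleaf D).
Local Notation partD := (fs_part fsD).
Local Notation regular_pt := (regular_pt D).

Record leaf_transversal (tau : RR -> Z) : Prop := Transversal {
  tr_cont : forall t : RR, 0 < t < 1 -> {for t, continuous tau};
  tr_reg : forall t : RR, 0 < t < 1 -> regular_pt (tau t);
  tr_inj : forall s t : RR, 0 < s < 1 -> 0 < t < 1 -> sameleaf (tau s) (tau t) -> s = t;
  tr_open : forall (t0 e : RR) y, 0 < t0 < 1 -> 0 < e -> sameleaf y (tau t0) ->
    nbhs y [set y' | exists t : RR, [/\ `|t - t0| < e, 0 < t < 1 & sameleaf y' (tau t)]] }.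

Definition strip_op (k : (RR -> Z) * RR * RR) : set Z :=
  [set y | exists t : RR, k.1.2 < t < k.2 /\ sameleaf y (k.1.1 t)].
(** The clause [0 < t] concerns strips that reach the end [0] of their transversal, where the limit
    point may be irregular. Such a strip is closed relative to the regular points, as [sd_closed]
    states. *)
Definition strip_cl (k : (RR -> Z) * RR * RR) : set Z :=
  [set y | exists t : RR, [/\ 0 < t, k.1.2 <= t <= k.2 & sameleaf y (k.1.1 t)]].

Record strip_datum (k : (RR -> Z) * RR * RR) : Prop := StripDatum {
  sd_tr : leaf_transversal k.1.1;
  sd_ab : [/\ 0 <= k.1.2, k.1.2 < k.2 & k.2 < 1];
  sd_closed : forall y, regular_pt y -> ~ strip_cl k y -> nbhs y (~` strip_cl k) }.

Lemma transversal_separated tau (a b : RR) y : leaf_transversal tau ->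
  0 < a -> a <= b -> b < 1 ->
  (forall t : RR, a <= t <= b -> ~ sameleaf y (tau t)) ->
  nbhs y [set y' | forall t : RR, a <= t <= b -> ~ sameleaf y' (tau t)].
Proof.
move=> tr a0 ab b1 ny.
pose P (c c' : RR) := nbhs y [set y' | forall t : RR, c <= t <= c' -> ~ sameleaf y' (tau t)].
apply: (@seg_ind P a b ab).
- move=> t tab; have t01 : 0 < t < 1 by qlra.
  have [V [V' [nV nV' VV]]] := regular_separated (tr_reg tr t01) (ny t tab).
  have [d d0 Hd] := (nbhsRP _ _).1 (continuous_nbhs (tr_cont tr t01) nV').
  exists d => // c c' ac cc' c'b h1 h2; rewrite /P; apply: filterS nV.
  by move=> v Vv s sc; apply: VV => //; apply: Hd; rewrite ltr_distl; qlra.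
- move=> x u v _ _ _ _ h1 h2; apply: filterS2 h1 h2 => y' h1 h2 t /andP[xt tv].
  by have [tu|ut] := leP t u; [apply: h1|apply: h2]; rewrite ?xt ?tv // ltW.
Qed.

Lemma strip_datum_interior tau (a b : RR) : leaf_transversal tau ->
  0 < a -> a < b -> b < 1 -> strip_datum (tau, a, b).
Proof.
move=> tr a0 ab b1; split => //=; first by split=> //; exact: ltW.
move=> y _ ny; have ny' (t : RR) : a <= t <= b -> ~ sameleaf y (tau t).
  by move=> tab E; apply: ny; exists t; split => //=; qlra.
have := transversal_separated tr a0 (ltW ab) b1 ny'.
by apply: filterS => y' H [t [_ /= tab]]; apply: H.
Qed.

Lemma strip_datum_regular z : regular_pt z -> exists k, strip_datum k /\ strip_op k z.
Proof.
move=> /regular_pt_chart[r [h [x [rc ->]]]].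
pose tau (t : RR) := r (x, 2 * t - 1).
have in1 (t : RR) : 0 < t < 1 -> `|2 * t - 1| < 1 by move=> ?; rewrite ltr_norml; qlra.
have z1 : `|0 : RR| < 1 by rewrite normr0.
have tr : leaf_transversal tau.
  split.
  - move=> t t01 B /(continuous_nbhs (rc_cont rc (p := (x, 2 * t - 1)) (in1 t t01)))/nbhs2P[d d0 Hd].
    apply/nbhsRP; exists (d / 2); first by qlra.
    move=> s sd; apply: Hd; rewrite /= ?subrr ?normr0 //.
    have -> : 2 * s - 1 - (2 * t - 1) = 2 * (s - t) by ring.
    by rewrite normrM ger0_norm //; qlra.
  - move=> t t01.
    by exists r, h, (x, 2 * t - 1); split => //; exact: in1.
  - move=> s t /in1 s1 /in1 t1 /(rc_leaf rc (p := (x, 2 * s - 1)) (q := (x, 2 * t - 1)) s1 t1) /=.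
    by qlra.
  - move=> t0 e y t01 e0 /sameleaf_sym E.
    have [u ->] := rc_sat rc (p := (x, 2 * t0 - 1)) (in1 _ t01) E.
    have := regular_chart_nbhs u rc e0 (in1 _ t01); apply: filterS => _ [v [t [_ te t1 ->]]].
    exists ((t + 1) / 2); split.
    + by move: te; rewrite !ltr_distl; qlra.
    + by move: t1; rewrite ltr_norml; qlra.
    + apply/(rc_leaf rc) => //=; last by qlra.
      by have -> : 2 * ((t + 1) / 2) - 1 = t by field.
exists (tau, 1 / 4, 3 / 4); split.
  by apply: strip_datum_interior => //; qlra.
exists (1 / 2); split; first by rewrite /=; qlra.
have -> : (x, 0) = (x, 2 * (1 / 2) - 1) :> plane by congr pair; field.
exact: (sameleaf_refl partD).
Qed.

(** The transversal is the part of the half-box below the height [m] of [end_injective]. A regular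
    point is separated from the irregular leaf at the end as well, which disposes of small
    parameters; the remaining ones form a compact interval inside [(0, 1)]. *)
Lemma strip_datum_end b : half_box D b ->
  (forall x s : RR, `|x| < 1 -> 0 < s < 1 -> regular_pt (b (x, s))) ->
  ~ regular_pt (b (0, 0)) ->
  exists k, strip_datum k /\ exists2 d : RR, 0 < d <= 1 &
    forall x s : RR, `|x| < 1 -> 0 < s < d -> strip_op k (b (x, s)).
Proof.
move=> hb breg nreg; have z1 : `|0 : RR| < 1 by rewrite normr0.
have [m m01 inj] := end_injective fsD hb (fun t => breg 0 t z1) nreg.
have m0 : 0 < m by qlra.
pose tau (t : RR) := b (0, m * t).
have in1 (t : RR) : 0 < t < 1 -> 0 < m * t < m.
  by move=> /andP[t0 t1]; rewrite mulr_gt0 //= gtr_pMr.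
have ctau (t : RR) : `|t| < 1 -> {for t, continuous tau}.
  move=> t1; have mt1 : `|m * t| < 1.
    rewrite normrM (gtr0_norm m0); apply: (lt_trans (y := m)); last by qlra.
    by rewrite gtr_pMr.
  move=> B /(continuous_nbhs (hb_cont hb z1 mt1))/nbhs2P[d d0 Hd].
  apply/nbhsRP; exists (d / m); first by rewrite divr_gt0.
  move=> s sd; apply: Hd; rewrite /= ?subrr ?normr0 //.
  by rewrite -mulrBr normrM (gtr0_norm m0) mulrC -ltr_pdivlMr.
have tr : leaf_transversal tau.
  split.
  - by move=> t t01; apply: ctau; rewrite gtr0_norm; qlra.
  - by move=> t /in1 mt; apply: breg => //; qlra.
  - move=> s t /in1 ms /in1 mt /(inj _ _ ms mt).
    by apply: mulfI; exact: lt0r_neq0.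
  - move=> t0 e y t01 e0 E.
    pose e' := Num.min (m * e) (Num.min (m * t0) (m * (1 - t0))).
    have e'0 : 0 < e' by rewrite !lt_min !mulr_gt0 //; qlra.
    have mt01 : 0 < m * t0 < 1 by have := in1 _ t01; qlra.
    have := half_box_vertical_open fsD hb mt01 e'0 E.
    apply: filterS => y' [t [te t1 Et]].
    have mt : m * (t / m) = t by rewrite mulrC divfK // gt_eqF.
    have te' : `|t / m - t0| < Num.min e (Num.min t0 (1 - t0)).
      rewrite -(ltr_pM2l m0) -{1}(gtr0_norm m0) -normrM mulrBr mt.
      by move: te; rewrite /e' !minr_pMr // ltW.
    have Et' : sameleaf y' (tau (t / m)) by rewrite /tau mt.
    have [v vE] : exists v : RR, v = t / m by exists (t / m).
    rewrite -vE in te' Et' *; exists v.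
    move: te'; rewrite !lt_min => /and3P[te1]; rewrite !ltr_distl => te2 te3.
    by rewrite ltr_distl in te1; split; [|qlra|].
exists (tau, 0, 1 / 2); split.
  split => //=; first by split; qlra.
  move=> y ry ny.
  have n0 : ~ sameleaf (tau 0) y.
    move=> E; apply: nreg; rewrite /tau mulr0 in E.
    exact: (regular_pt_sameleaf ry (sameleaf_sym E)).
  have [V [V' [nV nV' VV]]] := regular_separated ry n0.
  have [d d0 Hd] := (nbhsRP _ _).1 (continuous_nbhs (ctau 0 z1) nV).
  pose d' := Num.min d (1 / 2).
  have d'0 : 0 < d' by rewrite lt_min d0; qlra.
  have [d'd d'1] : d' <= d /\ d' <= 1 / 2 by rewrite /d' !ge_min !lexx !orbT.
  have ny' (t : RR) : d' <= t <= 1 / 2 -> ~ sameleaf y (tau t).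
    by move=> td E; apply: ny; exists t; split => //=; qlra.
  have h12 : 1 / 2 < 1 :> RR by lra.
  have := transversal_separated tr d'0 d'1 h12 ny'.
  apply: filterS2 nV' => y' V'y' H [t [/= t0 t12 E]].
  have [td|dt] := ltP t d'; last by apply: (H t) => //; qlra.
  apply: (VV (tau t) y' _ V'y' (sameleaf_sym E)).
  by apply: Hd; rewrite subr0 gtr0_norm //; qlra.
exists (m / 2); first by qlra.
move=> x s x1 sm; exists (s / m); split => /=.
  by rewrite divr_gt0 //=; [rewrite ltr_pdivrMr //; qlra|qlra].
rewrite /tau mulrC divfK ?gt_eqF //; apply: (hb_leaf hb) => //.
by rewrite gtr0_norm; qlra.
Qed.

Context (lf : locally_finite_family (irregular_leaf D)).

Lemma irregular_isolated (z : Z) :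
  nbhs z [set y | ~ regular_pt y -> sameleaf z y].
Proof.
have cF w : irregular_leaf D w -> closed w by move=> [/(fs_leaf fsD)[]].
have := locally_finite_isolate z cF lf; apply: filterS => y H ny.
have [w [Dw wy _]] := sameleaf_refl partD y.
exists w; split => //; apply: H => //; split => // rw; apply: ny.
exact: (regular_int_leaf_pt fsD Dw wy rw).
Qed.

(** Each side of an irregular point spans a strip of its own; at a regular point one strip is used
    twice. *)
Lemma strip_local_cover (z : Z) : exists (B : set Z) k, [/\ nbhs z B, strip_datum k.1, strip_datum k.2 &
  forall y, B y -> regular_pt y -> strip_op k.1 y \/ strip_op k.2 y].
Proof.
have [rz|nrz] := EM (regular_pt z).
  have [k [sk [t [tk Et]]]] := strip_datum_regular rz.
  have [al0 ab b1] := sd_ab sk.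
  exists (strip_op k), (k, k); split => //; last by left.
  pose e := Num.min (t - k.1.2) (k.2 - t).
  have e0 : 0 < e by rewrite lt_min !subr_gt0.
  have t01 : 0 < t < 1 by qlra.
  have := tr_open (sd_tr sk) t01 e0 Et; apply: filterS => y [s [se _ Es]].
  exists s; split => //.
  by move: se; rewrite /e lt_min !ltr_distl; qlra.
have [b1 [b2 [bp bz bO]]] := fs_box fsD (irregular_isolated z).
have reg b : half_box D b -> b (0, 0) = z ->
    (forall x s : RR, `|x| < 1 -> `|s| < 1 -> ~ regular_pt (b (x, s)) -> sameleaf z (b (x, s))) ->
    forall x s : RR, `|x| < 1 -> 0 < s < 1 -> regular_pt (b (x, s)).
  move=> hb b0 H x s x1 s1; apply: contrapT => nr.
  have s1' : `|s| < 1 by rewrite gtr0_norm; qlra.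
  have : s = 0.
    by apply: (hb_iso hb x1 s1'); rewrite b0; apply/sameleaf_sym/H.
  by move: s1; qlra.
have z1 : `|0 : RR| < 1 by rewrite normr0.
have b20 : b2 (0, 0) = z by rewrite -(bp_edge bp z1).
have n1 : ~ regular_pt (b1 (0, 0)) by rewrite bz.
have n2 : ~ regular_pt (b2 (0, 0)) by rewrite b20.
have r1 := reg b1 (bp_l bp) bz (fun x s x1 s1 => (bO x s x1 s1).1).
have r2 := reg b2 (bp_r bp) b20 (fun x s x1 s1 => (bO x s x1 s1).2).
have [k1 [sk1 [d1 d10 Hd1]]] := strip_datum_end (bp_l bp) r1 n1.
have [k2 [sk2 [d2 d20 Hd2]]] := strip_datum_end (bp_r bp) r2 n2.
pose m := Num.min d1 d2.
have m0 : 0 < m by rewrite lt_min; qlra.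
have [md1 md2] : m <= d1 /\ m <= d2 by rewrite /m !ge_min !lexx !orbT.
exists (b1 @` [set p | `|p.1 - 0| < 1 /\ `|p.2 - 0| < m] `|`
        b2 @` [set p | `|p.1 - 0| < 1 /\ `|p.2 - 0| < m]), (k1, k2); split => //=.
  by rewrite -bz; apply: (bp_cover bp z1); apply: nbhs_rect.
have fin b k (x s d : RR) : half_box D b -> b (0, 0) = z -> m <= d ->
    (forall x s : RR, `|x| < 1 -> 0 < s < d -> strip_op k (b (x, s))) ->
    `|x - 0| < 1 -> `|s - 0| < m -> regular_pt (b (x, s)) -> strip_op k (b (x, s)).
  rewrite !subr0 => hb b0 md Hd x1 sm rb.
  have sE : b (x, s) = b (x, `|s|).
    by have [h|h] := leP 0 s; rewrite ?(ger0_norm h) // ltr0_norm // (hb_even hb).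
  rewrite sE; apply: Hd => //; rewrite normr_gt0.
  have [s0|/= _] := eqVneq s 0; last by qlra.
  exfalso; apply: nrz; apply: (regular_pt_sameleaf rb).
  by rewrite s0 -b0; apply: (hb_leaf hb).
move=> y [|] [[x s] /= [x1 sm] <-] rb; [left|right].
  by apply: (fin _ _ _ _ d1) => //; exact: bp_l bp.
by apply: (fin _ _ _ _ d2) => //; exact: bp_r bp.
Qed.

(** The two strips of the i-th covering set are stored at the indices [2 i] and [2 i + 1]. The bound
    [N] is the source of local finiteness for the cuts: near [z] only finitely many strips
    matter. *)
Lemma strip_family : @second_countable Z ->
  exists kd : nat -> option ((RR -> Z) * RR * RR),
    (forall n k, kd n = Some k -> strip_datum k) /\
    forall z : Z, exists N, nbhs z [set y | regular_pt y ->
      exists n k, [/\ (n < N)%N, kd n = Some k & strip_op k y]].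
Proof.
move=> sc.
pose P (B : set Z) (k : ((RR -> Z) * RR * RR) * ((RR -> Z) * RR * RR)) :=
  [/\ strip_datum k.1, strip_datum k.2 &
  forall y, B y -> regular_pt y -> strip_op k.1 y \/ strip_op k.2 y].
have Pmono A B t : A `<=` B -> P B t -> P A t.
  by move=> AB [? ? H]; split => // y /AB /H.
have Pz (z : Z) : exists (B : set Z) t, nbhs z B /\ P B t.
  by have [B [k [? ? ? ?]]] := strip_local_cover z; exists B, k.
have [e [eP ez]] := countable_cover sc Pmono Pz.
exists (fun n => if e n./2 is Some (_, k) then Some (if odd n then k.2 else k.1) else None).
split.
  move=> n k; case E : (e _) => [[B [k1 k2]]|//].
  by have [_ [/= ? ? _]] := eP _ _ _ E; case: odd => -[<-].
move=> z; have [n [B [[k1 k2] [E Bz]]]] := ez z.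
have [oB [/= _ _ H]] := eP _ _ _ E.
exists (n.*2.+2); have : nbhs z B by apply: open_nbhs_nbhs.
apply: filterS => y By ry; case: (H y By ry) => h.
  exists n.*2, k1; split => //.
  by rewrite doubleK E odd_double.
exists n.*2.+1, k2; split => //.
by rewrite -[X in e X]/(uphalf n.*2) uphalf_double E /= odd_double.
Qed.
End Transversals.

(** * Product pieces *)

Lemma maximal_left (H : RR -> Prop) (lo t : RR) : lo < t -> ~ H lo -> H t ->
  (forall s : RR, H s -> exists2 d : RR, 0 < d & forall s' : RR, `|s' - s| < d -> H s') ->
  exists a : RR, [/\ lo <= a < t, forall s : RR, a < s <= t -> H s & ~ H a].
Proof.
move=> lot nlo Ht oH; pose S := [set s : RR | s <= t /\ ~ H s].
have Slo : S lo by split => //; exact: ltW.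
have hS : has_sup S by split; [exists lo|exists t => s []].
have sub s : S s -> s <= sup S by apply: sup_upper_bound.
have nHa : ~ H (sup S).
  move=> /oH[d d0 Hd]; have [s Ss ds] := sup_adherent d0 hS.
  by have := sub _ Ss => sS; apply: Ss.2; apply: Hd; rewrite ltr_distl; qlra.
have at_ : sup S <= t by apply: ge_sup; [exists lo|move=> s []].
exists (sup S); split => //.
  rewrite sub //= lt_neqAle at_ andbT; apply/eqP => E; apply: nHa; by rewrite E.
move=> s /andP[as_ st]; apply: contrapT => nH.
by have := sub s (conj st nH); rewrite leNgt as_.
Qed.

Lemma maximal_interval (H : RR -> Prop) (lo hi t : RR) : lo < t < hi -> ~ H lo -> ~ H hi ->
  H t -> (forall s : RR, H s -> exists2 d : RR, 0 < d & forall s' : RR, `|s' - s| < d -> H s') ->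
  exists a b : RR, [/\ lo <= a, b <= hi, a < t < b, forall s : RR, a < s < b -> H s & ~ H a /\ ~ H b].
Proof.
move=> /andP[lot thi] nlo nhi Ht oH.
have [a [/andP[loa at_] Ha na]] := maximal_left lot nlo Ht oH.
have [||||b [/andP[hib bt] Hb nb]] := @maximal_left (fun s => H (- s)) (- hi) (- t).
- by rewrite ltrN2.
- by rewrite opprK.
- by rewrite opprK.
- move=> s /oH[d d0 Hd]; exists d => // s' sd; apply: Hd.
  by rewrite -opprD normrN.
exists a, (- b); split => //.
- by rewrite lerNl.
- by rewrite at_ ltrNr.
- move=> s /andP[as_ sb]; have [st|ts] := leP s t; first by apply: Ha; rewrite as_.
  by rewrite -[s]opprK; apply: Hb; rewrite ltrNr sb lerN2 ltW.
Qed.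

Section Pieces.
Context {Z : topologicalType} (D : set (set Z)) (fsD : foliated_surface D).
Local Notation sameleaf := (sameleaf D).
Local Notation partD := (fs_part fsD).
Local Notation regular_pt := (regular_pt D).
Local Notation leaf_transversal := (leaf_transversal D).
Local Notation strip_op := (strip_op D).
Local Notation strip_cl := (strip_cl D).

Lemma transversal_restrict tau (a b : RR) : leaf_transversal tau -> 0 <= a -> a < b -> b <= 1 ->
  leaf_transversal (fun t => tau (a + (b - a) * t)).
Proof.
move=> tr a0 ab b1; have c0 : 0 < b - a by rewrite subr_gt0.
have in1 (t : RR) : 0 < t < 1 -> 0 < a + (b - a) * t < 1.
  move=> /andP[t0 t1].
  have : 0 < (b - a) * t by rewrite mulr_gt0.
  have : (b - a) * t < b - a by rewrite gtr_pMr.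
  by qlra.
split.
- move=> t t01 B /(continuous_nbhs (tr_cont tr (in1 t t01)))/nbhsRP[d d0 Hd].
  apply/nbhsRP; exists (d / (b - a)); first by rewrite divr_gt0.
  move=> s sd; apply: Hd.
  have -> : a + (b - a) * s - (a + (b - a) * t) = (b - a) * (s - t) by ring.
  by rewrite normrM (gtr0_norm c0) mulrC -ltr_pdivlMr.
- by move=> t /in1; apply: (tr_reg tr).
- by move=> s t /in1 s1 /in1 t1 /(tr_inj tr s1 t1)/addrI/(mulfI (lt0r_neq0 c0)).
- move=> t0 e y t01 e0 E.
  pose e' := (b - a) * Num.min e (Num.min t0 (1 - t0)).
  have e'0 : 0 < e' by rewrite mulr_gt0 // !lt_min e0; qlra.
  have := tr_open tr (in1 _ t01) e'0 E; apply: filterS => y' [s [se _ Es]].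
  have [v vE] : exists v : RR, v = (s - a) / (b - a) by exists ((s - a) / (b - a)).
  have sE : a + (b - a) * v = s by rewrite vE mulrC divfK ?gt_eqF //; ring.
  exists v.
  move: se; rewrite -sE.
  have -> : a + (b - a) * v - (a + (b - a) * t0) = (b - a) * (v - t0) by ring.
  rewrite normrM (gtr0_norm c0) /e' ltr_pM2l // !lt_min => /and3P[ve].
  rewrite !ltr_distl => h1 h2; rewrite ltr_distl in ve.
  by split; [exact: ve|qlra|rewrite sE].
Qed.

Context (kd : nat -> option ((RR -> Z) * RR * RR)).
Context (kdP : (forall n k, kd n = Some k -> strip_datum D k) /\
    forall z : Z, exists N, nbhs z [set y | regular_pt y ->
      exists n k, [/\ (n < N)%N, kd n = Some k & strip_op k y]]).

Definition family_op n : set Z := [set y | exists k, kd n = Some k /\ strip_op k y].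
Definition family_cl n : set Z := [set y | exists k, kd n = Some k /\ strip_cl k y].
Local Notation op := family_op.
Local Notation cl := family_cl.

(** Removing the earlier closed strips from an open one gives disjoint open sets; the regular leaves
    that are lost are end leaves of strips. *)
Definition layer n : set Z := [set y | op n y /\ forall j, (j < n)%N -> ~ cl j y].

Lemma family_op_cl n y : op n y -> cl n y.
Proof.
move=> [k [kn [t [tk E]]]]; exists k; split => //; exists t.
have [a0 _ _] := sd_ab (kdP.1 _ _ kn).
by split => //; qlra.
Qed.

Lemma family_cl_regular n y : cl n y -> regular_pt y.
Proof.
move=> [k [kn [t [t0 tk E]]]]; have sd := kdP.1 _ _ kn.
have [a0 _ b1] := sd_ab sd.
by apply: (regular_pt_sameleaf (tr_reg (sd_tr sd) (t := t) _) (sameleaf_sym E)); qlra.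
Qed.

Lemma family_cl_saturated n y z : cl n y -> sameleaf y z -> cl n z.
Proof.
move=> [k [kn [t [t0 tk E]]]] yz; exists k; split => //; exists t; split => //.
exact: (sameleaf_trans partD (sameleaf_sym yz)).
Qed.

Lemma family_op_saturated n y z : op n y -> sameleaf y z -> op n z.
Proof.
move=> [k [kn [t [tk E]]]] yz; exists k; split => //; exists t; split => //.
exact: (sameleaf_trans partD (sameleaf_sym yz)).
Qed.

Lemma layer_saturated n y z : layer n y -> sameleaf y z -> layer n z.
Proof.
move=> [oy ny] yz; split; first exact: family_op_saturated yz.
by move=> j jn /family_cl_saturated/(_ (sameleaf_sym yz)); apply: ny.
Qed.

Lemma layer_unique n m y : layer n y -> layer m y -> n = m.
Proof.
move=> [/family_op_cl on nn] [/family_op_cl om nm].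
by case: (ltngtP n m) => // h; exfalso; [apply: (nm n)|apply: (nn m)].
Qed.

Lemma layer_open n y : layer n y -> nbhs y (layer n).
Proof.
move=> [oy ny]; apply: filterI.
  have [k [kn [t [tk E]]]] := oy; have sd := kdP.1 _ _ kn.
  have [a0 _ b1] := sd_ab sd.
  pose e := Num.min (t - k.1.2) (k.2 - t).
  have e0 : 0 < e by rewrite lt_min !subr_gt0.
  have t01 : 0 < t < 1 by qlra.
  have := tr_open (sd_tr sd) t01 e0 E; apply: filterS => y' [s [se _ Es]].
  exists k; split => //; exists s; split => //.
  by move: se; rewrite /e lt_min !ltr_distl; qlra.
have ry := family_cl_regular (family_op_cl oy).
elim: n ny {oy} => [|n IH] ny; first by apply: filterE => y' j.
have IHn : nbhs y [set y' | forall j, (j < n)%N -> ~ cl j y'].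
  by apply: IH => j jn; apply: ny; apply: ltnW.
have nc : nbhs y (~` cl n).
  case E : (kd n) => [k|]; last by apply: filterE => y' [k []]; rewrite E.
  have : nbhs y (~` strip_cl k).
    apply: (sd_closed (kdP.1 _ _ E)) => // h; apply: (ny n) => //.
    by exists k.
  by apply: filterS => y' nk [k' []]; rewrite E => -[<-].
apply: filterS2 IHn nc => y' h1 h2 j; rewrite ltnS leq_eqVlt => /orP[/eqP->//|].
exact: h1.
Qed.

(** A component of a layer: [(a, b)] is an interval of the transversal whose leaves belong to the
    layer, and the last two clauses express its maximality. *)
Definition piece_of (J : set Z) : Prop := exists n k (a b : RR),
  [/\ kd n = Some k, k.1.2 <= a /\ b <= k.2, a < b,
      (forall s : RR, a < s < b -> layer n (k.1.1 s)) &
      ~ (k.1.2 < a < k.2 /\ layer n (k.1.1 a)) /\ ~ (k.1.2 < b < k.2 /\ layer n (k.1.1 b))] /\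
  J = [set y | exists t : RR, a < t < b /\ sameleaf y (k.1.1 t)].

Lemma piece_layer J y z : piece_of J -> J y -> sameleaf y z -> exists n, layer n z.
Proof.
move=> [n [k [a [b [[_ _ _ H _] ->]]]]] [t [tab E]] yz; exists n.
apply: layer_saturated (H t tab) _; exact: (sameleaf_trans partD (sameleaf_sym E)).
Qed.

Lemma layer_piece n y : layer n y -> exists J, piece_of J /\ J y.
Proof.
move=> ly; have [[k [kn [t [tk E]]]] _] := ly.
have sd := kdP.1 _ _ kn; have [a0 _ b1] := sd_ab sd.
pose H (s : RR) := k.1.2 < s < k.2 /\ layer n (k.1.1 s).
have [||||a [b [ka bk atb Hab nab]]] := @maximal_interval H k.1.2 k.2 t tk.
- by move=> [/andP[]]; rewrite ltxx.
- by move=> [/andP[_]]; rewrite ltxx.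
- by split => //; exact: layer_saturated E.
- move=> s [sk ls]; have s01 : 0 < s < 1 by qlra.
  have [d d0 Hd] := (nbhsRP _ _).1 (continuous_nbhs (tr_cont (sd_tr sd) s01) (layer_open ls)).
  exists (Num.min d (Num.min (s - k.1.2) (k.2 - s))).
    by rewrite !lt_min d0 !subr_gt0.
  move=> s'; rewrite !lt_min => /and3P[sd']; have Ls := Hd _ sd'; rewrite !ltr_distl => h1 h2.
  by split; [qlra|exact: Ls].
exists [set y | exists t : RR, a < t < b /\ sameleaf y (k.1.1 t)]; split; last by exists t.
exists n, k, a, b; split => //; split => //; first by qlra.
by move=> s /Hab[].
Qed.

Lemma piece_transversal J : piece_of J -> exists tau, leaf_transversal tau /\
  J = [set y | exists t : RR, 0 < t < 1 /\ sameleaf y (tau t)].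
Proof.
move=> [n [k [a [b [[kn [ka bk] ab H _] ->]]]]].
have sd := kdP.1 _ _ kn; have [a0 _ b1] := sd_ab sd.
exists (fun t => k.1.1 (a + (b - a) * t)); split.
  by apply: transversal_restrict; [exact: sd_tr sd|qlra|exact: ab|qlra].
have c0 : 0 < b - a by rewrite subr_gt0.
apply/seteqP; split => y [t [tab E]].
  exists ((t - a) / (b - a)); split.
    by rewrite divr_gt0 ?ltr_pdivrMr // ?mul1r; qlra.
  by rewrite mulrC divfK ?gt_eqF // addrC subrK.
exists (a + (b - a) * t); split => //.
have : 0 < (b - a) * t by rewrite mulr_gt0 //; qlra.
have : (b - a) * t < b - a by rewrite gtr_pMr //; qlra.
by qlra.
Qed.

Lemma piece_unique J J' : piece_of J -> piece_of J' -> J `&` J' !=set0 -> J = J'.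
Proof.
move=> [n [k [a [b [[kn [ka bk] ab H [na nb]] JE]]]]].
move=> [n' [k' [a' [b' [[kn' [ka' bk'] ab' H' [na' nb']] JE']]]]].
rewrite JE JE' => -[y [[t [tab E]] [t' [tab' E']]]].
have ln := layer_saturated (H t tab) (sameleaf_sym E).
have ln' := layer_saturated (H' t' tab') (sameleaf_sym E').
have nn := layer_unique ln ln'; subst n'.
move: kn'; rewrite kn => -[kk]; subst k'.
have sd := kdP.1 _ _ kn; have [a0 _ b1] := sd_ab sd.
have tt' : t = t'.
  apply: (tr_inj (sd_tr sd)); [by qlra|by qlra|].
  exact: (sameleaf_trans partD (sameleaf_sym E)).
subst t'.
have aa : a = a'.
  apply/eqP; rewrite eq_le !leNgt; apply/andP; split; apply/negP => lt.
    by apply: na; split; [qlra|apply: H'; qlra].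
  by apply: na'; split; [qlra|apply: H; qlra].
have bb : b = b'.
  apply/eqP; rewrite eq_le !leNgt; apply/andP; split; apply/negP => lt.
    by apply: nb'; split; [qlra|apply: H; qlra].
  by apply: nb; split; [qlra|apply: H'; qlra].
by rewrite aa bb.
Qed.

Definition cut_leaf (w : set Z) : Prop := D w /\ exists y, w y /\ forall n, ~ layer n y.

(** Let [j] be least such that the regular point [y] lies in the j-th closed strip. Being in no
    layer, [y] is not in the open strip, so it lies on one of the two end leaves of a strip with
    [j < N]. *)
Lemma cut_leaf_locally_finite : locally_finite_family (irregular_leaf D) ->
  locally_finite_family cut_leaf.
Proof.
move=> lf z; have [W [oW Wz Wf]] := lf z; have [N HN] := kdP.2 z.
exists (W `&` [set y | regular_pt y -> exists n k, [/\ (n < N)%N, kd n = Some k & strip_op k y]]^°).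
split; first by apply: openI => //; exact: open_interior.
  by split.
have f1 y : finite_set [set w | D w /\ w y].
  have [w [Dw wy _]] := sameleaf_refl partD y.
  apply: (@sub_finite_set _ _ [set w]); last exact: finite_set1.
  by move=> w' [Dw' w'y]; apply: (leaf_unique partD Dw' Dw w'y wy).
pose E n : set (set Z) := if kd n is Some k then
  [set w | D w /\ w (k.1.1 k.1.2)] `|` [set w | D w /\ w (k.1.1 k.2)] else set0.
have : finite_set ([set w | irregular_leaf D w /\ w `&` W !=set0] `|`
    \bigcup_(n in `I_N) E n).
  rewrite finite_setU; split => //; apply: bigcup_finite; first exact: finite_II.
  move=> n _; rewrite /E; case: (kd n) => [k|]; last exact: finite_set0.
  by rewrite finite_setU.
apply: sub_finite_set => w [[Dw [x [wx nl]]] [y [wy [Wy /interior_subset Hy]]]].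
have nly n : ~ layer n y.
  by move=> ly; apply: (nl n); apply: (layer_saturated ly); exists w.
have [ry|nry] := EM (regular_pt y); last first.
  left; split; last by exists y.
  by split => // rw; apply: nry; apply: (regular_int_leaf_pt fsD Dw wy rw).
right; have [n [k [nN kn oy]]] := Hy ry.
have [j [jn cj jmin]] : exists j, [/\ (j <= n)%N, cl j y & forall i, (i < j)%N -> ~ cl i y].
  have cn : exists j, `[< cl j y >] by exists n; apply/asboolP/family_op_cl; exists k.
  case: (ex_minnP cn) => j /asboolP cj jmin; exists j; split => //.
    by apply: jmin; apply/asboolP/family_op_cl; exists k.
  by move=> i ij ci; have := jmin i (asboolT ci); rewrite leqNgt ij.
exists j; first exact: leq_ltn_trans nN.
have noj : ~ op j y by move=> oj; apply: (nly j); split.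
have [k' [kj [t [t0 tk Et]]]] := cj.
rewrite /E kj; have [tE|tE] : t = k'.1.2 \/ t = k'.2.
  apply: contrapT => /not_orP[t1 t2]; apply: noj; exists k'; split => //; exists t; split => //.
  by move: tk; rewrite !le_eqVlt eq_sym => /andP[/orP[/eqP//|->] /orP[/eqP//|->]].
- by left; split => //; rewrite -tE; apply: (sameleaf_in partD Dw wy).
- by right; split => //; rewrite -tE; apply: (sameleaf_in partD Dw wy).
Qed.
End Pieces.

Lemma piece_decomposition (Z : topologicalType) (D : set (set Z)) :
  foliated_surface D -> @second_countable Z -> locally_finite_family (irregular_leaf D) ->
  exists P F : set (set Z), [/\ forall w, F w -> D w, locally_finite_family F,
    forall J, P J -> exists tau, leaf_transversal D tau /\
      J = [set y | exists t : RR, 0 < t < 1 /\ sameleaf D y (tau t)],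
    forall J J', P J -> P J' -> J `&` J' !=set0 -> J = J' &
    forall y, (exists J, P J /\ J y) <-> ~ (exists w, F w /\ w y)].
Proof.
move=> fsD sc lf; have [kd kdP] := strip_family fsD lf sc.
exists (piece_of D kd), (cut_leaf D kd); split.
- by move=> w [].
- exact: cut_leaf_locally_finite.
- by move=> J; apply: piece_transversal.
- by move=> J J'; apply: (piece_unique fsD kdP).
- move=> y; split.
    move=> [J [PJ Jy]] [w [[Dw [x [wx nl]]] wy]].
    have yx : sameleaf D y x by exists w.
    by have [n ln] := piece_layer fsD PJ Jy yx; apply: (nl n).
  move=> nF; have [w [Dw wy _]] := sameleaf_refl (fs_part fsD) y.
  apply: contrapT => nJ; apply: nF; exists w; split => //; split => //; exists y; split => // n ln.
  by apply: nJ; apply: (layer_piece fsD kdP ln).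
Qed.

(** * Trivializing a piece as a product *)

Definition exhaust_lo (n : nat) : RR := n.+3%:R^-1.
(** The denominator [n.+3] gives [exhaust_lo 0 = 1 / 3 < 2 / 3 = exhaust_hi 0], so none of the
    exhausting intervals is empty. *)
Definition exhaust_hi (n : nat) : RR := 1 - exhaust_lo n.

Lemma exhaust_lo_bounds n : 0 < exhaust_lo n.+1 /\ exhaust_lo n.+1 < exhaust_lo n /\ exhaust_lo n <= 1 / 3.
Proof.
rewrite /exhaust_lo; split; first by rewrite invr_gt0.
split; first by rewrite ltf_pV2 ?posrE // ltr_nat.
by rewrite div1r lef_pV2 ?posrE // ler_nat.
Qed.

Lemma exhaust_lo_small (e : RR) : 0 < e -> exists n, exhaust_lo n < e.
Proof.
move=> e0; have [n ne] : exists n : nat, e^-1 < n%:R.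
  by exists (Num.bound e^-1); apply: archi_boundP; rewrite invr_ge0 ltW.
exists n; rewrite /exhaust_lo -[e]invrK ltf_pV2 ?posrE ?invr_gt0 //.
by apply: (lt_trans ne); rewrite ltr_nat; exact: (ltn_trans (ltnSn _) (ltn_trans (ltnSn _) (ltnSn _))).
Qed.

Lemma exhaust_lo_mono n m : (n <= m)%N -> exhaust_lo m <= exhaust_lo n.
Proof. by move=> nm; rewrite /exhaust_lo lef_pV2 ?posrE // ler_nat !ltnS. Qed.

Section Trivialization.
Context {Z : topologicalType} (D : set (set Z)) (fsD : foliated_surface D).
Context (tau : RR -> Z) (tr : leaf_transversal D tau).
Local Notation sameleaf := (sameleaf D).
Local Notation partD := (fs_part fsD).
Local Notation leafR := (fs_leafR fsD).

(** A product structure over a closed interval of parameters, which allows gluing at an end.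
    Openness of the map is obtained afterwards in [trivialization_open]. *)
Record trivial_over (a b : RR) (f : plane -> Z) : Prop := TrivialOver {
  to_leaf : forall x t : RR, a <= t <= b -> sameleaf (f (x, t)) (tau t);
  to_surj : forall (t : RR) y, a <= t <= b -> sameleaf y (tau t) -> exists x : RR, f (x, t) = y;
  to_inj : forall x x' t : RR, a <= t <= b -> f (x, t) = f (x', t) -> x = x';
  to_cont : forall (x t : RR) B, a <= t <= b -> nbhs (f (x, t)) B ->
    nbhs (x, t) [set p | a <= p.2 <= b -> B (f p)] }.

Lemma trivial_over_sub (a b a' b' : RR) f : a <= a' -> b' <= b ->
  trivial_over a b f -> trivial_over a' b' f.
Proof.
move=> aa bb [h1 h2 h3 h4]; have sub (t : RR) : a' <= t <= b' -> a <= t <= b by qlra.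
split.
- by move=> x t /sub; apply: h1.
- by move=> t y /sub; apply: h2.
- by move=> x x' t /sub; apply: h3.
- move=> x t B /sub tt nB; have := h4 x t B tt nB.
  by apply: filterS => p H /sub /H.
Qed.

Lemma trivial_over_local (t0 : RR) : 0 < t0 < 1 -> exists2 d : RR, 0 < d &
  exists f, forall c c' : RR, t0 - d < c -> c' < t0 + d -> trivial_over c c' f.
Proof.
move=> t01; have [r [k [x0 [rc E0]]]] := regular_pt_chart (tr_reg tr t01).
have z1 : `|0 : RR| < 1 by rewrite normr0.
have rr := rc_open rc (p := (x0, 0)) z1; rewrite -E0 in rr.
have [d1 d10 Hd1] := (nbhsRP _ _).1 (continuous_nbhs (tr_cont tr t01) rr).
pose d := Num.min d1 (Num.min t0 (1 - t0)).
have d0 : 0 < d by rewrite /d !lt_min d10; qlra.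
have [dd1 dt dt'] : [/\ d <= d1, d <= t0 & d <= 1 - t0] by rewrite /d !ge_min !lexx !orbT.
pose h (t : RR) := (k (tau t)).2.
have ins (t : RR) : t0 - d < t < t0 + d -> [/\ 0 < t < 1, `|h t| < 1 & exists x : RR, tau t = r (x, h t)].
  move=> td; have [|q /= q1 qE] := Hd1 t; first by rewrite ltr_distl; qlra.
  have hq : h t = q.2 by rewrite /h -qE (rc_can rc).
  split; [qlra|by rewrite hq|exists q.1].
  by rewrite hq -surjective_pairing qE.
exists d => //; exists (fun p => r (p.1, h p.2)) => c c' tc c't.
have sub (t : RR) : c <= t <= c' -> t0 - d < t < t0 + d by qlra.
split.
- move=> x t /sub/ins[_ h1 [y ->]] /=.
  by apply/(rc_leaf rc).
- move=> t y /sub/ins[_ h1 [u E]] /sameleaf_sym; rewrite E => /(rc_sat rc (p := (u, h t)) h1)[x ->].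
  by exists x.
- move=> x x' t /sub/ins[_ h1 _] /= /(congr1 k).
  by rewrite !(rc_can rc) // => -[].
- move=> x t B /sub td nB; have [tt h1 [u E]] := ins t td.
  have [e e0 He] := (nbhs2P _ _).1 (continuous_nbhs (rc_cont rc (p := (x, h t)) h1) nB).
  have : nbhs (tau t) [set y | `|(k y).2 - h t| < e].
    rewrite E; apply: (continuous_nbhs (rc_kcont rc (p := (u, h t)) h1)
      (B := [set q : plane | `|q.2 - h t| < e])).
    rewrite (rc_can rc) //; apply/nbhs2P; exists e => //.
  move=> /(continuous_nbhs (tr_cont tr tt))/nbhsRP[e' e'0 He'].
  apply/nbhs2P; exists (Num.min e e'); first by rewrite lt_min e0.
  move=> v s; rewrite !lt_min => /andP[ve _] /andP[_ se] _.
  by apply: He => //=; apply: He'.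
Qed.

(** At the height [e] both maps parametrize the same leaf, so they differ by the homeomorphism [ga]
    of the line. Applying [ga] at every height makes them agree at [e]. *)
Lemma trivial_over_reparam (b c e : RR) f g : trivial_over b c f -> b <= e <= c ->
  0 < e < 1 -> trivial_over e e g ->
  exists f', trivial_over b c f' /\ forall x : RR, f' (x, e) = g (x, e).
Proof.
move=> tf bec e01 tg; have ee : e <= e <= e by rewrite lexx.
have [w [Dw we _]] := sameleaf_refl partD (tau e).
have [l [l' [_ /within_continuous_nbhs cl' l'l ll']]] := leafR Dw.
have wf (x : RR) : w (f (x, e)) by apply: (sameleaf_in partD Dw we); apply/sameleaf_sym/(to_leaf tf).
have wg (x : RR) : w (g (x, e)) by apply: (sameleaf_in partD Dw we); apply/sameleaf_sym/(to_leaf tg).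
have ef y : w y -> sameleaf y (tau e) by move=> wy; exists w.
have cl0 h (h' : RR) : (forall x : RR, w (h (x, e))) -> (exists c c' : RR, c <= e <= c' /\ trivial_over c c' h) ->
    continuous (fun x : RR => l' (h (x, e))).
  move=> wh [b1 [c1 [bc1 th]]] x B /(cl' _ (wh x)) nB; have := to_cont th bc1 nB => /nbhs2P[d d0 Hd].
  apply/nbhsRP; exists d => // y yd; apply: (Hd y e) => //=; by rewrite subrr normr0.
pose A (x : RR) := l' (f (x, e)).
have cA : continuous A by apply: cl0 => //; exists b, c.
have cG : continuous (fun x : RR => l' (g (x, e))) by apply: cl0 => //; exists e, e.
have /choice[A' HA'] : forall u : RR, exists x : RR, f (x, e) = l u.
  by move=> u; apply: (to_surj tf bec); apply: ef; exact: (l'l u I).1.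
have AA' : cancel A A'.
  by move=> x; apply: (to_inj tf bec); rewrite HA' /A (ll' _ (wf x)).2.
have A'A : cancel A' A by move=> u; rewrite /A HA' (l'l u I).2.
have cA' := bijection_inverse_continuous cA AA' A'A.
pose ga (x : RR) := A' (l' (g (x, e))).
have cga : continuous ga by move=> x; apply: continuous_comp; [exact: cG|exact: cA'].
have fga (x : RR) : f (ga x, e) = g (x, e) by rewrite /ga HA' (ll' _ (wg x)).2.
exists (fun p => f (ga p.1, p.2)); split; last exact: fga.
split.
- by move=> x t; apply: (to_leaf tf).
- move=> t y tt /(to_surj tf tt)[x' <-].
  have [x xE] := to_surj tg ee (to_leaf tf x' bec); exists x; congr (f (_, _)).
  by apply: (to_inj tf bec); rewrite fga.
- move=> x x' t tt /(to_inj tf tt) /= E; apply: (to_inj tg ee).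
  by rewrite -!fga E.
- move=> x t B tt nB; have [d d0 Hd] := (nbhs2P _ _).1 (to_cont tf tt nB).
  have : nbhs (ga x) [set u | `|u - ga x| < d] by apply/nbhsRP; exists d.
  move=> /(continuous_nbhs (cga x))/nbhsRP[d' d'0 Hd'].
  apply/nbhs2P; exists (Num.min d d'); first by rewrite lt_min d0.
  move=> v s; rewrite !lt_min => /andP[_ vd] /andP[sd _] sb.
  by apply: Hd => //=; apply: Hd'.
Qed.

Lemma trivial_over_glue (a b c : RR) f g : a <= b -> b <= c ->
  trivial_over a b f -> trivial_over b c g -> (forall x : RR, g (x, b) = f (x, b)) ->
  trivial_over a c (fun p => if p.2 <= b then f p else g p).
Proof.
move=> ab bc tf tg agree.
have L (t : RR) : a <= t <= c -> t <= b -> a <= t <= b by qlra.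
have R (t : RR) : a <= t <= c -> b <= t -> b <= t <= c by qlra.
split.
- move=> x t tt /=; case: leP => [tb|/ltW bt]; [apply: (to_leaf tf); qlra|apply: (to_leaf tg); qlra].
- move=> t y tt /=; case: leP => [tb|/ltW bt] E.
    exact: (to_surj tf (L t tt tb)).
  exact: (to_surj tg (R t tt bt)).
- move=> x x' t tt /=; case: leP => [tb|/ltW bt].
    exact: (to_inj tf (L t tt tb)).
  exact: (to_inj tg (R t tt bt)).
- move=> x t B tt /=.
  have F : t <= b -> nbhs (f (x, t)) B -> nbhs (x, t) [set p | a <= p.2 <= b -> B (f p)].
    by move=> tb; apply: (to_cont tf); apply: L.
  have G : b <= t -> nbhs (g (x, t)) B -> nbhs (x, t) [set p | b <= p.2 <= c -> B (g p)].
    by move=> tb; apply: (to_cont tg); apply: R.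
  have side (d : RR) : 0 < d -> nbhs (x, t) [set p : plane | `|p.2 - t| < d].
    by move=> d0; apply/nbhs2P; exists d.
  case: ltgtP => [tb|bt|tb] nB.
  + have d0 : 0 < b - t by rewrite subr_gt0.
    have := F (ltW tb) nB; have := side _ d0; apply: filterS2 => p /=.
    rewrite ltr_distl => pb H pac; have pb' : p.2 <= b by qlra.
    by rewrite pb'; apply: H; qlra.
  + have d0 : 0 < t - b by rewrite subr_gt0.
    have := G (ltW bt) nB; have := side _ d0; apply: filterS2 => p /=.
    rewrite ltr_distl => pb H pac; have pb' : b < p.2 by qlra.
    by rewrite leNgt pb' /=; apply: H; qlra.
  + have nB' : nbhs (g (x, t)) B by rewrite tb agree -tb.
    have tb1 : t <= b by rewrite tb.
    have tb2 : b <= t by rewrite tb.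
    have := G tb2 nB'; have := F tb1 nB; apply: filterS2 => p H1 H2 /= pac.
    case: leP => pb; first by apply: H1; qlra.
    by apply: H2; qlra.
Qed.

Lemma trivial_over_exists (a b : RR) : 0 < a -> a <= b -> b < 1 -> exists f, trivial_over a b f.
Proof.
move=> a0 ab b1; pose P (c c' : RR) := exists f, trivial_over c c' f.
apply: (@seg_ind P a b ab).
- move=> t tab; have [|d d0 [f Hf]] := @trivial_over_local t; first by qlra.
  by exists d => // c c' _ _ _ h1 h2; exists f; apply: Hf.
- move=> x y z ax xy yz zb [f tf] [g tg].
  have y01 : 0 < y < 1 by qlra.
  have yy : y <= y <= z by rewrite lexx.
  have tfy : trivial_over y y f by apply: trivial_over_sub tf.
  have [g' [tg' E]] := trivial_over_reparam tg yy y01 tfy.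
  by eexists; apply: (trivial_over_glue xy yz tf tg').
Qed.

Lemma trivial_over_extend (a b a' b' : RR) f : 0 < a' -> a' <= a -> a <= b -> b <= b' -> b' < 1 ->
  trivial_over a b f -> exists f', trivial_over a' b' f' /\
    forall x t : RR, a <= t <= b -> f' (x, t) = f (x, t).
Proof.
move=> a'0 aa ab bb b'1 tf.
have [|g1 tg1] := @trivial_over_exists a' a a'0 aa; first by qlra.
have [|||g2 tg2] := @trivial_over_exists b b'; try by qlra.
have [||g1' [tg1' E1]] := trivial_over_reparam tg1 (e := a) (g := f) _ _ (trivial_over_sub (lexx a) ab tf); try by qlra.
have [||g2' [tg2' E2]] := trivial_over_reparam tg2 (e := b) (g := f) _ _ (trivial_over_sub ab (lexx b) tf); try by qlra.
have t1 := trivial_over_glue aa ab tg1' tf (fun x => esym (E1 x)).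
have ab' : a' <= b by qlra.
have agree (x : RR) : g2' (x, b) = (if b <= a then g1' (x, b) else f (x, b)).
  case: leP => [ba|_]; last exact: E2.
  have {}ba : b = a by apply/eqP; rewrite eq_le ba ab.
  by subst b; rewrite E2 E1.
eexists; split; first exact: (trivial_over_glue ab' bb t1 tg2' agree).
move=> x t /andP[at_ tb] /=; rewrite tb; case: leP => // ta.
have -> : t = a by apply/eqP; rewrite eq_le ta at_.
exact: E1.
Qed.

Local Notation lo := exhaust_lo.
Local Notation hi := exhaust_hi.

(** Every extension leaves the earlier map unchanged on its interval, and the intervals exhaust
    [(0, 1)]; so the sequence of maps is eventually stationary near each height. *)
Lemma trivialization_exists : exists f : plane -> Z, [/\
  forall x t : RR, 0 < t < 1 -> sameleaf (f (x, t)) (tau t),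
  forall (t : RR) y, 0 < t < 1 -> sameleaf y (tau t) -> exists x : RR, f (x, t) = y,
  forall x x' t : RR, 0 < t < 1 -> f (x, t) = f (x', t) -> x = x' &
  forall x t : RR, 0 < t < 1 -> {for (x, t), continuous f}].
Proof.
have lo0 n : 0 < lo n by rewrite /exhaust_lo invr_gt0.
have lohi n : lo n <= hi n by have [_ [_]] := exhaust_lo_bounds n; rewrite /exhaust_hi; qlra.
have hi1 n : hi n < 1 by have := lo0 n; rewrite /exhaust_hi; qlra.
(* The implication makes the choice total in [nf], so that it can be iterated. *)
have : forall nf : nat * (plane -> Z), exists f', trivial_over (lo nf.1) (hi nf.1) nf.2 ->
    trivial_over (lo nf.1.+1) (hi nf.1.+1) f' /\
    forall x t : RR, lo nf.1 <= t <= hi nf.1 -> f' (x, t) = nf.2 (x, t).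
  move=> [n f]; have [tf|ntf] := EM (trivial_over (lo n) (hi n) f); last by exists f.
  have [h1 [h2 h3]] := exhaust_lo_bounds n.
  have hh : hi n <= hi n.+1 by rewrite /exhaust_hi; qlra.
  have [f' Hf'] := trivial_over_extend h1 (ltW h2) (lohi n) hh (hi1 _) tf.
  by exists f'.
move=> /choice[nx Hnx].
have [f0 tf0] := trivial_over_exists (lo0 0%N) (lohi 0%N) (hi1 0%N).
pose fs := fix fs n := if n is m.+1 then nx (m, fs m) else f0.
have tfs n : trivial_over (lo n) (hi n) (fs n).
  by elim: n => [//|n IH]; apply: (Hnx (n, fs n) IH).1.
have fsS n (x t : RR) : lo n <= t <= hi n -> fs n.+1 (x, t) = fs n (x, t).
  exact: (Hnx (n, fs n) (tfs n)).2.
have himono n m : (n <= m)%N -> hi n <= hi m.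
  by move=> /exhaust_lo_mono; rewrite /exhaust_hi; qlra.
have fsE n m (x t : RR) : (n <= m)%N -> lo n <= t <= hi n -> fs m (x, t) = fs n (x, t).
  elim: m => [|m IH]; first by rewrite leqn0 => /eqP ->.
  rewrite leq_eqVlt => /orP[/eqP->//|]; rewrite ltnS => nm tt.
  rewrite fsS ?IH //; have := himono _ _ nm; have := exhaust_lo_mono nm; qlra.
have : forall t : RR, exists n, 0 < t < 1 -> lo n < t < hi n.
  move=> t; have [t01|nt] := boolP (0 < t < 1); last by exists 0%N.
  have [n nt] : exists n, lo n < Num.min t (1 - t).
    by apply: exhaust_lo_small; rewrite lt_min; qlra.
  by exists n => _; move: nt; rewrite lt_min /exhaust_hi; qlra.
move=> /choice[N HN].
have fsE' n m (x t : RR) : lo n <= t <= hi n -> lo m <= t <= hi m -> fs m (x, t) = fs n (x, t).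
  by move=> tn tm; case: (leqP n m) => [|/ltnW] h; [apply: fsE|symmetry; apply: fsE].
pose f (p : plane) := fs (N p.2) p.
have fE n (x t : RR) : 0 < t < 1 -> lo n <= t <= hi n -> f (x, t) = fs n (x, t).
  by move=> t01 tn; apply: fsE' => //; have := HN t t01; rewrite /=; qlra.
have HN' t : 0 < t < 1 -> lo (N t) <= t <= hi (N t) by move=> /HN; qlra.
exists f; split.
- by move=> x t t01; apply: (to_leaf (tfs (N t))); exact: HN'.
- by move=> t y t01; apply: (to_surj (tfs (N t))); exact: HN'.
- by move=> x x' t t01; apply: (to_inj (tfs (N t))); exact: HN'.
- move=> x t t01 B nB; have := to_cont (tfs (N t)) (HN' _ t01) nB.
  have nn := HN t t01; pose d := Num.min (t - lo (N t)) (hi (N t) - t).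
  have d0 : 0 < d by rewrite lt_min !subr_gt0.
  have : nbhs (x, t) [set p : plane | `|p.2 - t| < d] by apply/nbhs2P; exists d.
  apply: filterS2 => -[u s] /=; rewrite /d lt_min !ltr_distl => sd H.
  have s01 : 0 < s < 1 by have := lo0 (N t); have := hi1 (N t); qlra.
  by rewrite (fE (N t)) //; [apply: H; qlra|qlra].
Qed.

(** In a regular chart the map sends levels to levels: [tr_open] provides the height of a nearby
    point, and [slide] solves for its horizontal coordinate. *)
Lemma trivialization_open (f : plane -> Z) :
  (forall x t : RR, 0 < t < 1 -> sameleaf (f (x, t)) (tau t)) ->
  (forall x x' t : RR, 0 < t < 1 -> f (x, t) = f (x', t) -> x = x') ->
  (forall x t : RR, 0 < t < 1 -> {for (x, t), continuous f}) ->
  forall (x0 t0 : RR) B, 0 < t0 < 1 -> nbhs (x0, t0) B -> nbhs (f (x0, t0)) (f @` B).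
Proof.
move=> fl fi cf x0 t0 B t01 /nbhs2P[e e0 HB].
have [r [k [u0 [rc E0]]]] := regular_pt_chart (tr_reg tr t01).
have z1 : `|0 : RR| < 1 by rewrite normr0.
have rr := rc_open rc (p := (u0, 0)) z1; rewrite -E0 in rr.
have [d1 d10 Hd1] := (nbhsRP _ _).1 (continuous_nbhs (tr_cont tr t01) rr).
pose d := Num.min d1 (Num.min t0 (1 - t0)).
have d0 : 0 < d by rewrite /d !lt_min d10; qlra.
have [dd1 dt dt'] : [/\ d <= d1, d <= t0 & d <= 1 - t0] by rewrite /d !ge_min !lexx !orbT.
clearbody d.
have ins (t : RR) y : `|t - t0| < d -> sameleaf y (tau t) ->
    0 < t < 1 /\ exists q : plane, [/\ `|q.2| < 1, y = r q & (k (tau t)).2 = q.2].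
  move=> td yt; have [|q /= q1 qE] := Hd1 t; first by qlra.
  split; first by move: td; rewrite ltr_distl; qlra.
  have [x yE] : exists x : RR, y = r (x, q.2).
    by apply: (rc_sat rc q1); rewrite qE; apply: sameleaf_sym.
  by exists (x, q.2); rewrite -qE (rc_can rc).
pose X (x t : RR) := (k (f (x, t))).1.
have kf (x t : RR) : `|t - t0| < d -> k (f (x, t)) = (X x t, (k (tau t)).2).
  move=> td; have [t1 _] := ins t (tau t) td (sameleaf_refl partD _).
  have [_ [q [q1 fq kq]]] := ins t (f (x, t)) td (fl x t t1).
  by rewrite /X fq (rc_can rc) // kq -surjective_pairing.
have cX (x t : RR) (A : set RR) : `|t - t0| < d -> nbhs (X x t) A ->
    nbhs (x, t) [set p : plane | A (X p.1 p.2)].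
  move=> td nA; have [t1 _] := ins t (tau t) td (sameleaf_refl partD _).
  have [_ [q [q1 fq _]]] := ins t (f (x, t)) td (fl x t t1).
  have : nbhs (f (x, t)) [set y | A (k y).1].
    rewrite fq; apply: (continuous_nbhs (rc_kcont rc q1) (B := [set p : plane | A p.1])).
    have [c c0 Hc] := (nbhsRP _ _).1 nA.
    by rewrite -fq; apply/nbhs2P; exists c => // v s vc _; apply: Hc.
  move=> /(continuous_nbhs (cf x t t1))/nbhs2P[c c0 Hc]; apply/nbhs2P; exists c => //.
have t0d : `|t0 - t0| < d by rewrite subrr normr0.
have axb : x0 - e / 2 < x0 < x0 + e / 2 by qlra.
have [|||c c0 Hc] := @slide (fun t => `|t - t0| < d) X _ _ _ t0 axb t0d.
- move=> t td x _ A /(cX x t A td)/nbhs2P[c c0 Hc]; apply/nbhsRP; exists c => // y yc.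
  by apply: (Hc y t) => //=; rewrite subrr normr0.
- move=> x x' _ _ E; apply: (fi x x' t0 t01).
  have E1 : k (f (x, t0)) = k (f (x', t0)) by rewrite !kf // E.
  have [_ [q [q1 fq _]]] := ins t0 _ t0d (fl x t0 t01).
  have [_ [q' [q'1 fq' _]]] := ins t0 _ t0d (fl x' t0 t01).
  by move: E1; rewrite fq fq' !(rc_can rc) // => ->.
- move=> x _ e' e'0; have N : nbhs (X x t0) [set v | `|v - X x t0| < e'] by apply/nbhsRP; exists e'.
  have [c c0 Hc] := (nbhs2P _ _).1 (cX x t0 _ t0d N); exists c => // s _ sc.
  by apply: (Hc x s) => //=; rewrite subrr normr0.
have fl0 := fl x0 t0 t01.
pose m := Num.min c (Num.min d e).
have m0 : 0 < m by rewrite /m (lt_min _ c) (lt_min _ d) c0 d0 e0.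
have [mc md me] : [/\ m <= c, m <= d & m <= e] by rewrite /m !ge_min !lexx !orbT.
have N1 := tr_open tr t01 m0 fl0.
have N2 : nbhs (f (x0, t0)) [set y | `|(k y).1 - X x0 t0| < c].
  have [_ [q [q1 fq _]]] := ins t0 _ t0d fl0.
  rewrite fq; apply: (continuous_nbhs (rc_kcont rc q1) (B := [set p : plane | `|p.1 - X x0 t0| < c])).
  by rewrite -fq; apply/nbhs2P; exists c => //.
apply: filterS2 N1 N2 => y [t [tm t1 yt]] /= yc.
have td : `|t - t0| < d by qlra.
have tc : `|t - t0| < c by qlra.
have [x xx Xx] := Hc t _ td tc yc.
exists (x, t).
  by apply: HB => //=; [rewrite ltr_distl; qlra|qlra].
have E1 : k (f (x, t)) = k y.
  rewrite kf // Xx [RHS]surjective_pairing; congr pair.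
  have [_ [q [q1 -> ->]]] := ins t y td yt; by rewrite (rc_can rc).
have [_ [q [q1 fq _]]] := ins t _ td (fl x t t1).
have [_ [q' [q'1 fq' _]]] := ins t y td yt.
by move: E1; rewrite fq fq' !(rc_can rc) // => ->.
Qed.
End Trivialization.

Record product_pieces {Z : topologicalType} (D : set (set Z)) (P F : set (set Z))
    (Phi : set Z -> plane -> Z) : Prop := ProductPieces {
  pp_leaves : forall w, F w -> D w;
  pp_lf : locally_finite_family F;
  pp_disj : forall J J', P J -> P J' -> J `&` J' !=set0 -> J = J';
  pp_cover : forall y, (exists J, P J /\ J y) <-> ~ (exists w, F w /\ w y);
  pp_in : forall J (x t : RR), P J -> 0 < t < 1 -> J (Phi J (x, t));
  pp_surj : forall J y, P J -> J y -> exists x t : RR, 0 < t < 1 /\ Phi J (x, t) = y;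
  pp_inj : forall J (x t x' t' : RR), P J -> 0 < t < 1 -> 0 < t' < 1 ->
    Phi J (x, t) = Phi J (x', t') -> x = x' /\ t = t';
  pp_leaf : forall J (x t x' t' : RR), P J -> 0 < t < 1 -> 0 < t' < 1 ->
    (sameleaf D (Phi J (x, t)) (Phi J (x', t')) <-> t = t');
  pp_cont : forall J (x t : RR), P J -> 0 < t < 1 -> {for (x, t), continuous (Phi J)};
  pp_open : forall J (x t : RR) B, P J -> 0 < t < 1 -> nbhs (x, t) B ->
    nbhs (Phi J (x, t)) (Phi J @` B);
  pp_sat : forall J y z, P J -> J y -> sameleaf D y z -> J z;
  pp_reg : forall J y, P J -> J y -> regular_pt D y }.

Lemma product_pieces_exist (Z : topologicalType) (D : set (set Z)) (z0 : Z) :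
  foliated_surface D -> @second_countable Z -> locally_finite_family (irregular_leaf D) ->
  exists P F Phi, product_pieces D P F Phi.
Proof.
move=> fsD sc lf; have partD := fs_part fsD.
have [P [F [Fl Flf Ptr Pdisj Pcov]]] := piece_decomposition fsD sc lf.
have : forall J, exists f : plane -> Z, P J -> exists tau, [/\ leaf_transversal D tau,
    J = [set y | exists t : RR, 0 < t < 1 /\ sameleaf D y (tau t)] & [/\
  forall x t : RR, 0 < t < 1 -> sameleaf D (f (x, t)) (tau t),
  forall (t : RR) y, 0 < t < 1 -> sameleaf D y (tau t) -> exists x : RR, f (x, t) = y,
  forall x x' t : RR, 0 < t < 1 -> f (x, t) = f (x', t) -> x = x' &
  forall x t : RR, 0 < t < 1 -> {for (x, t), continuous f}]].
  move=> J; have [PJ|nP] := EM (P J); last by exists (fun _ => z0).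
  have [tau [tr JE]] := Ptr J PJ; have [f [f1 f2 f3 f4]] := trivialization_exists fsD tr.
  by exists f => _; exists tau.
move=> /choice[Phi HPhi]; exists P, F, Phi; split => //.
- move=> J x t PJ t01; have [tau [tr -> [f1 _ _ _]]] := HPhi J PJ.
  by exists t; split => //; apply: f1.
- move=> J y PJ; have [tau [tr -> [f1 f2 _ _]]] := HPhi J PJ.
  by move=> [t [t01 /(f2 _ _ t01)[x <-]]]; exists x, t.
- move=> J x t x' t' PJ t01 t'01 E; have [tau [tr _ [f1 _ f3 _]]] := HPhi J PJ.
  have tt : t = t'.
    apply: (tr_inj tr) => //; apply: (sameleaf_trans partD (sameleaf_sym (f1 x t t01))).
    by rewrite E; apply: f1.
  by subst t'; split => //; apply: f3 E.
- move=> J x t x' t' PJ t01 t'01; have [tau [tr _ [f1 _ f3 _]]] := HPhi J PJ.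
  split => [E|tt].
    apply: (tr_inj tr) => //; apply: (sameleaf_trans partD (sameleaf_sym (f1 x t t01))).
    by apply: (sameleaf_trans partD E); apply: f1.
  subst t'; apply: (sameleaf_trans partD (f1 x t t01)); apply: sameleaf_sym; exact: f1.
- by move=> J x t PJ t01; have [tau [tr _ [_ _ _ f4]]] := HPhi J PJ; apply: f4.
- move=> J x t B PJ t01; have [tau [tr _ [f1 f2 f3 f4]]] := HPhi J PJ.
  exact: (trivialization_open fsD tr f1 f3 f4).
- move=> J y z PJ; have [tau [tr -> _]] := HPhi J PJ => -[t [t01 E]] yz.
  exists t; split => //; exact: (sameleaf_trans partD (sameleaf_sym yz)).
- move=> J y PJ; have [tau [tr -> _]] := HPhi J PJ => -[t [t01 E]].
  by apply: (regular_pt_sameleaf (tr_reg tr t01)); apply: sameleaf_sym.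
Qed.

(** * Coordinates on the pieces, and half-boxes along the cut leaves *)

Section Coordinates.
Context {Z : topologicalType} (D : set (set Z)) (fsD : foliated_surface D).
Context (P F : set (set Z)) (Phi : set Z -> plane -> Z).
Context (pp : product_pieces D P F Phi).
Local Notation sameleaf := (sameleaf D).

Definition in_piece (y : Z) : Prop := exists J, P J /\ J y.
Definition piece (y : Z) : set Z := xget set0 [set J | P J /\ J y].
Definition piece_coord (y : Z) : plane :=
  xget (0, 0) [set p | 0 < p.2 < 1 /\ Phi (piece y) p = y].
Local Notation Yc y := (piece_coord y).1.
Local Notation Tc y := (piece_coord y).2.

Lemma pieceP y : in_piece y -> P (piece y) /\ piece y y.
Proof. by move=> [J PJ]; rewrite /piece; case: xgetP => [J' _ //|/(_ J)]; case. Qed.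

Lemma piece_unique_in J y : P J -> J y -> piece y = J.
Proof.
move=> PJ Jy; have [PJ' Jy'] : P (piece y) /\ piece y y by apply: pieceP; exists J.
by apply: (pp_disj pp) => //; exists y.
Qed.

Lemma piece_coordP y : in_piece y ->
  0 < Tc y < 1 /\ Phi (piece y) (piece_coord y) = y.
Proof.
move=> /pieceP[PJ Jy]; rewrite /piece_coord; case: xgetP => [p _ []//|].
by have [x [t [t01 E]]] := pp_surj pp PJ Jy; move=> /(_ (x, t)); case.
Qed.

Lemma Phi_in_piece J (x t : RR) : P J -> 0 < t < 1 -> in_piece (Phi J (x, t)).
Proof. by move=> PJ t01; exists J; split => //; exact: (pp_in pp). Qed.

Lemma piece_Phi J (x t : RR) : P J -> 0 < t < 1 -> piece (Phi J (x, t)) = J.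
Proof. by move=> PJ t01; apply: piece_unique_in => //; exact: (pp_in pp). Qed.

Lemma piece_coord_Phi J (x t : RR) : P J -> 0 < t < 1 -> piece_coord (Phi J (x, t)) = (x, t).
Proof.
move=> PJ t01; have [] := piece_coordP (Phi_in_piece x PJ t01).
rewrite piece_Phi //; case: (piece_coord _) => x' t' /= t'01.
by move=> /(pp_inj pp PJ t'01 t01)[-> ->].
Qed.

Lemma piece_eq y y' : in_piece y -> in_piece y' -> piece y = piece y' ->
  piece_coord y = piece_coord y' -> y = y'.
Proof.
move=> /piece_coordP[_ E] /piece_coordP[_ E'] pyy cyy.
by rewrite -E -E' pyy cyy.
Qed.

Lemma piece_nbhs y B : in_piece y -> nbhs (piece_coord y) B ->
  nbhs y [set y' | [/\ in_piece y', piece y' = piece y & B (piece_coord y')]].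
Proof.
move=> iy nB; have [PJ Jy] := pieceP iy; have [t01 E] := piece_coordP iy.
have pE : piece_coord y = (Yc y, Tc y) by rewrite -surjective_pairing.
have nT : nbhs (piece_coord y) [set p : plane | 0 < p.2 < 1].
  apply/nbhs2P; exists (Num.min (Tc y) (1 - Tc y)); first by rewrite lt_min; qlra.
  by move=> x s _; rewrite /= lt_min !ltr_distl; qlra.
have N : nbhs (Yc y, Tc y) (B `&` [set p : plane | 0 < p.2 < 1]).
  by rewrite -pE; exact: filterI.
have := pp_open pp PJ t01 N.
rewrite -pE E; apply: filterS => _ [[x t] [Bp t1] <-].
by split; [exact: Phi_in_piece|exact: piece_Phi|rewrite piece_coord_Phi].
Qed.

Lemma piece_coord_cont y : in_piece y -> {for y, continuous piece_coord}.
Proof. by move=> iy B /(piece_nbhs iy); apply: filterS => y' []. Qed.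

Lemma sameleaf_piece y y' : in_piece y -> sameleaf y y' ->
  [/\ in_piece y', piece y' = piece y & Tc y' = Tc y].
Proof.
move=> iy yy; have [PJ Jy] := pieceP iy; have Jy' := pp_sat pp PJ Jy yy.
have iy' : in_piece y' by exists (piece y).
have py' := piece_unique_in PJ Jy'; split => //.
have [t01 E] := piece_coordP iy; have [t'01 E'] := piece_coordP iy'.
symmetry; apply/(pp_leaf pp (Yc y) (Yc y') PJ t01 t'01).
by rewrite -!surjective_pairing E -py' E'.
Qed.

Lemma piece_sameleaf y y' : in_piece y -> in_piece y' -> piece y' = piece y ->
  Tc y' = Tc y -> sameleaf y y'.
Proof.
move=> iy iy' pE tE; have [PJ _] := pieceP iy.
have [t01 E] := piece_coordP iy; have [t'01 E'] := piece_coordP iy'.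
rewrite -E -E' pE [piece_coord y]surjective_pairing [piece_coord y']surjective_pairing.
by apply/(pp_leaf pp).
Qed.

Lemma not_in_piece y : ~ in_piece y <-> exists w, F w /\ w y.
Proof.
split => [ny|h /(pp_cover pp)]; last by apply.
by apply: contrapT => h; apply: ny; apply/(pp_cover pp).
Qed.

Lemma not_in_piece_sameleaf y y' : ~ in_piece y -> sameleaf y y' -> ~ in_piece y'.
Proof.
by move=> ny yy /sameleaf_piece/(_ (sameleaf_sym yy))[].
Qed.

Lemma cut_isolated (z : Z) : nbhs z [set y | ~ in_piece y -> sameleaf z y].
Proof.
have cF w : F w -> closed w by move=> /(pp_leaves pp)/(fs_leaf fsD)[].
have := locally_finite_isolate z cF (pp_lf pp); apply: filterS => y H.
move=> /not_in_piece[w [Fw wy]]; exists w; split => //; first exact: (pp_leaves pp).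
exact: H.
Qed.

(** [val] marks the indices in use, and [sib n] is the half-box on the other side of the edge. The
    inner parts [|x| < 1 / 2] of the edges already cover the cut leaves, so every cut point lies
    strictly inside the range on which some parameter is measured. *)
Record half_box_family (val : nat -> Prop) (hb : nat -> plane -> Z) (sib : nat -> nat) : Prop :=
  HalfBoxFamily {
  hf_box : forall n, val n -> box_pair D (hb n) (hb (sib n));
  hf_sib : forall n, val n -> val (sib n);
  hf_in : forall n (x s : RR), val n -> `|x| < 1 -> 0 < s < 1 -> in_piece (hb n (x, s));
  hf_edge : forall n (x : RR), val n -> `|x| < 1 -> ~ in_piece (hb n (x, 0));
  hf_cover : forall z, ~ in_piece z -> exists n (x : RR), [/\ val n, `|x| < 1 / 2 & hb n (x, 0) = z] }.

Lemma box_pair_sym b1 b2 : box_pair D b1 b2 -> box_pair D b2 b1.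
Proof.
move=> bp; split.
- exact: bp_r bp.
- exact: bp_l bp.
- by move=> x x1; rewrite (bp_edge bp).
- by move=> x A x1 nA; rewrite -(bp_edge bp) // setUC; exact: (bp_cover bp).
- case: (bp_sides bp) => [->|fp]; [by left|right].
  by move=> x s x' s' x1 s1 x'1 s'1 E; apply: (fp x' s' x s).
Qed.

Lemma half_box_family_exists (z0 : Z) : @second_countable Z ->
  exists val hb sib, half_box_family val hb sib.
Proof.
move=> sc.
pose good (b : (plane -> Z) * (plane -> Z)) := [/\ box_pair D b.1 b.2,
  (forall x s : RR, `|x| < 1 -> 0 < s < 1 -> in_piece (b.1 (x, s)) /\ in_piece (b.2 (x, s))) &
  forall x : RR, `|x| < 1 -> ~ in_piece (b.1 (x, 0))].
pose Q (B : set Z) b := (forall y, B y -> in_piece y) \/ (good b /\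
  forall y, B y -> ~ in_piece y -> exists x : RR, `|x| < 1 / 2 /\ b.1 (x, 0) = y).
have Qmono A B b : A `<=` B -> Q B b -> Q A b.
  by move=> AB [H|[gb H]]; [left => y /AB /H|right; split => // y /AB /H].
have Qz (z : Z) : exists (B : set Z) b, nbhs z B /\ Q B b.
  have [iz|niz] := EM (in_piece z).
    exists [set y | in_piece y], (fun _ => z, fun _ => z); split; last by left.
    have nT : nbhs (piece_coord z) setT by apply: filterT.
    have := piece_nbhs iz nT.
    by apply: filterS => y [].
  have [b1 [b2 [bp bz bO]]] := fs_box fsD (cut_isolated z).
  have z1 : `|0 : RR| < 1 by rewrite normr0.
  have b2z : b2 (0, 0) = z by rewrite -(bp_edge bp z1).
  have h12 : 0 < 1 / 2 :> RR by lra.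
  exists (b1 @` [set p | `|p.1 - 0| < 1 / 2 /\ `|p.2 - 0| < 1] `|`
          b2 @` [set p | `|p.1 - 0| < 1 / 2 /\ `|p.2 - 0| < 1]), (b1, b2); split.
    by rewrite -bz; apply: (bp_cover bp z1); apply: nbhs_rect.
  have pos b : half_box D b -> b (0, 0) = z ->
      (forall x s : RR, `|x| < 1 -> `|s| < 1 -> ~ in_piece (b (x, s)) -> sameleaf z (b (x, s))) ->
      forall x s : RR, `|x| < 1 -> `|s| < 1 -> ~ in_piece (b (x, s)) -> s = 0.
    move=> hb b0 H x s x1 s1 ni; apply: (hb_iso hb x1 s1); rewrite b0.
    by apply/sameleaf_sym/H.
  have pos1 := pos b1 (bp_l bp) bz (fun x s x1 s1 => (bO x s x1 s1).1).
  have pos2 := pos b2 (bp_r bp) b2z (fun x s x1 s1 => (bO x s x1 s1).2).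
  right; split.
    split => //=.
      move=> x s x1 s1; have s1' : `|s| < 1 by rewrite gtr0_norm; qlra.
      by split; apply: contrapT => ni;
        [have := pos1 x s x1 s1' ni|have := pos2 x s x1 s1' ni]; move: s1; qlra.
    move=> x x1; apply: (not_in_piece_sameleaf niz); rewrite -bz.
    by apply: (hb_leaf (bp_l bp)).
  move=> y; case=> -[[x s] /= []]; rewrite !subr0 => x1 s1 <- ni.
    by have s0 := pos1 x s (_ : `|x| < 1) s1 ni; exists x; split => //; rewrite s0 //; qlra.
  exists x; split => //; have x1' : `|x| < 1 by qlra.
  by rewrite (bp_edge bp) // (pos2 x s).
have [e [eP ez]] := countable_cover sc Qmono Qz.
pose val n := exists B b, e n./2 = Some (B, b) /\ good b.
(* Even indices hold the first half-box of a pair, odd ones the second. *)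
pose sib n := if odd n then n.-1 else n.+1.
have sibh n : (sib n)./2 = n./2.
  rewrite /sib; case: ifP => on; last by rewrite /= uphalf_half on add0n.
  by case: n on => // m /= om; rewrite uphalf_half (negbTE om).
have sibo n : odd (sib n) = ~~ odd n.
  rewrite /sib; have [on|on] := boolP (odd n); last by rewrite /= (negbTE on).
  by case: n on => // m /= /negbTE ->.
pose hb n : plane -> Z := if e n./2 is Some (_, b) then (if odd n then b.2 else b.1) else (fun=> z0).
exists val, hb, sib; split.
- move=> n [B [b [E [bp _ _]]]]; rewrite /hb sibh E sibo; case: odd => //=.
  exact: box_pair_sym.
- by move=> n [B [b [E gb]]]; exists B, b; rewrite sibh.
- move=> n x s [B [b [E [_ H _]]]] x1 s1; rewrite /hb E.
  by have [? ?] := H x s x1 s1; case: odd.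
- move=> n x [B [b [E [bp _ H]]]] x1; rewrite /hb E.
  by case: odd; [rewrite -(bp_edge bp)//|]; apply: H.
- move=> z nz; have [n [B [b [E Bz]]]] := ez z; have [_ [H|[gb H]]] := eP _ _ _ E.
    by have := nz (H z Bz).
  have [x [x1 xz]] := H z Bz nz; exists n.*2, x; split => //.
    by exists B, b; rewrite doubleK.
  by rewrite /hb doubleK E odd_double.
Qed.
End Coordinates.

(** * Half-boxes at the ends of a piece *)

Lemma injective_increasing (f : RR -> RR) (a b x0 y0 : RR) :
  (forall t : RR, a < t < b -> {for t, continuous f}) ->
  (forall t t' : RR, a < t < b -> a < t' < b -> f t = f t' -> t = t') ->
  a < x0 -> x0 < y0 -> y0 < b -> f x0 < f y0 ->
  forall x y : RR, a < x -> x < y -> y < b -> f x < f y.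
Proof.
move=> cf fi ax0 xy0 yb0 fxy x y ax xy yb.
have cw : {within [set` `]a, b[], continuous f}.
  by apply: continuous_in_subspaceT => t; rewrite inE/= in_itv/=; apply: cf.
have iw : {in `]a, b[ &, injective f}.
  by move=> t t'; rewrite !in_itv/=; apply: fi.
have ex : exists x y, [/\ x \in `]a, b[, y \in `]a, b[, x < y & f x <= f y].
  by exists x0, y0; rewrite !in_itv/=; split=> //; [qlra|qlra|exact: ltW].
have mono := itv_continuous_inj_le ex cw iw.
have xI : x \in `]a, b[ by rewrite in_itv/=; qlra.
have yI : y \in `]a, b[ by rewrite in_itv/=; qlra.
rewrite ltNge; apply/negP; rewrite mono // => yx.
by move: xy; rewrite ltNge yx.
Qed.

Section HalfBoxes.
Context {Z : topologicalType} (D : set (set Z)).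
Context (P F : set (set Z)) (Phi : set Z -> plane -> Z).
Context (pp : product_pieces D P F Phi).
Context (val : nat -> Prop) (hb : nat -> plane -> Z) (sib : nat -> nat).
Context (hf : half_box_family D P val hb sib).
Local Notation sameleaf := (sameleaf D).
Local Notation in_piece := (in_piece P).
Local Notation piece := (piece P).
Local Notation piece_coord := (piece_coord P Phi).
Local Notation Yc y := (piece_coord y).1.
Local Notation Tc y := (piece_coord y).2.

Lemma hf_half n : val n -> half_box D (hb n).
Proof. by move=> /(hf_box hf)/bp_l. Qed.

Definition hpiece n : set Z := piece (hb n (0, 1 / 2)).
Definition hheight n (s : RR) : RR := Tc (hb n (0, s)).

Lemma pos_lt1 (s : RR) : 0 < s < 1 -> `|s| < 1.
Proof. by move=> s1; rewrite gtr0_norm; qlra. Qed.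

Lemma hb_coord_nbhs n (x s : RR) B : val n -> `|x| < 1 -> 0 < s < 1 ->
  nbhs (piece_coord (hb n (x, s))) B ->
  nbhs (x, s) [set p | [/\ in_piece (hb n p), piece (hb n p) = piece (hb n (x, s)) &
    B (piece_coord (hb n p))]].
Proof.
move=> vn x1 s1 nB; have ip := hf_in hf vn x1 s1.
exact: (continuous_nbhs (hb_cont (hf_half vn) x1 (pos_lt1 s1)) (piece_nbhs pp ip nB)).
Qed.

Lemma hb_piece n (x s : RR) : val n -> `|x| < 1 -> 0 < s < 1 ->
  piece (hb n (x, s)) = hpiece n.
Proof.
move=> vn x1 s1.
pose Q p := piece (hb n p) = hpiece n.
have loc (y t : RR) : `|y - 0| < 1 -> 0 < t < 1 -> nbhs (y, t) [set q | Q q <-> Q (y, t)].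
  rewrite subr0 => y1 t1.
  have nT : nbhs (piece_coord (hb n (y, t))) setT by apply: filterT.
  by have := hb_coord_nbhs vn y1 t1 nT; apply: filterS => q [_ pE _]; rewrite /Q /= pE.
have h01 : `|0 - 0 : RR| < 1 by rewrite subrr normr0.
have h12 : 0 < (1 / 2 : RR) < 1 by lra.
have x10 : `|x - 0| < 1 by rewrite subr0.
by apply/(hrect_const loc h01 h12 x10 s1).
Qed.

Lemma hpieceP n : val n -> P (hpiece n).
Proof.
move=> vn; have h12 : 0 < (1 / 2 : RR) < 1 by lra.
have z1 : `|0 : RR| < 1 by rewrite normr0.
by have [] := pieceP (hf_in hf vn z1 h12).
Qed.

Lemma hb_height n (x s : RR) : val n -> `|x| < 1 -> 0 < s < 1 ->
  Tc (hb n (x, s)) = hheight n s.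
Proof.
move=> vn x1 s1; have z1 : `|0 : RR| < 1 by rewrite normr0.
have L := hb_leaf (hf_half vn) z1 (pos_lt1 s1) x1.
by have [_ _ ->] := sameleaf_piece pp (hf_in hf vn z1 s1) L.
Qed.

Lemma hheight01 n (s : RR) : val n -> 0 < s < 1 -> 0 < hheight n s < 1.
Proof.
move=> vn s1; have z1 : `|0 : RR| < 1 by rewrite normr0.
by have [] := piece_coordP pp (hf_in hf vn z1 s1).
Qed.

Lemma hheight_cont n (s : RR) : val n -> 0 < s < 1 -> {for s, continuous (hheight n)}.
Proof.
move=> vn s1 B /nbhsRP[e e0 HB]; have z1 : `|0 : RR| < 1 by rewrite normr0.
have N : nbhs (piece_coord (hb n (0, s))) [set p : plane | B p.2].
  by apply/nbhs2P; exists e => // u v _ ve; apply: HB.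
have [d d0 Hd] := (nbhs2P _ _).1 (hb_coord_nbhs vn z1 s1 N).
apply/nbhsRP; exists d => // t td.
by have [|| _ _] // := Hd 0 t; rewrite /= ?subrr ?normr0.
Qed.

Lemma hY_cont n (s x : RR) : val n -> 0 < s < 1 -> `|x| < 1 ->
  {for x, continuous (fun x : RR => Yc (hb n (x, s)))}.
Proof.
move=> vn s1 x1 B /nbhsRP[e e0 HB].
have N : nbhs (piece_coord (hb n (x, s))) [set p : plane | B p.1].
  by apply/nbhs2P; exists e => // u v ue _; apply: HB.
have [d d0 Hd] := (nbhs2P _ _).1 (hb_coord_nbhs vn x1 s1 N).
apply/nbhsRP; exists d => // t td.
by have [|| _ _] // := Hd t s; rewrite /= ?subrr ?normr0.
Qed.

Lemma hY_cont_height n (s x : RR) : val n -> 0 < s < 1 -> `|x| < 1 ->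
  {for s, continuous (fun s : RR => Yc (hb n (x, s)))}.
Proof.
move=> vn s1 x1 B /nbhsRP[e e0 HB].
have N : nbhs (piece_coord (hb n (x, s))) [set p : plane | B p.1].
  by apply/nbhs2P; exists e => // u v ue _; apply: HB.
have [d d0 Hd] := (nbhs2P _ _).1 (hb_coord_nbhs vn x1 s1 N).
apply/nbhsRP; exists d => // t td.
by have [|| _ _] // := Hd x t; rewrite /= ?subrr ?normr0.
Qed.

Lemma hb_coord_inj n (x s x' s' : RR) : val n -> `|x| < 1 -> 0 < s < 1 ->
  `|x'| < 1 -> 0 < s' < 1 -> Yc (hb n (x, s)) = Yc (hb n (x', s')) ->
  hheight n s = hheight n s' -> x = x' /\ s = s'.
Proof.
move=> vn x1 s1 x'1 s'1 YY HH.
have [s0 s'0] : 0 <= s < 1 /\ 0 <= s' < 1 by qlra.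
apply: (hb_inj (hf_half vn)) => //.
apply: (piece_eq pp (hf_in hf vn x1 s1) (hf_in hf vn x'1 s'1)).
  by rewrite !hb_piece.
rewrite [LHS]surjective_pairing [RHS]surjective_pairing YY.
by rewrite !hb_height // HH.
Qed.

(** On the half-box the pair of [Y] and the height is injective and the height depends on [s] only.
    So the height is locally injective, and on an interval this gives injectivity. *)
Lemma hheight_inj n (s s' : RR) : val n -> 0 < s < 1 -> 0 < s' < 1 ->
  hheight n s = hheight n s' -> s = s'.
Proof.
move=> vn; wlog ss : s s' / s < s' => [wl s1 s'1 E|].
  by have [h|h|//] := ltgtP s s'; [apply: wl|symmetry; apply: wl].
move=> s1 s'1 E; exfalso; move: E; apply: (locally_injective_seg ss).
  by move=> t tt; apply: hheight_cont => //; qlra.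
move=> t tt; have t1 : 0 < t < 1 by qlra.
pose e := Num.min t (1 - t).
have e0 : 0 < e by rewrite lt_min; qlra.
have [et et'] : e <= t /\ e <= 1 - t by rewrite /e !ge_min !lexx !orbT.
have ins (u v : RR) : `|u - 0| < e -> `|v - t| < e -> `|u| < 1 /\ 0 < v < 1.
  by rewrite subr0 => ue; rewrite ltr_distl => ve; split; qlra.
have te : `|t - t| < e by rewrite subrr normr0.
have ze : `|0 - 0 : RR| < e by rewrite subrr normr0.
have [|||d d0 Hd] := @locally_injective_height (fun u v => Yc (hb n (u, v))) (hheight n) e 0 t e0.
- by move=> v ve u ue; have [u1 v1] := ins u v ue ve; apply: hY_cont.
- by move=> u ue; have [u1 v1] := ins u t ue te; apply: hY_cont_height.
- move=> u v u' v' ue ve u'e v'e; have [u1 v1] := ins u v ue ve.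
  by have [u'1 v'1] := ins u' v' u'e v'e; apply: hb_coord_inj.
by exists d => // c c' _ _; apply: Hd.
Qed.

(** The leaf at the level [l] of the piece is regular and therefore separated from the leaf of the
    edge, whereas the levels [s] of the half-box tend to the edge. *)
Lemma hheight_away n (l : RR) : val n -> 0 < l < 1 -> exists2 d : RR, 0 < d &
  forall s : RR, 0 < s < d -> s < 1 -> d <= `|hheight n s - l|.
Proof.
move=> vn l01; have PJ := hpieceP vn.
have z1 : `|0 : RR| < 1 by rewrite normr0.
have ni := hf_edge hf vn z1.
pose p := Phi (hpiece n) (0, l).
have ip : in_piece p by exact: (Phi_in_piece pp 0 PJ l01).
have np : ~ sameleaf (hb n (0, 0)) p.
  by move=> /sameleaf_sym/(sameleaf_piece pp ip)[/ni].
have rp : regular_pt D p by apply: (pp_reg pp PJ); exact: (pp_in pp).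
have [V [V' [nV nV' VV]]] := regular_separated rp np.
have [d1 d10 H1] := (nbhs2P _ _).1 (continuous_nbhs (hb_cont (hf_half vn) z1 z1) nV).
have [d2 d20 H2] := (nbhs2P _ _).1 (continuous_nbhs (pp_cont pp PJ l01) nV').
exists (Num.min d1 d2); first by rewrite lt_min d10.
move=> s /andP[s0]; rewrite lt_min => /andP[s1 s2] s11.
rewrite leNgt; apply/negP; rewrite lt_min => /andP[h1 h2].
have s01 : 0 < s < 1 by rewrite s0.
have h01 := hheight01 vn s01.
apply: (VV (hb n (0, s)) (Phi (hpiece n) (0, hheight n s))).
- by apply: H1 => /=; rewrite ?subrr ?subr0 ?normr0 // gtr0_norm.
- by apply: H2 => /=; rewrite ?subrr ?normr0.
have is_ := hf_in hf vn z1 s01.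
apply: (piece_sameleaf pp is_); first exact: (Phi_in_piece pp 0 PJ h01).
  by rewrite (piece_Phi pp 0 PJ h01) hb_piece.
by rewrite (piece_coord_Phi pp 0 PJ h01).
Qed.

(** The height in the piece is monotone in the height [s] of the half-box, and by [hheight_away] its
    limit at the edge is not an inner level. The end 1 is reduced to the end 0 by passing to
    [1 - hheight]. *)
Lemma hend_exists n : val n -> exists e : RR, [/\ e = 0 \/ e = 1,
  forall s s' : RR, 0 < s -> s < s' -> s' < 1 -> `|hheight n s - e| < `|hheight n s' - e| &
  forall eps : RR, 0 < eps -> exists2 d : RR, 0 < d & forall s : RR, 0 < s < d -> s < 1 ->
    `|hheight n s - e| < eps].
Proof.
move=> vn; have ch (t : RR) : 0 < t < 1 -> {for t, continuous (hheight n)} := @hheight_cont n t vn.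
have h01 (s : RR) : 0 < s < 1 -> 0 < hheight n s < 1 := @hheight01 n s vn.
have near (c : RR -> RR) : (forall s : RR, 0 < s < 1 -> 0 < c s < 1) ->
    (forall s s' : RR, 0 < s -> s < s' -> s' < 1 -> c s < c s') ->
    (forall l : RR, 0 < l < 1 -> exists2 d : RR, 0 < d & forall s : RR, 0 < s < d -> s < 1 -> d <= `|c s - l|) ->
    forall eps : RR, 0 < eps -> exists2 d : RR, 0 < d & forall s : RR, 0 < s < d -> s < 1 -> `|c s - 0| < eps.
  move=> c01 cm ca eps eps0; pose S := [set v | exists s : RR, 0 < s < 1 /\ c s = v].
  have S0 : S (c (1 / 2)) by exists (1 / 2); split => //; lra.
  have hS : has_inf S.
    by split; [exists (c (1 / 2))|exists 0 => _ [s [s1 <-]]; have := c01 s s1; qlra].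
  have lS s : 0 < s < 1 -> inf S <= c s by move=> s1; apply: ge_inf; [case: hS|exists s].
  have l0 : 0 <= inf S.
    by apply: lb_le_inf => [|_ [s [s1 <-]]]; [exists (c (1 / 2))|have := c01 s s1; qlra].
  have l1 : inf S < 1.
    have h : 0 < (1 / 2 : RR) < 1 by lra.
    by have h1 := c01 _ h; have h2 := lS _ h; qlra.
  have [l00|nl] := eqVneq (inf S) 0; last first.
    have lp : 0 < inf S by rewrite lt_neqAle eq_sym nl.
    have [|d d0 Hd] := ca (inf S); first by rewrite lp.
    have [_ [s [s1 <-]] sd] := inf_adherent d0 hS.
    pose s' := Num.min (s / 2) (d / 2).
    have s'0 : 0 < s' by rewrite lt_min; qlra.
    have [s's s'd] : s' <= s / 2 /\ s' <= d / 2 by rewrite /s' !ge_min !lexx !orbT.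
    have s'1 : 0 < s' < 1 by qlra.
    have h1 : d <= `|c s' - inf S| by apply: Hd; qlra.
    have h2 : c s' < c s by apply: cm; qlra.
    have h3 := lS s' s'1.
    by move: h1; rewrite ger0_norm ?subr_ge0 //; qlra.
  have [_ [s [s1 <-]] sd] := inf_adherent eps0 hS.
  exists s; first by qlra.
  move=> s' /andP[s'0 s's] s'1.
  have h1 : c s' < c s by apply: cm => //; qlra.
  have h2 : 0 < c s' < 1 by apply: c01; rewrite s'0.
  by rewrite subr0 gtr0_norm; move: sd; rewrite l00 add0r; qlra.
have h13 : 0 < 1 / 3 :> RR by lra.
have h123 : 1 / 3 < 2 / 3 :> RR by lra.
have h231 : 2 / 3 < 1 :> RR by lra.
have [lt|gt|eq] := ltgtP (hheight n (1 / 3)) (hheight n (2 / 3)).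
- have inc := injective_increasing ch (fun t t' => @hheight_inj n t t' vn) h13 h123 h231 lt.
  exists 0; split; first by left.
    move=> s s' s0 ss s1; rewrite !subr0.
    have [s01 s'01] : 0 < s < 1 /\ 0 < s' < 1 by qlra.
    have := h01 s s01; have := h01 s' s'01; have := inc s s' s0 ss s1.
    by move=> h1 h2 h3; rewrite !gtr0_norm; qlra.
  by apply: near => // l l01; apply: hheight_away.
- have ch' (t : RR) : 0 < t < 1 -> {for t, continuous (fun t => 1 - hheight n t)}.
    by move=> t1; apply: cvgB; [exact: cvg_cst|exact: ch].
  have ih' (t t' : RR) : 0 < t < 1 -> 0 < t' < 1 -> 1 - hheight n t = 1 - hheight n t' -> t = t'.
    by move=> t1 t'1 E; apply: (@hheight_inj n t t' vn) => //; move: E; qlra.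
  have gt' : 1 - hheight n (1 / 3) < 1 - hheight n (2 / 3) by qlra.
  have inc := injective_increasing ch' ih' h13 h123 h231 gt'.
  have nE (s : RR) : 0 < s < 1 -> `|hheight n s - 1| = 1 - hheight n s.
    by move=> /h01 h; rewrite distrC gtr0_norm; qlra.
  exists 1; split; first by right.
    move=> s s' s0 ss s1; rewrite !nE; [exact: inc|qlra|qlra].
  move=> eps eps0.
  have [||d d0 Hd] := near (fun s => 1 - hheight n s) _ inc _ eps eps0.
  + by move=> s /h01; qlra.
  + move=> l l01; have [|d d0 Hd] := @hheight_away n (1 - l) vn; first by qlra.
    exists d => // s sd s1; have := Hd s sd s1; rewrite -normrN.
    by have -> : - (hheight n s - (1 - l)) = 1 - hheight n s - l by ring.
  exists d => // s sd s1; have := Hd s sd s1.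
  by rewrite subr0 nE ?gtr0_norm; have := h01 s; qlra.
- by have := @hheight_inj n (1 / 3) (2 / 3) vn _ _ eq; lra.
Qed.

(** On each row [Y] is injective, hence monotone, and by continuity in [s] the sense is the same for
    all rows. The sign [sg] turns it into an increasing one. *)
Lemma hsign_exists n : val n -> exists sg : RR, (sg = 1 \/ sg = - 1) /\
  forall s x x' : RR, 0 < s < 1 -> - 1 < x -> x < x' -> x' < 1 ->
    Yc (hb n (sg * x, s)) < Yc (hb n (sg * x', s)).
Proof.
move=> vn.
pose p (s : RR) := Yc (hb n (- (1 / 2), s)) < Yc (hb n (1 / 2, s)).
have a1 : `|- (1 / 2) : RR| < 1 by rewrite normrN gtr0_norm; lra.
have a2 : `|1 / 2 : RR| < 1 by rewrite gtr0_norm; lra.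
have ne (s : RR) : 0 < s < 1 -> Yc (hb n (- (1 / 2), s)) <> Yc (hb n (1 / 2, s)).
  by move=> s1 E; have [] := hb_coord_inj vn a1 s1 a2 s1 E erefl; lra.
have loc (a b : RR) : 0 < a -> a <= b -> b < 1 -> (p a <-> p b).
  move=> a0 ab b1; apply: (@locally_constant_seg (fun s => is_true (p s)) a b ab) => t tab.
  have t1 : 0 < t < 1 by qlra.
  pose e := `|Yc (hb n (- (1 / 2), t)) - Yc (hb n (1 / 2, t))| / 2.
  have e0 : 0 < e by rewrite /e divr_gt0 // normr_gt0 subr_eq0; apply/eqP/ne.
  have B1 : nbhs (Yc (hb n (- (1 / 2), t))) [set v | `|v - Yc (hb n (- (1 / 2), t))| < e].
    by apply/nbhsRP; exists e.
  have B2 : nbhs (Yc (hb n (1 / 2, t))) [set v | `|v - Yc (hb n (1 / 2, t))| < e].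
    by apply/nbhsRP; exists e.
  have [d1 d10 H1] := (nbhsRP _ _).1 (continuous_nbhs (hY_cont_height vn t1 a1) B1).
  have [d2 d20 H2] := (nbhsRP _ _).1 (continuous_nbhs (hY_cont_height vn t1 a2) B2).
  exists (Num.min d1 d2); first by rewrite lt_min d10.
  move=> c _; rewrite lt_min => /andP[cd1 cd2].
  have h1 := H1 c cd1; have h2 := H2 c cd2.
  rewrite /= !ltr_distl /e in h1 h2; rewrite /p; have := ne t t1.
  move: h1 h2; move: (Yc (hb n (- (1 / 2), t))) (Yc (hb n (1 / 2, t))) => y1 y2.
  move: (Yc (hb n (- (1 / 2), c))) (Yc (hb n (1 / 2, c))) => y3 y4.
  have [h|h|//] := ltgtP y1 y2.
    rewrite ltr0_norm ?subr_lt0 // => h1 h2 _.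
    by split => // _; qlra.
  rewrite gtr0_norm ?subr_gt0 // => h1 h2 _.
  by split => // h3; exfalso; qlra.
have neg1 (x : RR) : - 1 < x < 1 -> `|x| < 1 by rewrite ltr_norml.
have cY (s : RR) : 0 < s < 1 -> forall t : RR, - 1 < t < 1 -> {for t, continuous (fun x : RR => Yc (hb n (x, s)))}.
  by move=> s1 t /neg1 t1; apply: hY_cont.
have iY (s : RR) : 0 < s < 1 -> forall t t' : RR, - 1 < t < 1 -> - 1 < t' < 1 ->
    Yc (hb n (t, s)) = Yc (hb n (t', s)) -> t = t'.
  by move=> s1 t t' /neg1 t1 /neg1 t'1 E; have [] := hb_coord_inj vn t1 s1 t'1 s1 E erefl.
have b1 : - 1 < - (1 / 2) :> RR by lra.
have b2 : - (1 / 2) < 1 / 2 :> RR by lra.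
have b3 : 1 / 2 < 1 :> RR by lra.
have allp (s s' : RR) : 0 < s < 1 -> 0 < s' < 1 -> (p s <-> p s').
  move=> s1 s'1; have [h|h] := leP s s'; first by apply: loc => //; qlra.
  by symmetry; apply: loc; qlra.
have h12 : 0 < (1 / 2 : RR) < 1 by lra.
have [ph|nph] := boolP (p (1 / 2)).
  exists 1; split; first by left.
  move=> s x x' s1 xm xx x1; rewrite !mul1r.
  have ps : p s by apply/(allp (1 / 2)).
  exact: (injective_increasing (cY s s1) (iY s s1) b1 b2 b3 ps).
exists (- 1); split; first by right.
move=> s x x' s1 xm xx x1; rewrite !mulN1r.
have nps : ~~ p s by apply/negP => /(allp s (1 / 2)); rewrite (negPf nph) => /(_ s1 h12).
have ps : - Yc (hb n (- (1 / 2), s)) < - Yc (hb n (1 / 2, s)).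
  by rewrite ltrN2 lt_neqAle eq_sym; apply/andP; split; [apply/eqP/ne|rewrite leNgt].
have cY' (t : RR) : - 1 < t < 1 -> {for t, continuous (fun x : RR => - Yc (hb n (x, s)))}.
  by move=> t1; apply: cvgN; exact: cY.
have iY' (t t' : RR) : - 1 < t < 1 -> - 1 < t' < 1 ->
    - Yc (hb n (t, s)) = - Yc (hb n (t', s)) -> t = t'.
  by move=> t1 t'1 /oppr_inj; apply: iY.
rewrite -ltrN2; apply: (injective_increasing cY' iY' b1 b2 b3 ps); qlra.
Qed.
End HalfBoxes.

(* [g] is the parameter in [0, 1] at which the increasing function [X] reaches
   [y], clamped at both ends. *)
Definition solves (X : RR -> RR) (y g : RR) : Prop :=
  [/\ 0 <= g <= 1, forall c : RR, 0 <= c < 1 -> (c < g <-> X c < y) &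
      forall c : RR, 0 < c <= 1 -> (g < c <-> y < X c)].

(** The strict inequalities that hold at [g0 - e / 2] and [g0 + e / 2] persist along the filter;
    where one of these arguments leaves [[0, 1]], the bounds on [g] suffice. *)
Lemma solves_cvg (T : Type) (F : set_system T) {FF : ProperFilter F}
    (X : T -> RR -> RR) (y g : T -> RR) (X0 : RR -> RR) (y0 g0 : RR) :
  F [set p | solves (X p) (y p) (g p)] -> solves X0 y0 g0 ->
  (forall c : RR, 0 <= c <= 1 -> X ^~ c @ F --> X0 c) -> y @ F --> y0 ->
  g @ F --> g0.
Proof.
move=> sF [g01 lo0 hi0] cX cy; apply/cvgrPdist_lt => e e0.
have lowF : F [set p | g0 - e < g p].
  have [ge|ge] := leP g0 (e / 2).
    by apply: filterS sF => p /= [h _ _]; move: h; qlra.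
  have c01 : 0 <= g0 - e / 2 < 1 by qlra.
  have lt0 : X0 (g0 - e / 2) < y0 by apply/(lo0 _ c01); qlra.
  have cB : (fun p => y p - X p (g0 - e / 2)) @ F --> y0 - X0 (g0 - e / 2).
    by apply: cvgB => //; apply: cX; qlra.
  have pos : 0 < y0 - X0 (g0 - e / 2) by rewrite subr_gt0.
  have gtF : F [set p | 0 < y p - X p (g0 - e / 2)] := @cvgr_gt _ _ F (@filter_filter _ _ FF) _ _ cB _ pos.
  have Fi : Filter F by exact: filter_filter.
  apply: filterS (filterI sF gtF) => p /= [[_ lo _]].
  by rewrite subr_gt0 => /(lo _ c01); qlra.
have hiF : F [set p | g p < g0 + e].
  have [ge|ge] := leP (1 - e / 2) g0.
    by apply: filterS sF => p /= [h _ _]; move: h; qlra.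
  have c01 : 0 < g0 + e / 2 <= 1 by qlra.
  have lt0 : y0 < X0 (g0 + e / 2) by apply/(hi0 _ c01); qlra.
  have cB : (fun p => X p (g0 + e / 2) - y p) @ F --> X0 (g0 + e / 2) - y0.
    by apply: cvgB => //; apply: cX; qlra.
  have pos : 0 < X0 (g0 + e / 2) - y0 by rewrite subr_gt0.
  have gtF : F [set p | 0 < X p (g0 + e / 2) - y p] := @cvgr_gt _ _ F (@filter_filter _ _ FF) _ _ cB _ pos.
  have Fi : Filter F by exact: filter_filter.
  apply: filterS (filterI sF gtF) => p /= [[_ _ hi]].
  by rewrite subr_gt0 => /(hi _ c01); qlra.
by apply: filterS (filterI lowF hiF) => p /= [h1 h2]; rewrite distrC ltr_distl h1 h2.
Qed.

Lemma solves_mono (X : RR -> RR) (y y' g g' : RR) : solves X y g -> solves X y' g' ->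
  y <= y' -> g <= g'.
Proof.
move=> [g1 lo _] [g1' lo' _] yy; rewrite leNgt; apply/negP => lt.
have c01 : 0 <= g' < 1 by qlra.
have h := (lo g' c01).1 lt; have : g' < g' by apply/(lo' g' c01); qlra.
by rewrite ltxx.
Qed.

Lemma solves_inner (X : RR -> RR) (y g : RR) : solves X y g -> 0 < g < 1 -> y = X g.
Proof.
move=> [g1 lo hi] g01; apply/eqP; rewrite eq_le !leNgt; apply/andP.
split; apply/negP => h.
  have : g < g by apply/lo => //; qlra.
  by rewrite ltxx.
have : g < g by apply/hi => //; qlra.
by rewrite ltxx.
Qed.

Lemma solves_value (X : RR -> RR) (c g : RR) : solves X (X c) g -> 0 < c < 1 -> g = c.
Proof.
move=> [g1 lo hi] c01; apply/eqP; rewrite eq_le !leNgt; apply/andP.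
split; apply/negP => h.
  have : X c < X c by apply/lo => //; qlra.
  by rewrite ltxx.
have : X c < X c by apply/hi => //; qlra.
by rewrite ltxx.
Qed.

Lemma solves0 (X : RR -> RR) (y g : RR) : solves X y g -> y <= X 0 -> g = 0.
Proof.
move=> [g1 lo _] yX; apply/eqP; rewrite eq_le; apply/andP; split; last by qlra.
rewrite leNgt; apply/negP => h; have : X 0 < y by apply/lo => //; lra.
by rewrite ltNge yX.
Qed.

Lemma solves1 (X : RR -> RR) (y g : RR) : solves X y g -> X 1 <= y -> g = 1.
Proof.
move=> [g1 _ hi] yX; apply/eqP; rewrite eq_le; apply/andP; split; first by qlra.
rewrite leNgt; apply/negP => h; have : y < X 1 by apply/hi => //; lra.
by rewrite ltNge yX.
Qed.

Lemma end_dist_inj (e h t : RR) : e = 0 \/ e = 1 -> 0 <= h <= 1 -> 0 <= t <= 1 ->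
  `|h - e| = `|t - e| -> h = t.
Proof.
move=> [->|->] h01 t01; first by rewrite !subr0 !ger0_norm; lra.
by rewrite distrC (distrC t) !ger0_norm; lra.
Qed.

(** * The parameter of a point with respect to a half-box *)

Section Shares.
Context {Z : topologicalType} (D : set (set Z)).
Context (P F : set (set Z)) (Phi : set Z -> plane -> Z).
Context (pp : product_pieces D P F Phi).
Context (val : nat -> Prop) (hb : nat -> plane -> Z) (sib : nat -> nat).
Context (hf : half_box_family D P val hb sib).
Local Notation in_piece := (in_piece P).
Local Notation piece := (piece P).
Local Notation piece_coord := (piece_coord P Phi).
Local Notation Yc y := (piece_coord y).1.
Local Notation Tc y := (piece_coord y).2.
Local Notation hpiece := (hpiece P hb).
Local Notation hheight := (hheight P Phi hb).

Definition hend n : RR := xget 0 [set e : RR | [/\ e = 0 \/ e = 1,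
  forall s s' : RR, 0 < s -> s < s' -> s' < 1 -> `|hheight n s - e| < `|hheight n s' - e| &
  forall eps : RR, 0 < eps -> exists2 d : RR, 0 < d & forall s : RR, 0 < s < d -> s < 1 ->
    `|hheight n s - e| < eps]].

Lemma hendP n : val n -> [/\ hend n = 0 \/ hend n = 1,
  forall s s' : RR, 0 < s -> s < s' -> s' < 1 ->
    `|hheight n s - hend n| < `|hheight n s' - hend n| &
  forall eps : RR, 0 < eps -> exists2 d : RR, 0 < d & forall s : RR, 0 < s < d -> s < 1 ->
    `|hheight n s - hend n| < eps].
Proof.
move=> vn; rewrite /hend; case: xgetP => [e -> //|H].
by have [e He] := hend_exists pp hf vn; have := H e.
Qed.

Definition hsg n : RR := xget 0 [set sg : RR | (sg = 1 \/ sg = - 1) /\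
  forall s x x' : RR, 0 < s < 1 -> - 1 < x -> x < x' -> x' < 1 ->
    Yc (hb n (sg * x, s)) < Yc (hb n (sg * x', s))].

Lemma hsgP n : val n -> (hsg n = 1 \/ hsg n = - 1) /\
  forall s x x' : RR, 0 < s < 1 -> - 1 < x -> x < x' -> x' < 1 ->
    Yc (hb n (hsg n * x, s)) < Yc (hb n (hsg n * x', s)).
Proof.
move=> vn; rewrite /hsg; case: xgetP => [e -> //|H].
by have [e He] := hsign_exists pp hf vn; have := H e.
Qed.

Lemma hsg_norm n (x : RR) : val n -> `|hsg n * x| = `|x|.
Proof. by move=> /hsgP[[->|->] _]; rewrite ?mul1r ?mulN1r ?normrN. Qed.

Lemma hsgK n (x : RR) : val n -> hsg n * (hsg n * x) = x.
Proof. by move=> /hsgP[[->|->] _]; rewrite ?mul1r ?mulN1r ?opprK. Qed.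

(** The distance of the level [s] from the end of the piece, continued by 0 to the edge, where
    [hheight] carries no meaning. *)
Definition hd n (s : RR) : RR := if s == 0 then 0 else `|hheight n s - hend n|.

Lemma hd0 n : hd n 0 = 0.
Proof. by rewrite /hd eqxx. Qed.

Lemma hd_pos n (s : RR) : val n -> 0 < s < 1 -> 0 < hd n s /\ hd n s = `|hheight n s - hend n|.
Proof.
move=> vn s1; rewrite /hd gt_eqF; last by qlra.
split => //; rewrite normr_gt0 subr_eq0; have := hheight01 pp hf vn s1.
by have [[->|->] _ _] := hendP vn => h; [rewrite gt_eqF|rewrite lt_eqF]; qlra.
Qed.

Lemma hd_mono n (s s' : RR) : val n -> 0 <= s -> s < s' -> s' < 1 -> hd n s < hd n s'.
Proof.
move=> vn; rewrite le_eqVlt => /orP[/eqP <-|s0] ss s1.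
  by rewrite {1}/hd eqxx; apply: (hd_pos vn _).1; rewrite ss.
have [_ m _] := hendP vn.
by rewrite !(hd_pos vn _).2 ?m //; qlra.
Qed.

Lemma hd_cont n (s : RR) : val n -> 0 <= s < 1 -> {for s, continuous (hd n)}.
Proof.
move=> vn; rewrite le_eqVlt andb_orl => /orP[/andP[/eqP <- _]|s1].
  have [_ _ lim] := hendP vn.
  move=> B /nbhsRP[e e0 HB]; have [d d0 Hd] := lim e e0.
  apply/nbhsRP; exists (Num.min d 1); first by rewrite lt_min d0 ltr01.
  move=> t; rewrite subr0 lt_min => /andP[td t1]; apply: HB.
  rewrite /hd eqxx; case: eqP => [_|/eqP t0]; first by rewrite subrr normr0.
  have -> : hheight n t = hheight n `|t|.
    have [h|h] := leP 0 t; first by rewrite ger0_norm.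
    by rewrite ltr0_norm // /hheight (hb_even (hf_half hf vn)).
  by rewrite subr0 normr_id; apply: Hd; rewrite // normr_gt0 t0.
move=> B nB; have s0 : 0 < s by qlra.
have ch : {for s, continuous (fun t => `|hheight n t - hend n|)}.
  by apply: cvg_norm; apply: cvgB; [exact: (hheight_cont pp hf vn s1)|exact: cvg_cst].
rewrite (hd_pos vn s1).2 in nB.
have := continuous_nbhs ch nB.
have nz : nbhs s [set t : RR | t != 0].
  apply/nbhsRP; exists s => // t; rewrite ltr_distl => st /=.
  by rewrite gt_eqF //; qlra.
by apply: filterS2 nz => t /negPf t0; rewrite /hd /= t0.
Qed.

(** The argument [c / 2] restricts to the lower half of the half-box, which keeps the rows in use
    away from height 1. *)
Definition hu n (v : RR) : RR := xget 0 [set g | solves (fun c => hd n (c / 2)) v g].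

Lemma huP n (v : RR) : val n -> solves (fun c => hd n (c / 2)) v (hu n v).
Proof.
move=> vn; rewrite /hu; case: xgetP => [g _ //|H].
have [||g Hg] := @mono_solve (fun c => hd n (c / 2)) v; last by case: (H g).
  move=> t t01; apply: continuous_comp; last by apply: hd_cont => //; qlra.
  by apply: cvgMr_tmp; exact: cvg_id.
by move=> t t' t0 tt t1; apply: hd_mono => //; qlra.
Qed.

Definition hdel n (p : Z) : RR := `|Tc p - hend n|.
(* The height in the n-th half-box at which the leaf of [p] crosses it, stopped at
   1 / 2 for the leaves that are too far from the edge. *)
Definition hpar n (p : Z) : RR := hu n (hdel n p) / 2.

Lemma hdelE n p : hdel n p = `|Tc p - hend n|.
Proof. by []. Qed.

Lemma hdel01 n p : val n -> in_piece p -> 0 < hdel n p < 1.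
Proof.
move=> vn /(piece_coordP pp)[t01 _]; rewrite /hdel.
have [[->|->] _ _] := hendP vn; first by rewrite subr0 gtr0_norm; qlra.
by rewrite distrC gtr0_norm; qlra.
Qed.

Lemma hpar01 n p : val n -> in_piece p -> 0 < hpar n p <= 1 / 2.
Proof.
move=> vn ip; have [g01 lo _] := huP (hdel n p) vn; rewrite /hpar.
suff : 0 < hu n (hdel n p) by qlra.
apply/lo; first by lra.
rewrite mul0r /hd eqxx; have := hdel01 vn ip; qlra.
Qed.

(** For [c] in [[0, 1]] this is the part [-1/2 <= x <= 1/2] of a row, oriented by [hsg] so that [Y]
    increases with [c]. *)
Definition hedge n p (c : RR) : RR := Yc (hb n (hsg n * (c - 1 / 2), hpar n p)).
Definition hG n (p : Z) : RR := xget 0 [set g | solves (hedge n p) (Yc p) g].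

Lemma hedge_arg n (c : RR) : val n -> 0 <= c <= 1 -> `|hsg n * (c - 1 / 2)| < 1.
Proof. by move=> vn c01; rewrite hsg_norm // ltr_norml; qlra. Qed.

Lemma hGP n p : val n -> in_piece p -> solves (hedge n p) (Yc p) (hG n p).
Proof.
move=> vn ip; rewrite /hG; case: xgetP => [g _ //|H].
have h01 := hpar01 vn ip; have s01 : 0 < hpar n p < 1 by qlra.
have [||g Hg] := @mono_solve (hedge n p) (Yc p); last by case: (H g).
  move=> t t01.
  apply: (continuous_comp (f := fun c : RR => hsg n * (c - 1 / 2))
     (g := fun x : RR => Yc (hb n (x, hpar n p)))).
    by apply: cvgMl_tmp; apply: cvgB; [exact: cvg_id|exact: cvg_cst].
  by apply: (hY_cont pp hf) => //; apply: hedge_arg.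
by move=> t t' t0 tt t1; apply: (hsgP vn).2 => //; qlra.
Qed.

Lemma hG01 n p : val n -> in_piece p -> 0 <= hG n p <= 1.
Proof. by move=> vn ip; have [] := hGP vn ip. Qed.

Lemma Tc_cont p : in_piece p -> {for p, continuous (fun p => Tc p)}.
Proof.
move=> ip; apply: (continuous_comp (f := piece_coord) (g := snd)).
  exact: (piece_coord_cont pp).
exact: cvg_snd.
Qed.

Lemma Yc_cont p : in_piece p -> {for p, continuous (fun p => Yc p)}.
Proof.
move=> ip; apply: (continuous_comp (f := piece_coord) (g := fst)).
  exact: (piece_coord_cont pp).
exact: cvg_fst.
Qed.

Lemma in_piece_near p : in_piece p -> nbhs p [set p' | in_piece p'].
Proof.
move=> ip; have nT : nbhs (piece_coord p) setT by apply: filterT.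
by have := piece_nbhs pp ip nT; apply: filterS => y [].
Qed.

Lemma hpar_cont n p : val n -> in_piece p -> {for p, continuous (hpar n)}.
Proof.
move=> vn ip; apply: cvgMr_tmp.
apply: (@solves_cvg _ (nbhs p) _ (fun=> fun c => hd n (c / 2)) (hdel n) (fun p => hu n (hdel n p))
  (fun c => hd n (c / 2)) (hdel n p)).
- by apply: filterE => p'; apply: huP.
- exact: huP.
- by move=> c _; exact: cvg_cst.
- by apply: cvg_norm; apply: cvgB; [exact: Tc_cont|exact: cvg_cst].
Qed.

Lemma hG_cont n p : val n -> in_piece p -> {for p, continuous (hG n)}.
Proof.
move=> vn ip; apply: (@solves_cvg _ (nbhs p) _ (hedge n) (fun p => Yc p) (hG n)
  (hedge n p) (Yc p)).
- by have := in_piece_near ip; apply: filterS => p' ip'; apply: hGP.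
- exact: hGP.
- move=> c c01; have h01 := hpar01 vn ip; have s01 : 0 < hpar n p < 1 by qlra.
  apply: (continuous_comp (f := hpar n) (g := fun s : RR => Yc (hb n (hsg n * (c - 1 / 2), s)))).
    exact: hpar_cont.
  by apply: (hY_cont_height pp hf) => //; apply: hedge_arg.
- exact: Yc_cont.
Qed.

Lemma hedge_Tc n p p' : Tc p = Tc p' -> hedge n p = hedge n p'.
Proof. by rewrite /hedge /hpar /hdel => ->. Qed.

Lemma hG_mono n p p' : val n -> in_piece p -> in_piece p' -> Tc p = Tc p' ->
  Yc p <= Yc p' -> hG n p <= hG n p'.
Proof.
move=> vn ip ip' TT YY; have e := hedge_Tc n TT.
by apply: (solves_mono (hGP vn ip) _ YY); rewrite e; apply: hGP.
Qed.

Lemma hpar_box n (x s : RR) : val n -> `|x| < 1 -> 0 < s < 1 / 2 -> hpar n (hb n (x, s)) = s.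
Proof.
move=> vn x1 s12; have s1 : 0 < s < 1 by qlra.
have dE : hdel n (hb n (x, s)) = hd n ((2 * s) / 2).
  rewrite mulrC mulKf // /hdel (hb_height pp hf) //.
  by rewrite (hd_pos vn s1).2.
rewrite /hpar; have := huP (hdel n (hb n (x, s))) vn; rewrite dE => h.
by rewrite (solves_value (X := fun c => hd n (c / 2)) h); [rewrite mulrC mulKf|qlra].
Qed.

Lemma hG_box n (c s : RR) : val n -> `|c - 1 / 2| < 1 -> 0 < s < 1 / 2 ->
  [/\ 0 <= c <= 1 -> hG n (hb n (hsg n * (c - 1 / 2), s)) = c,
      c <= 0 -> hG n (hb n (hsg n * (c - 1 / 2), s)) = 0 &
      1 <= c -> hG n (hb n (hsg n * (c - 1 / 2), s)) = 1].
Proof.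
move=> vn c1 s12; have s1 : 0 < s < 1 by qlra.
have x1 : `|hsg n * (c - 1 / 2)| < 1 by rewrite hsg_norm.
have ip := hf_in hf vn x1 s1.
have G := hGP vn ip; have pE := hpar_box vn x1 s12.
have eE (c' : RR) : hedge n (hb n (hsg n * (c - 1 / 2), s)) c' = Yc (hb n (hsg n * (c' - 1 / 2), s)).
  by rewrite /hedge pE.
have m (a b : RR) : `|a - 1 / 2| < 1 -> `|b - 1 / 2| < 1 -> a <= b ->
    Yc (hb n (hsg n * (a - 1 / 2), s)) <= Yc (hb n (hsg n * (b - 1 / 2), s)).
  rewrite !ltr_norml => a1 b1; rewrite le_eqVlt => /orP[/eqP-> //|ab].
  by apply/ltW/(hsgP vn).2 => //; qlra.
have z0 : `|0 - 1 / 2 : RR| < 1 by rewrite ltr_norml; lra.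
have z1 : `|1 - 1 / 2 : RR| < 1 by rewrite ltr_norml; lra.
have le0 : c <= 0 -> hG n (hb n (hsg n * (c - 1 / 2), s)) = 0.
  by move=> c0; apply: (solves0 G); rewrite eE; apply: m.
have ge1 : 1 <= c -> hG n (hb n (hsg n * (c - 1 / 2), s)) = 1.
  by move=> c0; apply: (solves1 G); rewrite eE; apply: m.
split => // /andP[c0 c11].
have [c0'|c0'] := leP c 0; first by rewrite le0 //; qlra.
have [c1'|c1'] := leP 1 c; first by rewrite ge1 //; qlra.
by apply: (solves_value (X := hedge n (hb n (hsg n * (c - 1 / 2), s)))); [rewrite eE|rewrite c0'].
Qed.

(** The bound on [hdel] and the strict bounds on [hG] exclude clamping in the vertical and in the
    horizontal direction, so that the two parameters are honest coordinates in the half-box. *)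
Lemma hG_inner n p : val n -> in_piece p -> piece p = hpiece n -> hdel n p < hd n (1 / 2) ->
  0 < hG n p < 1 -> p = hb n (hsg n * (hG n p - 1 / 2), hpar n p).
Proof.
move=> vn ip pE dl G01; have h01 := hpar01 vn ip; have s01 : 0 < hpar n p < 1 by qlra.
have YE := solves_inner (hGP vn ip) G01.
have u01 : 0 < hu n (hdel n p) < 1.
  move: h01; rewrite /hpar => h01; apply/andP; split; first by qlra.
  by have [_ _ hi] := huP (hdel n p) vn; apply/hi => //; lra.
have dE : hdel n p = hd n (hpar n p) := solves_inner (huP (hdel n p) vn) u01.
have x1 : `|hsg n * (hG n p - 1 / 2)| < 1 by apply: hedge_arg => //; exact: hG01.
have ih := hf_in hf vn x1 s01.
apply: (piece_eq pp ip ih); first by rewrite (hb_piece pp hf).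
rewrite [LHS]surjective_pairing [RHS]surjective_pairing; congr pair; first exact: YE.
rewrite (hb_height pp hf) //.
have [e01 _ _] := hendP vn; apply: (end_dist_inj e01).
- by have [] := piece_coordP pp ip; qlra.
- by have := hheight01 pp hf vn s01; qlra.
by move: dE; rewrite (hd_pos vn s01).2.
Qed.
End Shares.

(** * Limits of the parameters along germs at the cut leaves *)

Definition germ_filter {Z : topologicalType} (b : plane -> Z) (x : RR) : set_system Z :=
  [set A | exists2 e : RR, 0 < e & prect b x e `<=` A].

Section GermFilter.
Context {Z : topologicalType}.
Implicit Types (b c : plane -> Z) (x y : RR).

Lemma prect_mono b x (e e' : RR) : e <= e' -> prect b x e `<=` prect b x e'.
Proof. by move=> ee z [y [s [ye se <-]]]; exists y, s; split => //; qlra. Qed.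

Global Instance germ_filter_proper b x : ProperFilter (germ_filter b x).
Proof.
split; first last.
  split.
  - by exists 1.
  - move=> A B [e e0 HA] [e' e'0 HB].
    exists (Num.min e e'); first by rewrite lt_min e0.
    move=> z hz; split; [apply: HA|apply: HB]; apply: prect_mono hz.
      by rewrite ge_min lexx.
    by rewrite ge_min lexx orbT.
  - by move=> A B AB [e e0 HA]; exists e => // z /HA /AB.
move=> [e e0 /(_ (b (x, e / 2)))]; apply; exists x, (e / 2).
by rewrite subrr normr0; split => //; qlra.
Qed.

Lemma germ_filter_sub c y b x : germ_sub c y b x -> germ_filter b x `<=` germ_filter c y.
Proof. by move=> g A [e e0 HA]; have [e' e'0 H] := g e e0; exists e' => // z /H /HA. Qed.

Lemma germ_filter_prect b x (e : RR) : 0 < e -> germ_filter b x (prect b x e).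
Proof. by move=> e0; exists e. Qed.

Lemma small_rect (x eps : RR) (r : RR) : `|x| < r -> 0 < eps ->
  exists2 e : RR, 0 < e & e <= eps /\ forall y s : RR, `|y - x| < e -> 0 < s < e ->
    `|y| < r /\ 0 < s < 1 / 2.
Proof.
move=> xr e0; exists (Num.min eps (Num.min (r - `|x|) (1 / 2))).
  by rewrite !lt_min e0 subr_gt0 xr; lra.
split; first by rewrite ge_min lexx.
move=> y s; rewrite !lt_min => /and3P[_ yr _] /andP[s0 /and3P[_ _ s1]].
rewrite s0 s1; split => //; have := ler_distD x y 0; rewrite !subr0; qlra.
Qed.
End GermFilter.

Lemma dist_lt_gap (a b u v r : RR) : `|u - a| < r -> `|v - b| < r -> r <= (a - b) / 2 -> v < u.
Proof. by rewrite !ltr_distl; lra. Qed.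

Section EdgeLimits.
Context {Z : topologicalType} (D : set (set Z)) (fsD : foliated_surface D).
Context (hZ : hausdorff_space Z).
Context (P F : set (set Z)) (Phi : set Z -> plane -> Z).
Context (pp : product_pieces D P F Phi).
Context (val : nat -> Prop) (hb : nat -> plane -> Z) (sib : nat -> nat).
Context (hf : half_box_family D P val hb sib).
Local Notation partD := (fs_part fsD).
Local Notation in_piece := (in_piece P).
Local Notation piece := (piece P).
Local Notation piece_coord := (piece_coord P Phi).
Local Notation Yc y := (piece_coord y).1.
Local Notation Tc y := (piece_coord y).2.
Local Notation hpiece := (hpiece P hb).
Local Notation hend := (hend P Phi hb).
Local Notation hsg := (hsg P Phi hb).
Local Notation hd := (hd P Phi hb).
Local Notation hdel := (hdel P Phi hb).
Local Notation hpar := (hpar P Phi hb).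
Local Notation hG := (hG P Phi hb).
Local Notation hflt n x := (germ_filter (hb n) x).

Lemma hdel_box n m (x s : RR) : val n -> val m -> hend n = hend m -> `|x| < 1 -> 0 < s < 1 ->
  hdel n (hb m (x, s)) = hd m s.
Proof.
by move=> vn vm E x1 s1; rewrite hdelE (hb_height pp hf vm x1 s1) E (hd_pos pp hf vm s1).2.
Qed.

Lemma hd_small n (e : RR) : val n -> 0 < e -> exists2 d : RR, 0 < d &
  forall s : RR, 0 < s < d -> s < 1 -> hd n s < e.
Proof.
move=> vn e0; have [_ _ lim] := hendP pp hf vn; have [d d0 Hd] := lim e e0.
by exists d => // s sd s1; rewrite (hd_pos pp hf vn _).2 ?Hd //; qlra.
Qed.

Lemma germ_near n m (x eps : RR) : val n -> val m -> hpiece n = hpiece m -> hend n = hend m ->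
  `|x| < 1 -> 0 < eps -> exists2 e : RR, 0 < e & e <= eps /\
  forall y s : RR, `|y - x| < e -> 0 < s < e -> [/\ `|y| < 1, 0 < s < 1 / 2,
    in_piece (hb m (y, s)), piece (hb m (y, s)) = hpiece n &
    hdel n (hb m (y, s)) < hd n (1 / 2)].
Proof.
move=> vn vm pE eE x1 e0; have h12 : 0 < (1 / 2 : RR) < 1 by lra.
have [d d0 Hd] := hd_small vm (hd_pos pp hf vn h12).1.
have m0 : 0 < Num.min d eps by rewrite lt_min d0.
have [e e'0 [em H]] := small_rect x1 m0; move: em; rewrite le_min => /andP[ed ee].
exists e => //; split => // y s ye se; have [y1 s12] := H y s ye se.
have s1 : 0 < s < 1 by qlra.
split => //; first exact: (hf_in hf vm y1 s1).
  by rewrite pE (hb_piece pp hf vm y1 s1).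
by rewrite (hdel_box vn vm eE y1 s1) Hd //; qlra.
Qed.

Lemma hG_germ n (x : RR) : val n -> `|x| <= 1 / 2 -> hG n @ hflt n x --> hsg n * x + 1 / 2.
Proof.
move=> vn x12; have x1 : `|x| < 1 by qlra.
apply/cvgrPdist_lt => e e0; have [d d0 [de Hd]] := small_rect x1 e0.
exists d => // _ [y [s [yd sd <-]]] /=; have [y1 s12] := Hd y s yd sd.
have sgy := hsg_norm pp hf y vn; have sgx := hsg_norm pp hf x vn.
have c1 : `|(hsg n * y + 1 / 2) - 1 / 2| < 1 by rewrite addrK sgy.
have [hi lo up] := hG_box pp hf vn c1 s12.
have yE : hsg n * ((hsg n * y + 1 / 2) - 1 / 2) = y by rewrite addrK (hsgK pp hf).
rewrite yE in hi lo up.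
have dE : `|hsg n * x - hsg n * y| < e.
  by rewrite -mulrBr (hsg_norm pp hf) // distrC; qlra.
have bx : - (1 / 2) <= hsg n * x <= 1 / 2 by rewrite -ler_norml sgx.
have := dE; rewrite !ltr_distl.
have [h0|h0] := leP (hsg n * y + 1 / 2) 0; first by rewrite lo //; qlra.
have [h1|h1] := leP 1 (hsg n * y + 1 / 2); first by rewrite up //; qlra.
by rewrite hi; qlra.
Qed.

Lemma hG_limit01 n m (x eps : RR) : val n -> val m -> hpiece n = hpiece m -> hend n = hend m ->
  `|x| < 1 -> 0 < eps ->
  (forall y s : RR, `|y - x| < eps -> 0 < s < eps -> hG n (hb m (y, s)) = 0 \/ hG n (hb m (y, s)) = 1) ->
  exists2 L : RR, L = 0 \/ L = 1 & hG n @ hflt m x --> L.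
Proof.
move=> vn vm pE eE x1 eps0 H01; have [e e0 [ee He]] := germ_near vn vm pE eE x1 eps0.
have H (y s : RR) : `|y - x| < e -> 0 < s < e -> hG n (hb m (y, s)) = 0 \/ hG n (hb m (y, s)) = 1.
  by move=> ye se; apply: H01; qlra.
have loc (y s : RR) : `|y - x| < e -> 0 < s < e ->
    nbhs (y, s) [set q | hG n (hb m q) = 0 <-> hG n (hb m (y, s)) = 0].
  move=> ye se; have [y1 s12 ip _ _] := He y s ye se.
  have s1 : `|s| < 1 by rewrite gtr0_norm; qlra.
  have N : nbhs (hG n (hb m (y, s))) [set v | `|v - hG n (hb m (y, s))| < 1].
    by apply/nbhsRP; exists 1.
  have N1 := continuous_nbhs (hb_cont (hf_half hf vm) y1 s1) (continuous_nbhs (hG_cont pp hf vn ip) N).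
  pose r := Num.min (e - `|y - x|) (Num.min s (e - s)).
  have r0 : 0 < r by rewrite !lt_min !subr_gt0 ye; qlra.
  apply: filterS (filterI N1 (nbhs_rect y s r0 r0)) => -[y' s'] /= [N3].
  rewrite /r !lt_min => -[/and3P[yr _ _] /and3P[_ sr sr']].
  have y'e : `|y' - x| < e by have := ler_distD y y' x; qlra.
  have s'e : 0 < s' < e by move: sr sr'; rewrite !ltr_distl; qlra.
  move: N3; case: (H y s ye se) => ->; case: (H y' s' y'e s'e) => -> //.
    by rewrite subr0 normr1 ltxx.
  by rewrite sub0r normrN1 ltxx.
have K := hrect_const loc.
have xe : `|x - x| < e by rewrite subrr normr0.
have e2 : 0 < e / 2 < e by qlra.
have cst (L : RR) : (forall y s : RR, `|y - x| < e -> 0 < s < e -> hG n (hb m (y, s)) = L) ->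
    hG n @ hflt m x --> L.
  move=> E; apply/cvgrPdist_lt => d d0; exists e => // _ [y [s [ye se <-]]] /=.
  by rewrite E // subrr normr0.
have [E|E] := H x (e / 2) xe e2.
  exists 0; [by left|apply: cst => y s ye se].
  by apply/(K y s x (e / 2)).
exists 1; [by right|apply: cst => y s ye se].
have [E'|//] := H y s ye se.
have E0 : hG n (hb m (x, e / 2)) = 0 by apply/(K x (e / 2) y s).
by case/eqP: (oner_neq0 RR); exact: etrans (esym E) E0.
Qed.

(** A limit strictly between 0 and 1 occurs only for a germ of the half-box [n] itself. This clause
    is what makes the boundary values separate points. *)
Definition edge_limit n m (x L : RR) : Prop := [/\ hG n @ hflt m x --> L, 0 <= L <= 1 &
  0 < L < 1 -> exists x0 : RR, [/\ `|x0| < 1 / 2, L = hsg n * x0 + 1 / 2,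
    hb n (x0, 0) = hb m (x, 0) & germ_sub (hb m) x (hb n) x0]].

(** If the edge point lies outside the compact part of the half-box [n], or lies in it but is
    approached from the other side, then nearby points are not in that part; their parameter is
    clamped, hence constantly 0 or constantly 1. Otherwise the germ belongs to the half-box [n], and
    the limit is affine in the position. *)
Lemma edge_limit_exists n m (x : RR) : val n -> val m -> hpiece n = hpiece m ->
  hend n = hend m -> `|x| < 1 -> exists L, edge_limit n m x L.
Proof.
move=> vn vm pE eE x1.
have red : (exists2 eps : RR, 0 < eps & forall y s : RR, `|y - x| < eps -> 0 < s < eps ->
    hG n (hb m (y, s)) = 0 \/ hG n (hb m (y, s)) = 1) -> exists L, edge_limit n m x L.
  move=> [eps eps0 H]; have [L L01 cL] := hG_limit01 vn vm pE eE x1 eps0 H.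
  by exists L; split => //; case: L01 => ->; lra.
(* This square contains all positions with an unclamped parameter; its image is closed by
   compactness and the Hausdorff property. *)
pose K : set plane := [set p | - (1 / 2) <= p.1 <= 1 / 2 /\ - (1 / 2) <= p.2 <= 1 / 2].
have KE : K = [set t : RR | - (1 / 2) <= t <= 1 / 2] `*` [set t : RR | - (1 / 2) <= t <= 1 / 2].
  by [].
have cK : compact K.
  rewrite KE; have -> : [set t : RR | - (1 / 2) <= t <= 1 / 2] = [set` `[- (1 / 2), 1 / 2 : RR]].
    by apply/seteqP; split => t /=; rewrite in_itv.
  by apply: compact_setX; exact: segment_compact.
have Kin (p : plane) : K p -> `|p.1| < 1 /\ `|p.2| < 1.
  by move=> [? ?]; split; rewrite ltr_norml; qlra.
have cC : closed (hb n @` K).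
  apply: (compact_closed hZ); refine (continuous_compact _ cK).
  apply/within_continuous_nbhs => -[y s] /Kin[/= y1 s1] B nB.
  by have := continuous_nbhs (hb_cont (hf_half hf vn) y1 s1) nB; apply: filterS => q hq _.
have h0 : `|0 : RR| < 1 by rewrite normr0.
have ne01 (g : RR) : 0 <= g <= 1 -> ~ 0 < g < 1 -> g = 0 \/ g = 1.
  move=> g01 ng; have [|h] := eqVneq g 0; first by left.
  have [|h'] := eqVneq g 1; first by right.
  by exfalso; apply: ng; rewrite !lt_neqAle eq_sym h h' /=; qlra.
have [Cz|nCz] := EM ((hb n @` K) (hb m (x, 0))); last first.
  apply: red; have nC : nbhs (hb m (x, 0)) (~` (hb n @` K)).
    by apply: open_nbhs_nbhs; split => //; exact: closed_openC.
  have [d d0 Hd] := (nbhs2P _ _).1 (continuous_nbhs (hb_cont (hf_half hf vm) x1 h0) nC).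
  have [e e0 [ed He]] := germ_near vn vm pE eE x1 d0; exists e => // y s ye se.
  have [y1 s12 ip pp' dl] := He y s ye se; apply: ne01; first exact: (hG01 pp hf).
  move=> G01; have nin : (~` (hb n @` K)) (hb m (y, s)).
    by apply: Hd; rewrite /= ?subr0 ?(gtr0_norm (_ : 0 < s)); qlra.
  apply: nin.
  exists (hsg n * (hG n (hb m (y, s)) - 1 / 2), hpar n (hb m (y, s))); last first.
    by rewrite -(hG_inner pp hf vn ip pp' dl G01).
  split => /=; last by have := hpar01 pp hf vn ip; qlra.
  by rewrite -ler_norml (hsg_norm pp hf) // ler_norml; qlra.
case: Cz => -[x0 s0] [/= x0h s0h] E.
have x01 : `|x0| < 1 by rewrite ltr_norml; qlra.
have s00 : s0 = 0.
  apply: contrapT => /eqP ns; have := hf_edge hf vm x1; rewrite -E; apply.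
  have sE : hb n (x0, s0) = hb n (x0, `|s0|).
    have [h|h] := leP 0 s0; first by rewrite ger0_norm.
    by rewrite ltr0_norm // (hb_even (hf_half hf vn)).
  rewrite sE; apply: (hf_in hf vn x01); rewrite normr_gt0 ns /= ltr_norml; qlra.
rewrite s00 in E.
have same : germ_sub (hb m) x (hb n) x0 -> exists L, edge_limit n m x L.
  move=> g; exists (hsg n * x0 + 1 / 2).
  have x0n : `|hsg n * x0| <= 1 / 2 by rewrite (hsg_norm pp hf) // ler_norml.
  split.
  - apply: cvg_trans (hG_germ vn _); last by rewrite ler_norml.
    by apply: cvg_app => A; exact: (germ_filter_sub g).
  - by move: x0n; rewrite ler_norml; qlra.
  move=> L01; exists x0; split => //.
  by rewrite -(hsg_norm pp hf x0 vn) ltr_norml; qlra.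
have [g|g] := germ_cover partD (hf_box hf vn) (hf_half hf vm) x01 x1 (esym E); first exact: same.
have [bE|fp] := bp_sides (hf_box hf vn); first by apply: same; rewrite bE.
apply: red; have d1 : 0 < 1 - `|x0| by rewrite subr_gt0.
have [d d0 [dd Hd]] := small_rect x01 d1.
have [e' e'0 He'] := g d d0.
have [e e0 [ee He]] := germ_near vn vm pE eE x1 e'0; exists e => // y s ye se.
have [y1 s12 ip pp' dl] := He y s ye se; apply: ne01; first exact: (hG01 pp hf).
move=> G01; have [|u [t [ud td tE]]] := He' (hb m (y, s)).
  by exists y, s; split => //; qlra.
have [u1 t1] := Hd u t ud td; have h01 := hpar01 pp hf vn ip.
apply: (fp (hsg n * (hG n (hb m (y, s)) - 1 / 2)) (hpar n (hb m (y, s))) u t) => //.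
- by rewrite (hsg_norm pp hf) // ltr_norml; qlra.
- by qlra.
- by qlra.
by rewrite tE -(hG_inner pp hf vn ip pp' dl G01).
Qed.

Definition hL n m (x : RR) : RR := xget 0 [set L | edge_limit n m x L].

Lemma hLP n m (x : RR) : val n -> val m -> hpiece n = hpiece m ->
  hend n = hend m -> `|x| < 1 -> edge_limit n m x (hL n m x).
Proof.
move=> vn vm pE eE x1; rewrite /hL; case: xgetP => [L -> //|H].
by have [L] := edge_limit_exists vn vm pE eE x1; have := H L.
Qed.

Lemma hL_self n (x : RR) : val n -> `|x| < 1 / 2 -> hL n n x = hsg n * x + 1 / 2.
Proof.
move=> vn x12; have x1 : `|x| < 1 by qlra.
have [cL _ _] := hLP vn vn erefl erefl x1.
by apply: cvg_unique cL (hG_germ vn _); [exact: Rhausdorff|exact: ltW].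
Qed.

Lemma hL_self01 n (x : RR) : val n -> `|x| < 1 / 2 -> 0 < hL n n x < 1.
Proof.
move=> vn x12; rewrite hL_self //; move: x12; rewrite -(hsg_norm pp hf x vn) ltr_norml; lra.
Qed.

Lemma hL_edge n m (x x' : RR) : val n -> val m -> hpiece n = hpiece m -> hend n = hend m ->
  `|x| < 1 / 2 -> `|x'| < 1 -> hL n m x' = hL n n x ->
  hb n (x, 0) = hb m (x', 0) /\ germ_sub (hb m) x' (hb n) x.
Proof.
move=> vn vm pE eE x12 x'1 LL.
have [_ _ H] := hLP vn vm pE eE x'1.
have [|x0 [x01 E e0 g]] := H; first by rewrite LL hL_self01.
suff xx : x0 = x by rewrite -xx.
move: E; rewrite LL hL_self // => E.
by rewrite -(hsgK pp hf x0 vn) -(hsgK pp hf x vn); congr (_ * _); move: E; qlra.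
Qed.

Lemma matched_heights m m' (e : RR) : val m -> val m' -> 0 < e -> e < 1 ->
  exists s s' : RR, [/\ 0 < s < e, 0 < s' < e & hd m s = hd m' s'].
Proof.
move=> vm vm' e0 e1.
wlog le : m m' vm vm' / hd m (e / 2) <= hd m' (e / 2).
  move=> wl; have [h|h] := leP (hd m (e / 2)) (hd m' (e / 2)); first exact: wl.
  by have [|s [s' [s1 s2 E]]] := wl m' m vm' vm _; [exact: ltW|exists s', s].
have e12 : 0 < e / 2 < 1 by qlra.
have [|||c c01 cE] := @IVT_for (hd m') 0 (e / 2) (hd m (e / 2)); first by qlra.
- by move=> t tt; apply: (hd_cont pp hf) => //; qlra.
- left; rewrite le andbT hd0 ltW //.
  exact: (hd_pos pp hf vm e12).1.
exists (e / 2), c; split => //; first by qlra.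
have c0 : c != 0.
  apply/eqP => c0; have := (hd_pos pp hf vm e12).1; rewrite -cE c0.
  by rewrite hd0 ltxx.
by rewrite lt_neqAle eq_sym c0 /=; qlra.
Qed.

(* Two increasing parameters cannot order the same two germs oppositely: compare
   points of the two germs lying on a common leaf. *)
Lemma hL_order n k m m' (x x' : RR) : val n -> val k -> val m -> val m' ->
  hpiece n = hpiece m -> hpiece k = hpiece m -> hpiece m' = hpiece m ->
  hend n = hend m -> hend k = hend m -> hend m' = hend m -> `|x| < 1 -> `|x'| < 1 ->
  hL n m' x' < hL n m x -> hL k m' x' <= hL k m x.
Proof.
move=> vn vk vm vm' pn pk pm en ek em x1 x'1 ltn; rewrite leNgt; apply/negP => ltk.
have lims j : val j -> hpiece j = hpiece m -> hend j = hend m -> forall r : RR, 0 < r ->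
    exists2 d : RR, 0 < d & (forall y s : RR, `|y - x| < d -> 0 < s < d -> `|hG j (hb m (y, s)) - hL j m x| < r) /\
    (forall y s : RR, `|y - x'| < d -> 0 < s < d -> `|hG j (hb m' (y, s)) - hL j m' x'| < r).
  move=> vj pj ej r r0; have [c1 _ _] := hLP vj vm pj ej x1.
  have [c2 _ _] : edge_limit j m' x' (hL j m' x') by apply: hLP => //; rewrite ?pm ?em.
  have [d1 d10 H1] := (cvgrPdist_lt _ _).1 c1 r r0.
  have [d2 d20 H2] := (cvgrPdist_lt _ _).1 c2 r r0.
  exists (Num.min d1 d2); first by rewrite lt_min d10.
  split=> y s; rewrite !lt_min => /andP[yd yd'] /andP[s0 /andP[sd sd']].
    by have := H1 (hb m (y, s)); rewrite /= distrC; apply; exists y, s; rewrite s0.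
  by have := H2 (hb m' (y, s)); rewrite /= distrC; apply; exists y, s; rewrite s0.
(* Half of the smaller gap, so that on both germs the parameters keep the order of their limits. *)
pose r := Num.min ((hL n m x - hL n m' x') / 2) ((hL k m' x' - hL k m x) / 2).
have r0 : 0 < r by rewrite lt_min; qlra.
have [rn rk] : r <= (hL n m x - hL n m' x') / 2 /\ r <= (hL k m' x' - hL k m x) / 2.
  by rewrite /r !ge_min !lexx !orbT.
have [d1 d10 [n1 n2]] := lims n vn pn en r r0.
have [d2 d20 [k1 k2]] := lims k vk pk ek r r0.
pose e := Num.min (Num.min d1 d2) (1 / 2).
have e0 : 0 < e by rewrite !lt_min d10 d20; lra.
have [[ed1 ed2] e12] : (e <= d1 /\ e <= d2) /\ e <= 1 / 2 by rewrite /e !ge_min !lexx !orbT.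
clearbody r e.
have [|s [s' [se s'e hE]]] := matched_heights vm vm' e0; first by qlra.
have xx : forall d : RR, 0 < d -> `|x - x| < d by move=> d d0; rewrite subrr normr0.
have xx' : forall d : RR, 0 < d -> `|x' - x'| < d by move=> d d0; rewrite subrr normr0.
have [s1 s'1] : 0 < s < 1 /\ 0 < s' < 1 by qlra.
have ip := hf_in hf vm x1 s1; have ip' := hf_in hf vm' x'1 s'1.
(* The matched heights put both points on one leaf of the piece, where all parameters are
   nondecreasing in [Y]. *)
have TT : Tc (hb m (x, s)) = Tc (hb m' (x', s')).
  have : hdel m (hb m (x, s)) = hdel m (hb m' (x', s')).
    by rewrite !hdel_box // ?em.
  have [e01 _ _] := hendP pp hf vm; apply: (end_dist_inj e01).
    by have [] := piece_coordP pp ip; qlra.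
  by have [] := piece_coordP pp ip'; qlra.
have N1 : `|hG n (hb m (x, s)) - hL n m x| < r by apply: n1; [exact: xx|qlra].
have N2 : `|hG n (hb m' (x', s')) - hL n m' x'| < r by apply: n2; [exact: xx'|qlra].
have K1 : `|hG k (hb m (x, s)) - hL k m x| < r by apply: k1; [exact: xx|qlra].
have K2 : `|hG k (hb m' (x', s')) - hL k m' x'| < r by apply: k2; [exact: xx'|qlra].
have ltN := dist_lt_gap N1 N2 rn; have ltK := dist_lt_gap K2 K1 rk.
have [YY|YY] := leP (Yc (hb m (x, s))) (Yc (hb m' (x', s'))).
  by have := hG_mono pp hf vn ip ip' TT YY; rewrite leNgt ltN.
by have := hG_mono pp hf vk ip' ip (esym TT) (ltW YY); rewrite leNgt ltK.
Qed.
End EdgeLimits.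

(** * The strip coordinate *)

(** The increasing homeomorphism [y / (1 + |y|)] of the line onto [(-1, 1)], rescaled to
    [(0, 1)]. *)
Definition sigmoid (y : RR) : RR := 1 / 2 + y / (2 * (1 + `|y|)).

Lemma sigmoid_lt0 (y : RR) : y <= 0 -> sigmoid y = (2 * (1 - y))^-1.
Proof. by move=> y0; rewrite /sigmoid ler0_norm //; field; lra. Qed.

Lemma sigmoid_ge0 (y : RR) : 0 <= y -> sigmoid y = 1 - (2 * (1 + y))^-1.
Proof. by move=> y0; rewrite /sigmoid ger0_norm //; field; lra. Qed.

Lemma sigmoidN (y : RR) : sigmoid (- y) = 1 - sigmoid y.
Proof. by rewrite /sigmoid normrN mulNr; field; have := normr_ge0 y; lra. Qed.

Lemma sigmoid_gt0 (y : RR) : 0 < sigmoid y.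
Proof.
have [y0|y0] := leP y 0; first by rewrite sigmoid_lt0 // invr_gt0; lra.
rewrite sigmoid_ge0 ?(ltW y0) // subr_gt0 invf_lt1; lra.
Qed.

Lemma sigmoid_mono (y y' : RR) : y < y' -> sigmoid y < sigmoid y'.
Proof.
have neg (a b : RR) : b <= 0 -> a < b -> sigmoid a < sigmoid b.
  by move=> b0 ab; rewrite !sigmoid_lt0 ?ltf_pV2 ?posrE; lra.
move=> yy; have [h|h] := leP y' 0; first exact: neg.
have [h'|h'] := leP 0 y.
  have : sigmoid (- y') < sigmoid (- y) by apply: neg; lra.
  by rewrite !sigmoidN; lra.
rewrite sigmoid_lt0 ?(ltW h') // sigmoid_ge0 ?(ltW h) //.
have : (2 * (1 - y))^-1 < (2 : RR)^-1 by rewrite ltf_pV2 ?posrE; lra.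
have : (2 * (1 + y'))^-1 < (2 : RR)^-1 by rewrite ltf_pV2 ?posrE; lra.
lra.
Qed.

Lemma sigmoid_lt1 (y : RR) : sigmoid y < 1.
Proof. by have := sigmoid_gt0 (- y); rewrite sigmoidN; lra. Qed.

Lemma sigmoid_cont : continuous sigmoid.
Proof.
move=> y; apply: cvgD; first exact: cvg_cst.
apply: cvgM; first exact: cvg_id.
apply: cvgV; first by have := normr_ge0 y; lra.
apply: cvgMl_tmp; apply: cvgD; first exact: cvg_cst.
by apply: cvg_norm; exact: cvg_id.
Qed.

Lemma sigmoid_cvg0 : (fun u : RR => sigmoid (- u)) @ +oo --> (0 : RR).
Proof.
apply/cvgrPdist_lt => e e0.
have := nbhs_pinfty_gt (num_real (e^-1)); apply: filterS => u ue.
have u0 : 0 < u by apply: lt_trans ue; rewrite invr_gt0.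
rewrite sub0r normrN gtr0_norm ?sigmoid_gt0 // sigmoid_lt0; last by lra.
rewrite -[ltRHS]invrK ltf_pV2 ?posrE ?invr_gt0 //; lra.
Qed.

Lemma continuous_row (Y : topologicalType) (f : plane -> Y) (x t : RR) :
  {for (x, t), continuous f} -> {for x, continuous (fun x => f (x, t))}.
Proof.
move=> cf B nB; have [e e0 He] := (nbhs2P _ _).1 (continuous_nbhs cf nB).
by apply/nbhsRP; exists e => // y ye; apply: He; rewrite //= subrr normr0.
Qed.

Lemma continuous_column (Y : topologicalType) (f : plane -> Y) (x t : RR) :
  {for (x, t), continuous f} -> {for t, continuous (fun t => f (x, t))}.
Proof.
move=> cf B nB; have [e e0 He] := (nbhs2P _ _).1 (continuous_nbhs cf nB).
by apply/nbhsRP; exists e => // y ye; apply: He; rewrite //= subrr normr0.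
Qed.

Section StripCoordinate.
Context {Z : topologicalType} (D : set (set Z)).
Context (P F : set (set Z)) (Phi : set Z -> plane -> Z).
Context (pp : product_pieces D P F Phi).
Context (val : nat -> Prop) (hb : nat -> plane -> Z) (sib : nat -> nat).
Context (hf : half_box_family D P val hb sib).
Local Notation in_piece := (in_piece P).
Local Notation piece := (piece P).
Local Notation piece_coord := (piece_coord P Phi).
Local Notation Yc y := (piece_coord y).1.
Local Notation Tc y := (piece_coord y).2.
Local Notation hpiece := (hpiece P hb).
Local Notation hdel := (hdel P Phi hb).
Local Notation hG := (hG P Phi hb).
Local Notation hedge := (hedge P Phi hb).

(** Here and in [share] and [mass], [true] belongs to the sum of the [g_n] and [false] to that of
    the [1 - g_n]. *)
Definition flip (b : bool) (g : RR) : RR := if b then g else 1 - g.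

Lemma flip01 b (g : RR) : 0 <= g <= 1 -> 0 <= flip b g <= 1.
Proof. by case: b => //= g01; qlra. Qed.

Lemma flip_cvg (T : Type) (G : set_system T) {FG : ProperFilter G} b (g : T -> RR) (l : RR) :
  g @ G --> l -> (fun t => flip b (g t)) @ G --> flip b l.
Proof. by case: b => //= cg; apply: cvgB => //; exact: cvg_cst. Qed.

Definition active n p : Prop := [/\ in_piece p, val n & hpiece n = piece p].
(* The factor [1 - hdel n p] tends to 1 at the end of the piece at which the n-th
   half-box lies and to 0 at the other end. *)
Definition share b p n : RR :=
  if `[< active n p >] then (1 - hdel n p) * flip b (hG n p) else 0.
Definition hump p : RR := Tc p * (1 - Tc p).
(* The sigmoid term makes the masses positive and strictly monotone; its factor
   [hump] vanishes at both ends.  Along a leaf, [mass true] tends to 0 as Y -> -oo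
   and [mass false] as Y -> +oo, so that [strip_x] runs over the whole line. *)
Definition mass b p : RR :=
  dyadic_sum (share b p) + hump p * sigmoid (if b then Yc p else - Yc p).
Definition strip_x p : RR := (mass false p)^-1 - (mass true p)^-1.

Lemma share_active b p n : active n p -> share b p n = (1 - hdel n p) * flip b (hG n p).
Proof. by move=> a; rewrite /share asboolT. Qed.

Lemma share_inactive b p n : ~ active n p -> share b p n = 0.
Proof. by move=> a; rewrite /share asboolF. Qed.

Lemma share_bounds b p n : active n p -> 0 <= share b p n <= 1 - hdel n p.
Proof.
move=> a; rewrite share_active //; case: a => ip vn _.
have h := hdel01 pp hf vn ip; have /andP[g0 g1] := flip01 b (hG01 pp hf vn ip).
by rewrite mulr_ge0 ?ler_piMr //; qlra.
Qed.

Lemma share01 b p n : 0 <= share b p n <= 1.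
Proof.
have [a|a] := EM (active n p); last by rewrite share_inactive // lexx ler01.
have := share_bounds b a; case: a => ip vn _; have := hdel01 pp hf vn ip; qlra.
Qed.

Lemma humpE p : hump p = Tc p * (1 - Tc p).
Proof. by []. Qed.

Lemma hump_gt0 p : in_piece p -> 0 < hump p.
Proof. by move=> /(piece_coordP pp)[t01 _]; rewrite /hump mulr_gt0; qlra. Qed.

Lemma mass_gt0 b p : in_piece p -> 0 < mass b p.
Proof.
move=> ip; have := dyadic_sum_ge0 (share01 b p).
have : 0 < hump p * sigmoid (if b then Yc p else - Yc p) by rewrite mulr_gt0 ?hump_gt0 ?sigmoid_gt0.
rewrite /mass; lra.
Qed.

Lemma mass_cont b p : in_piece p -> {for p, continuous (mass b)}.
Proof.
move=> ip; apply: cvgD.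
  apply: (@cvg_dyadic_sum _ (nbhs p) _ (share b) (share b p)) => [q k|k|k]; try exact: share01.
  have nT : nbhs (piece_coord p) setT by apply: filterT.
  have [a|a] := EM (active k p).
    rewrite share_active //; have vk : val k by case: a.
    have c : {for p, continuous (fun q => (1 - hdel k q) * flip b (hG k q))}.
      apply: cvgM; last by apply: flip_cvg; exact: (hG_cont pp hf vk ip).
      apply: cvgB; first exact: cvg_cst.
      by apply: cvg_norm; apply: cvgB; [exact: (Tc_cont pp)|exact: cvg_cst].
    apply: cvg_trans c; apply: near_eq_cvg; have := piece_nbhs pp ip nT.
    apply: filterS => q [iq pq _]; rewrite share_active //.
    by case: a => _ _ E; split; rewrite ?pq.
  rewrite share_inactive //; apply: cvg_near_cst; have := piece_nbhs pp ip nT.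
  by apply: filterS => q [iq pq _]; rewrite share_inactive // => -[_ vk E]; apply: a; split; rewrite -?pq.
apply: cvgM.
  apply: cvgM; first exact: (Tc_cont pp).
  by apply: cvgB; [exact: cvg_cst|exact: (Tc_cont pp)].
apply: (continuous_comp (f := fun q => if b then Yc q else - Yc q)); last exact: sigmoid_cont.
by case: b; [|apply: cvgN]; exact: (Yc_cont pp).
Qed.

Lemma strip_x_cont p : in_piece p -> {for p, continuous strip_x}.
Proof.
by move=> ip; apply: cvgB; (apply: cvgV; [rewrite gt_eqF // mass_gt0|exact: mass_cont]).
Qed.

Lemma share_mono b p p' k : in_piece p -> in_piece p' -> piece p = piece p' -> Tc p = Tc p' ->
  Yc p <= Yc p' -> if b then share b p k <= share b p' k else share b p' k <= share b p k.
Proof.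
move=> ip ip' pE TT YY.
have aE : active k p <-> active k p' by split => -[_ vk E]; split; rewrite ?E.
have [a|a] := EM (active k p); last first.
  by rewrite !share_inactive ?lexx ?if_same // -aE.
have vk : val k by case: a.
have dE : hdel k p = hdel k p' by rewrite !hdelE TT.
have d0 : 0 <= 1 - hdel k p' by have := hdel01 pp hf vk ip'; qlra.
have G := hG_mono pp hf vk ip ip' TT YY.
rewrite !share_active // -?aE // dE.
by case: b => /=; apply: (ler_wpM2l d0); [exact: G|exact: (lerB (lexx 1) G)].
Qed.

Lemma strip_x_mono p p' : in_piece p -> in_piece p' -> piece p = piece p' -> Tc p = Tc p' ->
  Yc p < Yc p' -> strip_x p < strip_x p'.
Proof.
move=> ip ip' pE TT YY; have bE : hump p = hump p' by rewrite /hump TT.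
have b0 := hump_gt0 ip'.
have hT b : if b then mass b p < mass b p' else mass b p' < mass b p.
  have le : if b then dyadic_sum (share b p) <= dyadic_sum (share b p')
      else dyadic_sum (share b p') <= dyadic_sum (share b p).
    have m k := share_mono b k ip ip' pE TT (ltW YY).
    by case: b m => m; apply: ler_dyadic_sum => k; (exact: share01 || exact: m).
  have ls : if b then hump p' * sigmoid (Yc p) < hump p' * sigmoid (Yc p')
      else hump p' * sigmoid (- Yc p') < hump p' * sigmoid (- Yc p).
    by case: (b); rewrite ltr_pM2l // sigmoid_mono // ltrN2.
  by rewrite /mass bE; case: b le ls => le ls; apply: ler_ltD.
have i1 : (mass false p)^-1 < (mass false p')^-1.
  by rewrite ltf_pV2 ?posrE; [exact: (hT false)|exact: mass_gt0|exact: mass_gt0].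
have i2 : (mass true p')^-1 < (mass true p)^-1.
  by rewrite ltf_pV2 ?posrE; [exact: (hT true)|exact: mass_gt0|exact: mass_gt0].
rewrite /strip_x; lra.
Qed.

Lemma strip_x_inj p p' : in_piece p -> in_piece p' -> piece p = piece p' -> Tc p = Tc p' ->
  strip_x p = strip_x p' -> p = p'.
Proof.
move=> ip ip' pE TT XX; apply: (piece_eq pp ip ip' pE).
rewrite [LHS]surjective_pairing [RHS]surjective_pairing TT; congr pair.
have [h|h|//] := ltgtP (Yc p) (Yc p').
  by have := strip_x_mono ip ip' pE TT h; rewrite XX ltxx.
by have := strip_x_mono ip' ip (esym pE) (esym TT) h; rewrite XX ltxx.
Qed.

Definition outward (b : bool) (u : RR) : RR := if b then - u else u.

(** On a fixed level a parameter is clamped once [Y] has passed the end of its row, so each share is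
    eventually zero and [cvg_dyadic_sum] gives the limit of the sum. *)
Lemma mass_vanish b J (t : RR) : P J -> 0 < t < 1 ->
  (fun u : RR => mass b (Phi J (outward b u, t))) @ +oo --> (0 : RR).
Proof.
move=> PJ t01; have ip (x : RR) := Phi_in_piece pp x PJ t01.
have pc (x : RR) := piece_coord_Phi pp x PJ t01; have pE (x : RR) := piece_Phi pp x PJ t01.
have -> : 0 = dyadic_sum (fun=> 0) + t * (1 - t) * 0 :> RR.
  rewrite mulr0 addr0; apply/eqP; rewrite eq_le dyadic_sum_ge0 /=; last by move=> k; rewrite lexx ler01.
  apply/ler_addgt0Pr => e e0; have [n ne] := half_expr_small e0.
  have z01 (k : nat) : 0 <= (0 : RR) <= 1 by rewrite lexx ler01.
  have /andP[_] := dyadic_sum_bounds n z01.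
  by rewrite /dyadic_psum big1 ?add0r => [|i _]; [move/le_trans; apply; exact: ltW|rewrite mul0r].
apply: cvgD; last first.
  have E : (fun u : RR => hump (Phi J (outward b u, t)) *
      sigmoid (if b then Yc (Phi J (outward b u, t)) else - Yc (Phi J (outward b u, t)))) =
      (fun u : RR => t * (1 - t) * sigmoid (- u)).
    by apply/funext => u; rewrite /hump pc; case: (b).
  by rewrite E; apply: cvgMl_tmp; exact: sigmoid_cvg0.
apply: (@cvg_dyadic_sum _ +oo _ (fun u => share b (Phi J (outward b u, t)))) => [u k|k|k].
- exact: share01.
- by rewrite lexx ler01.
have [a|a] := EM (val k /\ hpiece k = J); last first.
  apply: cvg_near_cst; apply: filterE => u; rewrite share_inactive // => -[_ vk E]; apply: a.
  by rewrite E pE.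
case: a => vk kJ; apply: cvg_near_cst.
pose p0 := Phi J (0, t).
have eE u c : hedge k (Phi J (u, t)) c = hedge k p0 c by rewrite (hedge_Tc hb k (p' := p0)) // !pc.
apply: filterS (nbhs_pinfty_gt (num_real (if b then - hedge k p0 0 else hedge k p0 1))) => u big.
rewrite share_active; last by split => //; rewrite pE.
have s := hGP pp hf vk (ip (outward b u)).
case: b big s => /= big s.
  by rewrite (solves0 s) ?mulr0 // eE pc /=; qlra.
by rewrite (solves1 s) ?subrr ?mulr0 // eE pc /=; qlra.
Qed.

(** In the direction in which one mass vanishes, the sigmoid of the other is above [1 / 2]. That
    mass is at least half of [hump], so its inverse stays bounded while the first inverse grows
    without bound. *)
Lemma mass_extreme b J (t v : RR) : P J -> 0 < t < 1 -> exists2 x : RR, if b then x <= 0 else 0 <= x &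
  v < (mass b (Phi J (x, t)))^-1 - (mass (~~ b) (Phi J (x, t)))^-1.
Proof.
move=> PJ t01; have ip (x : RR) := Phi_in_piece pp x PJ t01.
have pc (x : RR) := piece_coord_Phi pp x PJ t01.
have k0 : 0 < t * (1 - t) by rewrite mulr_gt0; qlra.
pose M := `|v| + (t * (1 - t) / 2)^-1 + 1.
have M0 : 0 < M.
  have : 0 < (t * (1 - t) / 2)^-1 by rewrite invr_gt0; qlra.
  by have := normr_ge0 v; rewrite /M; lra.
have Mi : 0 < M^-1 by rewrite invr_gt0.
have c1 := (cvgrPdist_lt _ _).1 (mass_vanish b PJ t01) _ Mi.
have c2 := nbhs_pinfty_gt (num_real (0 : RR)).
have [u [u1 u0]] := filter_ex (filterI (c1 _) c2).
exists (outward b u); first by case: (b) => /=; move: u0 => /=; lra.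
move: u1; rewrite /= sub0r normrN gtr0_norm ?mass_gt0 // => u1.
have h1 : M < (mass b (Phi J (outward b u, t)))^-1.
  by rewrite -[ltLHS]invrK ltf_pV2 ?posrE ?mass_gt0.
have h2 : t * (1 - t) / 2 <= mass (~~ b) (Phi J (outward b u, t)).
  rewrite /mass /hump pc /= -[leLHS]add0r lerD //.
    exact: (dyadic_sum_ge0 (share01 _ _)).
  rewrite ler_pM2l //.
  have : sigmoid 0 < sigmoid u by apply: sigmoid_mono.
  rewrite [sigmoid 0]/sigmoid mul0r addr0 => h.
  by case: (b) => /=; rewrite ?opprK; lra.
have h3 : (mass (~~ b) (Phi J (outward b u, t)))^-1 <= (t * (1 - t) / 2)^-1.
  by rewrite lef_pV2 ?posrE ?mass_gt0 // divr_gt0.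
have := ler_norm v; move: h1; rewrite /M; lra.
Qed.

Lemma strip_x_onto J (t v : RR) : P J -> 0 < t < 1 ->
  exists p, [/\ in_piece p, piece p = J, Tc p = t & strip_x p = v].
Proof.
move=> PJ t01; have [a a0 ha] := @mass_extreme true J t (- v) PJ t01.
have [b b0 hb'] := @mass_extreme false J t v PJ t01.
have [|||x xx E] := @IVT_for (fun x => strip_x (Phi J (x, t))) a b v; first by lra.
- move=> x _; apply: (continuous_comp (f := fun x : RR => Phi J (x, t)) (g := strip_x)).
    by apply: continuous_row; exact: (pp_cont pp).
  by apply: strip_x_cont; exact: (Phi_in_piece pp).
- by left; move: ha hb'; rewrite /strip_x /=; lra.
exists (Phi J (x, t)); split => //; first exact: (Phi_in_piece pp).
  exact: (piece_Phi pp).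
by rewrite (piece_coord_Phi pp).
Qed.

Lemma strip_x_open p B : in_piece p -> nbhs p B -> exists2 d : RR, 0 < d &
  forall v t : RR, `|v - strip_x p| < d -> `|t - Tc p| < d -> exists p',
    [/\ B p', in_piece p', piece p' = piece p, strip_x p' = v & Tc p' = t].
Proof.
move=> ip nB; have [PJ _] := pieceP ip; have [t01 pE] := piece_coordP pp ip.
set J := piece p in PJ pE *.
have pE' : Phi J (Yc p, Tc p) = p by rewrite -surjective_pairing.
have iP (x t : RR) : 0 < t < 1 -> in_piece (Phi J (x, t)) by exact: (Phi_in_piece pp).
have pc (x t : RR) : 0 < t < 1 -> piece_coord (Phi J (x, t)) = (x, t) by exact: (piece_coord_Phi pp).
have nB' : nbhs (Yc p, Tc p) [set q | B (Phi J q)].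
  by apply: (continuous_nbhs (pp_cont pp PJ t01)); rewrite pE'.
have [e e0 He] := (nbhs2P _ _).1 nB'.
have axb : Yc p - e / 2 < Yc p < Yc p + e / 2 by qlra.
have cX (x t : RR) : 0 < t < 1 -> {for x, continuous (fun x : RR => strip_x (Phi J (x, t)))}.
  move=> tt; apply: (continuous_comp (f := fun x : RR => Phi J (x, t)) (g := strip_x)).
    by apply: continuous_row; exact: (pp_cont pp).
  by apply: strip_x_cont; exact: iP.
have [|||d d0 Hd] := @slide (fun t : RR => 0 < t < 1) (fun x t => strip_x (Phi J (x, t))) _ _ _ _ axb t01.
- by move=> t tt x _; apply: cX.
- move=> x x' _ _ E; have := strip_x_inj (iP x _ t01) (iP x' _ t01) _ _ E.
  by rewrite !(piece_Phi pp) // !pc // => /(_ erefl erefl)/(pp_inj pp PJ t01 t01)[].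
- move=> x _ r r0.
  have ct : {for Tc p, continuous (fun t : RR => strip_x (Phi J (x, t)))}.
    apply: (continuous_comp (f := fun t : RR => Phi J (x, t)) (g := strip_x)).
      by apply: continuous_column; exact: (pp_cont pp).
    by apply: strip_x_cont; exact: iP.
  have N : nbhs (strip_x (Phi J (x, Tc p))) [set v | `|v - strip_x (Phi J (x, Tc p))| < r].
    by apply/nbhsRP; exists r.
  by have [d d0 Hd] := (nbhsRP _ _).1 (continuous_nbhs ct N); exists d => // s _; apply: Hd.
exists (Num.min (Num.min d e) (Num.min (Tc p) (1 - Tc p))).
  by rewrite !lt_min d0 e0 /=; qlra.
move=> v t; rewrite !lt_min => /andP[/andP[vd ve] _] /andP[/andP[td te] /andP[t0 t1]].
have tt : 0 < t < 1 by move: t0 t1; rewrite !ltr_distl; qlra.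
have [|x xe E] := Hd t v tt td; first by rewrite pE'.
exists (Phi J (x, t)); split => //.
- by apply: (He x t) => //=; rewrite ltr_distl; qlra.
- exact: iP.
- exact: (piece_Phi pp).
- by rewrite pc.
Qed.
End StripCoordinate.

(** * Boundary values of the strip coordinate *)

Section EdgeCoordinate.
Context {Z : topologicalType} (D : set (set Z)).
Context (fz : foliated_surface D /\ hausdorff_space Z).
Context (P F : set (set Z)) (Phi : set Z -> plane -> Z).
Context (pp : product_pieces D P F Phi).
Context (val : nat -> Prop) (hb : nat -> plane -> Z) (sib : nat -> nat).
Context (hf : half_box_family D P val hb sib).
Local Notation in_piece := (in_piece P).
Local Notation piece := (piece P).
Local Notation piece_coord := (piece_coord P Phi).
Local Notation Tc y := (piece_coord y).2.
Local Notation hpiece := (hpiece P hb).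
Local Notation hend := (hend P Phi hb).
Local Notation hsg := (hsg P Phi hb).
Local Notation hd := (hd P Phi hb).
Local Notation hdel := (hdel P Phi hb).
Local Notation hG := (hG P Phi hb).
Local Notation hL := (hL P Phi hb).
Local Notation share := (share P Phi val hb).
Local Notation active := (active P val hb).
Local Notation mass := (mass P Phi val hb).
Local Notation hump := (hump P Phi).
Local Notation strip_x := (strip_x P Phi val hb).
Local Notation hflt n x := (germ_filter (hb n) x).
Local Notation fsD := fz.1.
Local Notation hZ := fz.2.

(** The half-boxes at the same end of the same piece as [m]; only their shares survive in the limit
    at the edge of [m]. *)
Definition coactive m n : Prop := [/\ val n, hpiece n = hpiece m & hend n = hend m].
Definition edge_share b m (x : RR) n : RR := if `[< coactive m n >] then flip b (hL n m x) else 0.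
Definition edge_mass b m (x : RR) : RR := dyadic_sum (edge_share b m x).
Definition edge_x m (x : RR) : RR := (edge_mass false m x)^-1 - (edge_mass true m x)^-1.

Lemma hL_cvg m n (x : RR) : val m -> coactive m n -> `|x| < 1 ->
  hG n @ hflt m x --> hL n m x /\ 0 <= hL n m x <= 1.
Proof. by move=> vm [vn pE eE] x1; have [] := hLP fsD hZ pp hf vn vm pE eE x1. Qed.

Lemma edge_share01 b m (x : RR) n : val m -> `|x| < 1 -> 0 <= edge_share b m x n <= 1.
Proof.
move=> vm x1; rewrite /edge_share; case: asboolP => [a|_]; last by rewrite lexx ler01.
by apply: flip01; have [] := hL_cvg vm a x1.
Qed.

(** For [|x| < 1 / 2] the limit parameter of [m] at its own edge is strictly between 0 and 1. So
    neither mass vanishes there, and [edge_x] is a genuine limit. *)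
Lemma edge_mass_gt0 b m (x : RR) : val m -> `|x| < 1 / 2 -> 0 < edge_mass b m x.
Proof.
move=> vm x12; have x1 : `|x| < 1 by qlra.
have z01 (k : nat) : 0 <= (0 : RR) <= 1 by rewrite lexx ler01.
apply: (le_lt_trans (dyadic_sum_ge0 z01)).
apply: (ltr_dyadic_sum (k := m) z01) => [k|k|]; first exact: edge_share01.
  by have /andP[] := edge_share01 b k vm x1.
rewrite /edge_share asboolT //; have := hL_self01 fsD hZ pp hf vm x12.
by case: b => /= h; qlra.
Qed.

Lemma hdel_cvg m n (x : RR) : val m -> val n -> `|x| < 1 ->
  hdel n @ hflt m x --> (if hend n == hend m then 0 else 1 : RR).
Proof.
move=> vm vn x1; apply/cvgrPdist_lt => e e0.
have [d d0 Hd] := hd_small pp hf vm e0.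
have [r r0 [rd Hr]] := small_rect x1 d0.
exists r => // _ [y [s [ye se <-]]] /=; have [y1 s12] := Hr y s ye se.
have s1 : 0 < s < 1 by qlra.
have small : `|hheight P Phi hb m s - hend m| < e.
  by rewrite -(hd_pos pp hf vm s1).2 Hd //; qlra.
have h01 := hheight01 pp hf vm s1.
rewrite hdelE (hb_height pp hf vm y1 s1).
have [n01 _ _] := hendP pp hf vn; have [m01 _ _] := hendP pp hf vm.
case: eqP => [->|ne]; first by rewrite sub0r normrN normr_id.
move: small; case: n01 => E; case: m01 => E'; rewrite E E' in ne *; try by [].
  rewrite subr0 [X in _ -> `|1 - X| < _]gtr0_norm; last by qlra.
  by rewrite distrC.
rewrite subr0 => h; rewrite [X in `|1 - X|]distrC [X in `|1 - X|]gtr0_norm; last by qlra.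
by rewrite opprB addrCA subrr addr0.
Qed.

Lemma share_cvg b m (x : RR) n : val m -> `|x| < 1 ->
  (share b) ^~ n @ hflt m x --> edge_share b m x n.
Proof.
move=> vm x1.
have near : hflt m x [set p | in_piece p /\ piece p = hpiece m].
  have [r r0 [_ Hr]] := small_rect x1 (@ltr01 RR).
  exists r => // _ [y [s [ye se <-]]]; have [y1 s12] := Hr y s ye se.
  have s1 : 0 < s < 1 by qlra.
  by split; [exact: (hf_in hf)|exact: (hb_piece pp hf)].
have [[vn pE]|a] := EM (val n /\ hpiece n = hpiece m); last first.
  rewrite /edge_share asboolF; last by case=> vn pE _; apply: a.
  apply: cvg_near_cst; apply: filterS near => p [ip pp'].
  by rewrite share_inactive // => -[_ vn E]; apply: a; rewrite E pp'.
have act : hflt m x [set p | share b p n = (1 - hdel n p) * flip b (hG n p)].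
  by apply: filterS near => p [ip pp'] /=; rewrite share_active //; split => //; rewrite pp'.
have dl := hdel_cvg vm vn x1.
have [eE|ne] := eqVneq (hend n) (hend m).
  rewrite eE eqxx in dl; have c : coactive m n by [].
  have [cG _] := hL_cvg vm c x1.
  have -> : edge_share b m x n = (1 - 0) * flip b (hL n m x).
    by rewrite /edge_share asboolT // subr0 mul1r.
  have ev : (fun p => (1 - hdel n p) * flip b (hG n p)) @ hflt m x --> (1 - 0) * flip b (hL n m x).
    apply: cvgM; last exact: flip_cvg.
    by apply: cvgB => //; exact: cvg_cst.
  by apply: cvg_trans ev; apply: near_eq_cvg; apply: filterS act => p /= ->.
rewrite (negPf ne) in dl; rewrite /edge_share asboolF; last by case=> _ _ /eqP; rewrite (negPf ne).
apply/cvgrPdist_lt => e e0; have dl' : hflt m x [set p | `|1 - hdel n p| < e].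
  exact: (cvgrPdist_lt _ _).1 dl e e0.
apply: filterS (filterI near (filterI act dl')) => p /= [[ip pp'] [_ de]].
have a : active n p by split => //; rewrite pp'.
have := share_bounds pp hf b a; move: de; rewrite sub0r normrN => de bd.
by rewrite ger0_norm; move: (ler_norm (1 - hdel n p)); qlra.
Qed.

(** The sigmoid term disappears because [hump] is at most the distance [hdel] to the end. *)
Lemma mass_cvg b m (x : RR) : val m -> `|x| < 1 ->
  mass b @ hflt m x --> edge_mass b m x.
Proof.
move=> vm x1; rewrite -[edge_mass _ _ _]addr0; apply: cvgD.
  apply: (@cvg_dyadic_sum _ (hflt m x) _ (share b)) => [p k|k|k].
  - exact: (share01 pp hf).
  - exact: edge_share01.
  - exact: share_cvg.
apply/cvgrPdist_lt => e e0; have dl := hdel_cvg vm vm x1; rewrite eqxx in dl.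
have dl' : hflt m x [set p | `|0 - hdel m p| < e] by exact: (cvgrPdist_lt _ _).1 dl e e0.
have near : hflt m x [set p | in_piece p].
  have [r r0 [_ Hr]] := small_rect x1 (@ltr01 RR).
  exists r => // _ [y [s [ye se <-]]]; have [y1 s12] := Hr y s ye se.
  by apply: (hf_in hf) => //; qlra.
apply: filterS (filterI near dl') => p /= [ip]; rewrite !sub0r !normrN normr_id => de.
have b0 := hump_gt0 pp ip; set y := if b then _ else _.
have s0 := sigmoid_gt0 y; have s1 := sigmoid_lt1 y.
have bd : hump p <= hdel m p.
  have [t01 _] := piece_coordP pp ip; rewrite humpE hdelE.
  have [[->|->] _ _] := hendP pp hf vm; first by rewrite subr0 gtr0_norm; nra.
  by rewrite distrC gtr0_norm; nra.
rewrite gtr0_norm; last by rewrite mulr_gt0.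
apply: le_lt_trans de; apply: le_trans bd; rewrite ler_piMr //; exact: ltW.
Qed.

Lemma strip_x_cvg m (x : RR) : val m -> `|x| < 1 / 2 -> strip_x @ hflt m x --> edge_x m x.
Proof.
move=> vm x12; have x1 : `|x| < 1 by qlra.
by apply: cvgB; (apply: cvgV; [rewrite gt_eqF // edge_mass_gt0|exact: mass_cvg]).
Qed.

(** By [hL_order] a strict inequality for one parameter forces the weak inequality in the same
    direction for all others. So one mass increases strictly, the other decreases strictly, and both
    inverses push [edge_x] the same way. *)
Lemma edge_x_lt k m m' (x x' : RR) : val m -> val m' -> hpiece m' = hpiece m ->
  hend m' = hend m -> coactive m k -> `|x| < 1 / 2 -> `|x'| < 1 / 2 ->
  hL k m' x' < hL k m x -> edge_x m' x' < edge_x m x.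
Proof.
move=> vm vm' pE eE [vk pk ek] x12 x'12 lt.
have [x1 x'1] : `|x| < 1 /\ `|x'| < 1 by qlra.
have sE b n : edge_share b m' x' n = if `[< coactive m n >] then flip b (hL n m' x') else 0.
  by rewrite /edge_share /coactive pE eE.
have le n : coactive m n -> hL n m' x' <= hL n m x.
  by move=> [vn pn en]; apply: (hL_order fsD hZ pp hf vk vn vm vm').
have lt1 : edge_mass true m' x' < edge_mass true m x.
  apply: (ltr_dyadic_sum (k := k)) => [n|n|n|]; try exact: edge_share01.
    by rewrite sE /edge_share; case: asboolP => //= /le.
  by rewrite sE /edge_share asboolT.
have lt2 : edge_mass false m x < edge_mass false m' x'.
  apply: (ltr_dyadic_sum (k := k)) => [n|n|n|]; try exact: edge_share01.
    by rewrite sE /edge_share; case: asboolP => //= /le; rewrite lerD2l lerN2.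
  by rewrite sE /edge_share asboolT //= ltrD2l ltrN2.
have i1 : (edge_mass false m' x')^-1 < (edge_mass false m x)^-1.
  by rewrite ltf_pV2 ?posrE; [exact: lt2|exact: edge_mass_gt0|exact: edge_mass_gt0].
have i2 : (edge_mass true m x)^-1 < (edge_mass true m' x')^-1.
  by rewrite ltf_pV2 ?posrE; [exact: lt1|exact: edge_mass_gt0|exact: edge_mass_gt0].
rewrite /edge_x; lra.
Qed.

(** Equal boundary values exclude a strict inequality for the parameter of [m]. At its own edge this
    parameter lies strictly between 0 and 1, so by [hL_edge] the germ of [m'] is a germ of [m]. *)
Lemma edge_x_inj m m' (x x' : RR) : val m -> val m' -> hpiece m' = hpiece m ->
  hend m' = hend m -> `|x| < 1 / 2 -> `|x'| < 1 / 2 -> edge_x m' x' = edge_x m x ->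
  hb m' (x', 0) = hb m (x, 0) /\ germ_sub (hb m') x' (hb m) x.
Proof.
move=> vm vm' pE eE x12 x'12 E.
have x'1 : `|x'| < 1 by qlra.
have LL : hL m m' x' = hL m m x.
  have [h|h|//] := ltgtP (hL m m' x') (hL m m x).
    have c : coactive m m by [].
    by have := edge_x_lt vm vm' pE eE c x12 x'12 h; rewrite E ltxx.
  have c : coactive m' m by split; rewrite ?pE ?eE.
  by have := edge_x_lt vm' vm (esym pE) (esym eE) c x'12 x12 h; rewrite E ltxx.
by have [-> ?] := hL_edge fsD hZ pp hf vm vm' (esym pE) (esym eE) x12 x'1 LL.
Qed.

(** Piece, end and boundary value are all read off along the germ filter, and [germ_sub] makes the
    filter of [m'] finer than that of [m]; real limits are unique. *)
Lemma edge_x_germ m m' (x x' : RR) : val m -> val m' -> `|x| < 1 / 2 -> `|x'| < 1 / 2 ->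
  germ_sub (hb m') x' (hb m) x ->
  [/\ hpiece m' = hpiece m, hend m' = hend m & edge_x m' x' = edge_x m x].
Proof.
move=> vm vm' x12 x'12 g; have [x1 x'1] : `|x| < 1 /\ `|x'| < 1 by qlra.
have sub := germ_filter_sub g.
have tr (T : topologicalType) (h : Z -> T) (l : T) : h @ hflt m x --> l -> h @ hflt m' x' --> l.
  by move=> c; apply: cvg_trans c; apply: cvg_app => A; exact: sub.
split.
- have [r r0 [_ Hr]] := small_rect x1 (@ltr01 RR).
  have [r' r'0 [_ Hr']] := small_rect x'1 (@ltr01 RR).
  have A1 := germ_filter_prect (hb m') x' r'0.
  have A2 := sub _ (germ_filter_prect (hb m) x r0).
  have [p [[y [s [ye se <-]]] [y' [s' [y'e s'e E]]]]] := filter_ex (filterI A1 A2).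
  have [y1 s1] := Hr' y s ye se; have [y'1 s'1] := Hr y' s' y'e s'e.
  by rewrite -(hb_piece pp hf vm' y1 (_ : 0 < s < 1)) -?E ?(hb_piece pp hf vm y'1) //; qlra.
- apply/eqP; have c1 := hdel_cvg vm' vm x'1; have c2 := tr _ _ _ (hdel_cvg vm vm x1).
  have : (if hend m == hend m' then 0 else 1 : RR) = (if hend m == hend m then 0 else 1).
    by apply: cvg_unique c1 c2; exact: Rhausdorff.
  rewrite eqxx eq_sym.
  by case: (hend m' == hend m) => // /eqP; rewrite oner_eq0.
by apply: cvg_unique (strip_x_cvg vm' x'12) (tr _ _ _ (strip_x_cvg vm x12)); exact: Rhausdorff.
Qed.

Lemma edge_x_incr m (x x' : RR) : val m -> `|x| < 1 / 2 -> `|x'| < 1 / 2 ->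
  hsg m * x < hsg m * x' -> edge_x m x < edge_x m x'.
Proof.
move=> vm x12 x'12 lt; have c : coactive m m by [].
by apply: (edge_x_lt vm vm erefl erefl c) => //; rewrite !(hL_self fsD hZ pp hf vm) // ltrD2r.
Qed.

Lemma edge_x_injx m (x x' : RR) : val m -> `|x| < 1 / 2 -> `|x'| < 1 / 2 ->
  edge_x m x = edge_x m x' -> x = x'.
Proof.
move=> vm x12 x'12 E; rewrite -(hsgK pp hf x vm) -(hsgK pp hf x' vm); congr (_ * _).
have [h|h|//] := ltgtP (hsg m * x) (hsg m * x').
  by have := edge_x_incr vm x12 x'12 h; rewrite E ltxx.
by have := edge_x_incr vm x'12 x12 h; rewrite E ltxx.
Qed.

(** The limit is taken jointly in [y] and [s], so it also controls the limits at neighbouring edge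
    points; [e / 2] leaves room for passing to these. *)
Lemma strip_x_near m (x e : RR) : val m -> `|x| < 1 / 2 -> 0 < e ->
  exists2 d : RR, 0 < d & (forall y : RR, `|y - x| < d -> `|y| < 1 / 2 /\ `|edge_x m y - edge_x m x| < e) /\
  forall y s : RR, `|y - x| < d -> 0 < s < d -> `|y| < 1 / 2 /\ `|strip_x (hb m (y, s)) - edge_x m x| < e.
Proof.
move=> vm x12 e0; have e20 : 0 < e / 2 by qlra.
have [d' d'0 Hd'] := (cvgrPdist_lt _ _).1 (strip_x_cvg vm x12) _ e20.
have [d d0 [dd Hd]] := small_rect x12 d'0.
have near (y s : RR) : `|y - x| < d -> 0 < s < d -> `|strip_x (hb m (y, s)) - edge_x m x| < e / 2.
  by move=> yd sd; rewrite distrC; apply: Hd'; exists y, s; split => //; qlra.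
have d20 : 0 < d / 2 < d by qlra.
have in12 (y : RR) : `|y - x| < d -> `|y| < 1 / 2 by move=> yd; have [] := Hd y (d / 2) yd d20.
exists d => //; split => [y yd|y s yd sd]; last first.
  by split; [exact: in12|have := near y s yd sd; qlra].
have y12 := in12 y yd; split => //.
have [r r0 Hr] := (cvgrPdist_lt _ _).1 (strip_x_cvg vm y12) _ e20.
pose s := Num.min (r / 2) (d / 2).
have s0 : 0 < s by rewrite lt_min; qlra.
have [sr sd] : s <= r / 2 /\ s <= d / 2 by rewrite /s !ge_min !lexx !orbT.
clearbody s.
have h1 : `|edge_x m y - strip_x (hb m (y, s))| < e / 2.
  by apply: Hr; exists y, s; rewrite subrr normr0; split => //; qlra.
have h2 := near y s yd (_ : 0 < s < d).
have := ler_distD (strip_x (hb m (y, s))) (edge_x m y) (edge_x m x).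
by have := h2 _; qlra.
Qed.

(** The function [X] continues [strip_x] by [edge_x] at [s = 0], and [slide] is applied with the
    one-sided range [0 <= s < r]. The height is matched by the intermediate value theorem for
    [hd]. *)
Lemma edge_x_open m (x eps : RR) : val m -> `|x| < 1 / 2 -> 0 < eps ->
  exists2 d : RR, 0 < d & forall v t : RR, `|v - edge_x m x| < d -> `|t - hend m| < d -> 0 <= t <= 1 ->
  exists2 y : RR, `|y - x| < eps /\ `|y| < 1 / 2 & (t = hend m /\ edge_x m y = v) \/
    (exists2 s : RR, 0 < s < eps /\ 0 < s < 1 & strip_x (hb m (y, s)) = v /\ Tc (hb m (y, s)) = t).
Proof.
move=> vm x12 eps0.
have [e e0 [ee He]] := small_rect x12 eps0.
pose r := Num.min e (1 / 2).
have r0 : 0 < r by rewrite lt_min e0; lra.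
have [re r12] : r <= e /\ r <= 1 / 2 by rewrite /r !ge_min !lexx !orbT.
clearbody r; have axb : x - r / 2 < x < x + r / 2 by qlra.
have r20 : 0 < r / 2 < r by qlra.
have in12 (y : RR) : x - r / 2 <= y <= x + r / 2 -> `|y| < 1 / 2.
  move=> yy; have [||] := He y (r / 2); [|qlra|by []].
  by rewrite ltr_distl; qlra.
pose X y (s : RR) := if s == 0 then edge_x m y else strip_x (hb m (y, s)).
have Q0 : 0 <= (0 : RR) < r by rewrite lexx.
have [|||d d0 Hd] := @slide (fun s : RR => 0 <= s < r) X _ _ _ _ axb Q0.
- move=> s s1 y yy; rewrite /X; case: eqP => [_|/eqP s0].
    move=> B /nbhsRP[e' e'0 HB].
    have [d d0 [Hd _]] := strip_x_near vm (in12 y yy) e'0.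
    by apply/nbhsRP; exists d => // y' y'd; apply: HB; have [] := Hd y' y'd.
  have s01 : 0 < s < 1 by rewrite lt_neqAle eq_sym s0 /=; qlra.
  have y1 : `|y| < 1 by have := in12 y yy; qlra.
  apply: (continuous_comp (f := fun y : RR => hb m (y, s)) (g := strip_x)).
    by apply: continuous_row; apply: (hb_cont (hf_half hf vm)) => //; exact: pos_lt1.
  by apply: (strip_x_cont pp hf); exact: (hf_in hf).
- by move=> y y' yy yy'; rewrite /X eqxx => /edge_x_injx -> //; exact: in12.
- move=> y yy e' e'0; have [d d0 [_ Hd]] := strip_x_near vm (in12 y yy) e'0.
  exists d => // s s1; rewrite subr0 /X eqxx => sd; case: eqP => [_|/eqP s0].
    by rewrite subrr normr0.
  have [||//] := Hd y s; first by rewrite subrr normr0.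
  by rewrite lt_neqAle eq_sym s0 /=; move: sd; rewrite ger0_norm; qlra.
pose s1 := Num.min (r / 2) (d / 2).
have s10 : 0 < s1 by rewrite lt_min; qlra.
have [sr sd] : s1 <= r / 2 /\ s1 <= d / 2 by rewrite /s1 !ge_min !lexx !orbT.
clearbody s1.
have s11 : 0 < s1 < 1 by qlra.
exists (Num.min d (hd m s1)); first by rewrite lt_min d0 (hd_pos pp hf vm s11).1.
move=> v t; rewrite !lt_min => /andP[vd _] /andP[_ th] t01.
have X0 : X x 0 = edge_x m x by rewrite /X eqxx.
rewrite -X0 in vd.
have ydx (y : RR) : x - r / 2 < y < x + r / 2 -> `|y - x| < eps /\ `|y| < 1 / 2.
  by move=> yy; split; [rewrite ltr_distl; qlra|apply: in12; qlra].
have [tE|tn] := eqVneq t (hend m).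
  have [|y yy E] := Hd 0 v Q0 _ vd; first by rewrite subrr normr0.
  by exists y; [exact: ydx|left; rewrite /X eqxx in E].
have [|||s sI sE] := @IVT_for (hd m) 0 s1 `|t - hend m|; first by qlra.
- by move=> s ss; apply: (hd_cont pp hf) => //; qlra.
- by left; rewrite hd0 normr_ge0 ltW.
have s0 : s != 0.
  apply/eqP => s0; move: sE; rewrite s0 hd0 => /esym/eqP.
  by rewrite normr_eq0 subr_eq0 (negPf tn).
have sp : 0 < s by rewrite lt_neqAle eq_sym s0 /=; qlra.
have [||y yy E] := Hd s v _ _ vd; [qlra|by rewrite subr0 gtr0_norm; qlra|].
have [ye y12] := ydx y yy; have y1 : `|y| < 1 by qlra.
have s01 : 0 < s < 1 by qlra.
exists y => //; right; exists s; first by qlra.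
rewrite /X (negPf s0) in E; split => //; rewrite (hb_height pp hf vm y1 s01).
have [e01 _ _] := hendP pp hf vm; apply: (end_dist_inj e01) => //.
  by have := hheight01 pp hf vm s01; qlra.
by move: sE; rewrite (hd_pos pp hf vm s01).2.
Qed.
End EdgeCoordinate.

(** * The atlas *)

Section StripMaps.
Context {Z : topologicalType} (D : set (set Z)).
Context (fz : foliated_surface D /\ hausdorff_space Z).
Context (P F : set (set Z)) (Phi : set Z -> plane -> Z).
Context (pp : product_pieces D P F Phi).
Context (val : nat -> Prop) (hb : nat -> plane -> Z) (sib : nat -> nat).
Context (hf : half_box_family D P val hb sib) (z0 : Z).
Local Notation in_piece := (in_piece P).
Local Notation piece := (piece P).
Local Notation piece_coord := (piece_coord P Phi).
Local Notation Tc y := (piece_coord y).2.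
Local Notation hpiece := (hpiece P hb).
Local Notation hend := (hend P Phi hb).
Local Notation strip_x := (strip_x P Phi val hb).
Local Notation edge_x := (edge_x P Phi val hb).
Local Notation partD := (fs_part fz.1).

Definition strip_pt (y : Z) : plane := (strip_x y, Tc y).
Definition edge_pt m (x : RR) : plane := (edge_x m x, hend m).
(** The boundary point [p] of the strip of [J] lies over [z]. Different half-boxes may represent the
    same pair; [edge_over_fun] shows that [p] determines [z], while [z] may have two points over
    it. *)
Definition edge_over (J : set Z) (p : plane) (z : Z) : Prop := exists m (x : RR),
  [/\ val m, hpiece m = J, `|x| < 1 / 2, edge_pt m x = p & hb m (x, 0) = z].
Definition strip (J : set Z) : set plane :=
  [set p | 0 < p.2 < 1 \/ exists z, edge_over J p z].
Definition strip_over (J : set Z) (p : plane) (z : Z) : Prop :=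
  [/\ in_piece z, piece z = J & strip_pt z = p] \/ edge_over J p z.
Definition strip_map (J : set Z) (p : plane) : Z := xget z0 (strip_over J p).

Lemma half_lt1 (x : RR) : `|x| < 1 / 2 -> `|x| < 1.
Proof. by move=> h; qlra. Qed.

Lemma edge_over_box m (x : RR) : val m -> `|x| < 1 / 2 ->
  edge_over (hpiece m) (edge_pt m x) (hb m (x, 0)).
Proof. by exists m, x. Qed.

Lemma edge_over_end J p z : edge_over J p z -> p.2 = 0 \/ p.2 = 1.
Proof. by move=> [m [x [vm _ _ <- _]]]; have [] := hendP pp hf vm. Qed.

Lemma edge_over_out J p z : edge_over J p z -> ~ in_piece z.
Proof.
by move=> [m [x [vm _ x12 _ <-]]]; apply: (hf_edge hf vm); exact: half_lt1.
Qed.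

Lemma edge_over_piece J p z : edge_over J p z -> P J.
Proof. by move=> [m [x [vm <- _ _ _]]]; exact: (hpieceP hf vm). Qed.

Lemma edge_over_fun J p z z' : edge_over J p z -> edge_over J p z' -> z = z'.
Proof.
move=> [m [x [vm pJ x12 <- <-]]] [m' [x' [vm' pJ' x'12 [X T] <-]]].
have pE : hpiece m' = hpiece m by rewrite pJ pJ'.
by have [-> _] := edge_x_inj fz pp hf vm vm' pE T x12 x'12 X.
Qed.

Lemma strip_pt01 z : in_piece z -> 0 < (strip_pt z).2 < 1.
Proof. by move=> /(piece_coordP pp)[]. Qed.

Lemma strip_over_fun J p z z' : strip_over J p z -> strip_over J p z' -> z = z'.
Proof.
have ex y w : in_piece y -> strip_pt y = p -> edge_over J p w -> False.
  by move=> iy <- /edge_over_end; have := strip_pt01 iy; move=> h [|]; qlra.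
move=> [[iz pz pzp]|e] [[iz' pz' pzp']|e'].
- have [X T] : strip_x z = strip_x z' /\ Tc z = Tc z'.
    by move: pzp'; rewrite -pzp => -[-> ->].
  by apply: (strip_x_inj pp hf iz iz' _ T X); rewrite pz.
- by exfalso; apply: (ex z z').
- by exfalso; apply: (ex z' z).
- exact: edge_over_fun e e'.
Qed.

Lemma strip_mapE J p z : strip_over J p z -> strip_map J p = z.
Proof.
by move=> H; apply: xget_subset1 => // y y' Hy Hy'; exact: strip_over_fun Hy Hy'.
Qed.

Lemma strip_map_pt z : in_piece z -> strip_map (piece z) (strip_pt z) = z.
Proof. by move=> iz; apply: strip_mapE; left. Qed.

Lemma strip_map_edge J p z : edge_over J p z -> strip_map J p = z.
Proof. by move=> e; apply: strip_mapE; right. Qed.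

Lemma strip_overP J p : P J -> strip J p -> strip_over J p (strip_map J p).
Proof.
move=> PJ [p01|[z e]]; last by rewrite (strip_map_edge e); right.
have [z [iz pz tz xz]] := strip_x_onto pp hf p.1 PJ p01.
have E : strip_over J p z by left; split => //; rewrite /strip_pt tz xz -surjective_pairing.
by rewrite (strip_mapE E).
Qed.

Lemma strip_pt_near y B : in_piece y -> nbhs (strip_pt y) B ->
  nbhs y [set y' | [/\ in_piece y', piece y' = piece y & B (strip_pt y')]].
Proof.
move=> iy /nbhs2P[e e0 He].
have N1 : nbhs (strip_x y) [set v | `|v - strip_x y| < e] by apply/nbhsRP; exists e.
have N2 : nbhs (piece_coord y) [set p : plane | `|p.2 - Tc y| < e].
  by apply/nbhs2P; exists e.
have M1 := continuous_nbhs (strip_x_cont pp hf iy) N1.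
have M2 := piece_nbhs pp iy N2.
by apply: filterS (filterI M1 M2) => y' /= [v [iy' py' t]]; split => //; exact: He.
Qed.

Lemma strip_pt_chart y B : in_piece y -> nbhs y B ->
  nbhs (strip_pt y) [set p | exists y', [/\ B y', in_piece y', piece y' = piece y & strip_pt y' = p]].
Proof.
move=> iy nB; have [d d0 Hd] := strip_x_open pp hf iy nB.
apply/nbhs2P; exists d => // v t vd td.
by have [y' [By iy' py <- <-]] := Hd v t vd td; exists y'.
Qed.

Lemma edge_chart m (x eps : RR) : val m -> `|x| < 1 / 2 -> 0 < eps ->
  nbhs (edge_pt m x) [set p | 0 <= p.2 <= 1 -> exists2 y : RR, `|y - x| < eps /\ `|y| < 1 / 2 &
    edge_pt m y = p \/ exists2 s : RR, 0 < s < eps /\ 0 < s < 1 & strip_pt (hb m (y, s)) = p].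
Proof.
move=> vm x12 e0; have [d d0 Hd] := edge_x_open fz pp hf vm x12 e0.
apply/nbhs2P; exists d => // v t vd td t01.
have [y yx [[tE xE]|[s s1 [xE tE]]]] := Hd v t vd td t01; exists y => //.
  by left; rewrite /edge_pt xE tE.
by right; exists s => //; rewrite /strip_pt xE tE.
Qed.

Lemma edge_near m (x : RR) B : val m -> `|x| < 1 / 2 -> nbhs (edge_pt m x) B ->
  exists2 d : RR, 0 < d & (forall y : RR, `|y - x| < d -> `|y| < 1 / 2 /\ B (edge_pt m y)) /\
  forall y s : RR, `|y - x| < d -> 0 < s < d -> [/\ `|y| < 1 / 2, s < 1 & B (strip_pt (hb m (y, s)))].
Proof.
move=> vm x12 /nbhs2P[e e0 /= He].
have [d d0 [H1 H2]] := strip_x_near fz pp hf vm x12 e0.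
have [r r0 Hr] := hd_small pp hf vm e0.
exists (Num.min d (Num.min r 1)); first by rewrite !lt_min d0 r0 ltr01.
split=> [y|y s]; rewrite !lt_min => /and3P[yd _ _].
  by have [y12 h] := H1 y yd; split => //; apply: He; rewrite //= subrr normr0.
move=> /andP[s0 /and3P[sd sr s1]]; have [|y12 h] := H2 y s yd; first by rewrite s0.
have s01 : 0 < s < 1 by rewrite s0.
split => //; apply: He => //=.
rewrite (hb_height pp hf vm (half_lt1 y12) s01) -(hd_pos pp hf vm s01).2.
by apply: Hr => //; rewrite s0.
Qed.

Lemma strip_is_strip J : P J -> is_strip (strip J) 0 1.
Proof.
move=> PJ; have sub : strip J `<=` [set p : plane | 0 <= p.2 <= 1].
  by move=> p [p01|[z /edge_over_end h]] /=; [qlra|case: h => ->; rewrite ?lexx ?ler01].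
split => //; first by move=> p p01; left.
apply: open_in_nbhs => // p [p01|[z [m [x [vm pJ x12 <- _]]]]].
  have [y [iy py ty xy]] := strip_x_onto pp hf p.1 PJ p01.
  have pE : strip_pt y = p by rewrite /strip_pt xy ty -surjective_pairing.
  have nT : nbhs y setT by apply: filterT.
  rewrite -pE; have := strip_pt_chart iy nT; apply: filterS => p' [y' [_ iy' _ <-]] _.
  by left; exact: strip_pt01.
have := edge_chart vm x12 (@ltr01 RR); apply: filterS => p' H /H[y [_ y12] [<-|[s [_ s1] <-]]].
  by right; exists (hb m (y, 0)); rewrite -pJ; exact: edge_over_box.
by left; apply: strip_pt01; exact: (hf_in hf vm (half_lt1 y12) s1).
Qed.

Lemma strip_map_cont J : P J -> {within strip J, continuous (strip_map J)}.
Proof.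
move=> PJ; apply/within_continuous_nbhs => p Sp B.
have [_ _ sub _] := strip_is_strip PJ.
have := strip_overP PJ Sp; move: (strip_map J p) => z [[iz pz <-] nB|].
  have := strip_pt_chart iz nB; apply: filterS => p' [y' [By' iy' py' <-]] _.
  by rewrite -pz -py' strip_map_pt.
move=> [m [x [vm pJ x12 <- <-]]] nB.
have h0 : `|0 : RR| < 1 by rewrite normr0.
have [e e0 He] := (nbhs2P _ _).1 (continuous_nbhs (hb_cont (hf_half hf vm) (half_lt1 x12) h0) nB).
have := edge_chart vm x12 e0; apply: filterS => p' H Sp'.
have [y [yx y12] [<-|[s [se s1] <-]]] := H (sub _ Sp').
  rewrite -pJ (strip_map_edge (edge_over_box vm y12)).
  by apply: (He y 0) => //=; rewrite subrr normr0.
rewrite -pJ -(hb_piece pp hf vm (half_lt1 y12) s1) strip_map_pt; last first.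
  exact: (hf_in hf vm (half_lt1 y12) s1).
by apply: (He y s) => //=; rewrite subr0 gtr0_norm; qlra.
Qed.

Lemma strip_surj z : exists J p, [/\ P J, strip J p & strip_map J p = z].
Proof.
have [iz|nz] := EM (in_piece z).
  exists (piece z), (strip_pt z); split; last exact: strip_map_pt.
    by have [] := pieceP iz.
  by left; exact: strip_pt01.
have [n [x [vn x12 <-]]] := hf_cover hf nz.
exists (hpiece n), (edge_pt n x); split; first exact: (hpieceP hf vn).
  by right; exists (hb n (x, 0)); exact: edge_over_box.
exact: strip_map_edge (edge_over_box vn x12).
Qed.

Lemma strip_open_image J A p : open_in (strip J) (strip J `&` strip_map J @^-1` A) ->
  strip J p -> A (strip_map J p) -> nbhs p [set p' | strip J p' -> A (strip_map J p')].
Proof.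
move=> [U [oU E]] Sp Ap.
have Up : U p.
  have : (strip J `&` strip_map J @^-1` A) p by [].
  by rewrite E => -[].
have nU : nbhs p U by apply: open_nbhs_nbhs.
apply: filterS nU => p' Up' Sp'.
have : (U `&` strip J) p' by [].
by rewrite -E => -[].
Qed.

(** At a point of a cut leaf openness is tested on each side in the strip of that side: the
    half-boxes [n] and [sib n] together cover a neighbourhood. *)
Lemma strip_quotient A : open A <->
  forall J, P J -> open_in (strip J) (strip J `&` strip_map J @^-1` A).
Proof.
split => [oA J PJ|H].
  apply: open_in_nbhs => [p []//|p [Sp Ap]].
  have nA : nbhs (strip_map J p) A by apply: open_nbhs_nbhs.
  have := (within_continuous_nbhs _ _).1 (strip_map_cont PJ) p Sp A nA.
  by apply: filterS => p' Hp Sp'; split => //; exact: Hp.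
rewrite openE => z Az; have [iz|nz] := EM (in_piece z).
  have [PJ _] := pieceP iz.
  have Sz : strip (piece z) (strip_pt z) by left; exact: strip_pt01.
  have N := strip_open_image (H _ PJ) Sz _; rewrite strip_map_pt // in N.
  have := strip_pt_near iz (N Az); apply: filterS => y [iy py Hy].
  rewrite -(strip_map_pt iy) py; apply: Hy; left; exact: strip_pt01.
have [n [x [vn x12 zE]]] := hf_cover hf nz.
have side m : val m -> hb m (x, 0) = z -> exists2 d : RR, 0 < d &
    forall y s : RR, `|y - x| < d -> `|s| < d -> A (hb m (y, s)).
  move=> vm mE; have PJ := hpieceP hf vm.
  have Sx (y : RR) : `|y| < 1 / 2 -> strip (hpiece m) (edge_pt m y).
    by move=> y12; right; exists (hb m (y, 0)); exact: edge_over_box.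
  have N := strip_open_image (H _ PJ) (Sx x x12) _.
  rewrite (strip_map_edge (edge_over_box vm x12)) mE in N.
  have [d d0 [H1 H2]] := edge_near vm x12 (N Az).
  exists d => // y s yd sd.
  have sE : hb m (y, s) = hb m (y, `|s|).
    have [h|h] := leP 0 s; first by rewrite ger0_norm.
    by rewrite ltr0_norm // (hb_even (hf_half hf vm)).
  rewrite sE; have [sz|sn] := eqVneq s 0.
    have [y12] := H1 y yd; rewrite sz normr0 => /(_ (Sx y y12)).
    by rewrite (strip_map_edge (edge_over_box vm y12)).
  have sp : 0 < `|s| < d by rewrite normr_gt0 sn.
  have [y12 s1 /= HA] := H2 y `|s| yd sp.
  have s01 : 0 < `|s| < 1 by rewrite normr_gt0 sn.
  have ip := hf_in hf vm (half_lt1 y12) s01.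
  rewrite -(hb_piece pp hf vm (half_lt1 y12) s01) strip_map_pt // in HA.
  by apply: HA; left; exact: strip_pt01.
have x1 := half_lt1 x12.
have [d1 d10 H1] := side n vn zE.
have [|d2 d20 H2] := side (sib n) (hf_sib hf vn); first by rewrite -(bp_edge (hf_box hf vn)).
have d0 : 0 < Num.min d1 d2 by rewrite lt_min d10.
rewrite -zE; apply: filterS (bp_cover (hf_box hf vn) x1 (nbhs_rect x 0 d0 d0)) => z'.
case=> -[[y s] /= [yd sd] <-]; move: yd sd; rewrite !lt_min subr0 => /andP[y1 y2] /andP[s1 s2].
  exact: H1.
exact: H2.
Qed.

(** By [germ_cover] the half-box behind [edge_over] has the germ of one of the two sides, and by
    [edge_x_germ] its boundary point depends on the germ only. Hence there are at most two points
    over a cut point. *)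
Lemma edge_over_box_cases J p n (x : RR) : val n -> `|x| < 1 / 2 -> edge_over J p (hb n (x, 0)) ->
  (J = hpiece n /\ p = edge_pt n x) \/ (J = hpiece (sib n) /\ p = edge_pt (sib n) x).
Proof.
move=> vn x12 [m [x' [vm <- x'12 <- E]]].
have side k : val k -> germ_sub (hb m) x' (hb k) x -> hpiece m = hpiece k /\ edge_pt m x' = edge_pt k x.
  by move=> vk g; have [-> eE xE] := edge_x_germ fz pp hf vk vm x12 x'12 g; rewrite /edge_pt eE xE.
have [g|g] := germ_cover partD (hf_box hf vn) (hf_half hf vm) (half_lt1 x12) (half_lt1 x'12) E.
  by left; exact: side.
by right; apply: side => //; exact: (hf_sib hf vn).
Qed.

Lemma edge_over_sides n (x : RR) : val n -> `|x| < 1 / 2 ->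
  edge_over (hpiece (sib n)) (edge_pt (sib n) x) (hb n (x, 0)).
Proof.
move=> vn x12; rewrite (bp_edge (hf_box hf vn) (half_lt1 x12)).
by apply: edge_over_box => //; exact: (hf_sib hf vn).
Qed.

Lemma edge_over_two J1 p1 J2 p2 J3 p3 z : edge_over J1 p1 z -> edge_over J2 p2 z ->
  edge_over J3 p3 z -> ~ (J1 = J2 /\ p1 = p2) ->
  (J3 = J1 /\ p3 = p1) \/ (J3 = J2 /\ p3 = p2).
Proof.
move=> e1 e2 e3 ne; have [n [x [vn x12 zE]]] := hf_cover hf (edge_over_out e1).
rewrite -zE in e1 e2 e3.
have [[j1 q1]|[j1 q1]] := edge_over_box_cases vn x12 e1;
  have [[j2 q2]|[j2 q2]] := edge_over_box_cases vn x12 e2;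
  have [[j3 q3]|[j3 q3]] := edge_over_box_cases vn x12 e3;
  rewrite j3 q3 j1 q1 j2 q2 in ne *; by [left|right|case: ne].
Qed.
End StripMaps.

Lemma connected_constant (T : topologicalType) (C : set T) (Q : T -> Prop) : connected C ->
  (forall x, C x -> nbhs x [set y | C y -> (Q y <-> Q x)]) ->
  forall x y, C x -> C y -> Q x -> Q y.
Proof.
move=> cC loc x y Cx Cy Qx.
suff E : C `&` Q = C by have : (C `&` Q) y; [rewrite E|case].
apply: cC; first by exists x.
  exists ([set y | C y -> Q y]^°); first exact: open_interior.
  apply/seteqP; split => z [Cz]; last by move=> /interior_subset/(_ Cz).
  by move=> Qz; split => //; have := loc z Cz; apply: filterS => u Hu /Hu ->.
exists (~` [set y | C y -> ~ Q y]^°); first by apply: open_closedC; exact: open_interior.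
apply/seteqP; split => z [Cz].
  by move=> Qz; split => // /interior_subset/(_ Cz).
move=> nz; split => //; apply: contrapT => nQ; apply: nz.
by have := loc z Cz; apply: filterS => u Hu /Hu ->.
Qed.

(** * Boundary intervals of the strips and their leaves *)

Section EdgeComponents.
Context {Z : topologicalType} (D : set (set Z)).
Context (fz : foliated_surface D /\ hausdorff_space Z).
Context (P F : set (set Z)) (Phi : set Z -> plane -> Z).
Context (pp : product_pieces D P F Phi).
Context (val : nat -> Prop) (hb : nat -> plane -> Z) (sib : nat -> nat).
Context (hf : half_box_family D P val hb sib) (z0 : Z).
Local Notation sameleaf := (sameleaf D).
Local Notation in_piece := (in_piece P).
Local Notation hpiece := (hpiece P hb).
Local Notation edge_pt := (edge_pt P Phi val hb).
Local Notation edge_over := (edge_over P Phi val hb).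
Local Notation strip := (strip P Phi val hb).
Local Notation strip_map := (strip_map P Phi val hb z0).
Local Notation fsD := fz.1.
Local Notation partD := (fs_part fz.1).

Definition edges (J : set Z) : set plane := strip_boundary (strip J) 0 1.
Definition edge_comp (J : set Z) (p : plane) : set plane := connected_component (edges J) p.

Lemma edgesP J p : edges J p <-> exists z, edge_over J p z.
Proof.
split => [[[p01 pE|//]]|[z e]]; first by exfalso; case: pE => pE; move: p01; rewrite pE; lra.
by split; [right; exists z|exact: (edge_over_end pp hf e)].
Qed.

Lemma edges_map J p : edges J p -> edge_over J p (strip_map J p).
Proof. by move=> /edgesP[z e]; rewrite (strip_map_edge fz pp hf z0 e). Qed.

Lemma edges_near m (x eps : RR) : val m -> `|x| < 1 / 2 -> 0 < eps ->
  nbhs (edge_pt m x) [set p : plane | p.2 = 0 \/ p.2 = 1 ->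
    exists2 y : RR, `|y - x| < eps /\ `|y| < 1 / 2 & edge_pt m y = p].
Proof.
move=> vm x12 e0; have := edge_chart fz pp hf vm x12 e0; apply: filterS => p H pE.
have [|y yx [<-|[s [_ s1] sE]]] := H.
- by case: pE => ->; rewrite ?lexx ?ler01.
- by exists y.
have := strip_pt01 pp val hb (hf_in hf vm (half_lt1 yx.2) s1).
by rewrite sE; case: pE => ->; lra.
Qed.

Lemma edge_pt_cont m (x : RR) : val m -> `|x| < 1 / 2 -> {for x, continuous (edge_pt m)}.
Proof.
move=> vm x12 B nB; have [d d0 [H _]] := edge_near fz pp hf vm x12 nB.
by apply/nbhsRP; exists d => // y yd; have [] := H y yd.
Qed.

Lemma edge_leaf_near n (x eps : RR) : val n -> `|x| < 1 / 2 -> 0 < eps ->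
  nbhs (hb n (x, 0)) [set z | ~ in_piece z ->
    exists2 y : RR, `|y - x| < eps /\ `|y| < 1 / 2 & hb n (y, 0) = z].
Proof.
move=> vn x12 e0; have x1 := half_lt1 x12; have [d d0 [de Hd]] := small_rect x12 e0.
have d20 : 0 < d / 2 < d by qlra.
have N := bp_cover (hf_box hf vn) x1 (nbhs_rect x 0 d0 (@ltr01 RR)).
apply: filterS N => z H nz.
have flat m (y s : RR) : val m -> `|y| < 1 -> `|s| < 1 -> ~ in_piece (hb m (y, s)) -> s = 0.
  move=> vm y1 s1 ni; apply: contrapT => /eqP s0; apply: ni.
  have sE : hb m (y, s) = hb m (y, `|s|).
    have [h|h] := leP 0 s; first by rewrite ger0_norm.
    by rewrite ltr0_norm // (hb_even (hf_half hf vm)).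
  by rewrite sE; apply: (hf_in hf vm y1); rewrite normr_gt0 s0.
case: H => -[[y s] /= [yd]]; rewrite subr0 => s1 E; exists y.
- by have [] := Hd y (d / 2) yd d20; split => //; qlra.
- have [y12 _] := Hd y (d / 2) yd d20; have y1 := half_lt1 y12.
  by rewrite -E (flat n y s) // E.
- by have [] := Hd y (d / 2) yd d20; split => //; qlra.
have [y12 _] := Hd y (d / 2) yd d20; have y1 := half_lt1 y12.
by rewrite (bp_edge (hf_box hf vn) y1) -E (flat (sib n) y s) // ?E //; exact: (hf_sib hf vn).
Qed.

Lemma edge_comp_edges J p p' : edge_comp J p p' -> edges J p'.
Proof. by move=> /connected_component_sub. Qed.

Lemma edge_comp_box J p m (x y : RR) : val m -> hpiece m = J -> `|x| < 1 / 2 -> `|y| < 1 / 2 ->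
  edge_comp J p (edge_pt m x) -> edge_comp J p (edge_pt m y).
Proof.
move=> vm <- x12 y12 /connected_component_trans; apply.
pose I := [set t : RR | `|t| < 1 / 2].
have cI : connected I.
  apply/connected_intervalP => a b; rewrite /I /= !ltr_norml => a1 b1 t tt.
  by rewrite ltr_norml; qlra.
have cE : connected (edge_pt m @` I).
  refine (connected_continuous_connected cI _).
  apply/within_continuous_nbhs => t It B nB.
  by have := continuous_nbhs (edge_pt_cont vm It) nB; apply: filterS => u Hu _.
apply: (connected_component_max _ _ cE); [by exists x| |by exists y].
by move=> _ [t It <-]; apply/edgesP; exists (hb m (t, 0)); exact: edge_over_box.
Qed.

Lemma edge_comp_height J p p' : edge_comp J p p' -> p'.2 = p.2.
Proof.
move=> Cp'; have Ep : edges J p.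
  by apply: contrapT => nE; move: Cp'; rewrite /edge_comp connected_component_out.
have Cp : edge_comp J p p := connected_component_refl Ep.
apply: (connected_constant (C := edge_comp J p) (Q := fun q => q.2 = p.2) _ _ Cp Cp' erefl).
  exact: component_connected.
move=> q /edge_comp_edges/edgesP[z [m [x [vm _ x12 <- _]]]].
apply: filterS (edges_near vm x12 (@ltr01 RR)) => q' H Cq'.
by have [|y _ <-] // := H; have [] := edge_comp_edges Cq'.
Qed.

Lemma edge_comp_sameleaf J p p' : edge_comp J p p' -> sameleaf (strip_map J p) (strip_map J p').
Proof.
move=> Cp'; have Ep : edges J p.
  by apply: contrapT => nE; move: Cp'; rewrite /edge_comp connected_component_out.
have Cp : edge_comp J p p := connected_component_refl Ep.
apply: (connected_constant (C := edge_comp J p)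
  (Q := fun q => sameleaf (strip_map J p) (strip_map J q)) _ _ Cp Cp'); last exact: (sameleaf_refl partD).
  exact: component_connected.
move=> q /edge_comp_edges/edgesP[z [m [x [vm <- x12 <- _]]]].
apply: filterS (edges_near vm x12 (@ltr01 RR)) => q' H Cq'.
have [|y [_ y12] <-] := H; first by have [] := edge_comp_edges Cq'.
have L : sameleaf (hb m (x, 0)) (hb m (y, 0)).
  by apply: (hb_leaf (hf_half hf vm)); rewrite ?normr0 //; exact: half_lt1.
rewrite !(strip_map_edge fz pp hf z0 (edge_over_box P Phi hb vm _)) //.
split => h; apply: (sameleaf_trans partD h) => //; exact: sameleaf_sym.
Qed.

Lemma edge_comp_move J p p' n (x y : RR) : val n -> `|x| < 1 / 2 -> `|y| < 1 / 2 ->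
  edge_comp J p p' -> strip_map J p' = hb n (x, 0) ->
  exists2 p'', edge_comp J p p'' & strip_map J p'' = hb n (y, 0).
Proof.
move=> vn x12 y12 Cp' E; have := edges_map (edge_comp_edges Cp'); rewrite E => e.
have [[JE pE]|[JE pE]] := edge_over_box_cases fz pp hf vn x12 e.
  exists (edge_pt n y); last first.
    by rewrite JE (strip_map_edge fz pp hf z0 (edge_over_box P Phi hb vn y12)).
  by apply: (edge_comp_box vn (esym JE) x12 y12); rewrite -pE.
exists (edge_pt (sib n) y); last first.
  by rewrite JE; apply: (strip_map_edge fz pp hf z0); exact: (edge_over_sides Phi hf vn y12).
by apply: (edge_comp_box (hf_sib hf vn) (esym JE) x12 y12); rewrite -pE.
Qed.

(** The boundary interval is continued along the leaf: being reached is a locally constant property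
    of the leaf parameter by [edge_comp_move]. *)
Lemma edge_comp_onto J p z : edges J p -> sameleaf (strip_map J p) z ->
  exists2 p', edge_comp J p p' & strip_map J p' = z.
Proof.
move=> Ep [w [Dw wp wz]]; have [f [g [/within_setT_continuous cf _ gf fg]]] := fs_leafR fsD Dw.
have out := edge_over_out hf (edges_map Ep).
pose Q t := exists2 p', edge_comp J p p' & strip_map J p' = f t.
have loc (t : RR) : exists2 d : RR, 0 < d & forall c : RR, `|c - t| < d -> (Q c <-> Q t).
  have nf : ~ in_piece (f t).
    apply: (not_in_piece_sameleaf pp out); exists w; split => //; exact: (gf t I).1.
  have [n [x [vn x12 xE]]] := hf_cover hf nf.
  have N := edge_leaf_near vn x12 (@ltr01 RR); rewrite xE in N.
  have [d d0 Hd] := (nbhsRP _ _).1 (continuous_nbhs (cf t) N).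
  exists d => // c cd; have [|y [_ y12] yE] := Hd c cd.
    apply: (not_in_piece_sameleaf pp out); exists w; split => //; exact: (gf c I).1.
  rewrite /Q -xE -yE; split => -[p' Cp' E].
    exact: edge_comp_move Cp' E.
  exact: edge_comp_move Cp' E.
have Qp : Q (g (strip_map J p)).
  by exists p; [exact: connected_component_refl|rewrite (fg _ wp).2].
have [p' Cp' E] : Q (g z).
  have loc' (a b t : RR) : a <= t <= b -> exists2 d : RR, 0 < d & forall c : RR,
      a <= c <= b -> `|c - t| < d -> (Q c <-> Q t).
    by move=> _; have [d d0 Hd] := loc t; exists d => // c _; exact: Hd.
  have [h|h] := leP (g (strip_map J p)) (g z).
    exact: (locally_constant_seg h (loc' _ _)).1 Qp.
  exact: (locally_constant_seg (ltW h) (loc' _ _)).2 Qp.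
by exists p' => //; rewrite E (fg _ wz).2.
Qed.

Lemma edge_comp_convex J p p1 p2 (c : RR) : edge_comp J p p1 -> edge_comp J p p2 ->
  p1.1 <= c <= p2.1 -> edge_comp J p (c, p.2).
Proof.
move=> C1 C2 cc; have cE : connected (fst @` edge_comp J p).
  refine (connected_continuous_connected (@component_connected _ _ _) _).
  apply/within_continuous_nbhs => q _ B /nbhsRP[e e0 He].
  by apply/nbhs2P; exists e => // v t ve _ _; apply: He.
have [||[c' t] /= Cq E] := (connected_intervalP _).1 cE p1.1 p2.1 _ _ c cc; [by exists p1|by exists p2|].
by rewrite -(edge_comp_height Cq) -E.
Qed.

(** On the segment between two points of a boundary interval the leaf coordinate of the image is
    continuous and locally injective, so [locally_injective_seg] excludes equal values at the
    ends. *)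
Lemma edge_comp_inj J p p1 p2 : P J -> edge_comp J p p1 -> edge_comp J p p2 ->
  strip_map J p1 = strip_map J p2 -> p1 = p2.
Proof.
move=> PJ; wlog le : p1 p2 / p1.1 <= p2.1 => [wl C1 C2 E|C1 C2 E].
  by have [h|h] := leP p1.1 p2.1; [exact: wl|symmetry; apply: wl => //; exact: ltW].
have [h1 h2] := (edge_comp_height C1, edge_comp_height C2).
rewrite [p1]surjective_pairing [p2]surjective_pairing h1 h2; congr pair.
move: le; rewrite le_eqVlt => /orP[/eqP //|lt]; exfalso.
have [w [Dw wp _]] := sameleaf_refl partD (strip_map J p).
have [f [g [_ /within_continuous_nbhs cg gf fg]]] := fs_leafR fsD Dw.
have wC q : edge_comp J p q -> w (strip_map J q).
  by move=> /edge_comp_sameleaf; exact: (sameleaf_in partD Dw wp).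
have onC (t : RR) : p1.1 <= t <= p2.1 -> exists m (x : RR), [/\ val m, hpiece m = J, `|x| < 1 / 2,
    edge_pt m x = (t, p.2) & exists2 d : RR, 0 < d & forall c : RR, `|c - t| < d ->
      exists2 y : RR, `|y| < 1 / 2 & edge_pt m y = (c, p.2) /\ edge_comp J p (c, p.2)].
  move=> tt; have Ct := edge_comp_convex C1 C2 tt.
  have /edgesP[z [m [x [vm mJ x12 xE _]]]] := edge_comp_edges Ct.
  exists m, x; split => //; have := edges_near vm x12 (@ltr01 RR); rewrite xE => /nbhs2P[d d0 Hd].
  exists d => // c cd; have [||y [_ y12] yE] := Hd c p.2 cd; first by rewrite subrr normr0.
    by have [_] := edge_comp_edges Ct.
  exists y => //; split => //; rewrite -yE; apply: (edge_comp_box vm mJ x12 y12).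
  by rewrite xE.
apply: (locally_injective_seg (f := fun c => g (strip_map J (c, p.2))) lt); last first.
- have e1 : (p1.1, p.2) = p1 by rewrite -h1 -surjective_pairing.
  have e2 : (p2.1, p.2) = p2 by rewrite -h2 -surjective_pairing.
  by rewrite /= e1 e2 E.
- move=> t tt; have [m [x [vm mJ x12 xE [d d0 Hd]]]] := onC t tt.
  exists d => // c c' _ _ cd c'd; have [y y12 [yE Cc]] := Hd c cd.
  have [y' y'12 [y'E Cc']] := Hd c' c'd => GE.
  have QE : strip_map J (c, p.2) = strip_map J (c', p.2).
    by rewrite -(fg _ (wC _ Cc)).2 -(fg _ (wC _ Cc')).2 GE.
  have : hb m (y, 0) = hb m (y', 0).
    move: QE; rewrite -yE -y'E -mJ.
    by rewrite !(strip_map_edge fz pp hf z0 (edge_over_box P Phi hb vm _)).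
  have zz : 0 <= (0 : RR) < 1 by rewrite lexx ltr01.
  move=> /(hb_inj (hf_half hf vm) (half_lt1 y12) zz (half_lt1 y'12) zz)[yy _].
  by move: y'E; rewrite -yy yE => -[].
move=> t tt B nB; have [m [x [vm mJ x12 xE [d d0 Hd]]]] := onC t tt.
have Ct := edge_comp_convex C1 C2 tt.
have N1 := cg _ (wC _ Ct) _ nB.
have St : strip J (t, p.2) by have [] := edge_comp_edges Ct.
have /nbhs2P[e e0 He] := (within_continuous_nbhs _ _).1 (strip_map_cont fz pp hf PJ) _ St _ N1.
apply/nbhsRP; exists (Num.min d e); first by rewrite lt_min d0.
move=> c; rewrite lt_min => /andP[cd ce]; have [y y12 [yE Cc]] := Hd c cd.
have Sc : strip J (c, p.2) by have [] := edge_comp_edges Cc.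
by apply: (He c p.2) => //=; [rewrite subrr normr0|exact: wC].
Qed.

Lemma edge_comp_image J p w : edges J p -> D w -> w (strip_map J p) ->
  strip_map J @` edge_comp J p = w.
Proof.
move=> Ep Dw wp; apply/seteqP; split => [_ [q Cq <-]|z wz].
  exact: (sameleaf_in partD Dw wp (edge_comp_sameleaf Cq)).
by have [|q Cq E] := @edge_comp_onto J p z Ep; [exists w|exists q].
Qed.

Lemma edge_comp_homeo J p : P J -> edges J p ->
  homeo_on (edge_comp J p) (strip_map J @` edge_comp J p) (strip_map J).
Proof.
move=> PJ Ep; pose G z := xget p [set q | edge_comp J p q /\ strip_map J q = z].
have GK q : edge_comp J p q -> G (strip_map J q) = q.
  move=> Cq; apply: xget_subset1 => // q1 q2 [Cq1 E1] [Cq2 E2].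
  by apply: (edge_comp_inj PJ Cq1 Cq2); rewrite E1.
exists G; split.
- apply/within_continuous_nbhs => q Cq B nB; have [Sq _] := edge_comp_edges Cq.
  have := (within_continuous_nbhs _ _).1 (strip_map_cont fz pp hf PJ) _ Sq _ nB.
  by apply: filterS => q' Hq' Cq'; apply: Hq'; have [] := edge_comp_edges Cq'.
- apply/within_continuous_nbhs => _ [q Cq <-] B; rewrite GK // => nB.
  have /edgesP[z [m [x [vm mJ x12 xE _]]]] := edge_comp_edges Cq.
  rewrite -xE in nB; have [d d0 [Hd _]] := edge_near fz pp hf vm x12 nB.
  have mapE (y : RR) : `|y| < 1 / 2 -> strip_map J (edge_pt m y) = hb m (y, 0).
    by move=> y12; rewrite -mJ (strip_map_edge fz pp hf z0 (edge_over_box P Phi hb vm y12)).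
  rewrite -xE mapE //; have := edge_leaf_near vm x12 d0; apply: filterS => z' H [q' Cq' qE].
  have [|y [yd y12] yE] := H; first by rewrite -qE; exact: (edge_over_out hf (edges_map (edge_comp_edges Cq'))).
  have Cy : edge_comp J p (edge_pt m y) by apply: (edge_comp_box vm mJ x12 y12); rewrite xE.
  by rewrite -yE -mapE // GK //; have [] := Hd y yd.
- by move=> q Cq; split; [exists q|exact: GK].
- by move=> _ [q Cq <-]; rewrite GK.
Qed.
End EdgeComponents.

(** * Gluing the strips *)

Section Assembly.
Context {Z : topologicalType} (D : set (set Z)).
Context (fz : foliated_surface D /\ hausdorff_space Z).
Context (P F : set (set Z)) (Phi : set Z -> plane -> Z).
Context (pp : product_pieces D P F Phi).
Context (val : nat -> Prop) (hb : nat -> plane -> Z) (sib : nat -> nat).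
Context (hf : half_box_family D P val hb sib) (z0 : Z).
Local Notation sameleaf := (sameleaf D).
Local Notation in_piece := (in_piece P).
Local Notation piece := (piece P).
Local Notation piece_coord := (piece_coord P Phi).
Local Notation Tc y := (piece_coord y).2.
Local Notation edge_over := (edge_over P Phi val hb).
Local Notation strip := (strip P Phi val hb).
Local Notation strip_pt := (strip_pt P Phi val hb).
Local Notation strip_map := (strip_map P Phi val hb z0).
Local Notation edges := (edges P Phi val hb).
Local Notation edge_comp := (edge_comp P Phi val hb).
Local Notation fsD := fz.1.
Local Notation partD := (fs_part fz.1).

Lemma pieces_countable : @second_countable Z -> countable [set: {J | P J}].
Proof.
move=> [B0 /countable_injP[f fi] [_ B0b]].
have h12 : 0 < (1 / 2 : RR) < 1 by lra.
have : forall l : {J | P J}, exists U, [/\ B0 U, U (Phi (sval l) (0, 1 / 2)) & U `<=` sval l].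
  move=> [J PJ] /=; have ip := Phi_in_piece pp 0 PJ h12.
  have nT : nbhs (piece_coord (Phi J (0, 1 / 2))) setT by apply: filterT.
  have nJ : nbhs (Phi J (0, 1 / 2)) J.
    have := piece_nbhs pp ip nT; apply: filterS => y [iy py _].
    by rewrite -(piece_Phi pp 0 PJ h12) -py; have [] := pieceP iy.
  by have [U [B0U Uy] UJ] := B0b _ _ nJ; exists U.
move=> /choice[e eP]; apply/countable_injP; exists (fun l => f (e l)) => l l' _ _ E.
have [B0e ye eJ] := eP l; have [B0e' _ eJ'] := eP l'.
have {}E : e l = e l' by apply: fi; rewrite ?inE.
have JJ : sval l = sval l'.
  apply: (pp_disj pp (svalP l) (svalP l')); exists (Phi (sval l) (0, 1 / 2)).
  by split; [exact: eJ|apply: eJ'; rewrite -E].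
case: l l' JJ {B0e ye eJ B0e' eJ' E} => J PJ [J' PJ'] /= JJ; subst J'.
by congr exist; exact: Prop_irrelevance.
Qed.

Lemma sval_piece_inj (l l' : {J | P J}) : sval l = sval l' -> l = l'.
Proof.
case: l l' => J PJ [J' PJ'] /= JJ; subst J'.
by congr exist; exact: Prop_irrelevance.
Qed.

Lemma strip_line_image y w : in_piece y -> D w -> w y ->
  strip_map (piece y) @` [set p : plane | p.2 = Tc y] = w.
Proof.
move=> iy Dw wy; have [PJ _] := pieceP iy; have [t01 _] := piece_coordP pp iy.
apply/seteqP; split => [_ [p /= pT <-]|y' wy'].
  have Sp : strip (piece y) p by left; rewrite pT.
  have [[iz pz zp]|e] := strip_overP fz pp hf z0 PJ Sp.
    apply: (sameleaf_in partD Dw wy); apply: (piece_sameleaf pp iy iz pz).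
    by rewrite -pT -[in RHS]zp.
  by have := edge_over_end pp hf e; rewrite pT; case=> E; move: t01; rewrite E; lra.
have [|iy' py' ty'] := sameleaf_piece pp iy (_ : sameleaf y y'); first by exists w.
by exists (strip_pt y') => //; rewrite -py' (strip_map_pt fz pp hf z0).
Qed.

Lemma leaf_canonical w : D w -> exists (l : {J | P J}) L,
  canonical_leaf (strip (sval l)) 0 1 L /\ w = strip_map (sval l) @` L.
Proof.
move=> Dw; have [ne _ _] := partD; have [y wy] := ne w Dw.
have [iy|ny] := EM (in_piece y).
  have [PJ _] := pieceP iy; exists (exist _ _ PJ), [set p : plane | p.2 = Tc y].
  split; last by rewrite (strip_line_image iy Dw wy).
  by left; exists (Tc y); have [] := piece_coordP pp iy.
have [n [x [vn x12 yE]]] := hf_cover hf ny.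
have e := edge_over_box P Phi hb vn x12.
have E : edges (hpiece P hb n) (edge_pt P Phi val hb n x) by apply/(edgesP pp hf); exists (hb n (x, 0)).
exists (exist _ _ (hpieceP hf vn)), (edge_comp (hpiece P hb n) (edge_pt P Phi val hb n x)).
split; first by right; exists (edge_pt P Phi val hb n x).
rewrite /= (edge_comp_image fz pp hf (z0 := z0) E Dw) //.
by rewrite (strip_map_edge fz pp hf z0 e) yE.
Qed.

Lemma canonical_leaf_image (l : {J | P J}) L : canonical_leaf (strip (sval l)) 0 1 L ->
  D (strip_map (sval l) @` L).
Proof.
case: l => J PJ /= [[t [t01 ->]]|[p [Ep ->]]].
  have [y [iy py ty _]] := strip_x_onto pp hf 0 PJ t01.
  have [w [Dw wy _]] := sameleaf_refl partD y.
  by rewrite -py -ty (strip_line_image iy Dw wy).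
have [w [Dw wy _]] := sameleaf_refl partD (strip_map J p).
by rewrite (edge_comp_image fz pp hf Ep Dw wy).
Qed.

(* The boundary intervals to be glued in pairs are those over the leaves having a
   point with this property; over a point there are at most two of them. *)
Definition two_sided (z : Z) : Prop := exists J1 p1 J2 p2,
  [/\ edge_over J1 p1 z, edge_over J2 p2 z & ~ (J1 = J2 /\ p1 = p2)].

Lemma striped_atlas_exists : @second_countable Z -> has_striped_atlas D.
Proof.
move=> sc; pose Lam := {J | P J}.
(* Gluings are indexed by leaves. For each of them [d] will pick two distinct boundary points over
   one point of the leaf, and the intervals glued are their components. *)
pose Gam := {w : set Z | F w /\ exists z, w z /\ two_sided z}.
have : forall g : Gam, exists d : (Lam * plane) * (Lam * plane), exists z,
    [/\ sval g z, edge_over (sval d.1.1) d.1.2 z, edge_over (sval d.2.1) d.2.2 z &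
      ~ (sval d.1.1 = sval d.2.1 /\ d.1.2 = d.2.2)].
  move=> [w [Fw [z [wz [J1 [p1 [J2 [p2 [e1 e2 ne]]]]]]]]] /=.
  exists ((exist _ _ (edge_over_piece hf e1), p1), (exist _ _ (edge_over_piece hf e2), p2)).
  by exists z.
move=> /choice[d Hd].
pose lx g := (d g).1.1; pose ly g := (d g).2.1.
pose X g := edge_comp (sval (lx g)) (d g).1.2; pose Y g := edge_comp (sval (ly g)) (d g).2.2.
have Ex g : edges (sval (lx g)) (d g).1.2 by have [z [_ e _ _]] := Hd g; apply/(edgesP pp hf); exists z.
have Ey g : edges (sval (ly g)) (d g).2.2 by have [z [_ _ e _]] := Hd g; apply/(edgesP pp hf); exists z.
have Dg (g : Gam) : D (sval g) by apply: (pp_leaves pp); case: (svalP g).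
have imX g : strip_map (sval (lx g)) @` X g = sval g.
  have [z [wz e _ _]] := Hd g; apply: (edge_comp_image fz pp hf (Ex g) (Dg g)).
  by rewrite (strip_map_edge fz pp hf z0 e).
have imY g : strip_map (sval (ly g)) @` Y g = sval g.
  have [z [wz _ e _]] := Hd g; apply: (edge_comp_image fz pp hf (Ey g) (Dg g)).
  by rewrite (strip_map_edge fz pp hf z0 e).
have Gam_inj (g g' : Gam) : sval g = sval g' -> g = g'.
  case: g g' => w Hw [w' Hw'] /= ww; subst w'.
  by congr exist; exact: Prop_irrelevance.
(* If the two intervals met, they would be one component, and its two points over [z] would coincide
   by [edge_comp_inj]. *)
have disXY g p : sval (lx g) = sval (ly g) -> X g p -> Y g p -> False.
  have [z [_ e1 e2 ne]] := Hd g; move=> JJ Xp Yp; apply: ne; split => //.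
  have PJ := svalP (lx g).
  have X1 : X g (d g).1.2 := connected_component_refl (Ex g).
  have X2 : X g (d g).2.2.
    apply: connected_component_trans Xp _; rewrite /lx JJ.
    exact: connected_component_sym Yp.
  apply: (edge_comp_inj fz pp hf (z0 := z0) PJ X1 X2).
  rewrite (strip_map_edge fz pp hf z0 e1); rewrite /lx in JJ; rewrite JJ.
  by rewrite (strip_map_edge fz pp hf z0 e2).
have fsL (g : Gam) : closed (sval g : set Z) by have [] := fs_leaf fsD (Dg g).
exists Lam, (fun l => strip (sval l)), (fun=> 0), (fun=> 1), (fun l => strip_map (sval l)).
exists Gam, lx, ly, X, Y; split.
- split; first exact: pieces_countable.
  by move=> l; exact: (strip_is_strip fz pp hf (svalP l)).
- split.
  + by move=> l; exact: (strip_map_cont fz pp hf (svalP l)).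
  + move=> z; have [J [p [PJ Sp E]]] := strip_surj fz pp hf z0 z.
    by exists (exist _ J PJ), p.
  + move=> A; split => [/(strip_quotient fz pp hf z0) H l|H]; first exact: H (svalP l).
    by apply/(strip_quotient fz pp hf z0) => J PJ; exact: (H (exist _ J PJ)).
- split.
  + by move=> g; exists (d g).1.2; split => //; exact: Ex.
  + by move=> g; exists (d g).2.2; split => //; exact: Ey.
  + by move=> g g' ll XX; apply: Gam_inj; rewrite -imX ll XX imX.
  + by move=> g g' ll YY; apply: Gam_inj; rewrite -imY ll YY imY.
  + move=> g g' [ll XY]; have gg : g = g'.
      by apply: Gam_inj; rewrite -imX ll XY imY.
    subst g'; have X1 : X g (d g).1.2 := connected_component_refl (Ex g).
    by apply: (disXY g _ _ X1); rewrite -?XY // ll.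
- split.
  + move=> l l' p p' Sp Sp' nX nX' E; set z := strip_map (sval l') p' in E.
    have := strip_overP fz pp hf z0 (svalP l) Sp; rewrite E.
    have := strip_overP fz pp hf z0 (svalP l') Sp'; rewrite -/z.
    move=> [[iz pz zp]|e'] [[iz' pz' zp']|e]; first last.
    (* Two distinct points over [z] make its leaf an element of [Gam]. The points of [X g] and [Y g]
       over [z] are then all the points over [z], so [p] is glued. *)
    * apply: contrapT => ne.
      have ne' : ~ (sval l = sval l' /\ p = p').
        by move=> [ll pp']; apply: ne; split => //; exact: sval_piece_inj.
      have [w [Fw wz]] := (not_in_piece pp z).1 (edge_over_out hf e).
      have tw : two_sided z by exists (sval l), p, (sval l'), p'.
      pose g : Gam := exist _ w (conj Fw (ex_intro _ z (conj wz tw))).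
      have [q1 X1 E1] : (strip_map (sval (lx g)) @` X g) z by rewrite imX.
      have [q2 Y2 E2] : (strip_map (sval (ly g)) @` Y g) z by rewrite imY.
      have e1 : edge_over (sval (lx g)) q1 z.
        by rewrite -E1; apply: (edges_map fz pp hf z0); exact: edge_comp_edges X1.
      have e2 : edge_over (sval (ly g)) q2 z.
        by rewrite -E2; apply: (edges_map fz pp hf z0); exact: edge_comp_edges Y2.
      have ne12 : ~ (sval (lx g) = sval (ly g) /\ q1 = q2).
        by move=> [JJ qq]; apply: (disXY g q1 JJ X1); rewrite qq.
      apply: nX; exists g.
      have [[JE pE]|[JE pE]] := edge_over_two fz pp hf e1 e2 e ne12.
        by left; rewrite pE; split => //; apply: sval_piece_inj.
      by right; rewrite pE; split => //; apply: sval_piece_inj.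
    * by have := edge_over_out hf e' iz'.
    * by have := edge_over_out hf e iz.
    * by split; [apply: sval_piece_inj; rewrite -pz -pz'|rewrite -zp -zp'].
  + by move=> g; rewrite imX imY.
  + by move=> g; split; [exact: (edge_comp_homeo fz pp hf z0 (svalP _) (Ex g))|rewrite imX].
  + by move=> g; split; [exact: (edge_comp_homeo fz pp hf z0 (svalP _) (Ey g))|rewrite imY].
- apply/seteqP; split => [w Dw|_ [l [L [cL ->]]]]; first exact: leaf_canonical.
  exact: canonical_leaf_image.
Qed.
End Assembly.

(** The empty surface is treated apart because the general construction takes a point [z0] as
    default value. *)
Lemma empty_striped_atlas (Z : topologicalType) (D : set (set Z)) : (Z -> False) ->
  Defs.partition D -> has_striped_atlas D.
Proof.
move=> nZ [ne _ _].
exists False, (fun=> set0), (fun=> 0), (fun=> 1), (fun l : False => match l with end).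
exists False, id, id, (fun=> set0), (fun=> set0); split.
- by split => [|[]]; apply/countable_injP; exists (fun=> 0%N) => -[].
- split => [[]|z|A]; first by case: (nZ z).
  by split => [_ []|_]; rewrite openE => z; case: (nZ z).
- by split => -[].
- by split => -[].
by apply/seteqP; split => [w /ne[z]|w [[]]]; case: (nZ z).
Qed.

Theorem theorem4p4 (Z : topologicalType) (D : set (set Z)) :
  @manifold2 Z -> @second_countable Z -> foliation1 D ->
  (forall z : Z, mboundary z -> D (connected_component mboundary z)) ->
  (forall w, D w -> closed w /\ exists f : RR -> Z, homeo_on setT w f) ->
  (has_striped_atlas D <-> locally_finite_family (singular_leaf D)).
Proof.
move=> [hZ _] sc folD bdD leafD; have fsD : foliated_surface D by [].
split => [|lf].
  move=> [Lam [S [u [v [q [Gam [lx [ly [X [Y]]]]]]]]]] [].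
  move=> [_ hS] [cq sq oq] [bX bY _ _ _] [iq _ _ _] DE.
  pose glued l : set plane := [set p | exists g, (lx g = l /\ X g p) \/ (ly g = l /\ Y g p)].
  apply: (@atlas_singular_locally_finite _ D fsD Lam S u v q glued); split => //.
  move=> l p [g [[<- Xp]|[<- Yp]]].
    by move: Xp; have [r [_ ->]] := bX g => /connected_component_sub.
  by move: Yp; have [r [_ ->]] := bY g => /connected_component_sub.
have [[z0 _]|nZ] := EM (exists z : Z, True); last first.
  by apply: empty_striped_atlas (fs_part fsD) => z; apply: nZ; exists z.
have ilf := irregular_locally_finite folD bdD leafD lf.
have [P [F [Phi pp]]] := product_pieces_exist z0 fsD sc ilf.
have [val [hb [sib hf]]] := half_box_family_exists fsD pp z0 sc.
exact: (striped_atlas_exists (conj fsD hZ) pp hf z0 sc).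
Qed.
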